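(* The group $G=\mathrm{SL}(3,\mathbb{R})$ has Strong Banach property (T) with respect to the class $\mathcal{E}_4$ of Banach spaces. That is: for every length function $\ell$ on $G$ there is a sequence $(m_n)$ of compactly supported symmetric Borel measures on $G$ such that for every Banach space $X$ in $\mathcal{E}_4$ there is a constant $t>0$ with the following property. For every strongly continuous linear representation $\pi$ of $G$ on $X$ satisfying $\|\pi(g)\|_{B(X)}\le L e^{t\ell(g)}$ for all $g\in G$, for some $L\in\mathbb{R}_+$, the sequence $\pi(m_n)$ converges in the norm topology of $B(X)$ to a projection onto the subspace of $\pi(G)$-invariant vectors of $X$.
   Context: All Banach spaces are over $\mathbb{C}$. A length function on a locally compact group $G$ is a function $\ell:G\to\mathbb{R}_+$ that is continuous (or merely bounded on compact sets) with $\ell(g^{-1})=\ell(g)$ and $\ell(g_1g_2)\le\ell(g_1)+\ell(g_2)$. For a compactly supported (signed) Borel measure $m$ on $G$, $\pi(m)\in B(X)$ is defined by the Bochner integral $\pi(m)\xi=\int_G\pi(g)\xi\,dm(g)$. A measure is symmetric if it is invariant under $g\mapsto g^{-1}$. Type and cotype: let $(g_i)$ be independent complex Gaussian $\mathcal N(0,1)$ variables on a probability space $(\Omega,\mathbb{P})$. $X$ has type $p\ge1$ if there is $T$ with $\|\sum_i g_ix_i\|_{L^2(\Omega;X)}\le T(\sum_i\|x_i\|^p)^{1/p}$ for all finite sequences $(x_i)$ in $X$; $X$ has cotype $q\le\infty$ if there is $C$ with $(\sum_i\|x_i\|^q)^{1/q}\le C\|\sum_i g_ix_i\|_{L^2(\Omega;X)}$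 for all finite sequences. The class $\mathcal{E}_4$: given a Banach space $X$, consider the operations (a) taking a (closed) subspace of $X$, (b) taking a quotient of $X$, (c) taking an ultrapower of $X$, (d) taking the complex interpolation space $[X_0,X_1]_\theta$ for a compatible couple $(X_0,X_1)$ of Banach spaces with $X_1$ isomorphic to $X$ ($X_0$ arbitrary) and $\theta\in(0,1)$. $\mathcal{E}_4$ is the smallest class of Banach spaces closed under these operations that contains all Banach spaces having type $p$ and cotype $q$ for some $p,q$ with $1/p-1/q<1/4$. *)

(* Defs.v *)
From HB Require Import structures.
From mathcomp Require Import all_boot all_order all_algebra.
From mathcomp Require Import all_classical all_reals all_analysis.
From mathcomp Require Import complex.

Set Implicit Arguments.
Unset Strict Implicit.
Unset Printing Implicit Defensive.

Import Order.TTheory GRing.Theory Num.Theory.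
Import numFieldNormedType.Exports.

Local Open Scope classical_set_scope.
Local Open Scope ring_scope.

Notation banachType R := (completeNormedModType R[i]).

(* The norm of a normed space over R[i] takes values in R[i]; this is the same
   norm seen as a real number. *)
Definition rnorm (R : realType) (X : normedModType R[i]) (x : X) : R :=
  complex.Re `|x|.

(* Operator norm, equal to +oo when T is unbounded. *)
Definition opnorm (R : realType) (X Y : normedModType R[i]) (T : X -> Y)
    : \bar R :=
  ereal_sup [set (rnorm (T x))%:E | x in [set x | rnorm x <= 1]].

Section Operations.
Context {R : realType}.
Implicit Types X Y : banachType R.

Definition isomorphic X Y : Prop :=
  exists (T : {linear X -> Y}) (S : {linear Y -> X}),
    [/\ cancel T S, cancel S T, continuous T & continuous S].

(* Y is isometric to a subspace of X; the subspace is closed because Y is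
   complete. *)
Definition is_subspace X Y : Prop :=
  exists T : {linear Y -> X}, forall y, rnorm (T y) = rnorm y.

(* Y is isometric to X / ker T. *)
Definition is_quotient X Y : Prop :=
  exists T : {linear X -> Y},
    [/\ continuous T, forall y, exists x, T x = y &
        forall y, rnorm y = inf [set rnorm x | x in [set x | T x = y]]].

(* Y is isometric to the quotient of the bounded families (x_i) in X by those
   with lim_U |x_i| = 0, normed by lim_U |x_i|; T is the quotient map, and is
   irrelevant on unbounded families. *)
Definition is_ultrapower X Y : Prop :=
  exists (I : Type) (U : set_system I) (T : (I -> X) -> Y),
    let bounded := [set x : I -> X | exists M, forall i, rnorm (x i) <= M] in
    [/\ UltraFilter U,
        forall (a : R[i]) x x', bounded x -> bounded x' ->
          T (fun i => a *: x i + x' i) = a *: T x + T x',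
        forall y, exists2 x, bounded x & T x = y &
        forall x, bounded x -> rnorm (x i) @[i --> U] --> rnorm (T x)].

End Operations.

Section Interpolation.
Context {R : realType}.

(* A compatible couple, presented through the space V = X0 + X1 with its
   norm |v| = inf {|x0| + |x1| : v = x0 + x1}; i0 and i1 are the inclusions.
   They are automatically contractive, and any continuous embedding of X0 and
   X1 in a Hausdorff topological vector space gives such a V. *)
Definition compatible_couple (X0 X1 : banachType R) (V : normedModType R[i])
    (i0 : {linear X0 -> V}) (i1 : {linear X1 -> V}) : Prop :=
  [/\ injective i0, injective i1,
      forall v, exists x0 x1, i0 x0 + i1 x1 = v &
      forall v, rnorm v =
        inf [set rnorm x.1 + rnorm x.2 | x in
               [set x : X0 * X1 | i0 x.1 + i1 x.2 = v]]].

Definition strip : set R[i]^o :=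
  [set z | 0 <= complex.Re z <= 1].

Definition open_strip : set R[i]^o :=
  [set z | 0 < complex.Re z < 1].

(* Calderon's space of functions on the strip; f0 and f1 are the boundary
   values of f on the lines Re z = 0 and Re z = 1. *)
Definition calderon (X0 X1 : banachType R) (V : normedModType R[i])
    (i0 : {linear X0 -> V}) (i1 : {linear X1 -> V})
    (f : R[i]^o -> V) (f0 : R -> X0) (f1 : R -> X1) : Prop :=
  [/\ {within strip, continuous f},
      exists M, forall z, strip z -> rnorm (f z) <= M &
      forall z, open_strip z -> derivable f z 1] /\
  [/\ continuous f0, f0 t @[t --> +oo] --> (0 : X0),
      f0 t @[t --> -oo] --> (0 : X0) &
      forall t, f (Complex 0 t) = i0 (f0 t)] /\
  [/\ continuous f1, f1 t @[t --> +oo] --> (0 : X1),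
      f1 t @[t --> -oo] --> (0 : X1) &
      forall t, f (Complex 1 t) = i1 (f1 t)].

Definition calderon_norm (X0 X1 : banachType R) (f0 : R -> X0) (f1 : R -> X1)
    : R :=
  Num.max (sup [set rnorm (f0 t) | t in [set: R]])
          (sup [set rnorm (f1 t) | t in [set: R]]).

(* Y is isometric to [X0, X1]_theta for the couple (i0, i1), via J. *)
Definition is_interpolation (X0 X1 : banachType R) (V : normedModType R[i])
    (i0 : {linear X0 -> V}) (i1 : {linear X1 -> V}) (theta : R)
    (Y : banachType R) : Prop :=
  exists J : {linear Y -> V},
    [/\ injective J,
        forall v, (exists y, J y = v) <->
          (exists f f0 f1, calderon i0 i1 f f0 f1 /\ f theta%:C%C = v) &
        forall y, rnorm y =
          inf [set r | exists f f0 f1, [/\ calderon i0 i1 f f0 f1,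
                 f theta%:C%C = J y & r = calderon_norm f0 f1]]].

End Interpolation.

Section TypeCotype.
Context {R : realType}.

Definition mutually_independent d (Omega : measurableType d)
    (P : probability Omega R) (I : eqType) (X : I -> Omega -> R) : Prop :=
  forall (s : seq I) (A : I -> set R), uniq s ->
    (forall i, measurable (A i)) ->
    P (\bigcap_(i in [set` s]) (X i @^-1` A i)) =
      (\prod_(i <- s) P (X i @^-1` A i))%E.

(* Independent complex standard Gaussian variables: the real and imaginary
   parts form an independent family of centred real Gaussian variables of
   variance 1/2, so that E|g_i|^2 = 1. *)
Definition complex_gaussian_seq d (Omega : measurableType d)
    (P : probability Omega R) (g : nat -> Omega -> R[i]) : Prop :=
  let part (k : nat * bool) w :=
    if k.2 then complex.Re (g k.1 w) else complex.Im (g k.1 w) in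
  [/\ forall k, measurable_fun setT (part k),
      forall k (A : set R), measurable A ->
        P (part k @^-1` A) = normal_prob 0 (Num.sqrt 2^-1) A &
      mutually_independent P part].

Definition gaussian_L2norm d (Omega : measurableType d)
    (P : probability Omega R) (g : nat -> Omega -> R[i])
    (X : normedModType R[i]) (n : nat) (x : 'I_n -> X) : \bar R :=
  Lnorm P 2%:E (fun w => (rnorm (\sum_(i < n) g i w *: x i))%:E).

Definition lq_norm (q : \bar R) (n : nat) (a : 'I_n -> R) : R :=
  match q with
  | r%:E => (\sum_(i < n) a i `^ r) `^ r^-1
  | _ => \big[Num.max/0]_(i < n) a i
  end.

(* The choice of the Gaussian sequence is immaterial, as the L^2 norm only
   depends on its law. *)
Definition has_type (p : R) (X : banachType R) : Prop :=
  1 <= p /\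
  exists d (Omega : measurableType d) (P : probability Omega R) g,
    complex_gaussian_seq P g /\
    exists T : R, forall n (x : 'I_n -> X),
      (gaussian_L2norm P g x <= (T * lq_norm p%:E (fun i => rnorm (x i)))%:E)%E.

Definition has_cotype (q : \bar R) (X : banachType R) : Prop :=
  (1 <= q)%E /\
  exists d (Omega : measurableType d) (P : probability Omega R) g,
    complex_gaussian_seq P g /\
    exists C : R, forall n (x : 'I_n -> X),
      ((lq_norm q (fun i => rnorm (x i)))%:E <= C%:E * gaussian_L2norm P g x)%E.

End TypeCotype.

(* q^-1 is 0 when q = +oo. *)
Inductive E4 (R : realType) : banachType R -> Prop :=
| E4_type_cotype (X : banachType R) (p : R) (q : \bar R) :
    has_type p X -> has_cotype q X -> ((p^-1)%:E - q^-1 < (4^-1)%:E)%E -> E4 X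
| E4_subspace (X Y : banachType R) : E4 X -> is_subspace X Y -> E4 Y
| E4_quotient (X Y : banachType R) : E4 X -> is_quotient X Y -> E4 Y
| E4_ultrapower (X Y : banachType R) : E4 X -> is_ultrapower X Y -> E4 Y
| E4_interpolation (X X0 X1 Y : banachType R) (V : normedModType R[i])
    (i0 : {linear X0 -> V}) (i1 : {linear X1 -> V}) (theta : R) :
    E4 X -> isomorphic X1 X -> compatible_couple i0 i1 -> 0 < theta < 1 ->
    is_interpolation i0 i1 theta Y -> E4 Y.

HB.mixin Record isTopologicalGroup G & Group G & Topological G := {
  mulg_continuous : continuous (fun gh : G * G => (gh.1 * gh.2)%g);
  invg_continuous : continuous (fun g : G => g^-1%g)
}.

#[short(type="topGroupType")]
HB.structure Definition TopologicalGroup :=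
  {G of Group G & PointedTopological G & isTopologicalGroup G}.

Section StrongPropertyT.
Context {R : realType}.

Definition length_function (G : topGroupType) (l : G -> R) : Prop :=
  [/\ forall g, 0 <= l g,
      forall K : set G, compact K -> exists M, forall g, K g -> l g <= M,
      forall g, l g^-1%g = l g &
      forall g h, l (g * h)%g <= l g + l h].

Notation borel G := (g_sigma_algebraType (@open G)).

Definition compactly_supported (G : topGroupType)
    (m : {charge set (borel G) -> \bar R}) : Prop :=
  exists2 K : set G, compact K &
    forall A : set (borel G), measurable A -> A `&` K = set0 -> m A = 0%E.

Definition symmetric_charge (G : topGroupType)
    (m : {charge set (borel G) -> \bar R}) : Prop :=
  forall A : set (borel G), measurable A -> m [set g | A (g^-1)%g] = m A.

(* Bochner integral against a finite signed measure m. A simple function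
   \sum_k 1_{A_k} x_k is given by the list of the pairs (A_k, x_k); |m| is
   the total variation measure, given by any Hahn decomposition of m. *)
Definition simple_fun d (T : measurableType d) (X : normedModType R[i])
    (s : seq (set T * X)) (t : T) : X :=
  \sum_(Ax <- s) (\1_(Ax.1) t : R)%:C%C *: Ax.2.

Definition simple_integral d (T : measurableType d) (X : normedModType R[i])
    (m : {charge set T -> \bar R}) (s : seq (set T * X)) : X :=
  \sum_(Ax <- s) (fine (m Ax.1))%:C%C *: Ax.2.

Definition is_bochner_integral d (T : measurableType d) (X : normedModType R[i])
    (m : {charge set T -> \bar R}) (f : T -> X) (v : X) : Prop :=
  exists (P N : set T) (mPN : hahn_decomposition m P N)
         (s : nat -> seq (set T * X)),
    let err n t : R := rnorm (f t - simple_fun (s n) t) in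
    [/\ forall n Ax, Ax \in s n -> measurable Ax.1,
        forall n, measurable_fun setT (err n),
        (\int[charge_variation mPN]_t (err n t)%:E)%E @[n --> \oo] --> 0%E &
        simple_integral m (s n) @[n --> \oo] --> v].

Definition bochner_integral d (T : measurableType d) (X : normedModType R[i])
    (m : {charge set T -> \bar R}) (f : T -> X) : X :=
  xget 0 [set v | is_bochner_integral m f v].

Definition strongly_continuous_rep (G : topGroupType) (X : normedModType R[i])
    (pi : G -> {linear X -> X}) : Prop :=
  [/\ forall x, pi 1%g x = x,
      forall g h x, pi (g * h)%g x = pi g (pi h x),
      forall g, continuous (pi g) &
      forall x, continuous (fun g => pi g x)].

Definition rep_measure (G : topGroupType) (X : normedModType R[i])
    (pi : G -> {linear X -> X}) (m : {charge set (borel G) -> \bar R}) (x : X)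
    : X :=
  bochner_integral m (fun g : borel G => pi g x).

Definition projection_onto (X : normedModType R[i]) (F : set X)
    (P : {linear X -> X}) : Prop :=
  [/\ continuous P, forall x, P (P x) = P x & range P = F].

Definition strong_banach_T (G : topGroupType) (E : banachType R -> Prop)
    : Prop :=
  forall l : G -> R, length_function l ->
  exists m : nat -> {charge set (borel G) -> \bar R},
    (forall n, compactly_supported (m n) /\ symmetric_charge (m n)) /\
    forall X : banachType R, E X ->
    exists2 t : R, 0 < t &
      forall (pi : G -> {linear X -> X}) (L : R),
        strongly_continuous_rep pi -> 0 <= L ->
        (forall g, (opnorm (pi g) <= (L * expR (t * l g))%:E)%E) ->
        exists2 P : {linear X -> X},
          projection_onto [set x | forall g, pi g x = x] P &
          opnorm (fun x => rep_measure pi (m n) x - P x) @[n --> \oo] --> 0%E.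

End StrongPropertyT.

Section SpecialLinear.
Variables (n : nat) (R : realType).

Record SL := MkSL { SLval :> 'M[R]_n; _ : \det SLval == 1 }.

HB.instance Definition _ := [isSub of SL for SLval].
HB.instance Definition _ := [Choice of SL by <:].

Lemma SL_det (A : SL) : \det A = 1. Proof. by apply/eqP; case: A. Qed.

Lemma SL_unit (A : SL) : (A : 'M[R]_n) \in unitmx.
Proof. by rewrite unitmxE SL_det unitr1. Qed.

Lemma SL_one_subproof : \det (1%:M : 'M[R]_n) == 1.
Proof. by rewrite det1. Qed.

Lemma SL_mul_subproof (A B : SL) : \det ((A : 'M[R]_n) *m B) == 1.
Proof. by rewrite det_mulmx !SL_det mulr1. Qed.

Lemma SL_inv_subproof (A : SL) : \det (invmx (A : 'M[R]_n)) == 1.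
Proof. by rewrite det_inv SL_det invr1. Qed.

Definition SL_one := MkSL SL_one_subproof.
Definition SL_mul A B := MkSL (SL_mul_subproof A B).
Definition SL_inv A := MkSL (SL_inv_subproof A).

Lemma SL_mulA : associative SL_mul.
Proof. by move=> A B C; apply/val_inj/mulmxA. Qed.
Lemma SL_mul1 : left_id SL_one SL_mul.
Proof. by move=> A; apply/val_inj/mul1mx. Qed.
Lemma SL_mulr1 : right_id SL_one SL_mul.
Proof. by move=> A; apply/val_inj/mulmx1. Qed.
Lemma SL_mulV : left_inverse SL_one SL_inv SL_mul.
Proof. by move=> A; apply/val_inj/mulVmx/SL_unit. Qed.
Lemma SL_mulrV : right_inverse SL_one SL_inv SL_mul.
Proof. by move=> A; apply/val_inj/mulmxV/SL_unit. Qed.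

HB.instance Definition _ :=
  isGroup.Build SL SL_mulA SL_mul1 SL_mulr1 SL_mulV SL_mulrV.

HB.instance Definition _ := isPointed.Build SL SL_one.
HB.instance Definition _ := Topological.copy SL (initial_topology SLval).

Lemma SL_coord_continuous (i j : 'I_n) :
  continuous (fun A : SL => SLval A i j).
Proof.
move=> A; apply: (@continuous_comp _ _ _ (@SLval : SL -> 'M[R]_n)
  (fun M : 'M[R]_n => M i j)); first exact: initial_continuous.
exact: coord_continuous.
Qed.

Lemma continuous_to_SL (T : topologicalType) (f : T -> SL) :
  (forall i j, continuous (fun t => SLval (f t) i j)) -> continuous f.
Proof.
move=> cf; apply: (@continuous_comp_initial _ _ _ (@SLval) f) => t B [P Pf PB].
have : nbhs t [set u | forall i j, P i j (SLval (f u) i j)].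
  apply: filter_forall => i; apply: filter_forall => j.
  by apply: cf; exact: Pf.
by apply: filterS => u Pu; apply: PB.
Qed.

Lemma continuous_sumr (T : topologicalType) (I : Type) (r : seq I)
    (F : I -> T -> R) :
  (forall i, continuous (F i)) -> continuous (fun t => \sum_(i <- r) F i t).
Proof. by move=> cF; apply: continuous_big => //; exact: add_continuous. Qed.

Lemma continuous_prodr (T : topologicalType) (I : Type) (r : seq I)
    (F : I -> T -> R) :
  (forall i, continuous (F i)) -> continuous (fun t => \prod_(i <- r) F i t).
Proof. by move=> cF; apply: continuous_big => //; exact: mul_continuous. Qed.

Lemma continuous_mull (T : topologicalType) (a : R) (F : T -> R) :
  continuous F -> continuous (fun t => a * F t).
Proof. by move=> cF t; apply: cvgMr; exact: cF. Qed.

Lemma SL_mul_continuous : continuous (fun gh : SL * SL => (gh.1 * gh.2)%g).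
Proof.
apply: continuous_to_SL => i j.
under eq_fun do rewrite mxE.
apply: continuous_sumr => k gh; apply: cvgM.
- apply: (@continuous_comp _ _ _ fst (fun A : SL => SLval A i k)).
    exact: cvg_fst.
  exact: SL_coord_continuous.
- apply: (@continuous_comp _ _ _ snd (fun A : SL => SLval A k j)).
    exact: cvg_snd.
  exact: SL_coord_continuous.
Qed.

Lemma SL_inv_continuous : continuous (fun g : SL => g^-1%g).
Proof.
apply: continuous_to_SL => i j.
have -> : (fun g : SL => SLval g^-1%g i j) = (fun g => cofactor (SLval g) j i).
  apply/funext => g; rewrite /= /invmx SL_unit SL_det invr1 scale1r.
  by rewrite mxE.
apply: continuous_mull.
apply: continuous_sumr => s; apply: continuous_mull.
apply: continuous_prodr => k.
under eq_fun do rewrite !mxE.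
exact: SL_coord_continuous.
Qed.

HB.instance Definition _ :=
  isTopologicalGroup.Build SL SL_mul_continuous SL_inv_continuous.

End SpecialLinear.

(* Main.v *)
(** Test functions on boxes of the plane against lines: [line_mat] is the matrix of a
    discretized difference of line averages in the Heisenberg group, viewed as an
    operator from l^oo(X) to l^1(X). For X of type p and cotype q, comparing Gaussian
    sums through the Schur test bounds it by a negative power of its size as soon as
    1/p - 1/q < 1/4. Such a bound passes to subspaces, quotients, ultrapowers, and, with
    a smaller exponent, to interpolation spaces, X_0 being arbitrary since the matrix is
    uniformly bounded on every Banach space. Hence it holds on all of E_4.

    Three root subgroups x, y and z = [x, y] of SL(3, R) form a Heisenberg group. In a
    representation on X, the decay says that averaging x over [0, A] and y over [0, B]
    almost absorbs averages of z over [0, c], up to a power of c / (A B). Consequently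
    the averages over x_12([0, 1]) x_23([0, b]) x_31([0, 1]) form a Cauchy sequence along
    b = 2^n, at an exponential rate. The loss e^(t l) is harmless, because l(x_ij(a)) is
    O(log |a|). The limit vectors are fixed by a root subgroup, and a vector fixed by
    one root subgroup is fixed by all of them, by the same absorption. The measures m_n
    are these averages, symmetrized under inversion. *)

From HB Require Import structures.
Require Import Defs.
From mathcomp Require Import all_boot all_order all_algebra.
From mathcomp Require Import all_classical all_reals all_analysis.
From mathcomp Require Import measurable_realfun complex.
From mathcomp Require Import ring lra zify.

Set Implicit Arguments.
Unset Strict Implicit.
Unset Printing Implicit Defensive.

Import Order.TTheory GRing.Theory Num.Theory.
Import numFieldNormedType.Exports.

Local Open Scope classical_set_scope.
Local Open Scope ring_scope.

(** The measures are fixed before X is known, so X may enter only through the rate of convergence.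
    This is why its geometry is condensed into scalar matrices that are the same for all spaces: X
    decides just the exponent of their decay, and t is a fraction of this exponent that depends only
    on the length function. The number 1/4 comes from a count of exponents. From l^oo to l^1 over a
    Hilbert space, the matrix gains n^(-1/2) up to logarithms; type p and cotype q lose n^(2 (1/p -
    1/q)) against that. The averages at b and 2 b are not compared directly. Both are close to a
    third one, in which the average of x_23 is traded for averages of x_13 and x_21 over [0, s] with
    s about b^(3/4). These are short against b, so they can be inserted, and long against sqrt b, so
    that their commutators absorb x_23([0, b]). *)

Section RealNorm.
Context {R : realType} {X : normedModType R[i]}.
Implicit Types (x y : X) (a : R[i]) (r : R).

Lemma normE x : `|x| = (rnorm x)%:C%C.
Proof. by apply/eqP; rewrite eq_complex /= eqxx /= ger0_Im. Qed.

Lemma rnorm_ge0 x : 0 <= rnorm x.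
Proof. by have := normr_ge0 x; rewrite normE lecR. Qed.

Lemma rnorm0 : rnorm (0 : X) = 0.
Proof. by rewrite /rnorm normr0. Qed.

Lemma rnorm0_eq0 x : rnorm x = 0 -> x = 0.
Proof. by move=> x0; apply/eqP; rewrite -normr_eq0 normE x0. Qed.

Lemma ler_rnormD x y : rnorm (x + y) <= rnorm x + rnorm y.
Proof. by rewrite -lecR rmorphD /= -!normE ler_normD. Qed.

Lemma rnormN x : rnorm (- x) = rnorm x.
Proof. by rewrite /rnorm normrN. Qed.

Lemma rnormBC x y : rnorm (x - y) = rnorm (y - x).
Proof. by rewrite -rnormN opprB. Qed.

Lemma ler_rnormB x y : rnorm (x - y) <= rnorm x + rnorm y.
Proof. by rewrite -(rnormN y) ler_rnormD. Qed.

Lemma ler_rnorm_trans y x z : rnorm (x - z) <= rnorm (x - y) + rnorm (y - z).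
Proof. by rewrite (le_trans _ (ler_rnormD _ _)) // addrA subrK. Qed.

Lemma ler_rnorm_dist x y : `|rnorm x - rnorm y| <= rnorm (x - y).
Proof.
rewrite ler_norml; apply/andP; split.
  by have := ler_rnormD (y - x) x; rewrite subrK -rnormBC; lra.
by have := ler_rnormD (x - y) y; rewrite subrK; lra.
Qed.

Lemma rnormZ a x : rnorm (a *: x) = complex.Re `|a| * rnorm x.
Proof.
apply: complexI; by rewrite -normE normrZ (normE x) rmorphM /=.
Qed.

Lemma rnormZr r x : rnorm (r%:C%C *: x) = `|r| * rnorm x.
Proof. by rewrite rnormZ normc_def /= expr0n addr0 sqrtr_sqr. Qed.

Lemma ler_rnorm_sum (I : Type) (s : seq I) (P : pred I) (F : I -> X) :
  rnorm (\sum_(i <- s | P i) F i) <= \sum_(i <- s | P i) rnorm (F i).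
Proof.
apply: (big_ind2 (fun (u : X) (v : R) => rnorm u <= v)) => //.
  by rewrite rnorm0.
by move=> u1 v1 u2 v2 h1 h2; apply: le_trans (ler_rnormD _ _) (lerD h1 h2).
Qed.

Lemma cvg_rnormP (T : Type) (F : set_system T) (f : T -> X) (l : X) :
  Filter F ->
  f x @[x --> F] --> l <->
  (forall e : R, 0 < e -> \forall t \near F, rnorm (f t - l) < e).
Proof.
move=> FF; split.
  move=> /cvgrPdist_lt fl e e0.
  have /fl : 0 < e%:C%C by rewrite ltcR.
  by apply: filterS => t; rewrite normE ltcR rnormBC.
move=> h; apply/cvgrPdist_lt => e e0.
(* In the order of [R[i]] a positive element has zero imaginary part, so it is a positive real. *)
have [r r0 er] : exists2 r : R, 0 < r & e = r%:C%C.
  case: e e0 => a b; rewrite ltcE /= => /andP[/eqP b0 a0]; exists a => //.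
  by rewrite b0.
by have := h r r0; apply: filterS => t; rewrite er normE ltcR rnormBC.
Qed.

Lemma cvg_rnormP_le (T : Type) (F : set_system T) (f : T -> X) (l : X) :
  Filter F ->
  (forall e : R, 0 < e -> \forall t \near F, rnorm (f t - l) <= e) ->
  f x @[x --> F] --> l.
Proof.
move=> FF h; apply/cvg_rnormP => e e0.
have := h (e / 2) (divr_gt0 e0 (ltr0Sn _ _)).
apply: filterS => t; lra.
Qed.

Lemma rnorm_continuous : continuous (@rnorm R X).
Proof.
move=> x; apply/cvgrPdist_lt => e e0.
have /cvg_rnormP /(_ e e0) : (fun y : X => y) y @[y --> x] --> x by exact: cvg_id.
apply: filterS => y; apply: le_lt_trans.
by rewrite distrC ler_rnorm_dist.
Qed.

Lemma cvg_rnorm (T : Type) (F : set_system T) (f : T -> X) (l : X) :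
  Filter F -> f x @[x --> F] --> l -> rnorm (f x) @[x --> F] --> rnorm l.
Proof. by move=> FF fl; apply: cvg_comp fl _; exact: rnorm_continuous. Qed.

Lemma cvg_rnorm_le (T : Type) (F : set_system T) (f : T -> X) (l : X) (M : R) :
  ProperFilter F -> f x @[x --> F] --> l ->
  (\forall t \near F, rnorm (f t) <= M) -> rnorm l <= M.
Proof.
move=> FF /cvg_rnorm fl h.
rewrite -(cvg_lim _ fl) //; apply: limr_le => //.
by apply/cvg_ex; exists (rnorm l).
Qed.

End RealNorm.

Lemma cvg_cauchy_rnorm (R : realType) (X : banachType R) (u : nat -> X) :
  (forall e : R, 0 < e -> exists N, forall m n, (N <= m)%N -> (N <= n)%N ->
    rnorm (u m - u n) <= e) -> cvgn u.
Proof.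
move=> h; apply/cauchy_cvgP/cauchy_exP => e e0.
have [r r0 er] : exists2 r : R, 0 < r & e = r%:C%C.
  case: e e0 => a b; rewrite ltcE /= => /andP[/eqP b0 a0]; exists a => //.
  by rewrite b0.
have [N hN] := h (r / 2) (divr_gt0 r0 (ltr0Sn _ _)).
exists (u N); exists N => // n /= Nn.
rewrite -ball_normE /= er normE ltcR.
by apply: le_lt_trans (hN _ _ _ _) _ => //; lra.
Qed.

Lemma cvg_rnorm_seqP (R : realType) (X : normedModType R[i]) (u : nat -> X) l :
  u n @[n --> \oo] --> l <->
  (forall e : R, 0 < e -> exists N, forall n, (N <= n)%N -> rnorm (u n - l) < e).
Proof.
split=> [/cvg_rnormP h e /h [N _ hN]|h]; first by exists N => n /hN.
by apply/cvg_rnormP => e /h [N hN]; exists N => // n /hN.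
Qed.

Lemma continuous_rnormP (R : realType) (X Y : normedModType R[i]) (f : X -> Y) x :
  {for x, continuous f} <->
  (forall e : R, 0 < e -> exists2 d : R, 0 < d &
     forall y, rnorm (y - x) < d -> rnorm (f y - f x) < e).
Proof.
rewrite /continuous_at; split.
  move=> /cvg_rnormP h e /h /nbhs_normP[d /= d0 hd].
  have [r r0 er] : exists2 r : R, 0 < r & d = r%:C%C.
    case: d d0 {hd} => a b; rewrite ltcE /= => /andP[/eqP b0 a0]; exists a => //.
    by rewrite b0.
  exists r => // y yx; apply: hd; rewrite /ball_ /= er normE ltcR.
  by rewrite rnormBC.
move=> h; apply/cvg_rnormP => e /h[d d0 hd].
apply/nbhs_normP; exists d%:C%C; first by rewrite /= ltcR.
by move=> y; rewrite /ball_ /= normE ltcR => yx; apply: hd; rewrite rnormBC.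
Qed.

Lemma continuous_rnorm_realP (R : realType) (X : normedModType R[i])
    (f : R -> X) x :
  {for x, continuous f} <->
  (forall e : R, 0 < e -> exists2 d : R, 0 < d &
     forall y, `|y - x| < d -> rnorm (f y - f x) < e).
Proof.
rewrite /continuous_at; split.
  move=> /cvg_rnormP h e /h /nbhs_normP[d /= d0 hd].
  by exists d => // y yx; apply: hd; rewrite /ball_ /= distrC.
move=> h; apply/cvg_rnormP => e /h[d d0 hd].
apply/nbhs_normP; exists d => //.
by move=> y; rewrite /ball_ /= distrC => ?; exact: hd.
Qed.

Lemma linear_rnorm_bound (R : realType) (X Y : normedModType R[i])
    (T : {linear X -> Y}) :
  continuous T -> exists2 M : R, 0 <= M & forall x, rnorm (T x) <= M * rnorm x.
Proof.
move=> /(_ 0) /continuous_rnormP /(_ 1 ltr01) [d d0 hd].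
exists (2 / d); first by rewrite divr_ge0 // ltW.
move=> x; have [/rnorm0_eq0 -> | x0] := eqVneq (rnorm x) 0.
  by rewrite linear0 !rnorm0 mulr0.
have xp : 0 < rnorm x by rewrite lt0r x0 rnorm_ge0.
set c := d / 2 / rnorm x.
have c0 : 0 < c by rewrite !divr_gt0.
have := hd (c%:C%C *: x); rewrite subr0 linear0 subr0 linearZ /= !rnormZr.
rewrite gtr0_norm // /c divfK // => /(_ _)/ltW.
have -> : d / 2 < d by lra.
move=> /(_ isT) h; rewrite -(ler_pM2l c0) (le_trans h) //.
by rewrite /c le_eqVlt; apply/orP; left; apply/eqP; field; rewrite x0 gt_eqF.
Qed.

Lemma rnorm_bound_continuous (R : realType) (X Y : normedModType R[i])
    (T : {linear X -> Y}) (M : R) :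
  (forall x, rnorm (T x) <= M * rnorm x) -> continuous T.
Proof.
move=> h x; apply/continuous_rnormP => e e0.
exists (e / (`|M| + 1)); first by rewrite divr_gt0 // ltr_wpDl.
move=> y yx; rewrite -linearB (le_lt_trans (h _)) //.
have := yx; rewrite ltr_pdivlMr ?ltr_wpDl // => /(le_lt_trans _); apply.
rewrite mulrC ler_wpM2l ?rnorm_ge0 // (le_trans (ler_norm _)) //.
by rewrite lerDl.
Qed.

(** * Operators from l^oo(X) to l^1(X) *)

Section MatBound.
Context {R : realType} {E O : finType}.
Implicit Types (X Y : banachType R) (k : O -> E -> R).

(* [k] has norm at most [C] as an operator from [l^oo(E; X)] to [l^1(O; X)]. *)
Definition mat_bound X k (C : R) : Prop :=
  forall x : E -> X, (forall e, rnorm (x e) <= 1) ->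
    \sum_o rnorm (\sum_e (k o e)%:C%C *: x e) <= C.

Lemma mat_bound_ge0 X k C : mat_bound X k C -> 0 <= C.
Proof.
move=> /(_ (fun=> 0)) h; apply: le_trans (h _); last by move=> e; rewrite rnorm0.
by apply: sumr_ge0 => o _; exact: rnorm_ge0.
Qed.

Lemma mat_bound_le X k C D : C <= D -> mat_bound X k C -> mat_bound X k D.
Proof. by move=> CD h x x1; apply: le_trans CD; exact: h. Qed.

Lemma mat_bound_scale X k C : mat_bound X k C ->
  forall (r : R) (x : E -> X), 0 <= r -> (forall e, rnorm (x e) <= r) ->
    \sum_o rnorm (\sum_e (k o e)%:C%C *: x e) <= r * C.
Proof.
move=> h r x; rewrite le_eqVlt => /predU1P[<-|r0] xr.
  rewrite mul0r big1 // => o _; rewrite big1 ?rnorm0 // => e _.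
  have -> : x e = 0 by apply: rnorm0_eq0; apply/eqP; rewrite eq_le xr rnorm_ge0.
  by rewrite scaler0.
have -> : \sum_o rnorm (\sum_e (k o e)%:C%C *: x e) =
    r * \sum_o rnorm (\sum_e (k o e)%:C%C *: (r^-1%:C%C *: x e)).
  rewrite mulr_sumr; apply: eq_bigr => o _.
  rewrite -[in RHS](gtr0_norm r0) -rnormZr scaler_sumr; congr rnorm.
  apply: eq_bigr => e _; rewrite !scalerA -!rmorphM /=; congr (_%:C%C *: _).
  by rewrite gtr0_norm //; field; rewrite gt_eqF.
rewrite ler_pM2l //; apply: h => e.
by rewrite rnormZr gtr0_norm ?invr_gt0 // mulrC ler_pdivrMr // mul1r.
Qed.

Lemma mat_bound_kscale X k C (c : R) : 0 <= c -> mat_bound X k C ->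
  mat_bound X (fun o e => c * k o e) (c * C).
Proof.
move=> c0 h x x1; rewrite (le_trans _ (ler_wpM2l c0 (h x x1))) //.
rewrite mulr_sumr; apply: ler_sum => o _.
rewrite -{2}(ger0_norm c0) -rnormZr scaler_sumr le_eqVlt; apply/orP; left.
by apply/eqP; congr rnorm; apply: eq_bigr => e _; rewrite scalerA -rmorphM.
Qed.

Lemma mat_bound_subspace X Y k C :
  is_subspace X Y -> mat_bound X k C -> mat_bound Y k C.
Proof.
move=> [T Tn] h y y1.
rewrite (le_trans _ (h (fun e => T (y e)) _)) //; last first.
  by move=> e; rewrite Tn.
apply: ler_sum => o _; rewrite -Tn linear_sum /=.
by rewrite le_eqVlt; apply/orP; left; apply/eqP; congr rnorm; apply: eq_bigr => e _;
  rewrite linearZ.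
Qed.

(** Each [y e] is lifted separately: the bound concerns arbitrary bounded families, so a non-linear
    choice of lifts does no harm. The quotient norm is an infimum, hence lifts of norm slightly
    above 1. *)
Lemma mat_bound_quotient X Y k C :
  is_quotient X Y -> mat_bound X k C -> mat_bound Y k C.
Proof.
move=> [T [Tc Tsurj Tn]] h y y1.
have lb y' : has_lbound [set rnorm x | x in [set x | T x = y']].
  by exists 0 => _ [x _ <-]; exact: rnorm_ge0.
have C0 := mat_bound_ge0 h.
have Tle x : rnorm (T x) <= rnorm x.
  by rewrite Tn; apply: ge_inf => //; exists x.
apply/ler_addgt0Pr => d d0.
(* Then [r * C <= C + d], also for [C = 0]. *)
set r := 1 + d / (C + 1).
have C1 : 0 < C + 1 by rewrite ltr_wpDl.
have r1 : 1 < r by rewrite /r ltrDl divr_gt0.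
have /choice[x xP] : forall e, exists x, T x = y e /\ rnorm x <= r.
  move=> e; have hi : has_inf [set rnorm x | x in [set x | T x = y e]].
    split; last exact: lb.
    by have [x Tx] := Tsurj (y e); exists (rnorm x); exists x.
  have r10 : 0 < r - 1 by rewrite subr_gt0.
  have [_ [x /= Tx <-] xr] := inf_adherent r10 hi.
  exists x; split => //; apply: le_trans (ltW xr) _.
  by rewrite -Tn; have := y1 e; lra.
apply: (@le_trans _ _ (r * C)).
  apply: le_trans (mat_bound_scale h (r := r) (x := x) _ _); last 2 first.
  - by apply: le_trans (ltW r1).
  - by move=> e; have [] := xP e.
  apply: ler_sum => o _; apply: le_trans (Tle _).
  rewrite linear_sum /= le_eqVlt; apply/orP; left; apply/eqP; congr rnorm.
  by apply: eq_bigr => e _; rewrite linearZ /= (xP e).1.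
rewrite /r mulrDl mul1r lerD2l mulrAC ler_pdivrMr //.
by rewrite ler_pM2l // lerDl.
Qed.

(** Only finitely many vectors and norms occur, so the inequality in X at U-almost every index
    passes to the limit along U. *)
Lemma mat_bound_ultrapower X Y k C :
  is_ultrapower X Y -> mat_bound X k C -> mat_bound Y k C.
Proof.
move=> [I [U [T]]] /=.
pose bd (x : I -> X) := exists M, forall i, rnorm (x i) <= M.
move=> [UU Tlin Tsurj Tn] h y y1.
have C0 := mat_bound_ge0 h.
have T0 : T (fun=> 0) = 0.
  have b0 : bd (fun=> 0) by exists 0 => i; rewrite rnorm0.
  have := Tlin (-1) _ _ b0 b0.
  have -> : (fun i : I => -1 *: (0 : X) + 0) = fun=> 0.
    by apply/funext => i; rewrite scaler0 addr0.
  by rewrite scaleN1r addNr.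
have Tsum (a : E -> R[i]) (x : E -> I -> X) (s : seq E) : (forall e, bd (x e)) ->
    bd (fun i => \sum_(e <- s) a e *: x e i) /\
    T (fun i => \sum_(e <- s) a e *: x e i) = \sum_(e <- s) a e *: T (x e).
  move=> xb; elim: s => [|e s [IH1 IH2]].
    split; last by rewrite big_nil; under eq_fun do rewrite big_nil.
    by exists 0 => i; rewrite big_nil rnorm0.
  split; last first.
    rewrite big_cons -IH2 -Tlin; [|exact: xb|exact: IH1].
    by congr T; apply/funext => i; rewrite big_cons.
  have [M1 hM1] := IH1; have [M2 hM2] := xb e.
  exists (complex.Re `|a e| * M2 + M1) => i; rewrite big_cons.
  apply: le_trans (ler_rnormD _ _) _; rewrite lerD // rnormZ ler_wpM2l //.
  by have := normr_ge0 (a e); rewrite lecE => /andP[_].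
have /choice[x xP] : forall e, exists x, bd x /\ T x = y e.
  by move=> e; have [x ? ?] := Tsurj (y e); exists x.
apply/ler_addgt0Pr => d d0.
set r := 1 + d / (C + 1).
have C1 : 0 < C + 1 by rewrite ltr_wpDl.
have r1 : 1 < r by rewrite /r ltrDl divr_gt0.
apply: (@le_trans _ _ (r * C)); last first.
  rewrite /r mulrDl mul1r lerD2l mulrAC ler_pdivrMr //.
  by rewrite ler_pM2l // lerDl.
have small : \forall i \near U, forall e, rnorm (x e i) <= r.
  apply: filter_forall => e.
  have [xb Tx] := xP e.
  have /cvgr_lt/(_ r) := Tn _ xb; rewrite Tx => /(_ (le_lt_trans (y1 e) r1)).
  by apply: filterS => i /ltW.
pose F o i := \sum_(e <- index_enum E) (k o e)%:C%C *: x e i.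
have FT o : rnorm (F o i) @[i --> U] --> rnorm (\sum_e (k o e)%:C%C *: y e).
  have [Fb FT] := Tsum (fun e => (k o e)%:C%C) x (index_enum E) (fun e => (xP e).1).
  have := Tn _ Fb; rewrite FT.
  by under eq_bigr do rewrite (xP _).2.
have FS : \sum_o rnorm (F o i) @[i --> U] -->
    \sum_o rnorm (\sum_e (k o e)%:C%C *: y e).
  by apply: cvg_big => [|o _]; [exact: add_continuous|exact: FT].
rewrite -(cvg_lim _ FS) //; apply: limr_le; first by apply/cvg_ex; eexists; exact: FS.
apply: filterS small => i hi.
by apply: mat_bound_scale => //; apply: le_trans (ltW r1).
Qed.

End MatBound.

(** The factor [M] is independent of the matrix, so an isomorphism leaves the decay exponent of a
    family of matrices unchanged. *)
Lemma mat_bound_isomorphic (R : realType) (X Y : banachType R) : isomorphic Y X ->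
  exists2 M : R, 1 <= M & forall (E O : finType) (k : O -> E -> R) C, mat_bound X k C -> mat_bound Y k (M * C).
Proof.
move=> [T [S [TS ST cT cS]]].
have [a a0 aP] := linear_rnorm_bound cT.
have [b b0 bP] := linear_rnorm_bound cS.
exists (b * a + 1) => [|E O k C h y y1]; first by rewrite lerDr mulr_ge0.
have C0 := mat_bound_ge0 h.
apply: (@le_trans _ _ (b * (a * C))); last first.
  by rewrite mulrA mulrDl lerDl mul1r.
apply: le_trans (ler_wpM2l b0 (mat_bound_scale h (r := a)
   (x := fun e => T (y e)) a0 _)); last first.
  by move=> e; apply: le_trans (aP _) _; rewrite ler_piMr.
rewrite mulr_sumr; apply: ler_sum => o _.
rewrite -{1}(TS (\sum_e _)); apply: le_trans (bP _) _.
rewrite ler_wpM2l // le_eqVlt linear_sum; apply/orP; left; apply/eqP; congr rnorm.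
by apply: eq_bigr => e _; rewrite linearZ.
Qed.


(** * Complex interpolation *)

Section ComplexAbs.
Context {R : realType}.
Implicit Types (z w : R[i]) (r : R).

Definition cabs z : R := complex.Re `|z|.

Lemma cabsE z : `|z| = (cabs z)%:C%C.
Proof. exact: (@normE R (R[i]^o) z). Qed.

Lemma cabs_ge0 z : 0 <= cabs z.
Proof. exact: (@rnorm_ge0 R (R[i]^o) z). Qed.

Lemma cabsM z w : cabs (z * w) = cabs z * cabs w.
Proof. by apply: complexI; rewrite -cabsE normrM !cabsE rmorphM. Qed.

Lemma cabsV z : cabs z^-1 = (cabs z)^-1.
Proof. by apply: complexI; rewrite -cabsE normfV cabsE fmorphV. Qed.

Lemma cabsX z n : cabs (z ^+ n) = cabs z ^+ n.
Proof. by apply: complexI; rewrite -cabsE normrX cabsE rmorphXn. Qed.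

Lemma cabsC r : cabs r%:C%C = `|r|.
Proof. by rewrite /cabs normc_def /= expr0n addr0 sqrtr_sqr. Qed.

Lemma ler_cabsD z w : cabs (z + w) <= cabs z + cabs w.
Proof. exact: (@ler_rnormD R (R[i]^o) z w). Qed.

Lemma ler_cabs_sum (I : Type) (s : seq I) (P : pred I) (F : I -> R[i]) :
  cabs (\sum_(i <- s | P i) F i) <= \sum_(i <- s | P i) cabs (F i).
Proof. exact: (@ler_rnorm_sum R (R[i]^o) I s P F). Qed.

Lemma cabs_sqr z : cabs z ^+ 2 = complex.Re z ^+ 2 + complex.Im z ^+ 2.
Proof.
case: z => a b; rewrite /cabs normc_def /= sqr_sqrtr //.
by rewrite addr_ge0 // sqr_ge0.
Qed.

Lemma Re_le_cabs z : complex.Re z <= cabs z.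
Proof.
have [/ltW h|h] := ltP (complex.Re z) 0; first exact: le_trans h (cabs_ge0 _).
rewrite -(ler_pXn2r (ltn0Sn 1)) ?nnegrE ?cabs_ge0 //.
by rewrite cabs_sqr lerDl sqr_ge0.
Qed.

Lemma ReV z : complex.Re z^-1 = complex.Re z / cabs z ^+ 2.
Proof. by rewrite cabs_sqr; case: z. Qed.

Lemma ReD z w : complex.Re (z + w) = complex.Re z + complex.Re w.
Proof. by case: z; case: w. Qed.

Lemma Re_sum (I : Type) (s : seq I) (P : pred I) (F : I -> R[i]) :
  complex.Re (\sum_(i <- s | P i) F i) = \sum_(i <- s | P i) complex.Re (F i).
Proof. by elim/big_rec2: _ => // i x y _ <-; rewrite ReD. Qed.

Lemma ReMr r z : complex.Re (r%:C%C * z) = r * complex.Re z.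
Proof. by case: z => a b /=; rewrite mul0r subr0. Qed.

End ComplexAbs.

Section NumFieldDerivable.
Context {K : numFieldType} {V : normedModType K}.

Lemma derivable1_continuous (f : K -> V) z : derivable f z 1 -> {for z, continuous f}.
Proof. by move=> df; apply: differentiable_continuous; apply/derivable1_diffP. Qed.

Lemma derivable_scale (g : K -> K) (f : K -> V) z :
  derivable g z 1 -> derivable f z 1 -> derivable (fun z => g z *: f z) z 1.
Proof.
move=> dg df; have cg : {for z, continuous g}.
  by apply: differentiable_continuous; apply/derivable1_diffP.
move: dg df; rewrite /derivable => /cvg_ex[/= a ga] /cvg_ex[/= b fb].
apply/cvg_ex; exists (g z *: b + a *: f z).
have hz : h *: (1 : K^o) + z @[h --> (0 : K)^'] --> z.
  rewrite -[X in _ --> X](add0r z) -[X in _ --> X + _](scale0r (1 : K^o)).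
  apply: cvgD; last exact: cvg_cst.
  by apply: cvgZ; [exact: nbhs_dnbhs|exact: cvg_cst].
have gs : (g \o shift z) (h *: 1) @[h --> 0^'] --> g z.
  exact: (@cvg_comp _ _ _ (fun h : K => h *: (1 : K^o) + z) g _ (nbhs z)).
have -> : (fun h : K => h^-1 *: (((fun z => g z *: f z) \o shift z)
      (h *: 1) - g z *: f z)) =
  (fun h => (g \o shift z) (h *: 1) *:
      (h^-1 *: ((f \o shift z) (h *: 1) - f z)) +
    (h^-1 *: ((g \o shift z) (h *: 1) - g z)) *: f z).
  apply/funext => h /=.
  have sE (u v : K) : u *: (v : K^o) = u * v by [].
  by rewrite !scalerBr !scalerBl !scalerA !sE !(mulrC _ h^-1) addrA subrK.
apply: cvgD; first by apply: cvgZ.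
by apply: cvgZ => //; exact: cvg_cst.
Qed.

Lemma within_continuous_scale (A : set K) (g : K -> K) (f : K -> V) :
  (forall z, A z -> derivable g z 1) -> {within A, continuous f} ->
  {within A, continuous (fun z => g z *: f z)}.
Proof.
move=> dg cf x; apply: cvgZ; last exact: cf.
have : {within A, continuous g}; last exact.
apply: continuous_in_subspaceT => z /set_mem Az.
by apply: differentiable_continuous; apply/derivable1_diffP; exact: dg.
Qed.

Lemma derivable_mul (g f : K -> K) z :
  derivable g z 1 -> derivable f z 1 -> derivable (fun z => g z * f z) z 1.
Proof. exact: derivableM. Qed.

Lemma derivable_affineV (a c z : K) : c - a * z != 0 ->
  derivable (fun z : K => (c - a * z)^-1) z 1.
Proof.
move=> h; by apply: derivableV.
Qed.

Lemma derivable_expn (f : K -> K) n z :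
  derivable f z 1 -> derivable (fun z => f z ^+ n) z 1.
Proof.
move=> df; elim: n => [|n IH]; first by under eq_fun do rewrite expr0; exact: derivable_cst.
by under eq_fun do rewrite exprS; exact: derivable_mul.
Qed.

Lemma derivable_bigsum (I : Type) (s : seq I) (F : I -> K -> V) z :
  (forall i, derivable (F i) z 1) -> derivable (fun z => \sum_(i <- s) F i z) z 1.
Proof.
move=> dF; elim: s => [|i s IH].
  by under eq_fun do rewrite big_nil; exact: derivable_cst.
by under eq_fun do rewrite big_cons; exact: derivableD.
Qed.

End NumFieldDerivable.

Section CalderonOperations.
Context {R : realType} {X0 X1 : banachType R} {V : normedModType R[i]}.
Context {i0 : {linear X0 -> V}} {i1 : {linear X1 -> V}}.

Lemma line_continuous (g : R[i]^o -> R[i]^o) (a : R) :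
  (forall t, derivable g (Complex a t) 1) ->
  continuous (fun t : R => g (Complex a t)).
Proof.
move=> dg t; apply/cvg_rnormP => e e0.
have /continuous_rnormP /(_ e e0)[d d0 hd] : {for (Complex a t : R[i]^o), continuous g}.
  exact: (@derivable1_continuous R[i]).
apply/nbhs_normP; exists d => // s ts; apply: hd.
rewrite /rnorm normc_def /= subrr expr0n add0r sqrtr_sqr.
by move: ts; rewrite /ball_ /= distrC.
Qed.

(* [f] on the strip with boundary values [f0], [f1]; the scalar [g] only has to be
   regular and bounded on the closed strip. *)
Lemma calderon_scale (g : R[i]^o -> R[i]^o) (M : R) f f0 f1 :
  (forall z, strip z -> derivable g z 1) ->
  (forall z, strip z -> cabs (g z) <= M) ->
  calderon i0 i1 f f0 f1 ->
  calderon i0 i1 (fun z => g z *: f z) (fun t => g (Complex 0 t) *: f0 t)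
    (fun t => g (Complex 1 t) *: f1 t).
Proof.
move=> dg gM [[cf [B fB] df] [[cf0 f0p f0m if0] [cf1 f1p f1m if1]]].
have s0 t : strip (Complex 0 t) by rewrite /strip /= lexx ler01.
have s1 t : strip (Complex 1 t) by rewrite /strip /= lexx ler01.
have bd0 (Y : normedModType R[i]) (u : R -> Y) (c : R -> R[i]) (F : set_system R) :
    Filter F -> (forall t, cabs (c t) <= M) -> u t @[t --> F] --> (0 : Y) ->
    c t *: u t @[t --> F] --> (0 : Y).
  move=> FF cM /cvg_rnormP h; apply/cvg_rnormP => e e0.
  have M1 : 0 < `|M| + 1 by rewrite ltr_wpDl.
  have /h : 0 < e / (`|M| + 1) by rewrite divr_gt0.
  apply: filterS => t; rewrite !subr0 ltr_pdivlMr // => /(le_lt_trans _); apply.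
  rewrite rnormZ mulrC ler_wpM2l ?rnorm_ge0 // (le_trans (cM t)) //.
  by rewrite (le_trans (ler_norm _)) // lerDl.
split; [split|split; split].
- exact: (@within_continuous_scale R[i]).
- exists (`|M| * `|B|) => z sz; rewrite rnormZ ler_pM ?cabs_ge0 ?rnorm_ge0 //.
    by rewrite (le_trans (gM _ sz)) // ler_norm.
  by rewrite (le_trans (fB _ sz)) // ler_norm.
- move=> z oz; apply: (@derivable_scale R[i]); last exact: df.
  by apply: dg; case/andP: oz => /ltW z0 /ltW z1; rewrite /strip /= z0.
- move=> t; apply: cvgZ; last exact: cf0.
  by apply: line_continuous => s; apply: dg.
- by apply: bd0 => // t; apply: gM.
- by apply: bd0 => // t; apply: gM.
- by move=> t; rewrite linearZ /= if0.
- move=> t; apply: cvgZ; last exact: cf1.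
  by apply: line_continuous => s; apply: dg.
- by apply: bd0 => // t; apply: gM.
- by apply: bd0 => // t; apply: gM.
- by move=> t; rewrite linearZ /= if1.
Qed.

(** Applied to the rows of a matrix: each coordinate of the image of a family of Calderon functions
    is again a Calderon function. *)
Lemma calderon_lincomb (E : finType) (c : E -> R[i]) f f0 f1 :
  (forall e : E, calderon i0 i1 (f e) (f0 e) (f1 e)) ->
  calderon i0 i1 (fun z => \sum_e c e *: f e z) (fun t => \sum_e c e *: f0 e t)
    (fun t => \sum_e c e *: f1 e t).
Proof.
move=> h; elim: (index_enum E) => [|e s [[IH1 [M IH2] IH3] [[a1 a2 a3 a4] [b1 b2 b3 b4]]]].
  have nil (Y : normedModType R[i]) (T : Type) (u : E -> T -> Y) :
      (fun t => \sum_(e <- [::]) c e *: u e t) = fun=> 0.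
    by apply/funext => t; rewrite big_nil.
  rewrite !nil; split; [split|split; split].
  - by move=> z; exact: cvg_cst.
  - by exists 0 => z _; rewrite rnorm0.
  - by move=> z _; exact: (@derivable_cst R[i]).
  - by move=> t; exact: cvg_cst.
  - exact: cvg_cst.
  - exact: cvg_cst.
  - by move=> t; rewrite linear0.
  - by move=> t; exact: cvg_cst.
  - exact: cvg_cst.
  - exact: cvg_cst.
  - by move=> t; rewrite linear0.
have cons (Y : normedModType R[i]) (T : Type) (u : E -> T -> Y) :
    (fun t => \sum_(e <- e :: s) c e *: u e t) =
    fun t => c e *: u e t + \sum_(e <- s) c e *: u e t.
  by apply/funext => t; rewrite big_cons.
have [[cf [B fB] df] [[cf0 f0p f0m if0] [cf1 f1p f1m if1]]] := h e.
have lim0 (Y : normedModType R[i]) (u v : R -> Y) (F : set_system R) :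
    Filter F -> u t @[t --> F] --> (0 : Y) -> v t @[t --> F] --> (0 : Y) ->
    c e *: u t + v t @[t --> F] --> (0 : Y).
  move=> FF u0 v0; rewrite -[X in _ --> X]addr0 -[X in _ --> X + _](scaler0 _ (c e)).
  by apply: cvgD => //; apply: cvgZ => //; exact: cvg_cst.
rewrite !cons; split; [split|split; split].
- move=> z; apply: cvgD; last exact: IH1.
  by apply: cvgZ; [exact: cvg_cst|exact: cf].
- exists (cabs (c e) * `|B| + M) => z sz; apply: le_trans (ler_rnormD _ _) _.
  rewrite lerD ?IH2 // rnormZ ler_wpM2l ?cabs_ge0 //.
  by rewrite (le_trans (fB _ sz)) // ler_norm.
- move=> z oz; apply: (@derivableD R[i]); last exact: IH3.
  by apply: (@derivableZ R[i]); exact: df.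
- move=> t; apply: cvgD; last exact: a1.
  by apply: cvgZ; [exact: cvg_cst|exact: cf0].
- exact: lim0.
- exact: lim0.
- by move=> t; rewrite linearD linearZ /= if0 a4.
- move=> t; apply: cvgD; last exact: b1.
  by apply: cvgZ; [exact: cvg_cst|exact: cf1].
- exact: lim0.
- exact: lim0.
- by move=> t; rewrite linearD linearZ /= if1 b4.
Qed.

End CalderonOperations.

(** Heine's theorem; only [x] is confined to K, so points next to K can be compared as well. *)
Lemma compact_uniform (R : realType) (T : pseudoMetricType R)
    (X : normedModType R[i]) (K : set T) (f : T -> X) :
  compact K -> continuous f -> forall e : R, 0 < e ->
  exists2 d : R, 0 < d & forall x y, K x -> ball x d y -> rnorm (f y - f x) < e.
Proof.
move=> /compact_near_coveringP cK cf e e0.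
have e20 : 0 < e / 2 by rewrite divr_gt0.
have := cK R (0^'+) (fun d x => forall y, ball x d y -> rnorm (f y - f x) < e).
move=> /(_ _)[x Kx|d /= d0 hd].
- have /cvg_rnormP /(_ _ e20) : f y @[y --> x] --> f x by exact: cf.
  move=> /nbhs_ballP[r /= r0 hr].
  have r20 : 0 < r / 2 by rewrite divr_gt0.
  exists (ball x (r / 2), [set d | 0 < d < r / 2]).
    split => /=; first exact: nbhsx_ballx.
    near=> u; apply/andP; split; near: u; first exact: nbhs_right_gt.
    exact: nbhs_right_lt.
  move=> [x' u] /= [xx' /andP[u0 ur]] y x'y.
  have h1 : rnorm (f x' - f x) < e / 2.
    by apply: hr; apply: le_ball xx'; lra.
  have h2 : rnorm (f y - f x) < e / 2.
    apply: hr; rewrite [r]splitr; apply: ball_triangle xx' _.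
    by apply: le_ball x'y; exact: ltW.
  have := ler_rnorm_trans (f x) (f y) (f x').
  rewrite (rnormBC (f x)); lra.
- exists (d / 2); first by rewrite divr_gt0.
  have d20 : 0 < d / 2 by rewrite divr_gt0.
  move=> x y Kx xy; apply: (hd (d / 2)) xy => //.
  by rewrite /ball_ /= sub0r normrN gtr0_norm //; lra.
Unshelve. all: by end_near. Qed.

(** Sampling points of the line Re z = 1: a finite sum over them does the work of a Poisson
    integral. *)
Definition grid (R : realType) (m K : nat) (i : 'I_K * bool) : R :=
  if i.2 then i.1%:R / m.+1%:R else - (i.1%:R / m.+1%:R).

Section VanishingFunctions.
Context {R : realType} {X : normedModType R[i]}.
Implicit Types u : R -> X.

Definition vanishing u := [/\ continuous u, u t @[t --> +oo] --> (0 : X) &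
  u t @[t --> -oo] --> (0 : X)].

Lemma vanishing_tail u (e : R) : vanishing u -> 0 < e ->
  exists2 A, 0 <= A & forall t, A < `|t| -> rnorm (u t) < e.
Proof.
move=> [_ /cvg_rnormP up /cvg_rnormP um] e0.
have [A [_ hA]] := up e e0; have [B [_ hB]] := um e e0.
exists (`|A| + `|B|) => [|t]; first by rewrite addr_ge0.
have [t0|t0] := leP 0 t.
  rewrite (ger0_norm t0) => At; have := hA t; rewrite subr0; apply.
  by apply: le_lt_trans At; rewrite (le_trans (ler_norm _)) // lerDl.
rewrite (ltr0_norm t0) => At; have := hB t; rewrite subr0; apply.
by have := ler_norm (- B); rewrite normrN; have := normr_ge0 A; lra.
Qed.

Lemma vanishing_bounded u : vanishing u -> exists M, forall t, rnorm (u t) <= M.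
Proof.
move=> vu; have [A A0 hA] := vanishing_tail vu ltr01.
have [cu _ _] := vu.
have cr : {within `[-A, A], continuous (fun t => rnorm (u t))}.
  apply: continuous_subspaceT => t.
  by apply: (@continuous_comp _ _ _ u (@rnorm R X)); [exact: cu|exact: rnorm_continuous].
have AA : - A <= A by lra.
have [c _ hc] := EVT_max AA cr.
exists (1 + rnorm (u c)) => t; have [tA|At] := leP `|t| A; last first.
  by rewrite (le_trans (ltW (hA _ At))) // lerDl rnorm_ge0.
rewrite (le_trans (hc _ _)) ?lerDr //.
by rewrite in_itv /= -ler_norml.
Qed.

(** Outside a compact interval all the functions are small, and inside it uniform continuity allows
    sampling. One grid serves every [o] because O is finite. *)
Lemma vanishing_grid (O : finType) (u : O -> R -> X) (e : R) :
  (forall o, vanishing (u o)) -> 0 < e ->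
  exists m K : nat, forall o t, rnorm (u o t) <= e \/
    exists2 i : 'I_K * bool, `|t - grid R m i| <= m.+1%:R^-1
      & rnorm (u o t) <= rnorm (u o (grid R m i)) + e.
Proof.
move=> vu e0.
have [A A0 hA] : exists2 A, 0 <= A & forall o t, A < `|t| -> rnorm (u o t) < e.
  have /choice[A hA] : forall o, exists A, 0 <= A /\
      forall t, A < `|t| -> rnorm (u o t) < e.
    by move=> o; have [A ? ?] := vanishing_tail (vu o) e0; exists A.
  exists (\sum_o A o); first by apply: sumr_ge0 => o _; have [] := hA o.
  move=> o t At; have [_] := hA o; apply; apply: le_lt_trans At.
  by rewrite (bigD1 o) //= lerDl sumr_ge0 // => i _; have [] := hA i.
have [d d0 hd] : exists2 d, 0 < d & forall o s t, `|s| <= A + 1 -> `|t - s| < d ->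
    rnorm (u o t - u o s) < e.
  have /choice[d hd] : forall o, exists d, 0 < d /\
      forall s t, `|s| <= A + 1 -> `|t - s| < d -> rnorm (u o t - u o s) < e.
    move=> o; have [cu _ _] := vu o.
    have [d d0 hd] := compact_uniform (@segment_compact _ (- (A + 1)) (A + 1)) cu e0.
    exists d; split=> // s t sA ts; apply: hd.
      by rewrite /= in_itv /= -ler_norml.
    by rewrite -ball_normE /= distrC.
  exists (\big[Num.min/1]_o d o).
    by apply: lt_bigmin => // o _; have [] := hd o.
  move=> o s t sA ts; have [_] := hd o; apply => //.
  by apply: lt_le_trans ts _; exact: bigmin_le_cond.
(* The mesh 1 / (m + 1) is below the modulus [d], and the K points of each sign reach beyond A. *)
set m := Num.truncn d^-1.
have mh : m.+1%:R^-1 < d.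
  by rewrite -[d]invrK ltf_pV2 ?posrE ?invr_gt0 // truncnS_gt.
set K := (Num.truncn (A * m.+1%:R)).+2.
exists m, K => o t; have [tA|/hA h] := leP `|t| A; last by left; exact: ltW.
right; have hp : 0 < m.+1%:R :> R by [].
set k := Num.truncn (`|t| * m.+1%:R).
have kK : (k < K)%N.
  by rewrite /K ltnS (leq_trans _ (leqnSn _)) // le_truncn // ler_wpM2r.
have t0 : 0 <= `|t| * m.+1%:R by rewrite mulr_ge0.
have /andP[k1 k2] := truncn_itv t0.
have ts : `| `|t| - k%:R / m.+1%:R | <= m.+1%:R^-1.
  rewrite ger0_norm ?subr_ge0 ?ler_pdivrMr //.
  by rewrite lerBlDl -[X in _ + X]div1r -mulrDl ler_pdivlMr // natr1 ltW.
have sA : k%:R / m.+1%:R <= A + 1.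
  rewrite (@le_trans _ _ `|t|) ?ler_pdivrMr //; lra.
have s0 : 0 <= k%:R / m.+1%:R :> R by [].
have fin s : `|s| <= A + 1 -> `|t - s| <= m.+1%:R^-1 -> rnorm (u o t) <= rnorm (u o s) + e.
  move=> sA' /le_lt_trans /(_ mh) /(hd o _ _ sA') /ltW.
  have := ler_rnormD (u o t - u o s) (u o s); rewrite subrK; lra.
have [tp|tn] := leP 0 t.
  rewrite (ger0_norm tp) in ts.
  exists (Ordinal kK, true) => //.
  by apply: fin => //; rewrite ger0_norm.
rewrite (ltr0_norm tn) in ts.
have ts' : `|t - - (k%:R / m.+1%:R)| <= m.+1%:R^-1 by rewrite -normrN opprB addrC.
exists (Ordinal kK, false) => //.
by apply: (fin (- _)) => //; rewrite normrN ger0_norm.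
Qed.

End VanishingFunctions.

(** A Riemann sum for the integral of (1 + |t|)^-2, whose value is 2; as the mesh is at most 1, the
    sum is at most twice that. *)
Lemma grid_sum_le (R : realType) (m K : nat) :
  \sum_(i : 'I_K * bool) m.+1%:R^-1 / (1 + `|grid R m i : R|) ^+ 2 <= 4.
Proof.
set h : R := m.+1%:R^-1.
have h0 : 0 < h by rewrite invr_gt0.
have h1 : h <= 1 by rewrite invf_le1 // ler1n.
have half : \sum_(k < K) h / (1 + k%:R * h) ^+ 2 <= 2.
  (* Telescoping: h / (1 + k h)^2 is at most twice the decrease of 1 / (1 + x) from k h to (k + 1)
     h, because h <= 1. *)
  suff : \sum_(k < K) h / (1 + k%:R * h) ^+ 2 <= 2 * (1 - (1 + K%:R * h)^-1).
    move=> /le_trans; apply; rewrite ler_piMr //.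
    by rewrite lerBlDr lerDl invr_ge0 addr_ge0 // mulr_ge0 // ltW.
  elim: K => [|K IH]; first by rewrite big_ord0 mul0r addr0 invr1 subrr mulr0.
  rewrite big_ord_recr /= (le_trans (lerD IH (lexx _))) //.
  have a0 : 0 < 1 + K%:R * h by rewrite ltr_wpDr // mulr_ge0 // ltW.
  have b0 : 0 < 1 + K.+1%:R * h by rewrite ltr_wpDr // mulr_ge0 // ltW.
  rewrite -subr_ge0.
  have -> : 2 * (1 - (1 + K.+1%:R * h)^-1) - (2 * (1 - (1 + K%:R * h)^-1) +
      h / (1 + K%:R * h) ^+ 2) =
      h * (1 + K%:R * h - h) / ((1 + K%:R * h) ^+ 2 * (1 + K.+1%:R * h)).
    rewrite -natr1 in b0 *; field; rewrite !gt_eqF //.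
  have Kh : 0 <= K%:R * h by rewrite mulr_ge0 // ltW.
  apply: divr_ge0; first by rewrite mulr_ge0 //; [exact: ltW|lra].
  by apply: mulr_ge0; [rewrite exprn_ge0 // ltW|exact: ltW].
rewrite -(pair_bigA _ (fun k b => h / (1 + `|grid R m (k, b)|) ^+ 2)) /=.
rewrite (eq_bigr (fun k : 'I_K => 2 * (h / (1 + k%:R * h) ^+ 2))); last first.
  move=> k _; have kh : 0 <= k%:R * h by rewrite mulr_ge0 // ltW.
  by rewrite big_bool /grid /= -/h normrN (ger0_norm kh); ring.
rewrite -mulr_sumr; lra.
Qed.

Section PoissonSum.
Context {R : realType} (m K : nat) (b : 'I_K * bool -> R) (kap : R).
Hypotheses (b0 : forall i, 0 <= b i) (kap0 : 0 < kap).
Let h : R := m.+1%:R^-1.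
Let h0 : 0 < h. Proof. by rewrite invr_gt0. Qed.

(* A discrete Poisson-type integral: on [Re z = 1] its real part dominates the
   sampled boundary data [b], and it stays positive on the strip. *)
Definition poisson (z : R[i]) : R[i] :=
  kap%:C%C + \sum_(i : 'I_K * bool) (h * b i)%:C%C * (Complex (1 + h) (grid R m i) - 1 * z)^-1.

Let Re_term z (i : 'I_K * bool) : complex.Re z <= 1 ->
  h <= complex.Re (Complex (1 + h) (grid R m i) - 1 * z).
Proof. by case: z => x y /=; rewrite !mul1r mul0r subr0 => x1; lra. Qed.

Let Re_inv_term z (i : 'I_K * bool) : complex.Re z <= 1 ->
  0 <= complex.Re (Complex (1 + h) (grid R m i) - 1 * z)^-1.
Proof.
move=> z1; rewrite ReV divr_ge0 ?sqr_ge0 //.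
by apply: le_trans (Re_term i z1); exact: ltW.
Qed.

Let ReC (r : R) : complex.Re r%:C%C = r. Proof. by []. Qed.

(** The poles lie at distance [h] to the right of Re z = 1, so every summand has nonnegative real
    part to the left of this line. *)
Lemma Re_poisson z : complex.Re z <= 1 -> kap <= complex.Re (poisson z).
Proof.
move=> z1; rewrite /poisson ReD Re_sum ReC lerDl sumr_ge0 // => i _.
by rewrite ReMr mulr_ge0 ?Re_inv_term // mulr_ge0 // ltW.
Qed.

(** Seen from a point within [h] of the grid point, the pole is at h + i y with |y| <= h, and Re (h
    + i y)^-1 >= 1 / (2 h); the factor [h] of the summand cancels. *)
Lemma Re_poisson_boundary t i : `|t - grid R m i| <= h ->
  kap + b i / 2 <= complex.Re (poisson (Complex 1 t)).
Proof.
move=> ti; rewrite /poisson ReD Re_sum ReC lerD2l (bigD1 i) //.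
rewrite -[leLHS]addr0 lerD //; last first.
  apply: sumr_ge0 => j _; rewrite ReMr mulr_ge0 ?Re_inv_term //.
  by rewrite mulr_ge0 // ltW.
rewrite ReMr ReV cabs_sqr /= !(mul1r, mul0r, subr0, addr0).
have -> : 1 + h - 1 = h by lra.
set y := grid R m i - t.
have yh : y ^+ 2 <= h ^+ 2.
  rewrite -[y ^+ 2]real_normK ?num_real //; apply: lerXn2r; rewrite ?nnegrE //.
    exact: ltW.
  by rewrite distrC.
have p0 : 0 < h ^+ 2 + y ^+ 2 by rewrite ltr_pwDl ?exprn_gt0 ?sqr_ge0.
rewrite mulrA ler_pdivlMr // mulrAC ler_pdivrMr //.
have -> : h * b i * h * 2 = b i * (h ^+ 2 + h ^+ 2) by ring.
by rewrite ler_wpM2l // lerD2l.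
Qed.

(** At [th] all poles are at distance at least [1 - th]. The bound is linear in the data, so it can
    be summed over the coordinates of a matrix. *)
Lemma cabs_poisson (th : R) : th < 1 ->
  cabs (poisson th%:C%C) <= kap + (\sum_i h * b i) / (1 - th).
Proof.
move=> t1; apply: le_trans (ler_cabsD _ _) _.
rewrite cabsC (ger0_norm (ltW kap0)) lerD2l mulr_suml.
apply: le_trans (ler_cabs_sum _ _ _) _; apply: ler_sum => i _.
have hb : 0 <= h * b i by rewrite mulr_ge0 // ltW.
rewrite cabsM cabsC ger0_norm // cabsV ler_wpM2l //.
rewrite lef_pV2 ?posrE ?subr_gt0 //; last first.
  apply: lt_le_trans (Re_le_cabs _); apply: lt_le_trans h0 _.
  by apply: Re_term; rewrite /= ltW.
apply: le_trans (Re_le_cabs _); rewrite /= !mul1r mul0r subr0.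
by move: h0; lra.
Qed.

Lemma derivable_poisson (z : R[i]^o) : complex.Re z <= 1 ->
  derivable (poisson : R[i]^o -> R[i]^o) z 1.
Proof.
move=> z1; apply: (@derivableD R[i]); first exact: (@derivable_cst R[i]).
apply: (@derivable_bigsum R[i] R[i]^o) => i.
apply: (@derivable_mul R[i]); first exact: (@derivable_cst R[i]).
apply: (@derivable_affineV R[i]); apply/eqP => e0.
have := Re_term i z1; rewrite e0 /=; move: h0; lra.
Qed.

End PoissonSum.

(* Replaces the factor [lam ^ (z - th)] with [lam = expR L]; a rational function
   avoids complex powers. *)
Lemma rational_power (R : realType) (th L : R) : 0 < th < 1 -> 0 <= L ->
  exists N (a : R), [/\ 0 <= a < 1, (1 - th * a) ^+ N <= expR (- (th * L)) &
    (1 - a) ^- N <= expR (L + 1)].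
Proof.
move=> /andP[t0 t1] L0.
(* With a = L / N this gives [a * (L + 1) < 1], that is, L / (1 - a) < L + 1, the exponent needed
   for the last claim. *)
set N := (Num.truncn (L * (L + 1))).+1.
have Np : 0 < N%:R :> R by [].
have LN : L * (L + 1) < N%:R by exact: truncnS_gt.
set a := L / N%:R.
have a0 : 0 <= a by rewrite divr_ge0.
have aL : a * (L + 1) < 1 by rewrite /a mulrAC ltr_pdivrMr // mul1r.
have a1 : a < 1 by rewrite (le_lt_trans _ aL) // ler_peMr // lerDr.
exists N, a; split; first by rewrite a0.
- have -> : - (th * L) = - (th * a) * N%:R.
    by rewrite /a; field; rewrite gt_eqF.
  rewrite expRM_natr lerXn2r ?nnegrE ?expR_ge0 //.
    by rewrite subr_ge0 mulr_ile1 // ltW.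
  by have := expR_ge1Dx (- (th * a)).
- have a1' : 0 < 1 - a by rewrite subr_gt0.
  rewrite -exprVn; have h : (1 - a)^-1 <= expR (a / (1 - a)).
    rewrite (le_trans _ (expR_ge1Dx _)) // le_eqVlt; apply/orP; left.
    by apply/eqP; field; rewrite gt_eqF.
  rewrite (le_trans (lerXn2r _ _ _ h)) ?nnegrE ?invr_ge0 ?expR_ge0 // ?(ltW a1') //.
  rewrite -expRM_natr ler_expR mulrAC ler_pdivrMr //.
  have -> : a * N%:R = L by rewrite /a divfK // gt_eqF.
  by rewrite mulrBr mulr1 [_ * a]mulrC; lra.
Qed.


Section Interpolation.
Context {R : realType} {X0 X1 : banachType R} {V : normedModType R[i]}.
Context {i0 : {linear X0 -> V}} {i1 : {linear X1 -> V}}.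

Lemma calderon_le (f0 : R -> X0) (f1 : R -> X1) (M : R) :
  (forall t, rnorm (f0 t) <= M) -> (forall t, rnorm (f1 t) <= M) ->
  calderon_norm f0 f1 <= M.
Proof.
move=> h0 h1; rewrite /calderon_norm ge_max; apply/andP; split; apply: ge_sup.
- by exists (rnorm (f0 0)), 0.
- by move=> _ [t _ <-].
- by exists (rnorm (f1 0)), 0.
- by move=> _ [t _ <-].
Qed.

Lemma le_calderon f f0 f1 : calderon i0 i1 f f0 f1 ->
  (forall t, rnorm (f0 t) <= calderon_norm f0 f1) /\
  (forall t, rnorm (f1 t) <= calderon_norm f0 f1).
Proof.
move=> [_ [[c0 p0 m0 _] [c1 p1 m1 _]]].
(* [sup] bounds its set only if the set has an upper bound. *)
have [M0 h0] : exists M, forall t, rnorm (f0 t) <= M by apply: vanishing_bounded.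
have [M1 h1] : exists M, forall t, rnorm (f1 t) <= M by apply: vanishing_bounded.
split=> t; rewrite /calderon_norm le_max; apply/orP; [left|right];
  apply: ub_le_sup; try by exists t.
- by exists M0 => _ [s _ <-].
- by exists M1 => _ [s _ <-].
Qed.

Section OneCoordinate.
Variables (th L nn : R).
Hypotheses (th01 : 0 < th < 1) (L0 : 0 <= L) (nn0 : 0 < nn).
Variables (N : nat) (a : R).
Hypotheses (a01 : 0 <= a < 1) (aN0 : (1 - th * a) ^+ N <= expR (- (th * L)))
  (aN1 : (1 - a) ^- N <= expR (L + 1)).
Variables (B : R) (G : R[i]^o -> V) (G0 : R -> X0) (G1 : R -> X1).
Hypotheses (cG : calderon i0 i1 G G0 G1)
  (bG0 : forall t, rnorm (G0 t) <= 2 * B / nn).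
Variables (m K : nat).
(** Lower bound of the outer function [phi]. The data on Re z = 0, of size [2 * B / nn], is
    [2 * B * expR L] times [kap], while [nn] coordinates contribute only [expR (- L)] in total. *)
Let kap := expR (- L) / nn.
Hypothesis gridG : forall t, rnorm (G1 t) <= kap \/
  exists2 i : 'I_K * bool, `|t - grid R m i| <= m.+1%:R^-1
      & rnorm (G1 t) <= rnorm (G1 (grid R m i)) + kap.
(** The weight makes the sum over the grid bounded; the decay of [w] on Re z = 1 pays for it. *)
Let b (i : 'I_K * bool) := rnorm (G1 (grid R m i)) / (1 + `|grid R m i|) ^+ 2.
Let phi := poisson m b kap.
(** Equal to 1 at [th], at most 1 on Re z = 0, and O(1 / (1 + t^2)) on Re z = 1. *)
Let w (z : R[i]) : R[i] := ((2 - th)%:C%C * (2%:C%C - 1 * z)^-1) ^+ 2.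
(** Plays the role of exp (L (z - th)): at most [expR (- (th * L))] on Re z = 0 and
    [expR ((1 - th) * L + 1)] on Re z = 1. *)
Let psi (z : R[i]) : R[i] := ((1 - th * a)%:C%C * (1 - a%:C%C * z)^-1) ^+ N.
(** All factors are normalized at [th], so multiplication by [g] keeps the value there. Dividing by
    [phi] balances the two boundary lines, and only its value at [th] is left in the bound. *)
Let g (z : R[i]) : R[i] := w z * (psi z * (phi th%:C%C * (phi z)^-1)).

Let kap0 : 0 < kap. Proof. by rewrite divr_gt0 ?expR_gt0. Qed.
Let b0 i : 0 <= b i. Proof. by rewrite divr_ge0 ?rnorm_ge0 ?sqr_ge0. Qed.
Let Re_phi z : complex.Re z <= 1 -> kap <= complex.Re (phi z).
Proof. exact: Re_poisson. Qed.
Let cphi z : complex.Re z <= 1 -> kap <= cabs (phi z).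
Proof. by move=> /Re_phi /le_trans; apply; exact: Re_le_cabs. Qed.

Let tha0 : 0 < 1 - th * a.
Proof.
move: th01 a01 => /andP[t0 t1] /andP[a0 a1].
have : th * a <= th * 1 by rewrite ler_pM2l // ltW.
by rewrite mulr1; lra.
Qed.

Let Re_a (z : R[i]) : complex.Re (1 - a%:C%C * z) = 1 - a * complex.Re z.
Proof. by case: z => x y /=; rewrite mul0r subr0. Qed.

Let Re_2 (z : R[i]) : complex.Re (2%:C%C - 1 * z) = 2 - complex.Re z.
Proof. by case: z => x y /=; rewrite !mul1r mul0r subr0. Qed.

Let a_lt z : strip z -> 1 - a <= 1 - a * complex.Re z.
Proof.
move: a01 => /andP[a0 a1] /andP[z0 z1].
by rewrite lerD2l lerN2 ler_piMr.
Qed.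

Let psi_le z (c : R) : 0 < c -> c <= complex.Re (1 - a%:C%C * z) ->
  cabs (psi z) <= (1 - th * a) ^+ N * c ^- N.
Proof.
move=> c0 cz; rewrite /psi cabsX cabsM cabsC cabsV gtr0_norm // exprMn.
rewrite ler_wpM2l ?exprn_ge0 // ?(ltW tha0) // -exprVn.
apply: lerXn2r; rewrite ?nnegrE ?invr_ge0 ?cabs_ge0 ?(ltW c0) //.
rewrite lef_pV2 ?posrE //; first exact: le_trans (Re_le_cabs _).
by apply: lt_le_trans c0 _; apply: le_trans (Re_le_cabs _).
Qed.

Let w_le z (c : R) : 0 < c -> c <= cabs (2%:C%C - 1 * z) ->
  cabs (w z) <= ((2 - th) / c) ^+ 2.
Proof.
move: th01 => /andP[t0 t1] c0 cz; rewrite /w cabsX cabsM cabsC cabsV.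
have t2 : 0 < 2 - th by lra.
rewrite gtr0_norm //; apply: lerXn2r; rewrite ?nnegrE ?mulr_ge0 ?invr_ge0 ?cabs_ge0 ?(ltW t2) ?(ltW c0) //.
rewrite ler_pM2l // lef_pV2 ?posrE //.
by apply: lt_le_trans c0 _.
Qed.

Let psi1 : 0 <= (1 - a) ^- N.
Proof. by move: a01 => /andP[_ a1]; rewrite invr_ge0 exprn_ge0 // subr_ge0 ltW. Qed.

Let g_bounded : exists M, forall z, strip z -> cabs (g z) <= M.
Proof.
move: (th01) (a01) => /andP[t0 t1] /andP[a0 a1].
exists (((2 - th) / 1) ^+ 2 * ((1 - th * a) ^+ N * (1 - a) ^- N *
  (cabs (phi th%:C%C) / kap))) => z sz; have /andP[z0 z1] := sz.
rewrite /g (cabsM (w _)) (cabsM (psi _)) (cabsM (phi _)) cabsV ler_pM ?mulr_ge0 ?cabs_ge0 ?invr_ge0 ?cabs_ge0 //.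
  apply: w_le => //; apply: le_trans (Re_le_cabs _).
  by rewrite Re_2; lra.
rewrite ler_pM ?mulr_ge0 ?cabs_ge0 ?invr_ge0 ?cabs_ge0 //.
  by apply: psi_le; rewrite ?subr_gt0 // Re_a a_lt.
rewrite ler_wpM2l ?cabs_ge0 // lef_pV2 ?posrE ?cphi //.
exact: lt_le_trans kap0 (cphi z1).
Qed.

Let g_derivable (z : R[i]^o) : strip z -> derivable (g : R[i]^o -> R[i]^o) z 1.
Proof.
move: (th01) (a01) => /andP[t0 t1] /andP[a0 a1] sz; have /andP[z0 z1] := sz.
have n0 (c : R[i]) : 0 < complex.Re c -> c != 0.
  by move=> c0; apply/eqP => e; move: c0; rewrite e ltxx.
apply: (@derivable_mul R[i]).
  apply: (@derivable_expn R[i]); apply: (@derivable_mul R[i]).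
    exact: (@derivable_cst R[i]).
  by apply: (@derivable_affineV R[i]); apply: n0; rewrite Re_2; lra.
apply: (@derivable_mul R[i]).
  apply: (@derivable_expn R[i]); apply: (@derivable_mul R[i]).
    exact: (@derivable_cst R[i]).
  apply: (@derivable_affineV R[i]); apply: n0; rewrite Re_a.
  by apply: lt_le_trans (a_lt sz); rewrite subr_gt0.
apply: (@derivable_mul R[i]); first exact: (@derivable_cst R[i]).
apply: (@derivableV R[i]); last exact: derivable_poisson.
by apply: n0; apply: lt_le_trans kap0 (Re_phi z1).
Qed.

Let g_th : g th%:C%C = 1.
Proof.
move: (th01) (a01) => /andP[t0 t1] /andP[a0 a1].
have p0 : phi th%:C%C != 0.
  apply/eqP => e; have := cphi (z := th%:C%C) (ltW t1).
  by rewrite e -(rmorph0 (real_complex R)) cabsC normr0 leNgt kap0.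
rewrite /g /w /psi mulfV // mulr1 mul1r.
have -> : 2%:C%C - th%:C%C = (2 - th)%:C%C by rewrite rmorphB.
have -> : 1 - a%:C%C * th%:C%C = (1 - th * a)%:C%C.
  by rewrite rmorphB rmorph1 rmorphM mulrC.
rewrite !mulfV ?expr1n ?mulr1 //; rewrite -(rmorph0 (real_complex R)) (inj_eq (@complexI R)).
  by rewrite gt_eqF.
by rewrite gt_eqF //; lra.
Qed.

Let line0 t : rnorm (g (Complex 0 t) *: G0 t) <= 2 * B * expR ((1 - th) * L) * cabs (phi th%:C%C).
Proof.
move: (th01) (a01) => /andP[t0 t1] /andP[a0 a1].
rewrite rnormZ -/(cabs _) /g (cabsM (w _)) (cabsM (psi _)) (cabsM (phi _)) cabsV.
have h1 : cabs (w (Complex 0 t)) <= 1.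
  apply: (@le_trans _ _ (((2 - th) / 2) ^+ 2)).
    apply: w_le => //; apply: le_trans (Re_le_cabs _).
    by rewrite Re_2 /=; lra.
  by rewrite expr_le1 //; lra.
have h2 : cabs (psi (Complex 0 t)) <= expR (- (th * L)).
  apply: le_trans aN0; apply: le_trans (psi_le (c := 1) _ _) _ => //.
    by rewrite Re_a /= mulr0 subr0.
  by rewrite expr1n invr1 mulr1.
have h3 : (cabs (phi (Complex 0 t)))^-1 <= kap^-1.
  rewrite lef_pV2 ?posrE //; first exact: cphi.
  by apply: lt_le_trans kap0 _; exact: cphi.
have B0 : 0 <= 2 * B / nn by apply: le_trans (bG0 0); exact: rnorm_ge0.
apply: (@le_trans _ _ (1 * (expR (- (th * L)) * (cabs (phi th%:C%C) * kap^-1)) * (2 * B / nn))).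
  rewrite ler_pM ?rnorm_ge0 // ?mulr_ge0 ?cabs_ge0 ?invr_ge0 ?cabs_ge0 //.
  rewrite ler_pM ?mulr_ge0 ?cabs_ge0 ?invr_ge0 ?cabs_ge0 //.
  rewrite ler_pM ?mulr_ge0 ?cabs_ge0 ?invr_ge0 ?cabs_ge0 //.
  by rewrite ler_wpM2l ?cabs_ge0.
rewrite le_eqVlt; apply/orP; left; apply/eqP.
rewrite mul1r /kap invfM invrK -expRN opprK.
have -> : (1 - th) * L = - (th * L) + L by ring.
by rewrite expRD; field; rewrite gt_eqF.
Qed.

Let line1 t : rnorm (g (Complex 1 t) *: G1 t) <= 64 * expR 1 * expR ((1 - th) * L) * cabs (phi th%:C%C).
Proof.
move: (th01) (a01) => /andP[t0 t1] /andP[a0 a1].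
set p := complex.Re (phi (Complex 1 t)).
have p0 : 0 < p by apply: lt_le_trans kap0 (Re_phi _).
have h2 : cabs (psi (Complex 1 t)) <= expR 1 * expR ((1 - th) * L).
  have h : 1 - a <= complex.Re (1 - a%:C%C * Complex 1 t) by rewrite Re_a mulr1.
  apply: le_trans (psi_le _ h) _; first by rewrite subr_gt0.
  apply: le_trans (ler_pM _ _ aN0 aN1) _; rewrite ?exprn_ge0 // ?(ltW tha0) //.
  by rewrite -!expRD ler_expR; lra.
have h1 : cabs (w (Complex 1 t)) <= 4 / (1 + t ^+ 2).
  have c0 : 0 < cabs (2%:C%C - 1 * Complex 1 t).
    by apply: lt_le_trans (Re_le_cabs _); rewrite Re_2 /=; lra.
  apply: le_trans (w_le c0 _) _ => //.
  rewrite exprMn exprVn cabs_sqr /= !mul1r !mul0r subr0 addr0.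
  have -> : 2 - 1 = 1 :> R by lra.
  rewrite expr1n sub0r sqrrN ler_wpM2r ?invr_ge0 ?addr_ge0 ?sqr_ge0 //.
  have -> : 4 = 2 ^+ 2 :> R by rewrite -natrX.
  by apply: lerXn2r; rewrite ?nnegrE //; lra.
have T0 : 0 < 1 + t ^+ 2 by rewrite ltr_pwDl ?sqr_ge0.
(* Since [p] dominates [kap + b i / 2], it remains to compare weights: (1 + |s|)^2 <= (2 + |t|)^2 <=
   8 (1 + t^2) for the grid point s next to t. *)
have wG : 4 / (1 + t ^+ 2) * rnorm (G1 t) <= 64 * p.
  have k4 : 4 / (1 + t ^+ 2) * kap <= 4 * kap.
    by rewrite ler_wpM2r ?(ltW kap0) // ler_pdivrMr // ler_peMr // lerDl sqr_ge0.
  have k4' : 0 <= 4 / (1 + t ^+ 2) by rewrite divr_ge0 // ltW.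
  have [h|[i ti h]] := gridG t.
    apply: le_trans (ler_wpM2l k4' h) _; apply: le_trans k4 _.
    by have := Re_phi (z := Complex 1 t) (lexx 1); rewrite -/p; move: kap0; lra.
  apply: le_trans (ler_wpM2l k4' h) _; rewrite mulrDr.
  have pb : kap + b i / 2 <= p by apply: Re_poisson_boundary.
  suff : 4 / (1 + t ^+ 2) * rnorm (G1 (grid R m i)) <= 32 * b i.
    by move: k4 pb kap0; lra.
  rewrite /b; set s := grid R m i; rewrite [32 * _]mulrA [32 * _]mulrC -[X in _ <= X]mulrA [X in _ <= X]mulrC.
  rewrite ler_wpM2r ?rnorm_ge0 //.
  have s1 : 0 < 1 + `|s| by rewrite ltr_pwDl.
  rewrite ler_pdivrMr // mulrAC ler_pdivlMr ?exprn_gt0 //.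
  have st : `|s| <= 1 + `|t|.
    have := ler_normD (s - t) t; rewrite subrK => /le_trans; apply.
    rewrite lerD2r distrC; apply: le_trans ti _.
    by rewrite invf_le1 // ler1n.
  have : (1 + `|s|) ^+ 2 <= (2 + `|t|) ^+ 2.
    by apply: lerXn2r; rewrite ?nnegrE ?addr_ge0 //; move: st; lra.
  have := real_normK (num_real t); set T := `|t|; move=> <-.
  have : 0 <= (T - 1) ^+ 2 by exact: sqr_ge0.
  have : 0 <= T ^+ 2 by exact: sqr_ge0.
  rewrite !expr2; lra.
have h3 : (cabs (phi (Complex 1 t)))^-1 <= p^-1.
  rewrite lef_pV2 ?posrE //; first exact: Re_le_cabs.
  by apply: lt_le_trans p0 _; exact: Re_le_cabs.
rewrite rnormZ -/(cabs _) /g (cabsM (w _)) (cabsM (psi _)) (cabsM (phi _)) cabsV.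
apply: (@le_trans _ _ (4 / (1 + t ^+ 2) * (expR 1 * expR ((1 - th) * L) *
    (cabs (phi th%:C%C) * p^-1)) * rnorm (G1 t))).
  rewrite ler_wpM2r ?rnorm_ge0 //.
  rewrite ler_pM ?mulr_ge0 ?cabs_ge0 ?invr_ge0 ?cabs_ge0 //.
  rewrite ler_pM ?mulr_ge0 ?cabs_ge0 ?invr_ge0 ?cabs_ge0 //.
  by rewrite ler_wpM2l ?cabs_ge0.
rewrite [X in X <= _]mulrAC.
apply: (@le_trans _ _ (64 * p * (expR 1 * expR ((1 - th) * L) *
    (cabs (phi th%:C%C) * p^-1)))).
  by rewrite ler_wpM2r // !mulr_ge0 ?expR_ge0 ?cabs_ge0 ?invr_ge0 ?(ltW p0).
rewrite le_eqVlt; apply/orP; left; apply/eqP.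
by field; rewrite gt_eqF.
Qed.

Lemma interpolate_coordinate : 0 <= B ->
  exists f f0 f1, [/\ calderon i0 i1 f f0 f1, f th%:C%C = G th%:C%C &
    calderon_norm f0 f1 <= (64 * expR 1 + 2 * B) * expR ((1 - th) * L) *
      (kap + \sum_(i : 'I_K * bool) m.+1%:R^-1 * b i / (1 - th))].
Proof.
move=> B0; have [M gM] := g_bounded.
have := calderon_scale g_derivable gM cG.
set f := fun z => _; set f0 := fun t => _; set f1 := fun t => _ => cf.
exists f, f0, f1; split => //; first by rewrite /f g_th scale1r.
have le_phi : cabs (phi th%:C%C) <= kap + \sum_(i : 'I_K * bool) m.+1%:R^-1 * b i / (1 - th).
  rewrite -mulr_suml; apply: cabs_poisson => //.
  by case/andP: th01.
apply: (@le_trans _ _ ((64 * expR 1 + 2 * B) * expR ((1 - th) * L) * cabs (phi th%:C%C))).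
  have e1 : 0 <= 64 * expR 1 :> R by rewrite mulr_ge0 // expR_ge0.
  apply: calderon_le => t.
    apply: le_trans (line0 t) _; rewrite ler_wpM2r ?cabs_ge0 //.
    by rewrite ler_wpM2r ?expR_ge0 // lerDr.
  apply: le_trans (line1 t) _; rewrite ler_wpM2r ?cabs_ge0 //.
  by rewrite ler_wpM2r ?expR_ge0 // lerDl mulr_ge0.
by rewrite ler_wpM2l // mulr_ge0 ?expR_ge0 // addr_ge0 // mulr_ge0 // expR_ge0.
Qed.

End OneCoordinate.

(** The image of a Calderon family is corrected coordinate by coordinate, each with its own factor
    [g]. On Re z = 0 this needs only the size of a row, which is meaningful in every Banach space;
    on Re z = 1 the outer function absorbs the data. The l^1 sum is formed only at [th], from bounds
    linear in the samples on Re z = 1, where the hypothesis on X1 applies. *)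
Lemma mat_bound_interpolation (E O : finType) (k : O -> E -> R) (th B nn L : R)
    (Y : banachType R) :
  0 < th < 1 -> is_interpolation i0 i1 th Y -> 0 <= B -> 0 < nn ->
  (forall o, \sum_e `|k o e| <= B / nn) -> #|O|%:R <= nn -> 0 <= L ->
  mat_bound X1 k (expR (- L)) ->
  mat_bound Y k ((64 * expR 1 + 2 * B) * (9 / (1 - th)) * expR (- (th * L))).
Proof.
move=> th01 [J [Jinj Jex Jn]] B0 nn0 kB On L0 kX1 y y1.
have [t0 t1] := andP th01.
have [N [a [a01 aN0 aN1]]] := rational_power th01 L0.
pose S v := [set r | exists f f0 f1, [/\ calderon i0 i1 f f0 f1,
                 f th%:C%C = J v & r = calderon_norm f0 f1]].
have S0 v : has_inf (S v).
  split; last first.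
    exists 0 => _ [f [f0 [f1 [cf _ ->]]]]; apply: le_trans ((le_calderon cf).1 0).
    exact: rnorm_ge0.
  have [f [f0 [f1 [cf fv]]]] := (Jex (J v)).1 (ex_intro _ v erefl).
  by exists (calderon_norm f0 f1), f, f0, f1.
(* The interpolation norm is an infimum, so norm at most 1 yields representatives of norm at most
   2. *)
have /choice[F hF] : forall e, exists p : (R[i]^o -> V) * (R -> X0) * (R -> X1),
    [/\ calderon i0 i1 p.1.1 p.1.2 p.2, p.1.1 th%:C%C = J (y e) &
     calderon_norm p.1.2 p.2 <= 2].
  move=> e; have [r [f [f0 [f1 [cf fv ->]]]] fr] := inf_adherent ltr01 (S0 (y e)).
  exists (f, f0, f1); split => //=.
  by apply: ltW (lt_le_trans fr _); rewrite -Jn; have := y1 e; lra.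
pose G o z := \sum_e (k o e)%:C%C *: (F e).1.1 z.
pose G0 o t := \sum_e (k o e)%:C%C *: (F e).1.2 t.
pose G1 o t := \sum_e (k o e)%:C%C *: (F e).2 t.
have cG o : calderon i0 i1 (G o) (G0 o) (G1 o).
  by apply: calderon_lincomb => e; have [] := hF e.
have bG0 o t : rnorm (G0 o t) <= 2 * B / nn.
  apply: le_trans (ler_rnorm_sum _ _ _) _.
  rewrite -mulrA (le_trans _ (ler_wpM2l _ (kB o))) // mulr_sumr.
  apply: ler_sum => e _; rewrite rnormZr mulrC ler_wpM2r //.
  by have [cf _ h] := hF e; apply: le_trans ((le_calderon cf).1 t) h.
have bG1 t : \sum_o rnorm (G1 o t) <= 2 * expR (- L).
  apply: mat_bound_scale => // e.
  by have [cf _ h] := hF e; apply: le_trans ((le_calderon cf).2 t) h.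
set kap := expR (- L) / nn.
have kap0 : 0 < kap by rewrite divr_gt0 ?expR_gt0.
have vG o : vanishing (G1 o) by have [_ [_ [? ? ? _]]] := cG o.
have [m [K gridG]] := vanishing_grid vG kap0.
set h : R := m.+1%:R^-1.
set C1 := (64 * expR 1 + 2 * B) * expR ((1 - th) * L).
have C10 : 0 <= C1 by rewrite mulr_ge0 ?expR_ge0 // addr_ge0 ?mulr_ge0 ?expR_ge0.
pose b o (i : 'I_K * bool) := rnorm (G1 o (grid R m i)) / (1 + `|grid R m i|) ^+ 2.
have coord o : rnorm (\sum_e (k o e)%:C%C *: y e) <=
    C1 * (kap + \sum_(i : 'I_K * bool) h * b o i / (1 - th)).
  have [f [f0 [f1 [cf fG le_f]]]] := interpolate_coordinate th01 nn0 a01 aN0 aN1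
    (cG o) (bG0 o) (gridG o) B0.
  apply: le_trans le_f; rewrite Jn; apply: ge_inf; first exact: (S0 _).2.
  exists f, f0, f1; split => //.
  rewrite fG /G linear_sum; apply: eq_bigr => e _.
  by rewrite linearZ; have [_ ->] := hF e.
apply: le_trans (ler_sum _ (fun o _ => coord o)) _.
rewrite -mulr_sumr big_split /= sumr_const exchange_big /=.
have tp : 0 < 1 - th by lra.
have le1 : kap *+ #|O| <= expR (- L).
  by rewrite /kap -mulr_natr mulrAC ler_pdivrMr // ler_wpM2l ?expR_ge0.
(* At each grid point the hypothesis on X1 bounds the sum over [o] by [2 * expR (- L)]; the weights
   sum to at most 4. *)
have le2 : \sum_(i : 'I_K * bool) \sum_o h * b o i / (1 - th) <=
    8 * expR (- L) / (1 - th).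
  rewrite ler_pdivlMr // mulr_suml.
  apply: (@le_trans _ _ (\sum_(i : 'I_K * bool)
      (2 * expR (- L)) * (h / (1 + `|grid R m i|) ^+ 2))).
    apply: ler_sum => i _; rewrite mulr_suml.
    under eq_bigr do rewrite divfK ?gt_eqF // /b mulrCA.
    by rewrite -mulr_suml ler_wpM2r // mulr_ge0 // invr_ge0 ?ler0n // exprn_ge0 // addr_ge0.
  rewrite -mulr_sumr; have := grid_sum_le R m K; rewrite -/h => hs.
  have -> : 8 * expR (- L) = 2 * expR (- L) * 4 by ring.
  by rewrite ler_wpM2l // mulr_ge0 ?expR_ge0.
apply: le_trans (ler_wpM2l C10 (lerD le1 le2)) _.
have -> : - (th * L) = (1 - th) * L + - L by ring.
rewrite expRD /C1 -!mulrA ler_wpM2l //.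
  by rewrite addr_ge0 ?mulr_ge0 ?expR_ge0.
have : 1 <= (1 - th)^-1 by rewrite invf_ge1 //; lra.
set iv := (1 - th)^-1; set x := expR _; set z := expR _ => iv1.
have -> : x * (z + 8 * (z * iv)) = (x * z) * (1 + 8 * iv) by ring.
have -> : 9 * (iv * (x * z)) = (x * z) * (9 * iv) by ring.
by rewrite ler_wpM2l ?mulr_ge0 ?expR_ge0 //; lra.
Qed.

End Interpolation.

(** * The line matrices *)

Section LineMatrix.
Context {R : realType}.

Definition box (a H u : nat) : nat := (a <= u < a + H)%N.

Lemma box_sum a H U : (\sum_(u < U) box a H u = minn U (a + H) - minn U a)%N.
Proof.
elim: U => [|U IH]; first by rewrite big_ord0 !min0n.
by rewrite big_ord_recr /= IH /box; lia.
Qed.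

Lemma box_sumr_le a H U : \sum_(u < U) (box a H u)%:R <= H%:R :> R.
Proof. by rewrite -natr_sum box_sum ler_nat; lia. Qed.

(* The entry at the line [(j, l)] and the point [(r, u)] is [1 / (n H)^2] times the
   difference of the indicators of two consecutive boxes of length [H] above the
   point of the line of slope [j] and height [l H] at abscissa [r]. *)
Definition line_mat (n H U : nat) (o : 'I_n * 'I_n) (e : 'I_H * 'I_U) : R :=
  ((box (o.2 * H + e.1 * o.1) H e.2)%:R - (box (o.2 * H + e.1 * o.1 + H) H e.2)%:R)
  / (n%:R ^+ 2 * H%:R ^+ 2).

(** Over the n^2 rows this bounds the matrix by 2 on every Banach space, which is all that
    interpolation asks of X0. *)
Lemma line_mat_row n H U o :
  \sum_e `|@line_mat n H U o e| <= 2 / n%:R ^+ 2.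
Proof.
have [->|H0] := posnP H.
  rewrite big1 ?divr_ge0 ?sqr_ge0 // => e _.
  by rewrite /line_mat expr0n mulr0 invr0 mulr0 normr0.
have [n0|n0] := posnP n; first by case: o => [[p]]; rewrite n0.
have nH0 : 0 < n%:R ^+ 2 * H%:R ^+ 2 :> R by rewrite mulr_gt0 // exprn_gt0 // ltr0n.
apply: (@le_trans _ _ (\sum_(e : 'I_H * 'I_U)
    ((box (o.2 * H + e.1 * o.1) H e.2)%:R + (box (o.2 * H + e.1 * o.1 + H) H e.2)%:R)
    / (n%:R ^+ 2 * H%:R ^+ 2))).
  apply: ler_sum => e _; rewrite normrM normfV (gtr0_norm nH0) ler_pM2r ?invr_gt0 //.
  by apply: le_trans (ler_normB _ _) _; rewrite !normr_nat.
rewrite -mulr_suml -(pair_bigA _ (fun (r : 'I_H) (u : 'I_U) =>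
   (box (o.2 * H + r * o.1) H u)%:R + (box (o.2 * H + r * o.1 + H) H u)%:R)) /=.
rewrite ler_pdivrMr // mulrA divfK ?gt_eqF ?exprn_gt0 ?ltr0n //.
apply: (@le_trans _ _ (\sum_(r < H) (2 * H%:R))).
  apply: ler_sum => r _; rewrite big_split /=.
  by have := box_sumr_le (o.2 * H + r * o.1) H U;
     have := box_sumr_le (o.2 * H + r * o.1 + H) H U; lra.
by rewrite sumr_const card_ord -[leLHS]mulr_natr -mulrA -expr2.
Qed.

(** Divisible by every difference of slopes, so that two lines can be shifted against each other by
    exactly one box, and by n K for every K <= n, so that it splits into whole cells. *)
Definition line_height n := ((n ^ 2)`!)%N.

Lemma line_height_gt0 n : (0 < line_height n)%N. Proof. exact: fact_gt0. Qed.

Lemma dvdn_line_height n d : (0 < d <= n ^ 2)%N -> (d %| line_height n)%N.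
Proof. by move=> /andP[d0 dn]; apply: dvdn_fact; rewrite d0. Qed.

(** The exponential is n^(-eps); [C] and [eps] depend on X but not on n. *)
Definition line_decay (X : banachType R) : Prop :=
  exists C eps : R, [/\ 0 <= C, 0 < eps & forall n, (0 < n)%N ->
    mat_bound X (@line_mat n (line_height n) (2 * n * line_height n))
      (C * expR (- (eps * ln n%:R)))].

Lemma line_decay_subspace (X Y : banachType R) :
  is_subspace X Y -> line_decay X -> line_decay Y.
Proof.
move=> XY [C [e [C0 e0 h]]]; exists C, e; split => // n n0.
exact: mat_bound_subspace XY (h n n0).
Qed.

Lemma line_decay_quotient (X Y : banachType R) :
  is_quotient X Y -> line_decay X -> line_decay Y.
Proof.
move=> XY [C [e [C0 e0 h]]]; exists C, e; split => // n n0.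
exact: mat_bound_quotient XY (h n n0).
Qed.

Lemma line_decay_ultrapower (X Y : banachType R) :
  is_ultrapower X Y -> line_decay X -> line_decay Y.
Proof.
move=> XY [C [e [C0 e0 h]]]; exists C, e; split => // n n0.
exact: mat_bound_ultrapower XY (h n n0).
Qed.

Lemma line_decay_interpolation (X X0 X1 Y : banachType R) (V : normedModType R[i])
    (i0 : {linear X0 -> V}) (i1 : {linear X1 -> V}) (th : R) :
  isomorphic X1 X -> 0 < th < 1 -> is_interpolation i0 i1 th Y ->
  line_decay X -> line_decay Y.
Proof.
move=> /mat_bound_isomorphic[M M1 hM] th01 XY [C [e [C0 e0 h]]].
have [t0 t1] := andP th01.
(* Division by [D] turns the bound on X1 into [expR (- L)] with L = e ln n, the form that
   [mat_bound_interpolation] takes; the exponent becomes [th * e]. *)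
set D := M * C + 1.
have D1 : 1 <= D by rewrite lerDr mulr_ge0 // (le_trans _ M1).
have D0 : 0 < D by apply: lt_le_trans D1.
exists (D * ((64 * expR 1 + 2 * 2) * (9 / (1 - th)))), (th * e); split.
- have tp : 0 <= 9 / (1 - th) by rewrite divr_ge0 // subr_ge0 ltW.
  by rewrite mulr_ge0 ?(ltW D0) // mulr_ge0 // addr_ge0 // mulr_ge0 // expR_ge0.
- exact: mulr_gt0.
- move=> n n0; have nR : 0 < n%:R :> R by rewrite ltr0n.
  set k := @line_mat n _ _.
  have L0 : 0 <= e * ln n%:R :> R by rewrite mulr_ge0 ?(ltW e0) // ln_ge0 // ler1n.
  have card : #|{: 'I_n * 'I_n}|%:R <= n%:R ^+ 2 :> R.
    by rewrite card_prod !card_ord natrM expr2.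
  have row (o : 'I_n * 'I_n) : \sum_e `|D^-1 * k o e| <= 2 / n%:R ^+ 2.
    apply: le_trans (line_mat_row (line_height n) (2 * n * line_height n) o).
    apply: ler_sum => i _; rewrite normrM ler_piMl // gtr0_norm ?invr_gt0 //.
    by rewrite invf_le1.
  have nn0 : 0 < n%:R ^+ 2 :> R by rewrite exprn_gt0.
  have kX1 : mat_bound X1 (fun o e => D^-1 * k o e) (expR (- (e * ln n%:R))).
    apply: (@mat_bound_le _ _ _ _ _ (D^-1 * (M * (C * expR (- (e * ln n%:R)))))).
      rewrite ler_pdivrMl // mulrA ler_wpM2r ?expR_ge0 //.
      by rewrite /D lerDl.
    by apply: mat_bound_kscale; [rewrite invr_ge0 ltW|apply: hM; exact: h].
  have two0 : 0 <= 2 :> R by [].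
  have := mat_bound_interpolation th01 XY two0 nn0 row card L0 kX1.
  move=> /(mat_bound_kscale (ltW D0)); rewrite !mulrA.
  have -> : (fun o e => D * (D^-1 * k o e)) = k.
    by apply/funext => o; apply/funext => i; rewrite mulrA mulfV ?mul1r ?gt_eqF.
  by [].
Qed.

End LineMatrix.

(** * Gaussian integrals *)

Section Caratheodory.
Context {R : realType}.

Lemma floor_grid_cvg (x : R) :
  (Num.floor (x * m.+1%:R))%:~R / m.+1%:R @[m --> \oo] --> x.
Proof.
apply/cvgrPdist_le => e e0.
near=> m; have m0 : 0 < m.+1%:R :> R by [].
have /andP[h1 h2] := floor_itv (x * m.+1%:R).
rewrite ger0_norm ?subr_ge0 ?ler_pdivrMr //.
apply: (@le_trans _ _ m.+1%:R^-1).
  rewrite lerBlDr -[X in X + _]div1r -mulrDl ler_pdivlMr // addrC.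
  by move: h2; rewrite intrD => /ltW.
rewrite -[e]invrK lef_pV2 ?posrE ?invr_gt0 //.
near: m; exists (Num.truncn e^-1) => // m /= hm.
by apply: ltW (lt_le_trans (truncnS_gt _) _); rewrite ler_nat ltnS.
Unshelve. all: by end_near. Qed.

(** Round the first variable down to a multiple of 1 / (m + 1): the rounded function is measurable
    on each of countably many slabs, and continuity recovers [f] as the limit. *)
Lemma measurable_Caratheodory d (T : measurableType d) (f : R * T -> R) :
  (forall t, continuous (fun s => f (s, t))) ->
  (forall s, measurable_fun setT (fun t => f (s, t))) ->
  measurable_fun setT f.
Proof.
move=> cf mf.
pose F (m : nat) (p : R * T) := f ((Num.floor (p.1 * m.+1%:R))%:~R / m.+1%:R, p.2).
apply: (@measurable_fun_cvg _ _ _ _ F).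
  move=> m _ B mB; rewrite setTI.
  have -> : F m @^-1` B = \bigcup_(k : int)
      ([set s | (k%:~R / m.+1%:R <= s < (k + 1)%:~R / m.+1%:R)] `*`
       [set t | B (f (k%:~R / m.+1%:R, t))]).
    have m0 : 0 < m.+1%:R :> R by [].
    apply/seteqP; split => [[s t] /= Bst|[s t] [k _ [/= sk Bt]]].
      exists (Num.floor (s * m.+1%:R)) => //=; split => //.
      by rewrite ler_pdivrMr // ltr_pdivlMr // floor_itv.
    rewrite /F /=; suff -> : Num.floor (s * m.+1%:R) = k by [].
    by apply: floor_def; rewrite -ler_pdivrMr // -ltr_pdivlMr.
  apply: countable_bigcupT_measurable => [|k]; first exact: countableP.
  apply: measurableX.
    have -> : [set s : R | (k%:~R / m.+1%:R <= s < (k + 1)%:~R / m.+1%:R)] =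
        [set` `[k%:~R / m.+1%:R, (k + 1)%:~R / m.+1%:R[ ].
      by apply/seteqP; split => s /=; rewrite in_itv.
    exact: measurable_itv.
  by have := mf (k%:~R / m.+1%:R) measurableT B mB; rewrite setTI.
move=> [s t] _; rewrite /F /=.
have h : f ((Num.floor ((s : R) * m.+1%:R))%:~R / m.+1%:R, t) @[m --> \oo] --> f (s, t).
  apply: (@cvg_comp nat R R (fun m => (Num.floor ((s : R) * m.+1%:R))%:~R / m.+1%:R)
    (fun s => f (s, t))); [exact: floor_grid_cvg|exact: cf].
exact: h.
Qed.

End Caratheodory.

Section Mean.
Context {R : realType} d (T : measurableType d) (mu : probability T R).

(** [fine] turns an infinite integral into 0, hence the bounds imposed on the integrands in the
    lemmas below. *)
Definition mean (f : T -> R) : R := fine (\int[mu]_x (f x)%:E)%E.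

Lemma integral_bounds (f : T -> R) (M : R) : measurable_fun setT f ->
  (forall x, 0 <= f x <= M) -> (0 <= \int[mu]_x (f x)%:E <= M%:E)%E.
Proof.
move=> mf fM; apply/andP; split.
  by apply: integral_ge0 => x _; rewrite lee_fin; have /andP[] := fM x.
apply: (@le_trans _ _ (\int[mu]_x (cst M%:E) x)%E); last first.
  by rewrite integral_cst //= probability_setT mule1.
apply: ge0_le_integral => //.
- by move=> x _; rewrite lee_fin; have /andP[] := fM x.
- exact/measurable_EFinP.
- by move=> x _; rewrite lee_fin; have /andP[] := fM x.
Qed.

Lemma meanE (f : T -> R) (M : R) : measurable_fun setT f ->
  (forall x, 0 <= f x <= M) -> (mean f)%:E = (\int[mu]_x (f x)%:E)%E.
Proof.
move=> mf fM; have /andP[h0 h1] := integral_bounds mf fM.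
rewrite /mean fineK // ge0_fin_numE //.
by apply: le_lt_trans h1 _; rewrite ltry.
Qed.

Lemma mean_bounds (f : T -> R) (M : R) : measurable_fun setT f ->
  (forall x, 0 <= f x <= M) -> 0 <= mean f <= M.
Proof.
move=> mf fM; rewrite -!lee_fin (meanE mf fM); exact: integral_bounds.
Qed.

Lemma mean_leD (f g : T -> R) (M c : R) : measurable_fun setT f -> measurable_fun setT g ->
  (forall x, 0 <= f x <= M) -> (forall x, 0 <= g x <= M) ->
  (forall x, f x <= g x + c) -> 0 <= c -> mean f <= mean g + c.
Proof.
move=> mf mg fM gM fg c0; rewrite -lee_fin EFinD (meanE mf fM) (meanE mg gM).
apply: (@le_trans _ _ (\int[mu]_x ((g x)%:E + (cst c%:E) x))%E); last first.
  rewrite ge0_integralD //; first by rewrite integral_cst //= probability_setT mule1.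
    by move=> x _; rewrite lee_fin; have /andP[] := gM x.
  exact/measurable_EFinP.
apply: ge0_le_integral => //.
- by move=> x _; rewrite lee_fin; have /andP[] := fM x.
- exact/measurable_EFinP.
- by apply: emeasurable_funD => //; exact/measurable_EFinP.
- by move=> x _; rewrite -EFinD lee_fin.
Qed.

End Mean.

Section NormalIntegral.
Context {R : realType}.
Notation leb := (@lebesgue_measure R).
Notation sg := (Num.sqrt 2^-1 : R).

Lemma integral_normal (f : R -> R) (M : R) : measurable_fun setT f ->
  (forall x, 0 <= f x <= M) ->
  (\int[normal_prob 0 sg]_x (f x)%:E =
   \int[leb]_x (f x * normal_pdf 0 sg x)%:E)%E.
Proof.
move=> mf fM.
have mfE : measurable_fun setT (fun x : measurableTypeR R => (f x)%:E) by exact/measurable_EFinP.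
have dom := @normal_prob_dominates R 0 sg.
have intf : (normal_prob 0 sg).-integrable setT (fun x : measurableTypeR R => (f x)%:E).
  apply: (@le_integrable _ _ _ _ _ measurableT _ (cst M%:E)) => //.
    move=> x _ /=; rewrite lee_fin; have /andP[h1 h2] := fM x.
    by rewrite ger0_norm // (le_trans h2) // ler_norm.
  by apply: finite_measure_integrable_cst.
rewrite -(Radon_Nikodym_change_of_variables dom) //=.
apply: ae_eq_integral => //.
- by apply: emeasurable_funM => //; apply: (measurable_int leb).
- apply/measurable_EFinP; apply: measurable_funM => //.
  exact: measurable_normal_pdf.
- under [X in ae_eq _ _ _ X]eq_fun do rewrite EFinM.
  apply: ae_eqe_mul2l => /=.
  apply: integral_ae_eq => //.
  + by apply: Radon_Nikodym_integrable.
  + by apply/measurable_EFinP; apply: measurable_normal_pdf.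
  + by move=> E _ mE; rewrite -Radon_Nikodym_integral.
Qed.

Lemma integral_translate (G : R -> R) (a : R) : continuous G ->
  (forall x, 0 <= G x) ->
  (\int[leb]_x (G (x + a))%:E = \int[leb]_x (G x)%:E)%E.
Proof.
move=> cG G0.
have dE : ((fun x : R => x + a)^`())%classic = cst 1.
  by apply/funext => x; rewrite derive1E deriveD // derive_id derive_cst addr0.
rewrite [RHS](@increasing_ge0_integration_by_substitutionT R (fun x => x + a)) //.
- by apply: eq_integral => x _ /=; rewrite dE /= mulr1.
- by move=> x y; rewrite ltrD2r.
- by rewrite dE => x; exact: cvg_cst.
- by rewrite dE; exact: is_cvg_cst.
- by rewrite dE; exact: is_cvg_cst.
- apply/cvgrNyPle => A; exists (A - a); split; first exact: num_real.
  by move=> x /= xA; lra.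
- apply/cvgryPge => A; exists (A - a); split; first exact: num_real.
  by move=> x /= xA; lra.
Qed.

Lemma continuous_pair1 (K : R * R -> R) : continuous K ->
  forall t, continuous (fun s => K (s, t)).
Proof.
move=> cK t s; apply: (@cvg_comp _ _ _ (fun s => (s, t)) K _ (nbhs (s, t))); last exact: cK.
exact: (cvg_pair cvg_id (cvg_cst t)).
Qed.

Lemma continuous_pair2 (K : R * R -> R) : continuous K ->
  forall s, continuous (fun t => K (s, t)).
Proof.
move=> cK s t; apply: (@cvg_comp _ _ _ (fun t => (s, t)) K _ (nbhs (s, t))); last exact: cK.
exact: (cvg_pair (cvg_cst s) cvg_id).
Qed.

Lemma continuous_measurable2 (K : R * R -> R) : continuous K ->
  measurable_fun setT K.
Proof.
move=> cK; apply: measurable_Caratheodory; first exact: continuous_pair1.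
by move=> s; apply: continuous_measurable_fun; exact: continuous_pair2.
Qed.

Lemma continuous_affine2 (a b c d : R) :
  continuous (fun p : R * R => (a * p.1 + b * p.2, c * p.1 + d * p.2)).
Proof.
have lin (u v : R) (p : R * R) : u * q.1 + v * q.2 @[q --> p] --> u * p.1 + v * p.2.
  by apply: cvgD; apply: cvgM; by [exact: cvg_cst|exact: cvg_fst|exact: cvg_snd].
move=> p; exact: (cvg_pair (lin a b p) (lin c d p)).
Qed.

Let Q (K : R * R -> R) := (\int[leb]_s \int[leb]_t (K (s, t))%:E)%E.

Let Q_swap (K : R * R -> R) : continuous K -> (forall p, 0 <= K p) ->
  Q K = (\int[leb]_t \int[leb]_s (K (s, t))%:E)%E.
Proof.
move=> cK K0; rewrite /Q.
apply: (@fubini_tonelli _ _ _ _ R leb leb (fun p : measurableTypeR R * measurableTypeR R => (K p)%:E)) => //.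
by apply/measurable_EFinP; exact: continuous_measurable2.
Qed.

Let continuous_affine (K : R * R -> R) (a b c d : R) : continuous K ->
  continuous (fun p : R * R => K (a * p.1 + b * p.2, c * p.1 + d * p.2)).
Proof.
move=> cK p; apply: (@continuous_comp _ _ _ _ K); last exact: cK.
exact: continuous_affine2.
Qed.

Let Q_shear1 (K : R * R -> R) (a : R) : continuous K -> (forall p, 0 <= K p) ->
  Q (fun p => K (1 * p.1 + a * p.2, 0 * p.1 + 1 * p.2)) = Q K.
Proof.
move=> cK K0; rewrite !Q_swap //; last exact: continuous_affine.
apply: eq_integral => t _ /=.
rewrite -[RHS](@integral_translate _ (a * t)) //; last exact: continuous_pair1.
by apply: eq_integral => s _; rewrite !mul1r mul0r add0r.
Qed.

Let Q_shear2 (K : R * R -> R) (a : R) : continuous K -> (forall p, 0 <= K p) ->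
  Q (fun p => K (1 * p.1 + 0 * p.2, a * p.1 + 1 * p.2)) = Q K.
Proof.
move=> cK K0; apply: eq_integral => s _ /=.
rewrite -[RHS](@integral_translate _ (a * s)) //; last exact: continuous_pair2.
by apply: eq_integral => t _; rewrite !mul1r mul0r addr0 addrC.
Qed.

(** A rotation with nonzero sine is a product of three shears, and a shear preserves a double
    integral by translation invariance in one variable. *)
Let Q_rotation (K : R * R -> R) (c d : R) : continuous K -> (forall p, 0 <= K p) ->
  c ^+ 2 + d ^+ 2 = 1 -> d != 0 ->
  Q (fun p => K (c * p.1 + - d * p.2, d * p.1 + c * p.2)) = Q K.
Proof.
move=> cK K0 cd d0.
have cK1 := @continuous_affine K 1 ((c - 1) / d) 0 1 cK.
have cK2 := @continuous_affine _ 1 0 d 1 cK1.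
rewrite -(Q_shear1 ((c - 1) / d) cK K0) -(Q_shear2 d cK1 (fun p => K0 _)).
rewrite -(Q_shear1 ((c - 1) / d) cK2 (fun p => K0 _)).
apply: eq_integral => s _; apply: eq_integral => t _ /=; congr (K _)%:E.
have dd : d ^+ 2 = 1 - c ^+ 2 by rewrite -cd addrAC subrr add0r.
congr (_, _); last by field.
rewrite -[LHS]subr0 -[RHS]subr0.
suff -> : c * s + - d * t = c * s + (c ^+ 2 - 1) / d * t by field.
by congr (_ + _ * _); rewrite -opprB -dd; field.
Qed.

Let dens (p : R * R) := normal_pdf 0 sg p.1 * normal_pdf 0 sg p.2.

Let sg0 : sg != 0 :> R. Proof. by rewrite gt_eqF // sqrtr_gt0 invr_gt0. Qed.

Let dens_rot c d p : c ^+ 2 + d ^+ 2 = 1 ->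
  dens (c * p.1 + - d * p.2, d * p.1 + c * p.2) = dens p.
Proof.
move=> cd; rewrite /dens /= !normal_pdfE // /normal_fun !subr0.
have E (pk v x y x' y' : R) : x + y = x' + y' ->
    pk * expR (x / v) * (pk * expR (y / v)) = pk * expR (x' / v) * (pk * expR (y' / v)).
  by move=> xy; rewrite [LHS]mulrACA [RHS]mulrACA -!expRD -!mulrDl xy.
apply: E.
have -> : - (c * p.1 + - d * p.2) ^+ 2 + - (d * p.1 + c * p.2) ^+ 2 =
  - (c ^+ 2 + d ^+ 2) * (p.1 ^+ 2 + p.2 ^+ 2) by ring.
by rewrite cd; ring.
Qed.

Lemma normal_rotation (h : R * R -> R) (M c d : R) : continuous h ->
  (forall p, 0 <= h p <= M) -> c ^+ 2 + d ^+ 2 = 1 -> d != 0 ->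
  (\int[normal_prob 0 sg]_s \int[normal_prob 0 sg]_t
     (h (c * s + - d * t, d * s + c * t))%:E =
   \int[normal_prob 0 sg]_s \int[normal_prob 0 sg]_t (h (s, t))%:E)%E.
Proof.
move=> ch hM cd d0.
have p0 := @normal_pdf_ge0 R 0 sg.
have cp := @continuous_normal_pdf R 0 sg sg0.
have cd' : continuous dens.
  move=> p; apply: cvgM.
    by apply: (@continuous_comp _ _ _ fst (normal_pdf 0 sg)); [exact: cvg_fst|exact: cp].
  by apply: (@continuous_comp _ _ _ snd (normal_pdf 0 sg)); [exact: cvg_snd|exact: cp].
have d0' p : 0 <= dens p by rewrite mulr_ge0.
have toQ (k : R * R -> R) : continuous k -> (forall p, 0 <= k p <= M) ->
    (\int[normal_prob 0 sg]_s \int[normal_prob 0 sg]_t (k (s, t))%:E =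
     Q (fun p => (k p * dens p)%R))%E.
  move=> ck kM.
  have mk s : measurable_fun setT (fun t => k (s, t)).
    by apply: continuous_measurable_fun; exact: continuous_pair2.
  have k0 p : 0 <= k p by have /andP[] := kM p.
  have mk' s : measurable_fun setT (fun t : measurableTypeR R => k (s, t)) by exact: mk.
  pose k1 s := mean (normal_prob 0 sg) (fun t => k (s, t)).
  have k1E s : ((k1 s)%:E = \int[normal_prob 0 sg]_t (k (s, t))%:E)%E.
    exact: (@meanE _ _ _ _ _ M (mk' s) (fun t => kM (s, t))).
  have k1M s : 0 <= k1 s <= M.
    exact: (@mean_bounds _ _ _ _ _ M (mk' s) (fun t => kM (s, t))).
  have mk1 : measurable_fun setT k1.
    apply: (@measurableT_comp _ _ _ _ _ _ (@fine R)) => //.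
    apply: (@measurable_fun_fubini_tonelli_F _ _ _ _ _ (normal_prob 0 sg)
      (fun p : measurableTypeR R * measurableTypeR R => (k p)%:E)) => //.
      by apply/measurable_EFinP; exact: continuous_measurable2.
  under eq_integral do rewrite -k1E.
  rewrite (integral_normal mk1 k1M); apply: eq_integral => s _.
  rewrite EFinM k1E (integral_normal (mk s) (fun t => kM (s, t))).
  rewrite muleC -ge0_integralZl //.
  - by apply: eq_integral => t _; rewrite -!EFinM /dens /= mulrCA mulrA.
  - apply/measurable_EFinP; apply: measurable_funM; first exact: mk.
    exact: measurable_normal_pdf.
  - by move=> t _; rewrite lee_fin mulr_ge0.
  - by rewrite lee_fin.
rewrite (toQ _ (@continuous_affine h c (- d) d c ch) (fun p => hM _)) (toQ _ ch hM).
have chd : continuous (fun p => h p * dens p).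
  by move=> p; apply: cvgM; [exact: ch|exact: cd'].
have hd0 p : 0 <= h p * dens p by rewrite mulr_ge0 //; have /andP[] := hM p.
rewrite -(Q_rotation chd hd0 cd d0).
by apply: eq_integral => s _; apply: eq_integral => t _ /=; rewrite (dens_rot (s, t) cd).
Qed.

Lemma normal_symmetric (f : R -> R) (M : R) : continuous f ->
  (forall x, 0 <= f x <= M) ->
  (\int[normal_prob 0 sg]_s (f (- s))%:E = \int[normal_prob 0 sg]_s (f s)%:E)%E.
Proof.
move=> cf fM.
have cf' : continuous (fun s => f (- s)).
  move=> s; apply: (@cvg_comp _ _ _ -%R f _ (nbhs (- s))); last exact: cf.
  exact: cvgN.
have mf := continuous_measurable_fun cf.
have mf' := continuous_measurable_fun cf'.
have rot (g : R -> R) (c e : R) : continuous g -> (forall x, 0 <= g x <= M) ->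
    c ^+ 2 + e ^+ 2 = 1 -> e != 0 ->
  (\int[normal_prob 0 sg]_s \int[normal_prob 0 sg]_t (g (c * s + - e * t))%:E =
   \int[normal_prob 0 sg]_s (g s)%:E)%E.
  move=> cg gM ce e0.
  rewrite (@normal_rotation (fun p => g p.1) M c e) //.
    apply: eq_integral => s _ /=.
    by rewrite integral_cst //= probability_setT mule1.
  by move=> p; apply: (@continuous_comp _ _ _ fst g); [exact: cvg_fst|exact: cg].
have e1 : (-1 : R) != 0 by rewrite oppr_eq0 oner_neq0.
have e2 : (1 : R) != 0 by exact: oner_neq0.
have c1 : (0 : R) ^+ 2 + (-1) ^+ 2 = 1 by rewrite expr0n add0r sqrrN expr1n.
have c2 : (0 : R) ^+ 2 + 1 ^+ 2 = 1 by rewrite expr0n add0r expr1n.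
(* Two opposite quarter turns bring both sides to the double integral of [f (- t)]. *)
rewrite -(rot _ _ _ cf' (fun x => fM _) c1 e1) -(rot _ _ _ cf fM c2 e2).
by apply: eq_integral => s _; apply: eq_integral => t _; rewrite !mul0r !add0r opprK mul1r mulN1r.
Qed.

End NormalIntegral.

Section MeanMore.
Context {R : realType} d (T : measurableType d) (mu : probability T R).

Lemma mean_addge (f g : T -> R) (M c : R) :
  measurable_fun setT f -> measurable_fun setT g ->
  (forall x, 0 <= f x <= M) -> (forall x, 0 <= g x <= M) ->
  (forall x, c <= f x + g x) -> 0 <= c -> c <= mean mu f + mean mu g.
Proof.
move=> mf mg fM gM fg c0; rewrite -lee_fin EFinD (meanE mu mf fM) (meanE mu mg gM).
rewrite -ge0_integralD //.
- apply: (@le_trans _ _ (\int[mu]_x (cst c%:E) x)%E).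
    by rewrite integral_cst //= probability_setT mule1.
  apply: ge0_le_integral => //.
  + by apply: emeasurable_funD; exact/measurable_EFinP.
  + by move=> x _; rewrite -EFinD lee_fin.
- by move=> x _; rewrite lee_fin; have /andP[] := fM x.
- exact/measurable_EFinP.
- by move=> x _; rewrite lee_fin; have /andP[] := gM x.
- exact/measurable_EFinP.
Qed.

Lemma mean_leM (f g : T -> R) (M c : R) :
  measurable_fun setT f -> measurable_fun setT g ->
  (forall x, 0 <= f x <= M) -> (forall x, 0 <= g x <= M) ->
  (forall x, f x <= c * g x) -> 0 <= c -> mean mu f <= c * mean mu g.
Proof.
move=> mf mg fM gM fg c0; rewrite -lee_fin EFinM (meanE mu mf fM) (meanE mu mg gM).
rewrite -ge0_integralZl //.
- apply: ge0_le_integral => //.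
  + by move=> x _; rewrite lee_fin; have /andP[] := fM x.
  + exact/measurable_EFinP.
  + by apply: emeasurable_funM => //; exact/measurable_EFinP.
  + by move=> x _; rewrite -EFinM lee_fin.
- exact/measurable_EFinP.
- by move=> x _; rewrite lee_fin; have /andP[] := gM x.
Qed.

End MeanMore.

(** * Gaussian averages of bounded Lipschitz functions *)

Section GaussianAverage.
Context {R : realType} {X : normedModType R[i]}.
Implicit Types (Phi : X -> R) (x y z : X) (xs ys : seq X).

Definition gauss : probability (measurableTypeR R) R := normal_prob 0 (Num.sqrt 2^-1).

(** Test functions for the laws of Gaussian sums. The class is stable under [gavg], so iterated
    averages stay continuous and measurability is only ever needed for real functions. *)
Definition blip (M L : R) Phi := [/\ forall z, 0 <= Phi z <= M, 0 <= L &
  forall z z', Phi z <= Phi z' + L * rnorm (z - z')].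

Definition gavg Phi x z := mean gauss (fun s => Phi (z + s%:C%C *: x)).

(** The expectation of [Phi] at z plus a sum of independent real Gaussian multiples of the vectors
    [xs], as an iterated one-dimensional integral. *)
Definition gint xs Phi := foldr (fun x Psi => gavg Psi x) Phi xs.

Lemma blip_continuous M L Phi : blip M L Phi -> continuous Phi.
Proof.
move=> [_ L0 lip] z; apply/cvgrPdist_lt => e e0.
have L1 : 0 < L + 1 by rewrite ltr_wpDl.
have /cvg_rnormP/(_ (e / (L + 1))) : (fun y => y) y @[y --> z] --> z by exact: cvg_id.
rewrite divr_gt0 // => /(_ isT); apply: filterS => y yz.
have Le : L * rnorm (y - z) < e.
  move: yz; rewrite ltr_pdivlMr // => /(le_lt_trans _); apply.
  by rewrite mulrC ler_wpM2l ?rnorm_ge0 // lerDl.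
rewrite ltr_norml; have := lip y z; have := lip z y; rewrite (rnormBC z y).
by move=> h1 h2; apply/andP; split; lra.
Qed.

Lemma continuous_realscale x : continuous (fun s : R => s%:C%C *: x).
Proof.
move=> s; apply/cvg_rnormP => e e0.
have x1 : 0 < rnorm x + 1 by rewrite ltr_wpDl ?rnorm_ge0.
apply/nbhs_normP; exists (e / (rnorm x + 1)); first by rewrite /= divr_gt0.
move=> t; rewrite /ball_ /= ltr_pdivlMr // distrC => /(le_lt_trans _); apply.
by rewrite -scalerBl -rmorphB rnormZr ler_wpM2l // lerDl.
Qed.

Lemma continuous_line z x : continuous (fun s : R => z + s%:C%C *: x).
Proof. by move=> s; apply: cvgD; [exact: cvg_cst|exact: continuous_realscale]. Qed.

Lemma continuous_plane z x y :
  continuous (fun p : R * R => z + p.1%:C%C *: x + p.2%:C%C *: y).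
Proof.
move=> p; apply: cvgD.
  apply: cvgD; first exact: cvg_cst.
  apply: (@continuous_comp _ _ _ fst (fun s : R => s%:C%C *: x)); first exact: cvg_fst.
  exact: continuous_realscale.
apply: (@continuous_comp _ _ _ snd (fun s : R => s%:C%C *: y)); first exact: cvg_snd.
exact: continuous_realscale.
Qed.

Lemma blip_line_continuous M L Phi z x : blip M L Phi ->
  continuous (fun s : R => Phi (z + s%:C%C *: x)).
Proof.
move=> bP s; apply: (@continuous_comp _ _ _ (fun s : R => z + s%:C%C *: x) Phi).
  exact: continuous_line.
exact: blip_continuous bP _.
Qed.

Lemma blip_plane_continuous M L Phi z x y : blip M L Phi ->
  continuous (fun p : R * R => Phi (z + p.1%:C%C *: x + p.2%:C%C *: y)).
Proof.
move=> bP p; apply: (@continuous_comp _ _ _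
  (fun p : R * R => z + p.1%:C%C *: x + p.2%:C%C *: y) Phi).
  exact: continuous_plane.
exact: blip_continuous bP _.
Qed.

Lemma blip_line_measurable M L Phi z x : blip M L Phi ->
  measurable_fun setT (fun s : measurableTypeR R => Phi (z + s%:C%C *: x)).
Proof. by move=> bP; apply: continuous_measurable_fun; exact: blip_line_continuous bP. Qed.

Lemma blip_gavg M L Phi x : blip M L Phi -> blip M L (gavg Phi x).
Proof.
move=> bP; have [b0 L0 lip] := bP; split => // [z|z z'].
  by apply: mean_bounds => [|s]; [exact: blip_line_measurable bP|exact: b0].
apply: (@mean_leD _ _ _ _ _ _ M); try exact: blip_line_measurable bP.
- by move=> s; exact: b0.
- by move=> s; exact: b0.
- move=> s; have -> : z - z' = z + s%:C%C *: x - (z' + s%:C%C *: x).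
    by rewrite opprD addrACA subrr addr0.
  exact: lip.
- by rewrite mulr_ge0 ?rnorm_ge0.
Qed.

Lemma blip_gint M L Phi xs : blip M L Phi -> blip M L (gint xs Phi).
Proof. by move=> bP; elim: xs => //= x xs; exact: blip_gavg. Qed.

Lemma gavgE M L Phi x z : blip M L Phi ->
  ((gavg Phi x z)%:E = \int[gauss]_s (Phi (z + s%:C%C *: x))%:E)%E.
Proof.
move=> bP; have [b0 _ _] := bP.
by apply: (@meanE _ _ _ _ _ M) => [|s]; [exact: blip_line_measurable bP|exact: b0].
Qed.

Lemma gavg2E M L Phi x y z : blip M L Phi ->
  ((gavg (gavg Phi y) x z)%:E =
   \int[gauss]_s \int[gauss]_t (Phi (z + s%:C%C *: x + t%:C%C *: y))%:E)%E.
Proof.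
move=> bP; rewrite (gavgE _ _ (blip_gavg y bP)).
by apply: eq_integral => s _; rewrite (gavgE _ _ bP).
Qed.

Lemma gavg_rotation M L Phi x y (c e : R) : blip M L Phi ->
  c ^+ 2 + e ^+ 2 = 1 -> e != 0 ->
  gavg (gavg Phi (- (e%:C%C *: x) + c%:C%C *: y)) (c%:C%C *: x + e%:C%C *: y) =
  gavg (gavg Phi y) x.
Proof.
move=> bP ce e0; apply/funext => z; apply: EFin_inj.
rewrite !(gavg2E _ _ _ bP).
have b0 : forall z, 0 <= Phi z <= M by have [] := bP.
have := @normal_rotation R _ M c e (@blip_plane_continuous M L Phi z x y bP) (fun p => b0 _) ce e0.
move=> /= <-.
apply: eq_integral => s _; apply: eq_integral => t _; congr (Phi _)%:E => /=.
rewrite !(rmorphD, rmorphM, rmorphN) /= !scalerDl !scalerDr !scalerA !mulNr !scaleNr !scalerN.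
rewrite scalerA -!addrA; congr (_ + _).
rewrite (mulrC s%:C%C) (mulrC s%:C%C) (mulrC t%:C%C) (mulrC t%:C%C); congr (_ + _).
by rewrite addrCA.
Qed.

Lemma gavg_opp M L Phi x : blip M L Phi -> gavg Phi (- x) = gavg Phi x.
Proof.
move=> bP; apply/funext => z; apply: EFin_inj; rewrite !(gavgE _ _ bP).
rewrite -(@normal_symmetric R (fun s => Phi (z + s%:C%C *: x)) M).
- by apply: eq_integral => s _; rewrite rmorphN scaleNr scalerN.
- exact: blip_line_continuous bP.
- by move=> s; have [b0 _ _] := bP; exact: b0.
Qed.

Lemma gavg0 M L Phi : blip M L Phi -> gavg Phi 0 = Phi.
Proof.
move=> bP; apply/funext => z; apply: EFin_inj; rewrite (gavgE _ _ bP).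
under eq_integral do rewrite scaler0 addr0.
by rewrite integral_cst //= probability_setT mule1.
Qed.

(** A quarter turn exchanges the two directions up to a sign, which the symmetry of the Gaussian
    removes. *)
Lemma gavg_comm M L Phi x y : blip M L Phi -> gavg (gavg Phi y) x = gavg (gavg Phi x) y.
Proof.
move=> bP.
have c1 : (0 : R) ^+ 2 + 1 ^+ 2 = 1 by rewrite expr0n add0r expr1n.
have := gavg_rotation x y bP c1 (oner_neq0 _).
rewrite rmorph0 rmorph1 !scale0r !scale1r addr0 add0r.
by rewrite (gavg_opp x bP) => <-.
Qed.

Lemma gint_cat xs ys Phi : gint (xs ++ ys) Phi = gint xs (gint ys Phi).
Proof. exact: foldr_cat. Qed.

Lemma gavg_gint M L Phi x xs : blip M L Phi ->
  gavg (gint xs Phi) x = gint xs (gavg Phi x).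
Proof.
move=> bP; elim: xs => //= y xs IH.
by rewrite (gavg_comm _ _ (blip_gint xs bP)) IH.
Qed.

Lemma gint_comm M L Phi xs ys : blip M L Phi ->
  gint xs (gint ys Phi) = gint ys (gint xs Phi).
Proof.
move=> bP; elim: xs => //= x xs IH.
by rewrite IH (gavg_gint x ys (blip_gint xs bP)).
Qed.

Lemma gint_perm M L Phi xs ys : blip M L Phi -> perm_eq xs ys -> gint xs Phi = gint ys Phi.
Proof.
move=> bP xys.
apply: (@catCA_perm_ind X (fun us => gint xs Phi = gint us Phi) _ _ _ xys) => //.
by move=> s1 s2 s3 ->; rewrite !gint_cat (gint_comm _ _ (blip_gint s3 bP)).
Qed.

Lemma gint_opp M L Phi xs : blip M L Phi -> gint (map -%R xs) Phi = gint xs Phi.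
Proof.
move=> bP; elim: xs => //= x xs ->.
by rewrite (gavg_opp _ (blip_gint xs bP)).
Qed.

Lemma gint_nseq0 M L Phi n : blip M L Phi -> gint (nseq n 0) Phi = Phi.
Proof. by move=> bP; elim: n => //= n ->; exact: gavg0 bP. Qed.

(** The second average runs over the opposite vectors, so at every stage the two arguments keep the
    form [u + v] and [u' - v]. *)
Lemma gint_addge M L (Phi Psi : X -> R) ys (c : R) u u' :
  blip M L Phi -> blip M L Psi -> 0 <= c ->
  (forall v, c <= Phi (u + v) + Psi (u' - v)) ->
  forall v, c <= gint ys Phi (u + v) + gint (map -%R ys) Psi (u' - v).
Proof.
move=> bP bQ c0 h; elim: ys => [|y ys IH] v //=.
have bP' := blip_gint ys bP; have bQ' := blip_gint (map -%R ys) bQ.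
apply: (@mean_addge _ _ _ _ _ _ M) => //.
- exact: blip_line_measurable bP'.
- exact: blip_line_measurable bQ'.
- by move=> s; have [b0 _ _] := bP'; exact: b0.
- by move=> s; have [b0 _ _] := bQ'; exact: b0.
- by move=> s; rewrite -addrA scalerN -addrA -opprD; exact: IH.
Qed.

(** The law of the added directions is symmetric, so averaging the hypothesis gives twice the
    average of [Phi]. A convex [Phi] would give the constant 1; truncated squares satisfy only this
    weaker inequality. *)
Lemma gint_drop M L Phi ys u : blip M L Phi ->
  (forall u v, Phi u <= Phi (u + v) + Phi (u - v)) ->
  Phi u <= 2 * gint ys Phi u.
Proof.
move=> bP h; have [b0 _ _] := bP; have /andP[u0 _] := b0 u.
have := gint_addge ys bP bP u0 (h u) 0.
by rewrite addr0 subr0 (gint_opp _ bP); lra.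
Qed.

End GaussianAverage.

(* [givens i j c e] rotates the coordinates [i] and [j]; it acts alike on scalar
   coefficients and on vectors. *)
Section Givens.
Context {K : comNzRingType} {V : lmodType K} {n : nat}.

Definition givens (i j : 'I_n) (c e : K) (v : 'I_n -> V) (k : 'I_n) : V :=
  if k == i then c *: v i + e *: v j else
  if k == j then - (e *: v i) + c *: v j else v k.

End Givens.

Lemma givens_sum (K : comNzRingType) (V : lmodType K) n (i j : 'I_n) (c e : K)
    (a : 'I_n -> K^o) (v : 'I_n -> V) : i != j -> c ^+ 2 + e ^+ 2 = 1 ->
  \sum_k givens i j c e a k *: givens i j c e v k = \sum_k a k *: v k.
Proof.
move=> ij ce; rewrite (bigD1 i) //= (bigD1 j) 1?eq_sym //=.
rewrite [RHS](bigD1 i) //= [in RHS](bigD1 j) 1?eq_sym //=; rewrite !addrA; congr (_ + _).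
  rewrite /givens eqxx [j == i]eq_sym (negbTE ij) eqxx.
  set p := a i; set q := a j; set x := v i; set y := v j.
  have sE (u w : K) : u *: (w : K^o) = u * w by [].
  rewrite !sE.
  transitivity (((c * p + e * q) * c - (- (e * p) + c * q) * e) *: x +
      ((c * p + e * q) * e + (- (e * p) + c * q) * c) *: y).
    rewrite [in RHS]scalerBl [in RHS]scalerDl -!scalerA.
    by rewrite [in LHS]scalerDr [in LHS]scalerDr scalerN !addrA; congr (_ + _); rewrite addrAC.
  have -> : (c * p + e * q) * c - (- (e * p) + c * q) * e = (c ^+ 2 + e ^+ 2) * p by ring.
  have -> : (c * p + e * q) * e + (- (e * p) + c * q) * c = (c ^+ 2 + e ^+ 2) * q by ring.
  by rewrite ce !mul1r.
apply: eq_bigr => k /andP[ki kj].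
by rewrite /givens (negbTE ki) (negbTE kj).
Qed.

Section GaussianContraction.
Context {R : realType} {X : normedModType R[i]}.
Implicit Types (Phi : X -> R).

(* The integral of [Phi] over the Gaussian family with coefficient vectors [x]. *)
Definition gfam (E : finType) (x : E -> X) Phi := gint (map x (enum E)) Phi.

Lemma gfam_givens M L Phi n (x : 'I_n -> X) (i j : 'I_n) (c e : R) : blip M L Phi ->
  i != j -> c ^+ 2 + e ^+ 2 = 1 ->
  gfam (givens i j c%:C%C e%:C%C x) Phi = gfam x Phi.
Proof.
move=> bP ij ce.
(* For [e = 0] the rotation is plus or minus the identity on the two coordinates, and [gavg_opp]
   suffices. *)
have [e0|e0] := eqVneq e 0.
  have c2 : c ^+ 2 = 1 by rewrite -ce e0 expr0n addr0.
  have cc : c == 1 \/ c == -1 by apply/orP; rewrite -eqf_sqr expr1n c2.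
  rewrite /gfam; elim: (enum 'I_n) => //= k s ->.
  have bP' := blip_gint (map x s) bP.
  rewrite /givens e0 rmorph0 !scale0r addr0 oppr0 add0r.
  case: cc => /eqP ->; rewrite ?rmorphN ?rmorph1 ?scaleN1r ?scale1r.
    by case: eqP => [->//|_]; case: eqP => [->//|_].
  case: eqP => [->|_]; first exact: gavg_opp bP'.
  by case: eqP => [->|_] //; exact: gavg_opp bP'.
have pe : perm_eq (enum 'I_n) [:: i, j & rem j (rem i (enum 'I_n))].
  apply: perm_trans (perm_to_rem (mem_enum _ i)) _; rewrite perm_cons.
  apply: perm_to_rem; rewrite mem_rem_uniq ?enum_uniq // !inE eq_sym ij /=.
  exact: mem_enum.
rewrite /gfam (gint_perm bP (perm_map _ pe)) (gint_perm bP (perm_map x pe)) /=.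
have -> : map (givens i j c%:C%C e%:C%C x) (rem j (rem i (enum 'I_n))) =
    map x (rem j (rem i (enum 'I_n))).
  apply/eq_in_map => k.
  rewrite mem_rem_uniq ?rem_uniq ?enum_uniq // !inE.
  rewrite mem_rem_uniq ?enum_uniq // !inE => /andP[kj /andP[ki _]].
  by rewrite /givens (negbTE ki) (negbTE kj).
rewrite /givens !eqxx [j == i]eq_sym (negbTE ij).
exact: gavg_rotation (blip_gint _ bP) ce e0.
Qed.

(** [S] is an orthogonal change of coefficients and [x'] the correspondingly rotated family of
    vectors, with the same Gaussian law. *)
Definition law_equiv n (x x' : 'I_n -> X) (S : ('I_n -> R) -> 'I_n -> R) :=
  [/\ forall v w, \sum_k S v k * S w k = \sum_k v k * w k,
      forall v, \sum_k (S v k)%:C%C *: x' k = \sum_k (v k)%:C%C *: x k &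
      forall M L Phi, blip M L Phi -> gfam x' Phi = gfam x Phi].

Lemma law_equiv_givens n (x x' : 'I_n -> X) S (i j : 'I_n) (c e : R) :
  i != j -> c ^+ 2 + e ^+ 2 = 1 -> law_equiv x x' S ->
  law_equiv x (givens i j c%:C%C e%:C%C x') (fun v => givens i j c e (S v : 'I_n -> R^o)).
Proof.
move=> ij ce [h1 h2 h3]; split.
- move=> v w; rewrite -[RHS]h1.
  exact: (@givens_sum R R^o n i j c e (S v) (S w) ij ce).
- move=> v; rewrite -[RHS]h2.
  have ceC : c%:C%C ^+ 2 + e%:C%C ^+ 2 = 1 :> R[i] by rewrite -!rmorphXn -rmorphD ce rmorph1.
  rewrite -(@givens_sum R[i] X n i j c%:C%C e%:C%C (fun k => (S v k)%:C%C) x' ij ceC).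
  apply: eq_bigr => k _; congr (_ *: _); rewrite /givens.
  by case: eqP => _; [|case: eqP => _]; rewrite ?(rmorphD, rmorphM, rmorphN).
- by move=> M L Phi bP; rewrite (gfam_givens _ bP ij ce) (h3 _ _ _ bP).
Qed.

(* Rotating the first coordinate successively against the others concentrates
   [w] on the first coordinate. *)
Lemma law_equiv_unit n (x : 'I_n.+1 -> X) (w : 'I_n.+1 -> R) :
  exists x' S, law_equiv x x' S /\ forall k, k != ord0 -> S w k = 0.
Proof.
suff : forall m, exists x' S, law_equiv x x' S /\
    forall k : 'I_n.+1, k != ord0 -> (k <= m)%N -> S w k = 0.
  move=> /(_ n)[x' [S [h1 h2]]]; exists x', S; split=> // k k0; apply: h2 => //.
  by rewrite -ltnS.
elim=> [|m [x' [S [h1 h2]]]].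
  exists x, id; split; first by split.
  by move=> k k0; rewrite leqn0 => /eqP k00; case/negP: k0; apply/eqP/val_inj.
have [mn|nm] := ltnP m.+1 n.+1; last first.
  exists x', S; split=> // k k0 _; apply: h2 => //.
  by rewrite -ltnS (leq_trans (ltn_ord k)).
pose j := Ordinal mn; set a := S w ord0; set b := S w j.
have j0 : ord0 != j by [].
have [ab|ab] := eqVneq (a ^+ 2 + b ^+ 2) 0.
  exists x', S; split=> // k k0; rewrite leq_eqVlt => /orP[/eqP km|]; last exact: h2.
  have -> : k = j by apply/val_inj.
  apply/eqP; rewrite -sqrf_eq0 -/b.
  by move/eqP: ab; rewrite paddr_eq0 ?sqr_ge0 // => /andP[].
have r0 : 0 < a ^+ 2 + b ^+ 2 by rewrite lt0r ab addr_ge0 ?sqr_ge0.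
set r := Num.sqrt (a ^+ 2 + b ^+ 2).
have rp : 0 < r by rewrite sqrtr_gt0.
have ce : (a / r) ^+ 2 + (b / r) ^+ 2 = 1.
  by rewrite !exprMn -mulrDl exprVn sqr_sqrtr ?(ltW r0) // mulfV.
exists (givens ord0 j (a / r)%:C%C (b / r)%:C%C x'),
  (fun v => givens ord0 j (a / r) (b / r) (S v : 'I_n.+1 -> R^o)).
split; first exact: law_equiv_givens.
move=> k k0 km; rewrite /givens (negbTE k0); have [_|kj] := eqVneq k j.
  rewrite -/a -/b /GRing.scale /=; ring.
apply: h2 => //; move: km; rewrite leq_eqVlt => /orP[/eqP km|//].
by case/eqP: kj; apply/val_inj.
Qed.

Lemma gfam_recl n (x : 'I_n.+1 -> X) Phi :
  gfam x Phi = gavg (gfam (fun k => x (lift ord0 k)) Phi) (x ord0).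
Proof. by rewrite /gfam enum_ordSl /= -map_comp. Qed.

(** Rotate the first row onto the first coordinate axis. By orthogonality the other rows then live
    on the remaining coordinates, and induction applies. The factor 2 is paid only once, when no row
    is left and the leftover directions are dropped. *)
Lemma gfam_orthonormal_rows M L Phi m n (x : 'I_n -> X) (W : 'I_m -> 'I_n -> R) z :
  blip M L Phi -> (forall u v, Phi u <= Phi (u + v) + Phi (u - v)) ->
  (forall k l, \sum_i W k i * W l i = (k == l)%:R) ->
  gfam (fun k => \sum_i (W k i)%:C%C *: x i) Phi z <= 2 * gfam x Phi z.
Proof.
move=> bP Pd; elim: m n x W z => [|m IH] n x W z oW.
  by rewrite {1}/gfam enum_ord0 /=; exact: gint_drop bP Pd.
case: n x W oW => [|n] x W oW.
  by have := oW ord0 ord0; rewrite big_ord0 eqxx => /eqP; rewrite eq_sym oner_eq0.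
have [x' [S [[S1 S2 S3] Sw]]] := law_equiv_unit x (W ord0).
rewrite -(S3 _ _ _ bP) !gfam_recl.
set tl := fun k => x' (lift ord0 k).
have s0 : S (W ord0) ord0 ^+ 2 = 1.
  have := S1 (W ord0) (W ord0); rewrite oW eqxx big_ord_recl big1 ?addr0.
    by rewrite -expr2.
  by move=> k _; rewrite Sw ?mul0r.
have hd : \sum_i (W ord0 i)%:C%C *: x i = (S (W ord0) ord0)%:C%C *: x' ord0.
  by rewrite -S2 big_ord_recl big1 ?addr0 // => k _; rewrite Sw // scale0r.
pose W' (k : 'I_m) (i : 'I_n) := S (W (lift ord0 k)) (lift ord0 i).
have sk0 k : S (W (lift ord0 k)) ord0 = 0.
  have := S1 (W ord0) (W (lift ord0 k)).
  rewrite oW /= big_ord_recl big1 ?addr0; last by move=> i _; rewrite Sw ?mul0r.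
  move=> /eqP; rewrite mulf_eq0 => /orP[/eqP s00|/eqP //].
  by move: s0; rewrite s00 expr0n => /eqP; rewrite eq_sym oner_eq0.
have tlE : (fun k => \sum_i (W (lift ord0 k) i)%:C%C *: x i) =
    (fun k => \sum_i (W' k i)%:C%C *: tl i).
  by apply/funext => k; rewrite -S2 big_ord_recl sk0 scale0r add0r.
have oW' k l : \sum_i W' k i * W' l i = (k == l)%:R.
  have := S1 (W (lift ord0 k)) (W (lift ord0 l)).
  by rewrite oW big_ord_recl sk0 mul0r add0r (inj_eq lift_inj).
rewrite hd tlE.
set F := gfam _ Phi; set G := gfam tl Phi.
have bF : blip M L F by exact: blip_gint.
have bG : blip M L G by exact: blip_gint.
have -> : gavg F ((S (W ord0) ord0)%:C%C *: x' ord0) = gavg F (x' ord0).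
  have /orP[/eqP->|/eqP->] : (S (W ord0) ord0 == 1) || (S (W ord0) ord0 == -1).
    by rewrite -eqf_sqr expr1n s0.
    by rewrite rmorph1 scale1r.
  by rewrite rmorphN rmorph1 scaleN1r (gavg_opp _ bF).
apply: (@mean_leM _ _ _ _ _ _ M) => //.
- exact: blip_line_measurable bF.
- exact: blip_line_measurable bG.
- by move=> s; have [b0 _ _] := bF; exact: b0.
- by move=> s; have [b0 _ _] := bG; exact: b0.
- by move=> s; exact: IH.
Qed.

End GaussianContraction.

Section SchurContraction.
Context {R : realType} {X : normedModType R[i]}.
Implicit Types (Phi : X -> R).

Lemma gfam_enum_val M L Phi (E : finType) (x : E -> X) : blip M L Phi ->
  gfam (fun i : 'I_#|E| => x (enum_val i)) Phi = gfam x Phi.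
Proof.
move=> bP; rewrite /gfam (map_comp x enum_val); apply: (gint_perm bP); apply: perm_map.
apply: uniq_perm; rewrite ?enum_uniq //.
  by rewrite (map_inj_uniq enum_val_inj) enum_uniq.
move=> e; rewrite mem_enum inE; apply/mapP; exists (enum_rank e); first exact: mem_enum.
by rewrite enum_rankK.
Qed.

Lemma sum_enum_val (V : nmodType) (E : finType) (F : E -> V) :
  \sum_(i < #|E|) F (enum_val i) = \sum_e F e.
Proof. by rewrite [RHS](reindex _ (onW_bij _ (@enum_val_bij E))). Qed.

Lemma gfam_orthonormal M L Phi (E O : finType) (x : E -> X) (W : O -> E -> R) z :
  blip M L Phi -> (forall u v, Phi u <= Phi (u + v) + Phi (u - v)) ->
  (forall k l, \sum_i W k i * W l i = (k == l)%:R) ->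
  gfam (fun k => \sum_i (W k i)%:C%C *: x i) Phi z <= 2 * gfam x Phi z.
Proof.
move=> bP Pd oW; rewrite -(gfam_enum_val x bP) -(gfam_enum_val _ bP).
have -> : (fun k : 'I_#|O| => \sum_i (W (enum_val k) i)%:C%C *: x i) =
    (fun k : 'I_#|O| => \sum_(i < #|E|) (W (enum_val k) (enum_val i))%:C%C *: x (enum_val i)).
  by apply/funext => k; rewrite (sum_enum_val (fun i => (W (enum_val k) i)%:C%C *: x i)).
apply: (gfam_orthonormal_rows (fun i => x (enum_val i))
  (W := fun k i => W (enum_val k) (enum_val i)) z bP Pd) => k l.
rewrite (sum_enum_val (fun i => W (enum_val k) i * W (enum_val l) i)) oW.
by rewrite (inj_eq enum_val_inj).
Qed.

Lemma gfam_sum0 M L Phi (E C : finType) (x : E -> X) : blip M L Phi ->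
  gfam (fun i : E + C => if i is inl e then x e else 0) Phi = gfam x Phi.
Proof.
move=> bP; rewrite /gfam.
have pe : perm_eq (enum {: E + C}) (map inl (enum E) ++ map inr (enum C)).
  apply: uniq_perm; rewrite ?enum_uniq //.
    rewrite cat_uniq (map_inj_uniq (@inl_inj E C)) (map_inj_uniq (@inr_inj E C)).
    rewrite !enum_uniq /= andbT; apply/hasPn => i /mapP[c _ ->].
    by apply/negP => /mapP[].
  move=> [e|c]; rewrite mem_enum inE mem_cat.
    by rewrite (mem_map (@inl_inj E C)) mem_enum.
  by rewrite (mem_map (@inr_inj E C)) mem_enum orbT.
rewrite (gint_perm bP (perm_map _ pe)) map_cat gint_cat.
set f := fun i : E + C => _.
have -> : map f (map inr (enum C)) = nseq (size (enum C)) 0 by elim: (enum C) => //= c s ->.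
rewrite (gint_nseq0 _ bP); congr gint.
by elim: (enum E) => //= e s ->.
Qed.

Lemma sum_delta (I : finType) (i : I) (F : I -> R) :
  \sum_j (i == j)%:R * F j = F i.
Proof.
rewrite (bigD1 i) //= eqxx mul1r big1 ?addr0 // => j ji.
by rewrite eq_sym (negbTE ji) mul0r.
Qed.

(* [nu ^ 2 - A A^T] is diagonally dominant, hence of the form [C C^T] for an
   explicit [C]; then [(A | C) / nu] has orthonormal rows. *)
Lemma gfam_schur M L Phi (E O : finType) (x : E -> X) (A : O -> E -> R) nu z :
  blip M L Phi -> (forall u v, Phi u <= Phi (u + v) + Phi (u - v)) ->
  0 < nu -> (forall o, \sum_o' `|\sum_e A o e * A o' e| <= nu ^+ 2) ->
  gfam (fun o => \sum_e (A o e / nu)%:C%C *: x e) Phi z <= 2 * gfam x Phi z.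
Proof.
move=> bP Pd nu0 row.
pose G o o' := \sum_e A o e * A o' e.
have Gsym o o' : G o o' = G o' o by apply: eq_bigr => e _; rewrite mulrC.
pose N := (E + (O * O + O))%type.
(* The columns indexed by pairs (p, q) have the Gram matrix diag (sum_q |G p q|) - G, and the last
   block fills the diagonal up to [nu ^+ 2]. *)
pose W (o : O) (i : N) : R := match i with
  | inl e => A o e
  | inr (inl (p, q)) => Num.sqrt (`|G p q| / 2) * ((o == p)%:R - Num.sg (G p q) * (o == q)%:R)
  | inr (inr p) => (o == p)%:R * Num.sqrt (nu ^+ 2 - \sum_q `|G p q|)
  end / nu.
pose x' (i : N) := if i is inl e then x e else 0.
have -> : (fun o => \sum_e (A o e / nu)%:C%C *: x e) =
    (fun o => \sum_i (W o i)%:C%C *: x' i).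
  apply/funext => o; rewrite big_sumType /= [X in _ + X]big1 ?addr0 // => c _.
  by rewrite scaler0.
rewrite -(@gfam_sum0 _ _ _ E (O * O + O)%type x bP).
apply: gfam_orthonormal bP Pd _ => o o'.
have sq p q : Num.sqrt (`|G p q| / 2) * Num.sqrt (`|G p q| / 2) = `|G p q| / 2.
  by rewrite -expr2 sqr_sqrtr // divr_ge0.
have sq' p : Num.sqrt (nu ^+ 2 - \sum_q `|G p q|) * Num.sqrt (nu ^+ 2 - \sum_q `|G p q|) =
    nu ^+ 2 - \sum_q `|G p q|.
  by rewrite -expr2 sqr_sqrtr // subr_ge0; exact: row.
have sgG p q : `|G p q| * Num.sg (G p q) = G p q by rewrite mulrC -numEsg.
have sg2 p q : `|G p q| * Num.sg (G p q) * Num.sg (G p q) = `|G p q|.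
  by rewrite sgG mulrC -normrEsg.
rewrite big_sumType big_sumType /=.
have -> : \sum_e W o (inl e) * W o' (inl e) = G o o' / nu ^+ 2.
  rewrite /G mulr_suml; apply: eq_bigr => e _; rewrite /W /=; field.
  by rewrite gt_eqF.
have -> : \sum_c W o (inr (inr c)) * W o' (inr (inr c)) =
    (o == o')%:R * (nu ^+ 2 - \sum_q `|G o q|) / nu ^+ 2.
  transitivity (\sum_c (o == c)%:R * ((o' == c)%:R * (nu ^+ 2 - \sum_q `|G c q|) / nu ^+ 2)).
    by apply: eq_bigr => c _; rewrite -sq' /W /=; field; rewrite gt_eqF.
  by rewrite sum_delta eq_sym.
have -> : \sum_i W o (inr (inl i)) * W o' (inr (inl i)) =
    ((o == o')%:R * \sum_q `|G o q| - G o o') / nu ^+ 2.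
  transitivity ((\sum_p \sum_q ((o == p)%:R * ((o' == p)%:R * (`|G p q| / 2)) +
      (o == p)%:R * ((o' == q)%:R * (- G p q / 2)) +
      (o' == p)%:R * ((o == q)%:R * (- G p q / 2)) +
      (o == q)%:R * ((o' == q)%:R * (`|G p q| / 2)))) / nu ^+ 2).
    rewrite pair_bigA mulr_suml; apply: eq_bigr => -[p q] _ /=.
    rewrite -[X in - X / 2](sgG p q) -[X in (o == q)%:R * ((o' == q)%:R * (X / 2))](sg2 p q).
    transitivity (Num.sqrt (`|G p q| / 2) * Num.sqrt (`|G p q| / 2) *
      (((o == p)%:R - Num.sg (G p q) * (o == q)%:R) *
       ((o' == p)%:R - Num.sg (G p q) * (o' == q)%:R)) / nu ^+ 2).
      by rewrite /W /=; field; rewrite gt_eqF.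
    by rewrite sq; congr (_ / _); field.
  congr (_ / _); under eq_bigr do rewrite 3!big_split /=.
  rewrite 3!big_split /=.
  have dsum (u v : O) (F : O -> O -> R) :
      \sum_p \sum_q (u == p)%:R * ((v == q)%:R * F p q) = F u v.
    by under eq_bigr do rewrite -mulr_sumr sum_delta; rewrite sum_delta.
  rewrite (dsum o o' (fun p q => - G p q / 2)) (dsum o' o (fun p q => - G p q / 2)).
  have -> : \sum_p \sum_q (o == p)%:R * ((o' == p)%:R * (`|G p q| / 2)) =
      (o' == o)%:R * (\sum_q `|G o q| / 2).
    under eq_bigr do rewrite -!mulr_sumr.
    by rewrite sum_delta.
  rewrite [X in _ + X]exchange_big /=.
  under [X in _ + X]eq_bigr do rewrite -!mulr_sumr.
  rewrite sum_delta -!mulr_suml -(Gsym o o') (eq_sym o' o).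
  have -> : \sum_p `|G p o| = \sum_p `|G o p| by apply: eq_bigr => p _; rewrite Gsym.
  by field.
by field; rewrite gt_eqF.
Qed.

End SchurContraction.

Section Measurability.
Context {R : realType} {X : normedModType R[i]} {I : eqType}.

(** The variables are split off one at a time, through functions continuous in that one and
    measurable in the rest. *)
Lemma measurable_blip_sum d (T : measurableType d) (q : I -> T -> R) (ks : seq I)
    (M L : R) (Phi : X -> R) (v : I -> X) z :
  (forall k, k \in ks -> measurable_fun setT (q k)) -> blip M L Phi ->
  measurable_fun setT (fun w => Phi (z + \sum_(k <- ks) (q k w)%:C%C *: v k)).
Proof.
move=> mq bP; elim: ks mq z => [|k ks IH] mq z.
  by under eq_fun do rewrite big_nil; exact: measurable_cst.
pose F (sw : R * T) := Phi (z + sw.1%:C%C *: v k + \sum_(k <- ks) (q k sw.2)%:C%C *: v k).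
have mF : measurable_fun setT F.
  apply: measurable_Caratheodory => [t|s].
    pose c := \sum_(j <- ks) (q j t)%:C%C *: v j.
    have -> : (fun s => F (s, t)) = fun s => Phi (z + c + s%:C%C *: v k).
      by apply/funext => s; rewrite /F /= addrAC.
    exact: blip_line_continuous bP.
  have : measurable_fun setT
      (fun w => Phi (z + s%:C%C *: v k + \sum_(k <- ks) (q k w)%:C%C *: v k)).
    by apply: IH => j jks; apply: mq; rewrite inE jks orbT.
  exact.
have -> : (fun w => Phi (z + \sum_(j <- k :: ks) (q j w)%:C%C *: v j)) =
    F \o (fun w => (q k w, w)).
  by apply/funext => w; rewrite /F /= big_cons addrA.
apply: measurableT_comp mF _.
by apply: measurable_fun_pair => //; apply: mq; rewrite inE eqxx.
Qed.

End Measurability.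

(** Independence makes the joint law of [f] and [U] the product of their laws; the rest is Tonelli's
    theorem. *)
Lemma indep_integral (R : realType) d d' (T : measurableType d) (S : measurableType d')
    (P : probability T R) (N : probability (measurableTypeR R) R)
    (f : T -> measurableTypeR R) (U : T -> S)
    (mf : measurable_fun setT f) (mU : measurable_fun setT U) :
  (forall A B, measurable A -> measurable B ->
     P (f @^-1` A `&` U @^-1` B) = (N A * P (U @^-1` B))%E) ->
  forall h : measurableTypeR R * S -> \bar R, measurable_fun setT h -> (forall x, 0 <= h x)%E ->
  (\int[P]_w h (f w, U w) = \int[N]_s \int[P]_w h (s, U w))%E.
Proof.
move=> ind h mh h0.
have mfU : measurable_fun setT (fun w => (f w, U w)) by exact: measurable_fun_pair.
pose fU : {mfun T >-> (measurableTypeR R * S)%type} :=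
  HB.pack (fun w => (f w, U w)) (isMeasurableFun.Build _ _ _ _ _ mfU).
pose U' : {mfun T >-> S} := HB.pack U (isMeasurableFun.Build _ _ _ _ _ mU).
pose PU : probability S R := distribution P U'.
pose PfU : probability (measurableTypeR R * S)%type R := distribution P fU.
have E X : measurable X -> (N \x PU)%E X = PfU X.
  by apply: product_measure_unique => A B mA mB; rewrite -ind.
transitivity (\int[PfU]_x h x)%E.
  by rewrite ge0_integral_pushforward //; move=> y _; exact: h0.
transitivity (\int[(N \x PU)%E]_x h x)%E.
  by apply: eq_measure_integral => A mA _; first [exact: E|apply/esym; exact: E].
rewrite fubini_tonelli1 //; apply: eq_integral => s _; rewrite /fubini_F.
have mhs : measurable_fun setT (fun y => h (s, y)).
  by apply: measurableT_comp mh _; exact: measurable_pair1.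
by rewrite ge0_integral_pushforward //; move=> y _; exact: h0.
Qed.

(** * The law of a finite Gaussian sum *)

Section GaussianLaw.
Context {R : realType} d (Omega : measurableType d) (P : probability Omega R).
Context {I : eqType} (p : I -> Omega -> R).
Hypotheses (mp : forall k, measurable_fun setT (p k))
  (np : forall k (A : set R), measurable A -> P (p k @^-1` A) = gauss A)
  (ip : mutually_independent P p).

(** They generate the sigma-algebra of the variables [ks]; Omega with this sigma-algebra is the
    partner of which one further variable is independent. *)
Definition cylinders (ks : seq I) : set (set Omega) :=
  [set B | exists A : I -> set R, (forall i, measurable (A i)) /\
     B = \bigcap_(i in [set` ks]) (p i @^-1` A i)].

Local Notation T ks := (g_sigma_algebraType (cylinders ks)).

Let mcyl ks B : cylinders ks B -> measurable B.
Proof.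
move=> [A [mA ->]]; apply: fin_bigcap_measurable; first exact: finite_seq.
by move=> i _; rewrite -[X in measurable X]setTI; apply: mp.
Qed.

Let id_measurable ks : measurable_fun setT (idfun : Omega -> T ks).
Proof.
move=> _ B mB; rewrite setTI preimage_id.
apply: (@smallest_sub _ _ _ _ _ _ _ mB).
  exact: sigma_algebra_measurable.
exact: mcyl.
Qed.

Let p_measurable ks k : k \in ks -> measurable_fun setT (p k : T ks -> R).
Proof.
move=> kks _ B mB; rewrite setTI; apply: sub_sigma_algebra.
exists (fun i => if i == k then B else setT); split.
  by move=> i; case: eqP => // _; exact: measurableT.
apply/seteqP; split => w /=.
  by move=> h i _ /=; case: eqP => // ->.
by move=> /(_ k kks) /=; rewrite eqxx.
Qed.

(** As functions of B, both sides are finite measures that agree on cylinders, a family stable under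
    intersection. *)
Let p_indep ks k A : k \notin ks -> uniq ks -> measurable A ->
  forall B, measurable (B : set (T ks)) ->
  P (p k @^-1` A `&` B) = (gauss A * P B)%E.
Proof.
move=> kks uks mA.
have mpA : measurable (p k @^-1` A) by rewrite -[X in measurable X]setTI; exact: mp.
have gA0 : 0 <= fine (gauss A) by apply: fine_ge0.
have gAE : ((fine (gauss A))%:E = gauss A)%E by apply: fineK; exact: fin_num_measure.
pose m1 := mrestr P mpA; pose m2 := mscale (NngNum gA0) P.
have cT : cylinders ks setT.
  exists (fun=> setT); split=> [_|]; first exact: measurableT.
  by apply/seteqP; split => w // _ i _.
have E : forall B, <<s cylinders ks >> B -> m1 B = m2 B.
  apply: (@g_sigma_algebra_measure_unique _ R Omega (cylinders ks) _ (fun=> setT)).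
  - by move=> B; exact: mcyl.
  - by move=> _; exact: cT.
  - by apply/seteqP; split => w // _; exists 0%N.
  - move=> B C [A1 [mA1 ->]] [A2 [mA2 ->]]; exists (fun i => A1 i `&` A2 i); split.
      by move=> i; exact: measurableI.
    apply/seteqP; split => w /=.
      by move=> [h1 h2] i iks; split; [exact: h1|exact: h2].
    by move=> h; split => i /h [].
  - move=> _ [B [mB ->]].
    set BB := \bigcap_(i in _) _.
    have : (P (BB `&` p k @^-1` A) = (fine (gauss A))%:E * P BB)%E; last exact.
    rewrite gAE /BB {BB}.
    have -> : \bigcap_(i in [set` ks]) (p i @^-1` B i) `&` p k @^-1` A =
        \bigcap_(i in [set` (k :: ks)]) (p i @^-1` (if i == k then A else B i)).
      apply/seteqP; split => w /=.
        move=> [h1 h2] i /=; rewrite inE => /orP[/eqP ->|iks]; first by rewrite eqxx.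
        by case: eqP => [ik|_]; [move: kks; rewrite -ik iks|exact: h1].
      move=> h; split.
        move=> i iks; have := h i; rewrite /= inE iks orbT => /(_ isT).
        by case: eqP => // ik; move: kks; rewrite -ik; move: iks => /= ->.
      by have := h k; rewrite /= inE eqxx => /(_ isT).
    rewrite ip /=; last 2 first.
    - by rewrite kks uks.
    - by move=> i; case: eqP.
    rewrite big_cons eqxx np //; congr (_ * _)%E.
    rewrite ip //; apply: eq_big_seq => i iks.
    by case: eqP => // ik; move: kks; rewrite -ik iks.
  - move=> _; have : (P (setT `&` p k @^-1` A) < +oo)%E; last exact.
    by rewrite setTI; apply: le_lt_trans (probability_le1 _ _) _ => //; rewrite ltry.
move=> B mB; rewrite setIC.
have : (P (B `&` p k @^-1` A) = (fine (gauss A))%:E * P B)%E by exact: E B mB.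
by rewrite gAE.
Qed.

Context {X : normedModType R[i]}.

(** The first variable is integrated out, with the identity map of Omega, taken in the sigma-algebra
    of the other variables, as its independent partner. *)
Lemma gaussian_law (M L : R) (Phi : X -> R) (v : I -> X) (ks : seq I) z :
  blip M L Phi -> uniq ks ->
  mean P (fun w => Phi (z + \sum_(k <- ks) (p k w)%:C%C *: v k)) = gint (map v ks) Phi z.
Proof.
move=> bP; have [b0 _ _] := bP; elim: ks z => [|k ks IH] z.
  move=> _; apply: EFin_inj; rewrite (@meanE _ _ _ _ _ M) //.
    under eq_integral do rewrite big_nil addr0.
    by rewrite integral_cst //= probability_setT mule1.
  by apply: measurable_blip_sum bP.
move=> /= /andP[kks uks]; apply: EFin_inj.
have bG := blip_gint (map v ks) bP.
rewrite (gavgE _ _ bG) (@meanE _ _ _ _ _ M) //; last first.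
  by apply: measurable_blip_sum bP => j _; exact: mp.
pose h (sw : measurableTypeR R * T ks) : \bar R :=
  (Phi (z + sw.1%:C%C *: v k + \sum_(k <- ks) (p k sw.2)%:C%C *: v k))%:E.
have mh : measurable_fun setT h.
  apply/measurable_EFinP; apply: measurable_Caratheodory => [t|s].
    pose c := \sum_(j <- ks) (p j t)%:C%C *: v j.
    have E : (fun s : R => Phi (z + s%:C%C *: v k + c)) =
        fun s => Phi (z + c + s%:C%C *: v k) by apply/funext => s; rewrite addrAC.
    have : continuous (fun s : R => Phi (z + s%:C%C *: v k + c)).
      by rewrite E; exact: blip_line_continuous bP.
    exact.
  have : measurable_fun setT (fun w : T ks =>
      Phi (z + s%:C%C *: v k + \sum_(k <- ks) (p k w)%:C%C *: v k)).
    by apply: measurable_blip_sum bP => j jks; exact: p_measurable.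
  exact.
have h0 x : (0 <= h x)%E by rewrite lee_fin; have /andP[] := b0 (z + x.1%:C%C *: v k + \sum_(k <- ks) (p k x.2)%:C%C *: v k).
transitivity (\int[P]_w h (p k w, w))%E.
  by apply: eq_integral => w _; rewrite /h /= big_cons addrA.
have E := @indep_integral R _ _ _ (T ks) P gauss (p k) idfun (mp k) (@id_measurable ks) _ h mh h0.
rewrite {}E.
  apply: eq_integral => s _; rewrite -IH // (@meanE _ _ _ _ _ M) //.
  by apply: measurable_blip_sum bP => j _; exact: mp.
by move=> A B mA mB; rewrite preimage_id; exact: p_indep.
Qed.

End GaussianLaw.

Section SquareMoments.
Context {R : realType} d (T : measurableType d) (P : probability T R).

Lemma min_nat_cvg (a : R) : Num.min a m%:R @[m --> \oo] --> a.
Proof.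
apply: cvg_near_cst; near=> m; apply/min_idPl.
by near: m; exact: nbhs_infty_ger.
Unshelve. all: by end_near. Qed.

Lemma square_moment_sup (f : T -> R) : (forall w, 0 <= f w) ->
  (forall m : nat, measurable_fun setT (fun w => Num.min (f w) m%:R ^+ 2)) ->
  (\int[P]_w ((f w) ^+ 2)%:E =
   ereal_sup (range (fun m : nat => \int[P]_w (Num.min (f w) m%:R ^+ 2)%:E)))%E.
Proof.
move=> f0 mf.
have min0 w (m : nat) : 0 <= Num.min (f w) m%:R by rewrite le_min f0 ler0n.
have nd : {homo (fun m : nat => \int[P]_w (Num.min (f w) m%:R ^+ 2)%:E)%E :
    m m' / (m <= m')%N >-> (m <= m')%E}.
  move=> m m' mm'; apply: ge0_le_integral => //.
  - by move=> w _; rewrite lee_fin sqr_ge0.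
  - exact/measurable_EFinP.
  - exact/measurable_EFinP.
  - move=> w _; rewrite lee_fin ler_sqr ?nnegrE //.
    by rewrite le_min ge_min lexx /= ge_min ler_nat mm' orbT.
have h := ereal_nondecreasing_cvgn nd.
have h2 := @cvg_monotone_convergence _ T R P setT measurableT
  (fun m w => (Num.min (f w) m%:R ^+ 2)%:E)
  (fun m => (measurable_EFinP _ _).2 (mf m)).
have {}h2 : (\int[P]_w (Num.min (f w) m%:R ^+ 2)%:E)%E @[m --> \oo] -->
    (\int[P]_w ((f w) ^+ 2)%:E)%E.
  have -> : (\int[P]_w ((f w) ^+ 2)%:E =
      \int[P]_w limn (fun m => (Num.min (f w) m%:R ^+ 2)%:E))%E.
    apply: eq_integral => w _; apply/esym/cvg_lim => //.
    apply: cvg_EFin; first exact: nearW.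
    by apply: (@cvgM R nat \oo _ (fun m => Num.min (f w) m%:R)); exact: min_nat_cvg.
  apply: h2.
  - by move=> n x _; rewrite lee_fin sqr_ge0.
  - move=> w _ m m' mm'; rewrite lee_fin ler_sqr ?nnegrE //.
    by rewrite le_min ge_min lexx /= ge_min ler_nat mm' orbT.
by rewrite -(cvg_lim _ h2) // (cvg_lim _ h).
Qed.

(** Test functions are bounded, so the L^2 norm is reached through truncations and monotone
    convergence. *)
Lemma Lnorm2_leP (f : T -> R) (B : R) : 0 <= B -> (forall w, 0 <= f w) ->
  (forall m : nat, measurable_fun setT (fun w => Num.min (f w) m%:R ^+ 2)) ->
  (Lnorm P 2%:E (EFin \o f) <= B%:E)%E <->
  (forall m : nat, mean P (fun w => Num.min (f w) m%:R ^+ 2) <= B ^+ 2).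
Proof.
move=> B0 f0 mf.
have bd (m : nat) w : 0 <= Num.min (f w) m%:R ^+ 2 <= m%:R ^+ 2.
  have m0 : 0 <= Num.min (f w) m%:R by rewrite le_min f0 ler0n.
  by rewrite sqr_ge0 ler_sqr ?nnegrE ?ler0n // ge_min lexx orbT.
have mE m := meanE P (mf m) (bd m).
have LE : Lnorm P 2%:E (EFin \o f) = ((\int[P]_w ((f w) ^+ 2)%:E) `^ 2^-1)%E.
  rewrite unlock /=; congr (_ `^ _)%E; apply: eq_integral => w _ /=.
  by rewrite ger0_norm // powR_mulrn.
set I := (\int[P]_w ((f w) ^+ 2)%:E)%E in LE.
have I0 : (0 <= I)%E by apply: integral_ge0 => w _; rewrite lee_fin sqr_ge0.
have h : (Lnorm P 2%:E (EFin \o f) <= B%:E)%E <-> (I <= (B ^+ 2)%:E)%E.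
  rewrite LE; split => h.
    have : ((I `^ 2^-1) `^ 2 <= B%:E `^ 2)%E by apply: gt0_ler_poweR => //; rewrite in_itv /= ?poweR_ge0 ?lee_fin ?B0 leey.
    by rewrite -poweRrM mulVf ?pnatr_eq0 // poweRe1 // poweR_EFin powR_mulrn.
  have : (I `^ 2^-1 <= (B ^+ 2)%:E `^ 2^-1)%E.
    by apply: gt0_ler_poweR => //; rewrite ?invr_ge0 // in_itv /= ?I0 ?lee_fin ?sqr_ge0 leey.
  by rewrite poweR_EFin -powR_mulrn // -powRrM mulfV ?pnatr_eq0 // powRr1.
rewrite h /I square_moment_sup //; split.
  move=> hI m; rewrite -lee_fin mE; apply: le_trans hI.
  by apply: ereal_sup_ubound; exists m.
by move=> hm; apply: ge_ereal_sup => _ [m _ <-]; rewrite -mE lee_fin.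
Qed.

End SquareMoments.

Section ComplexGaussian.
Context {R : realType} {X : normedModType R[i]}.

Definition cut (M : R) (z : X) : R := Num.min (rnorm z) M ^+ 2.

Lemma blip_cut (M : R) : 0 <= M -> blip (M ^+ 2) (2 * M) (cut M).
Proof.
move=> M0; have m0 (z : X) : 0 <= Num.min (rnorm z) M by rewrite le_min rnorm_ge0.
have mM (z : X) : Num.min (rnorm z) M <= M by rewrite ge_min lexx orbT.
split; [|by rewrite mulr_ge0|].
  by move=> z; rewrite /cut sqr_ge0 ler_sqr ?nnegrE ?m0 ?mM.
move=> z z'; rewrite /cut; set a := Num.min _ _; set b := Num.min _ _.
have ab : a <= b + rnorm (z - z').
  rewrite /a /b; have h := ler_rnorm_trans z' z 0; rewrite !subr0 in h.
  have := rnorm_ge0 (z - z').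
  move=> n0; rewrite [leRHS]addrC; case: (leP (rnorm z') M) => _.
    by apply: le_trans h; rewrite ge_min lexx.
  by rewrite ler_wpDl // ge_min lexx orbT.
have [a0 aM b0 bM] : [/\ 0 <= a, a <= M, 0 <= b & b <= M] by split; rewrite /a /b.
have n0 := rnorm_ge0 (z - z').
have [ba|ba] := leP a b; first by nra.
by nra.
Qed.

(** One of [u + v] and [u - v] has norm at least that of [u]. *)
Lemma cut_midpoint M (u v : X) : 0 <= M -> cut M u <= cut M (u + v) + cut M (u - v).
Proof.
move=> M0; rewrite /cut.
have h : 2 * rnorm u <= rnorm (u + v) + rnorm (u - v).
  have -> : 2 * rnorm u = rnorm ((u + v) + (u - v)).
    rewrite addrACA subrr addr0 -[in RHS](scale1r u) -scalerDl.
    have -> : (1 + 1 : R[i]) = (2 : R)%:C%C by rewrite -rmorphD.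
    by rewrite rnormZr ger0_norm.
  exact: ler_rnormD.
have m0 z : 0 <= Num.min (rnorm z) M by rewrite le_min rnorm_ge0.
have [h1|h1] := leP (rnorm u) (rnorm (u + v)).
  apply: ler_wpDr; first exact: sqr_ge0.
  by rewrite ler_sqr ?nnegrE // le_min !ge_min h1 lexx orbT.
apply: ler_wpDl; first exact: sqr_ge0.
have h2 : rnorm u <= rnorm (u - v) by lra.
by rewrite ler_sqr ?nnegrE // le_min !ge_min h2 lexx orbT.
Qed.

(** A complex Gaussian multiple of x is a real Gaussian multiple of x plus an independent one of i
    x. *)
Definition cfam (E : Type) (x : E -> X) (eb : E * bool) : X :=
  if eb.2 then x eb.1 else ('i%C : R[i]) *: x eb.1.

Lemma mean_gaussian d (Omega : measurableType d) (P : probability Omega R)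
    (g : nat -> Omega -> R[i]) n (x : 'I_n -> X) M : complex_gaussian_seq P g -> 0 <= M ->
  measurable_fun setT (fun w => cut M (\sum_(i < n) g i w *: x i)) /\
  mean P (fun w => cut M (\sum_(i < n) g i w *: x i)) = gfam (cfam x) (cut M) 0.
Proof.
move=> [mp np ip] M0; have bM := blip_cut M0.
pose p (k : nat * bool) w := if k.2 then complex.Re (g k.1 w) else complex.Im (g k.1 w).
pose v (k : nat * bool) : X := if insub k.1 is Some i then cfam x (i : 'I_n, k.2) else 0.
pose nk (ib : 'I_n * bool) : nat * bool := (ib.1 : nat, ib.2).
pose ks := map nk (enum {: 'I_n * bool}).
have vn ib : v (nk ib) = cfam x ib by rewrite /v /nk /= valK; case: ib.
have -> : (fun w => cut M (\sum_(i < n) g i w *: x i)) =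
    (fun w => cut M (0 + \sum_(k <- ks) (p k w)%:C%C *: v k)).
  apply/funext => w; rewrite add0r /ks big_map big_enum /=; congr cut.
  under [RHS]eq_bigr do rewrite vn.
  rewrite -(pair_bigA _ (fun i b => (p (nk (i, b)) w)%:C%C *: cfam x (i, b))) /=.
  apply: eq_bigr => i _; rewrite big_bool /p /nk /cfam /= scalerA -scalerDl.
  by congr (_ *: _); case: (g i w) => a b; apply/eqP; rewrite eq_complex /=; apply/andP; split; apply/eqP; ring.
split; first by apply: measurable_blip_sum bM => k _; exact: mp.
have uk : uniq ks.
  by rewrite map_inj_uniq ?enum_uniq // => -[i b] [j c] [/ord_inj -> ->].
rewrite (@gaussian_law _ _ _ P _ p mp np ip _ _ _ _ v ks 0 bM uk).
by rewrite /gfam /ks -map_comp; congr (gint _ _ _); apply: eq_map => ib /=; rewrite vn.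
Qed.

Lemma gaussian_L2norm_leP d (Omega : measurableType d) (P : probability Omega R)
    (g : nat -> Omega -> R[i]) n (x : 'I_n -> X) B : complex_gaussian_seq P g -> 0 <= B ->
  (gaussian_L2norm P g x <= B%:E)%E <->
  (forall m : nat, gfam (cfam x) (cut m%:R) 0 <= B ^+ 2).
Proof.
move=> cg B0; rewrite (@Lnorm2_leP _ _ _ P (fun w => rnorm (\sum_(i < n) g i w *: x i))) //.
- by split => h m; have := h m; rewrite -(mean_gaussian x cg (ler0n _ m)).2.
- by move=> w; exact: rnorm_ge0.
- by move=> m; exact: (mean_gaussian x cg (ler0n _ m)).1.
Qed.

End ComplexGaussian.

Section TypeCotypeCompare.
Context {R : realType} {X : banachType R}.

Lemma lq_norm_ge0 q n (a : 'I_n -> R) : 0 <= lq_norm q a.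
Proof.
case: q => [r| |] /=; first exact: powR_ge0.
  by elim/big_rec: _ => // i u _ u0; rewrite le_max u0 orbT.
by elim/big_rec: _ => // i u _ u0; rewrite le_max u0 orbT.
Qed.

(** Type and cotype may be witnessed by different Gaussian sequences; they meet in [gfam], which
    depends on the vectors only. *)
Lemma type_cotype_compare (p : R) (q : \bar R) : has_type p X -> has_cotype q X ->
  exists2 K : R, 0 <= K & forall (c : R) m n (x : 'I_n -> X) (y : 'I_m -> X), 0 <= c ->
    (forall k : nat, gfam (cfam y) (cut k%:R) 0 <= c ^+ 2 * gfam (cfam x) (cut k%:R) 0) ->
    lq_norm q (fun i => rnorm (y i)) <= c * K * lq_norm p%:E (fun i => rnorm (x i)).
Proof.
move=> [_ [d1 [Om1 [P1 [g1 [cg1 [T hT]]]]]]] [_ [d2 [Om2 [P2 [g2 [cg2 [C hC]]]]]]].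
exists (`|C| * `|T|); first by rewrite mulr_ge0.
move=> c m n x y c0 hk.
pose lp := lq_norm p%:E (fun i => rnorm (x i)).
have lp0 : 0 <= lp by exact: lq_norm_ge0.
have h1 : (gaussian_L2norm P1 g1 x <= (`|T| * lp)%:E)%E.
  by apply: le_trans (hT _ x) _; rewrite lee_fin ler_wpM2r // ler_norm.
have B0 : 0 <= `|T| * lp by rewrite mulr_ge0.
have {}h1 := (gaussian_L2norm_leP x cg1 B0).1 h1.
have h2 : (gaussian_L2norm P2 g2 y <= (c * (`|T| * lp))%:E)%E.
  apply/(gaussian_L2norm_leP y cg2 (mulr_ge0 c0 B0)) => k.
  by apply: le_trans (hk k) _; rewrite exprMn ler_wpM2l ?sqr_ge0.
have L0 : (0 <= gaussian_L2norm P2 g2 y)%E by exact: Lnorm_ge0.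
rewrite -lee_fin; apply: le_trans (hC _ y) _.
apply: (@le_trans _ _ (`|C|%:E * gaussian_L2norm P2 g2 y)%E).
  by apply: lee_wpmul2r => //; rewrite lee_fin ler_norm.
apply: (@le_trans _ _ (`|C|%:E * (c * (`|T| * lp))%:E)%E).
  by apply: lee_wpmul2l => //; rewrite lee_fin.
have -> : c * (`|C| * `|T|) * lp = `|C| * (c * (`|T| * lp)) by ring.
by rewrite -EFinM.
Qed.

End TypeCotypeCompare.

(** * Type and cotype *)

Section Contraction.
Context {R : realType} {X : normedModType R[i]}.

(** Real and imaginary parts are treated alike: the matrix is A tensored with the 2 by 2 identity,
    and its Gram matrix has the same row sums. *)
Lemma gfam_cfam_schur M L (Phi : X -> R) (E O : finType) (x : E -> X) (A : O -> E -> R) nu z :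
  blip M L Phi -> (forall u v, Phi u <= Phi (u + v) + Phi (u - v)) ->
  0 < nu -> (forall o, \sum_o' `|\sum_e A o e * A o' e| <= nu ^+ 2) ->
  gfam (cfam (fun o => \sum_e (A o e / nu)%:C%C *: x e)) Phi z <= 2 * gfam (cfam x) Phi z.
Proof.
move=> bP Pd nu0 row.
pose A' (o : O * bool) (e : E * bool) := (o.2 == e.2)%:R * A o.1 e.1.
have S (I : finType) b (V : nmodType) (F : I -> bool -> V) (G : I -> V) :
    (forall e b', F e b' = if b == b' then G e else 0) ->
    \sum_(e : I * bool) F e.1 e.2 = \sum_e G e.
  move=> FG; rewrite -(pair_bigA _ F) /=; apply: eq_bigr => e _.
  by rewrite big_bool /= !FG; case: b FG => _ /=; rewrite ?addr0 ?add0r.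
have -> : cfam (fun o => \sum_e (A o e / nu)%:C%C *: x e) =
    (fun o => \sum_e (A' o e / nu)%:C%C *: cfam x e).
  apply/funext => -[k b]; rewrite /A' /=.
  rewrite (S _ b _ (fun e b' => ((b == b')%:R * A k e / nu)%:C%C *: cfam x (e, b'))
    (fun e => (A k e / nu)%:C%C *: cfam x (e, b))).
    rewrite /cfam /=; case: b => //; rewrite scaler_sumr.
    by apply: eq_bigr => e _; rewrite !scalerA mulrC.
  by move=> e b'; case: eqP => [->|_]; rewrite ?mul1r // !mul0r scale0r.
apply: gfam_schur bP Pd nu0 _ => -[k b].
rewrite (S _ b _ (fun o' b' => `|\sum_e A' (k, b) e * A' (o', b') e|)
  (fun o' => `|\sum_e A k e * A o' e|)).
  exact: row.
move=> o' b'.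
rewrite (S _ b _ (fun e c => A' (k, b) (e, c) * A' (o', b') (e, c))
  (fun e => if b == b' then A k e * A o' e else 0)).
  by case: eqP => // _; rewrite big1 ?normr0.
move=> e c; rewrite /A' /=; case: (eqVneq b c) => [->|bc]; last by rewrite !mul0r.
by rewrite eq_sym; case: eqP => _; rewrite ?mul1r // mul0r mulr0.
Qed.

End Contraction.

Section PowerMean.
Context {R : realType}.

Lemma bernoulli_powR (x q : R) : 0 <= x -> 1 <= q -> x <= x `^ q / q + (1 - q^-1).
Proof.
move=> x0 q1; have [->|qn1] := eqVneq q 1.
  by rewrite powRr1 // invr1 mulr1 subrr addr0.
have q0 : 0 < q by exact: lt_le_trans q1.
have c0 : 0 < 1 - q^-1 by rewrite subr_gt0 invf_lt1 // lt_neqAle eq_sym qn1.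
have := @conjugate_powR R x 1 q (1 - q^-1)^-1 x0 ler01 q0.
rewrite invr_gt0 invrK mulr1 powR1 mul1r; apply => //.
by rewrite addrC subrK.
Qed.

Lemma powR_div (a b r : R) : 0 <= a -> 0 < b -> (a / b) `^ r = a `^ r / b `^ r.
Proof.
move=> a0 b0; apply: (canRL (mulfK _)); first by rewrite gt_eqF ?powR_gt0.
by rewrite -powRM ?divr_ge0 ?(ltW b0) // divfK ?gt_eqF.
Qed.

Definition inv_exponent (q : \bar R) : R := if q is r%:E then r^-1 else 0.

(** Hoelder's inequality, from Young's inequality for each [a i] divided by the mean of order q. *)
Lemma sum_le_lq_norm (q : \bar R) n (a : 'I_n -> R) : (1 <= q)%E -> (forall i, 0 <= a i) ->
  \sum_i a i <= n%:R `^ (1 - inv_exponent q) * lq_norm q a.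
Proof.
case: n a => [|n] a q1 a0.
  rewrite big_ord0 mulr_ge0 ?powR_ge0 //.
  case: q q1 => [r| |] //=; rewrite ?powR_ge0 // big_ord0 //.
have n0 : 0 < n.+1%:R :> R by rewrite ltr0n.
case: q q1 => [q| |] //= q1; last first.
  rewrite subr0 powRr1 ?(ltW n0) //.
  apply: le_trans (_ : \sum_(i < n.+1) \big[Num.max/0]_(i < n.+1) a i <= _).
    by apply: ler_sum => i _; apply: le_bigmax.
  by rewrite sumr_const card_ord -[leLHS]mulr_natl.
rewrite lee_fin in q1; have q0 : 0 < q by exact: lt_le_trans q1.
set S := \sum_i a i `^ q.
have S0 : 0 <= S by apply: sumr_ge0 => i _; exact: powR_ge0.
have [SE|Sn0] := eqVneq S 0.
  rewrite big1 ?mulr_ge0 ?powR_ge0 // => i _.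
  have /eqP : a i `^ q = 0.
    apply/eqP; rewrite eq_le powR_ge0 andbT -SE /S (bigD1 i) //= lerDl.
    by apply: sumr_ge0 => j _; exact: powR_ge0.
  by rewrite powR_eq0 => /andP[/eqP].
have Sp : 0 < S by rewrite lt_def Sn0.
pose c := (S / n.+1%:R) `^ q^-1.
have c0 : 0 < c by rewrite powR_gt0 // divr_gt0.
have cq : c `^ q = S / n.+1%:R.
  by rewrite -powRrM mulVf ?gt_eqF // powRr1 // divr_ge0 // (ltW n0).
have h i : a i <= c * (a i `^ q / (c `^ q) / q + (1 - q^-1)).
  have := bernoulli_powR (divr_ge0 (a0 i) (ltW c0)) q1.
  rewrite -(ler_pM2l c0) mulrC divfK ?gt_eqF // => /le_trans; apply.
  by rewrite powR_div.
apply: (@le_trans _ _ (c * n.+1%:R)).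
  apply: le_trans (ler_sum _ (fun i _ => h i)) _.
  rewrite -mulr_sumr ler_pM2l // big_split /= sumr_const card_ord -!mulr_suml -/S.
  by rewrite cq -[leLHS]/(_ + _ *+ n.+1) -mulr_natr le_eqVlt; apply/orP; left; apply/eqP; field;
    rewrite Sn0 gt_eqF // gt_eqF.
rewrite /c powR_div // powRD ?pnatr_eq0 ?implybT // powRr1 ?(ltW n0) // powRN.
by rewrite mulrAC mulrC mulrA mulrAC [X in X * _]mulrC.
Qed.

Lemma lq_norm_le1 (p : R) n (a : 'I_n -> R) : 1 <= p -> (forall i, 0 <= a i <= 1) ->
  lq_norm p%:E a <= n%:R `^ p^-1.
Proof.
move=> p1 a1 /=; have p0 : 0 < p by exact: lt_le_trans p1.
apply: ge0_ler_powR; rewrite ?nnegrE ?invr_ge0 ?(ltW p0) //.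
  by apply: sumr_ge0 => i _; exact: powR_ge0.
apply: (@le_trans _ _ (\sum_(i < n) 1)); last by rewrite sumr_const card_ord.
apply: ler_sum => i _; have /andP[i0 i1] := a1 i.
by have := ge0_ler_powR (ltW p0) i0 ler01 i1; rewrite powR1.
Qed.

End PowerMean.

(** By the Schur test [B] and [A] act on Gaussian sums with norms [nu2] and [nu1], up to constants.
    Type bounds the input by #|E|^(1/p), cotype and Hoelder bound the l^1 norm of the output by a
    factor #|O|^(1 - 1/q). Factoring through F allows E to be much smaller than the domain of
    [A]. *)
Lemma type_cotype_sum (R : realType) (X : banachType R) (p : R) (q : \bar R) :
  has_type p X -> has_cotype q X ->
  exists2 K : R, 0 <= K & forall (E F O : finType) (A : O -> F -> R) (B : F -> E -> R) nu1 nu2,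
    0 < nu1 -> (forall o, \sum_o' `|\sum_e A o e * A o' e| <= nu1 ^+ 2) ->
    0 < nu2 -> (forall o, \sum_o' `|\sum_e B o e * B o' e| <= nu2 ^+ 2) ->
    forall x : E -> X, (forall e, rnorm (x e) <= 1) ->
    \sum_o rnorm (\sum_f (A o f)%:C%C *: \sum_e (B f e)%:C%C *: x e) <=
      nu1 * nu2 * K * (#|O|%:R `^ (1 - inv_exponent q) * #|E|%:R `^ p^-1).
Proof.
move=> tX cX; have [K K0 hK] := type_cotype_compare tX cX.
exists (2 * K); first by rewrite mulr_ge0.
move=> E F O A B nu1 nu2 n1 rA n2 rB x x1.
pose y o := \sum_f (A o f / nu1)%:C%C *: \sum_e (B f e / nu2)%:C%C *: x e.
have -> : \sum_o rnorm (\sum_f (A o f)%:C%C *: \sum_e (B f e)%:C%C *: x e) =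
    nu1 * nu2 * \sum_o rnorm (y o).
  rewrite mulr_sumr; apply: eq_bigr => o _.
  have n12 : 0 < nu1 * nu2 by rewrite mulr_gt0.
  rewrite -[nu1 * nu2 in RHS](gtr0_norm n12) -rnormZr; congr rnorm.
  rewrite scaler_sumr; apply: eq_bigr => f _; rewrite !scaler_sumr; apply: eq_bigr => e _.
  by rewrite !scalerA -!rmorphM; congr (_%:C%C *: _) => /=; field; rewrite !gt_eqF.
rewrite -[leRHS]mulrA ler_pM2l ?mulr_gt0 //.
pose x' (i : 'I_#|E|) := x (enum_val i); pose y' (i : 'I_#|O|) := y (enum_val i).
have hxy (k : nat) : gfam (cfam y') (cut k%:R) 0 <= 2 ^+ 2 * gfam (cfam x') (cut k%:R) 0.
  have bP := @blip_cut R X k%:R (ler0n _ k).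
  have Pd u v := @cut_midpoint R X k%:R u v (ler0n _ k).
  pose z f := \sum_e (B f e / nu2)%:C%C *: x e.
  have h1 : gfam (cfam z) (cut k%:R) 0 <= 2 * gfam (cfam x') (cut k%:R) 0.
    have -> : z = (fun f => \sum_i (B f (enum_val i) / nu2)%:C%C *: x' i).
      by apply/funext => f; rewrite (sum_enum_val (fun e => (B f e / nu2)%:C%C *: x e)).
    apply: gfam_cfam_schur bP Pd n2 _ => f.
    under eq_bigr do rewrite (sum_enum_val (fun e => B f e * B _ e)).
    exact: rB.
  have h2 : gfam (cfam y') (cut k%:R) 0 <= 2 * gfam (cfam z) (cut k%:R) 0.
    apply: (@gfam_cfam_schur _ _ _ _ _ _ _ z (fun i f => A (enum_val i) f)) bP Pd n1 _ => i.
    rewrite (sum_enum_val (fun o => `|\sum_e A (enum_val i) e * A o e|)).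
    exact: rA.
  by rewrite expr2 -mulrA; apply: le_trans h2 _; rewrite ler_pM2l.
have hl := hK 2 _ _ x' y' (ler0n _ _) hxy.
have q1 := cX.1; have p1 := tX.1.
have -> : \sum_o rnorm (y o) = \sum_i rnorm (y' i) by rewrite (sum_enum_val (fun o => rnorm (y o))).
apply: le_trans (sum_le_lq_norm q1 (fun i => rnorm_ge0 (y' i))) _.
rewrite [leRHS]mulrCA ler_wpM2l ?powR_ge0 //.
apply: le_trans hl _; rewrite ler_wpM2l ?mulr_ge0 //.
by apply: lq_norm_le1 => // i; rewrite rnorm_ge0 x1.
Qed.

(** * The Gram matrix of the lines *)

Section LineGram.
Context {R : realType}.
Variable H : nat.

(** The number of common points of two boxes of length H. Subtraction is truncated: the inner sum is
    |s - t|, and disjoint boxes give 0. *)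
Definition overlap (s t : nat) : nat := (H - ((s - t) + (t - s)))%N.

Lemma sum_box_box U s t : (s + H <= U)%N -> (t + H <= U)%N ->
  (\sum_(u < U) box s H u * box t H u = overlap s t)%N.
Proof.
move=> sU tU.
transitivity (\sum_(u < U) box (maxn s t) (overlap s t) u)%N.
  apply: eq_bigr => u _; rewrite mulnb /box /overlap; congr nat_of_bool.
  by lia.
by rewrite box_sum /overlap; lia.
Qed.

Lemma sum_box_disjoint n c u : (\sum_(l < n) box (l * H + c) H u <= 1)%N.
Proof.
suff -> : (\sum_(l < n) box (l * H + c) H u = box c (n * H) u)%N by rewrite /box leq_b1.
elim: n => [|n IH]; first by rewrite big_ord0 /box; lia.
rewrite big_ord_recr /= {}IH /box mulSn.
move: (n * H)%N => N.
by case: (leqP c u); case: (ltnP u (c + N)); case: (leqP (N + c) u);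
  case: (ltnP u (N + c + H)); case: (ltnP u (c + (H + N))) => /=; lia.
Qed.

Lemma sum_overlap n s c : (\sum_(l < n) overlap s (l * H + c) <= H)%N.
Proof.
pose U := (s + c + n * H + H)%N.
have -> : (\sum_(l < n) overlap s (l * H + c) =
    \sum_(l < n) \sum_(u < U) box s H u * box (l * H + c) H u)%N.
  apply: eq_bigr => l _; rewrite sum_box_box //; rewrite /U; first by lia.
  by have := ltn_ord l; nia.
rewrite exchange_big /=.
apply: (@leq_trans (\sum_(u < U) box s H u)%N); last by rewrite box_sum; lia.
apply: leq_sum => u _; rewrite -big_distrr /=.
by rewrite -[leqRHS]muln1 leq_mul2l sum_box_disjoint orbT.
Qed.

Lemma overlap_shift s t s' t' : (s + t' = s' + t)%N -> overlap s t = overlap s' t'.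
Proof. by rewrite /overlap; lia. Qed.

Definition overlap_diff (s t : nat) : R := (overlap s t)%:R - (overlap (s + H) t)%:R.

Lemma sum_overlap_diff n s c : \sum_(l < n) `|overlap_diff s (l * H + c)| <= 2 * H%:R.
Proof.
apply: (@le_trans _ _ (\sum_(l < n) ((overlap s (l * H + c))%:R +
    (overlap (s + H) (l * H + c))%:R))).
  by apply: ler_sum => l _; apply: le_trans (ler_normB _ _) _; rewrite !normr_nat.
rewrite big_split /= -!natr_sum.
have : (\sum_(l < n) overlap s (l * H + c))%:R <= H%:R :> R by rewrite ler_nat sum_overlap.
have : (\sum_(l < n) overlap (s + H) (l * H + c))%:R <= H%:R :> R by rewrite ler_nat sum_overlap.
by lra.
Qed.

Lemma sum_boxdiff U s t : (s + 2 * H <= U)%N -> (t + 2 * H <= U)%N ->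
  \sum_(u < U) ((box s H u)%:R - (box (s + H) H u)%:R) *
     ((box t H u)%:R - (box (t + H) H u)%:R) =
  overlap_diff s t - overlap_diff s (t + H) :> R.
Proof.
move=> sU tU.
transitivity (\sum_(u < U) ((box s H u * box t H u)%:R - (box (s + H) H u * box t H u)%:R
  - ((box s H u * box (t + H) H u)%:R - (box (s + H) H u * box (t + H) H u)%:R)) : R).
  by apply: eq_bigr => u _; rewrite !natrM; ring.
rewrite !sumrB -!natr_sum !sum_box_box; try lia.
by [].
Qed.

(** Telescoping with step q leaves q terms at each end, however q compares with N. *)
Lemma telescope_shift_le N q (g : nat -> R) :
  `|\sum_(r < N) (g r - g (r + q)%N)| <= \sum_(r < q) (`|g r| + `|g (N + r)%N|).
Proof.
have E : \sum_(r < N) (g r - g (r + q)%N) = \sum_(r < q) (g r - g (N + r)%N).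
  elim: N => [|N IH].
    rewrite big_ord0; apply/esym/big1 => r _; by rewrite add0n subrr.
  rewrite big_ord_recr /= IH.
  have hl : \sum_(r < q.+1) g (N + r)%N = \sum_(r < q) g (N + r)%N + g (N + q)%N.
    by rewrite big_ord_recr.
  have hr : \sum_(r < q.+1) g (N + r)%N = g N + \sum_(r < q) g (N.+1 + r)%N.
    rewrite big_ord_recl addn0; congr (_ + _); apply: eq_bigr => r _.
    by rewrite lift0 addSnnS.
  by rewrite !sumrB; lra.
rewrite E; apply: le_trans (ler_norm_sum _ _ _) _.
by apply: ler_sum => r _; exact: ler_normB.
Qed.

Definition line_corr (s t : nat) : R := overlap_diff s t - overlap_diff s (t + H).

Definition hweight (d : nat) : R := (maxn 1 d)%:R^-1.

(** Let j < j' and q = H / (j' - j). Moving r by q shifts the two lines against each other by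
    exactly H, so [line_corr] is a difference g r - g (r + q), and the sum over r reduces to 2 q
    terms. Summed over l', each is at most 2 H. The case j > j' is symmetric, and for j = j' the
    trivial bound has the right order. *)
Lemma sum_line_corr n (j l j' : 'I_n) : (forall d, (0 < d < n)%N -> (d %| H)%N) ->
  \sum_(l' < n) `|\sum_(r < H) line_corr (l * H + r * j) (l' * H + r * j')| <=
    4 * H%:R ^+ 2 * hweight ((j' - j) + (j - j')).
Proof.
move=> dH.
have [jj|jj|jj] := ltngtP j j'.
- have dv : (j' - j %| H)%N by apply: dH; have := ltn_ord j'; lia.
  set q := (H %/ (j' - j))%N; have qE : (q * (j' - j) = H)%N by rewrite divnK.
  apply: (@le_trans _ _ (\sum_(l' < n) \sum_(r < q)
      (`|overlap_diff (l * H + r * j) (l' * H + r * j')| +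
       `|overlap_diff (l * H + (H + r) * j) (l' * H + (H + r) * j')|))).
    apply: ler_sum => l' _.
    pose g r := overlap_diff (l * H + r * j) (l' * H + r * j').
    have -> : \sum_(r < H) line_corr (l * H + r * j) (l' * H + r * j') =
        \sum_(r < H) (g r - g (r + q)%N).
      apply: eq_bigr => r _; have mr := mulnDl r q j; have mr' := mulnDl r q j'.
      have mq := qE; rewrite mulnBr in mq; have qj := leq_mul2l q j j'; have qj' := leq_mul2l q j' j.
      rewrite ?(ltnW jj) ?orbT in qj qj'.
      rewrite /g /line_corr; congr (_ - _).
      by rewrite /overlap_diff; congr (_%:R - _%:R); apply: overlap_shift; lia.
    exact: telescope_shift_le.
  rewrite exchange_big /=.
  apply: (@le_trans _ _ (\sum_(r < q) (4 * H%:R))).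
    apply: ler_sum => r _; rewrite big_split /=.
    by have := sum_overlap_diff n (l * H + r * j) (r * j');
      have := sum_overlap_diff n (l * H + (H + r) * j) ((H + r) * j'); lra.
  have -> : ((j' - j) + (j - j') = j' - j)%N by lia.
  rewrite sumr_const card_ord /hweight (_ : maxn 1 (j' - j) = j' - j)%N; last by lia.
  rewrite ler_pdivlMr ?ltr0n ?subn_gt0 // -[X in X * _](mulr_natr (4 * H%:R) q).
  rewrite -[X in X <= _](mulrA (4 * H%:R)) -(natrM _ q) qE expr2.
  by rewrite mulrA.
- have dv : (j - j' %| H)%N by apply: dH; have := ltn_ord j; lia.
  set q := (H %/ (j - j'))%N; have qE : (q * (j - j') = H)%N by rewrite divnK.
  apply: (@le_trans _ _ (\sum_(l' < n) \sum_(r < q)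
      (`|- overlap_diff (l * H + r * j) (l' * H + r * j' + H)| +
       `|- overlap_diff (l * H + (H + r) * j) (l' * H + (H + r) * j' + H)|))).
    apply: ler_sum => l' _.
    pose g r := - overlap_diff (l * H + r * j) (l' * H + r * j' + H).
    have -> : \sum_(r < H) line_corr (l * H + r * j) (l' * H + r * j') =
        \sum_(r < H) (g r - g (r + q)%N).
      apply: eq_bigr => r _; have mr := mulnDl r q j; have mr' := mulnDl r q j'.
      have mq := qE; rewrite mulnBr in mq; have qj := leq_mul2l q j j'; have qj' := leq_mul2l q j' j.
      rewrite ?(ltnW jj) ?orbT in qj qj'.
      rewrite /g /line_corr opprK addrC; congr (_ + _).
      by rewrite /overlap_diff; congr (_%:R - _%:R); apply: overlap_shift; lia.
    exact: telescope_shift_le.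
  rewrite exchange_big /=.
  apply: (@le_trans _ _ (\sum_(r < q) (4 * H%:R))).
    apply: ler_sum => r _; under eq_bigr do rewrite !normrN -!addnA.
    rewrite big_split /=.
    by have := sum_overlap_diff n (l * H + r * j) (r * j' + H);
      have := sum_overlap_diff n (l * H + (H + r) * j) ((H + r) * j' + H); lra.
  have -> : ((j' - j) + (j - j') = j - j')%N by lia.
  rewrite sumr_const card_ord /hweight (_ : maxn 1 (j - j') = j - j')%N; last by lia.
  rewrite ler_pdivlMr ?ltr0n ?subn_gt0 // -[X in X * _](mulr_natr (4 * H%:R) q).
  rewrite -[X in X <= _](mulrA (4 * H%:R)) -(natrM _ q) qE expr2.
  by rewrite mulrA.
- rewrite jj subnn addn0 /hweight maxn0 invr1 mulr1.
  apply: (@le_trans _ _ (\sum_(l' < n) \sum_(r < H)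
      (`|overlap_diff (l * H + r * j') (l' * H + r * j')| +
       `|overlap_diff (l * H + r * j') (l' * H + r * j' + H)|))).
    apply: ler_sum => l' _; apply: le_trans (ler_norm_sum _ _ _) _.
    by apply: ler_sum => r _; exact: ler_normB.
  rewrite exchange_big /=.
  apply: (@le_trans _ _ (\sum_(r < H) (4 * H%:R))).
    apply: ler_sum => r _; under eq_bigr do rewrite -!addnA.
    rewrite big_split /=.
    by have := sum_overlap_diff n (l * H + r * j') (r * j');
      have := sum_overlap_diff n (l * H + r * j') (r * j' + H); lra.
  by rewrite sumr_const card_ord -[leLHS]mulr_natr -mulrA -expr2.
Qed.

Lemma hweight_ge0 d : 0 <= hweight d. Proof. by rewrite invr_ge0. Qed.

Lemma sum_hweight n : (0 < n)%N -> \sum_(d < n) hweight d <= 2 + ln n%:R.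
Proof.
(* The terms d = 0 and d = 1 are both 1 and account for the 2; the convention that [ln] vanishes at
   0 covers n = 0. *)
case: n => // n _; suff h : \sum_(d < n.+1) hweight d <= 2 + ln n%:R.
  apply: le_trans h _; rewrite lerD2l; case: n => [|n]; first by rewrite ln0 // ln1.
  by rewrite ler_ln ?posrE ?ltr0n // ler_nat.
elim: n => [|n IH].
  by rewrite big_ord1 /hweight maxn0 invr1 ln0 //; lra.
rewrite big_ord_recr /=; case: n IH => [|n] IH.
  by rewrite big_ord1 /hweight !maxn0 maxnn invr1 ln1; lra.
apply: le_trans (lerD IH (lexx _)) _.
rewrite /hweight (_ : maxn 1 n.+2 = n.+2)%N; last by lia.
have n1 : 0 < n.+1%:R :> R by rewrite ltr0n.
have n2 : 0 < n.+2%:R :> R by rewrite ltr0n.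
(* This says that 1 / (n + 2) <= ln (n + 2) - ln (n + 1). *)
have h : ln (1 - n.+2%:R^-1) <= - n.+2%:R^-1 :> R.
  by apply: le_ln1Dx; rewrite ltrN2 invf_lt1 // ltr1n.
have E : 1 - n.+2%:R^-1 = (n.+2%:R - 1) / n.+2%:R :> R.
  by rewrite mulrBl divff ?lt0r_neq0 // div1r.
have E' : n.+2%:R - 1 = n.+1%:R :> R by rewrite -[n.+2]addn1 natrD addrK.
rewrite E E' ln_div ?posrE // in h.
by rewrite -addrA lerD2l -lerBrDl -lerN2 opprB.
Qed.

Lemma sum_hweight_dist n (j : 'I_n) :
  \sum_(j' < n) hweight ((j' - j) + (j - j')) <= 2 * (2 + ln n%:R).
Proof.
have n0 : (0 < n)%N by case: n j => [[]|].
apply: (@le_trans _ _ (2 * \sum_(d < n) hweight d)); last by rewrite ler_pM2l // sum_hweight.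
rewrite -(big_mkord xpredT hweight).
rewrite -(big_mkord xpredT (fun j' => hweight ((j' - j) + (j - j')))).
rewrite (@big_cat_nat _ _ _ j.+1) //= mulr2n mulrDl mul1r.
have nn a b : (a <= b)%N -> \sum_(0 <= d < a) hweight d <= \sum_(0 <= d < b) hweight d.
  move=> ab; rewrite (@big_cat_nat _ _ _ a _ b) //= lerDl.
  by apply: sumr_ge0 => d _; exact: hweight_ge0.
apply: lerD.
  rewrite big_nat_rev /= add0n; apply: le_trans (nn j.+1 n (ltn_ord j)).
  rewrite !big_nat; apply: ler_sum => d /andP[_ dj].
  by rewrite (_ : (j.+1 - d.+1 - j + (j - (j.+1 - d.+1)) = d)%N) //; lia.
have h : \sum_(j.+1 <= i < n) hweight (i - j + (j - i)) = \sum_(1 <= d < n - j) hweight d.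
  have -> : \sum_(j.+1 <= i < n) hweight (i - j + (j - i)) =
      \sum_(1 + j <= i < (n - j) + j) hweight (i - j + (j - i)).
    by rewrite add1n subnK // ltnW.
  rewrite big_addn addnK; apply: eq_bigr => d _; congr hweight; lia.
rewrite h; apply: le_trans (nn (n - j)%N n (leq_subr _ _)).
rewrite [leRHS](@big_cat_nat _ _ _ 1) //= ?lerDr ?subn_gt0 //.
by apply: sumr_ge0 => d _; exact: hweight_ge0.
Qed.

(* The hypothesis of the Schur test for [line_mat]. *)
Lemma line_mat_gram n (o : 'I_n * 'I_n) : (0 < H)%N -> (forall d, (0 < d < n)%N -> (d %| H)%N) ->
  \sum_o' `|\sum_e @line_mat R n H (2 * n * H) o e * @line_mat R n H (2 * n * H) o' e| <=
    8 * (2 + ln n%:R) / (n%:R ^+ 4 * H%:R ^+ 2).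
Proof.
move=> H0 dH; case: o => j l.
have n0 : (0 < n)%N by case: n j {l dH} => [[]|].
have Hr : 0 < H%:R :> R by rewrite ltr0n.
have nr : 0 < n%:R :> R by rewrite ltr0n.
pose N : R := n%:R ^+ 2 * H%:R ^+ 2.
have Np : 0 < N by rewrite mulr_gt0 ?exprn_gt0.
have E j' l' : \sum_e @line_mat R n H (2 * n * H) (j, l) e * @line_mat R n H (2 * n * H) (j', l') e =
    (\sum_(r < H) line_corr (l * H + r * j) (l' * H + r * j')) / N ^+ 2.
  rewrite mulr_suml -(pair_bigA _ (fun (r : 'I_H) (u : 'I_(2 * n * H)) =>
    @line_mat R n H (2 * n * H) (j, l) (r, u) * @line_mat R n H (2 * n * H) (j', l') (r, u))) /=.
  apply: eq_bigr => r _; rewrite /line_corr -(@sum_boxdiff (2 * n * H)).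
  - rewrite mulr_suml; apply: eq_bigr => u _; rewrite /line_mat /=.
    by rewrite -/N; field; rewrite gt_eqF.
  - by have := ltn_ord j; have := ltn_ord l; have := ltn_ord r; nia.
  - by have := ltn_ord j'; have := ltn_ord l'; have := ltn_ord r; nia.
rewrite -(pair_bigA _ (fun j' l' => `|\sum_e @line_mat R n H (2 * n * H) (j, l) e *
  @line_mat R n H (2 * n * H) (j', l') e|)) /=.
under eq_bigr => j' _ do under eq_bigr => l' _ do
  rewrite E normrM [X in _ * X]gtr0_norm ?invr_gt0 ?exprn_gt0 //.
under eq_bigr do rewrite -mulr_suml.
rewrite -mulr_suml ler_pdivrMr ?exprn_gt0 //.
apply: (@le_trans _ _ (\sum_(j' < n) (4 * H%:R ^+ 2 * hweight ((j' - j) + (j - j'))))).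
  by apply: ler_sum => j' _; exact: sum_line_corr.
rewrite -mulr_sumr.
have -> : 8 * (2 + ln n%:R) / (n%:R ^+ 4 * H%:R ^+ 2) * N ^+ 2 =
    4 * H%:R ^+ 2 * (2 * (2 + ln n%:R)) :> R.
  by rewrite /N; field; rewrite !gt_eqF.
by rewrite ler_pM2l ?mulr_gt0 ?exprn_gt0 // sum_hweight_dist.
Qed.

End LineGram.

(** * Rounding points to cells *)

Section Cells.
Context {R : realType}.

Lemma sum_divn_eq a m c : (0 < a)%N -> (c < m)%N ->
  (\sum_(r < m * a) (r %/ a == c) = a)%N.
Proof.
move=> a0 cm; transitivity (\sum_(r < m * a) box (c * a) a r)%N.
  apply: eq_bigr => r _; rewrite /box eqn_leq -ltnS ltn_divLR // leq_divRL //.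
  by rewrite andbC mulSn addnC.
by rewrite box_sum; nia.
Qed.

(** Both roundings move their argument down by less than b, so the two indicators can differ only
    for u within b of the jump. *)
Lemma step_round_le b s s' u : (s' <= s < s' + b)%N ->
  `|((s <= u)%N%:R - (s' <= u %/ b * b)%N%:R : R)| <= (box (s - b) (2 * b) u)%:R.
Proof.
move=> ss; have b0 : (0 < b)%N by lia.
have h1 := leq_trunc_div u b; have h2 := ltn_ceil u b0; rewrite mulSn in h2.
move: (u %/ b * b)%N h1 h2 => u' h1 h2; rewrite /box.
case: (leqP s u) => c1; case: (leqP s' u') => c2; rewrite ?subrr ?normr0 ?ler0n //=;
  rewrite ?subr0 ?sub0r ?normrN normr1 ler1n lt0b; lia.
Qed.

Definition box_diff H s u : R := (box s H u)%:R - (box (s + H) H u)%:R.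

Lemma box_diffE H s u : box_diff H s u =
  (s <= u)%N%:R - 2 * (s + H <= u)%N%:R + (s + H + H <= u)%N%:R.
Proof.
rewrite /box_diff /box.
case: (leqP s u); case: (ltnP u (s + H)) => h1; case: (leqP (s + H) u) => h2;
 case: (ltnP u (s + H + H)) => h3; case: (leqP (s + H + H) u) => h4 h5 /=; try lia; by ring.
Qed.

(** [box_diff] has three jumps, of weights 1, -2 and 1, and each is blurred over at most 2 b
    points. *)
Lemma box_diff_round_le b H U s s' : (s' <= s < s' + b)%N ->
  \sum_(u < U) `|box_diff H s u - box_diff H s' (u %/ b * b)%N| <= 8 * b%:R.
Proof.
move=> ss.
have st c u : `|((s + c <= u)%N%:R - (s' + c <= u %/ b * b)%N%:R : R)| <=
    (box (s + c - b) (2 * b) u)%:R by apply: step_round_le; lia.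
apply: (@le_trans _ _ (\sum_(u < U) ((box (s + 0 - b) (2 * b) u)%:R +
   2 * (box (s + H - b) (2 * b) u)%:R + (box (s + (H + H) - b) (2 * b) u)%:R))).
  apply: ler_sum => u _; have := st 0%N u; have := st H u; have := st (H + H)%N u.
  rewrite !addn0 !addnA !box_diffE !ler_norml; lra.
rewrite !big_split /= -mulr_sumr.
have := @box_sumr_le R (s + 0 - b) (2 * b) U; have := @box_sumr_le R (s + H - b) (2 * b) U.
by have := @box_sumr_le R (s + (H + H) - b) (2 * b) U; rewrite natrM; lra.
Qed.

Context {X : banachType R}.
Variables (n K a : nat).
Hypotheses (n0 : (0 < n)%N) (K0 : (0 < K)%N) (a0 : (0 < a)%N).
Let b := (n * a)%N.
Let H := (n * K * a)%N.
Let U := (2 * n * H)%N.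

Let b0 : (0 < b)%N. Proof. by rewrite muln_gt0 n0. Qed.
Let HE : H = (K * b)%N. Proof. by rewrite /H /b; lia. Qed.
Let H0 : (0 < H)%N. Proof. by rewrite HE muln_gt0 K0. Qed.
Let UE : U = (2 * n * K * b)%N. Proof. by rewrite /U HE; lia. Qed.

Let cell1 (r : 'I_H) : (r %/ a < n * K)%N.
Proof. by rewrite ltn_divLR // ltn_ord. Qed.
Let cell2 (u : 'I_U) : (u %/ b < 2 * n * K)%N.
Proof. by rewrite ltn_divLR // -UE ltn_ord. Qed.

(** Cells have width a in r and b = n a in u, so a line of slope below n rises by less than b across
    one cell. The number of points is of factorial size, the number of cells polynomial in n and K;
    only the latter is affordable in the factor #|E|^(1/p). *)
Definition cell (e : 'I_H * 'I_U) : 'I_(n * K) * 'I_(2 * n * K) :=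
  (Ordinal (cell1 e.1), Ordinal (cell2 e.2)).

Lemma sum_cell f : (\sum_e (cell e == f) = a * b)%N.
Proof.
case: f => c d; transitivity (\sum_(r < H) \sum_(u < U) (r %/ a == c) * (u %/ b == d))%N.
  rewrite pair_bigA; apply: eq_bigr => -[r u] _ /=.
  by rewrite /cell /= xpair_eqE -!val_eqE /= mulnb.
under eq_bigr do rewrite -big_distrr /=.
by rewrite -big_distrl /= sum_divn_eq // UE sum_divn_eq.
Qed.

Let ab0 : 0 < (a * b)%:R :> R. Proof. by rewrite ltr0n muln_gt0 a0. Qed.

Definition cell_mean (F : 'I_H * 'I_U -> X) f : X :=
  ((a * b)%:R^-1 : R)%:C%C *: \sum_e ((cell e == f)%:R : R)%:C%C *: F e.

Lemma cell_mean_le1 F : (forall e, rnorm (F e) <= 1) -> forall f, rnorm (cell_mean F f) <= 1.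
Proof.
move=> F1 f; rewrite rnormZr gtr0_norm ?invr_gt0 // mulrC ler_pdivrMr // mul1r.
rewrite -(sum_cell f) natr_sum; apply: le_trans (ler_rnorm_sum _ _ _) _.
by apply: ler_sum => e _; rewrite rnormZr normr_nat ler_piMr.
Qed.

(** The fluctuation of F around its cell means is invisible to a kernel that is constant on
    cells. *)
Lemma sum_cell_mean (G : _ -> R) F :
  \sum_e (G (cell e))%:C%C *: (F e - cell_mean F (cell e)) = 0.
Proof.
transitivity (\sum_f (G f)%:C%C *: \sum_e ((cell e == f)%:R : R)%:C%C *: (F e - cell_mean F f)).
  under [RHS]eq_bigr do rewrite scaler_sumr.
  rewrite exchange_big /=; apply: eq_bigr => e _.
  rewrite (bigD1 (cell e)) //= eqxx scale1r big1 ?addr0 // => f fe.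
  by rewrite eq_sym (negbTE fe) scale0r scaler0.
rewrite big1 // => f _; under eq_bigr do rewrite scalerBr.
rewrite sumrB -scaler_suml -rmorph_sum /= -natr_sum sum_cell /cell_mean scalerA -rmorphM /=.
by rewrite divff ?gt_eqF // scale1r subrr scaler0.
Qed.

Notation M := (@line_mat R n H U).

(** By [sum_cell_mean] each kernel entry may be replaced by its difference from the value at the
    corner of the cell; [box_diff_round_le] makes these differences of total size O(1 / K). *)
Lemma line_mat_cell_error F : (forall e, rnorm (F e) <= 1) ->
  \sum_o rnorm (\sum_e (M o e)%:C%C *: (F e - cell_mean F (cell e))) <= 16 / K%:R.
Proof.
move=> F1; have nr : 0 < n%:R :> R by rewrite ltr0n.
have Hr : 0 < H%:R :> R by rewrite ltr0n.
have NN : 0 < n%:R ^+ 2 * H%:R ^+ 2 :> R by rewrite mulr_gt0 ?exprn_gt0.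
apply: (@le_trans _ _ (\sum_(o : 'I_n * 'I_n) 16 / (K%:R * n%:R ^+ 2))); last first.
  rewrite sumr_const card_prod card_ord -[leLHS]mulr_natr natrM.
  by rewrite le_eqVlt; apply/orP; left; apply/eqP; field; rewrite !gt_eqF ?ltr0n.
apply: ler_sum => -[j l] _.
pose s r := (l * H + r * j)%N.
pose G (f : 'I_(n * K) * 'I_(2 * n * K)) : R := box_diff H (s (f.1 * a)%N) (f.2 * b)%N / (n%:R ^+ 2 * H%:R ^+ 2).
have -> : \sum_e (M (j, l) e)%:C%C *: (F e - cell_mean F (cell e)) =
    \sum_e (M (j, l) e - G (cell e))%:C%C *: (F e - cell_mean F (cell e)).
  under [RHS]eq_bigr do rewrite rmorphB scalerBl.
  by rewrite sumrB sum_cell_mean subr0.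
apply: le_trans (ler_rnorm_sum _ _ _) _.
apply: (@le_trans _ _ (\sum_e `|M (j, l) e - G (cell e)| * 2)).
  apply: ler_sum => e _; rewrite rnormZr ler_wpM2l //.
  by apply: le_trans (ler_rnormB _ _) _; have := F1 e; have := cell_mean_le1 F1 (cell e); lra.
rewrite -mulr_suml.
apply: (@le_trans _ _ ((\sum_(r < H) (8 * b%:R)) / (n%:R ^+ 2 * H%:R ^+ 2) * 2)).
  rewrite ler_pM2r // mulr_suml.
  rewrite -(pair_bigA _ (fun r u => `|M (j, l) (r, u) - G (cell (r, u))|)) /=.
  apply: ler_sum => r _; rewrite ler_pdivlMr // mulr_suml.
  apply: le_trans (_ : \sum_(u < U) `|box_diff H (s r) u - box_diff H (s (r %/ a * a)%N) (u %/ b * b)%N| <= _).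
    apply: ler_sum => u _; rewrite -[X in _ * X](gtr0_norm NN) -normrM /G /cell /=.
    by rewrite mulrBl divfK ?gt_eqF // /line_mat /= divfK ?gt_eqF.
  apply: box_diff_round_le; rewrite /s.
  have h1 := leq_trunc_div r a; have h2 := ltn_ceil r a0; rewrite mulSn in h2.
  by have := ltn_ord j; rewrite /b; nia.
rewrite sumr_const card_ord -[X in X / _ * _]mulr_natr HE natrM.
rewrite le_eqVlt; apply/orP; left; apply/eqP; field.
by rewrite !pnatr_eq0 -!lt0n K0 b0 n0.
Qed.

End Cells.

Lemma type_cotype_line_cells (R : realType) (X : banachType R) (p : R) (q : \bar R) :
  has_type p X -> has_cotype q X ->
  exists2 C : R, 0 <= C & forall n K a, (0 < n)%N -> (0 < K)%N -> (0 < a)%N ->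
    (forall d, (0 < d < n)%N -> (d %| n * K * a)%N) ->
    mat_bound X (@line_mat R n (n * K * a) (2 * n * (n * K * a)))
      (16 / K%:R + C * (Num.sqrt ((2 + ln n%:R) / n%:R ^+ 5) / K%:R *
         ((n%:R ^+ 2) `^ (1 - inv_exponent q) * (2 * n%:R ^+ 2 * K%:R ^+ 2) `^ p^-1))).
Proof.
move=> tX cX; have [C C0 hC] := type_cotype_sum tX cX.
exists (Num.sqrt 8 * C); first by rewrite mulr_ge0.
move=> n K a n0 K0 a0 dH F F1.
have nr : 0 < n%:R :> R by rewrite ltr0n.
have Kr : 0 < K%:R :> R by rewrite ltr0n.
have ar : 0 < a%:R :> R by rewrite ltr0n.
set H := (n * K * a)%N in F F1 dH *.
have H0 : (0 < H)%N by rewrite !muln_gt0 n0 K0.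
have Hr : 0 < H%:R :> R by rewrite ltr0n.
pose M := @line_mat R n H (2 * n * H).
pose phi := cell_mean n0 K0 a0 F.
pose cl := cell n0 K0 a0 : 'I_H * 'I_(2 * n * H) -> _.
apply: (@le_trans _ _ (\sum_o (rnorm (\sum_e (M o e)%:C%C *: (F e - phi (cl e))) +
    rnorm (\sum_e (M o e)%:C%C *: phi (cl e))))).
  apply: ler_sum => o _; apply: le_trans (ler_rnormD _ _); rewrite -big_split /=.
  by rewrite le_eqVlt; apply/orP; left; apply/eqP; congr rnorm; apply: eq_bigr => e _; rewrite -scalerDr subrK.
rewrite big_split /=; apply: lerD; first exact: line_mat_cell_error.
(* [B] copies the value of a cell to all its points; the row sums of its Gram matrix are the size a
   (n a) of a cell. *)
pose B e f : R := (cl e == f)%:R.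
have L0 : 0 <= ln n%:R :> R by rewrite ln_ge0 // ler1n.
pose g2 : R := 8 * (2 + ln n%:R) / (n%:R ^+ 4 * H%:R ^+ 2).
have g20 : 0 < g2 by rewrite divr_gt0 ?mulr_gt0 ?exprn_gt0 // ltr_wpDr.
have h := hC _ _ _ M B (Num.sqrt g2) (Num.sqrt (a * (n * a))%:R).
have {h} := h _ _ _ _ phi (cell_mean_le1 n0 K0 a0 F1).
rewrite sqrtr_gt0 g20 sqr_sqrtr ?(ltW g20) // sqrtr_gt0 ltr0n !muln_gt0 a0 n0 sqr_sqrtr //.
move=> /(_ isT (fun o => line_mat_gram o H0 dH) isT) h.
have {h} := h _.
have bs o : \sum_o' `|\sum_e B o e * B o' e| <= (a * (n * a))%:R.
  apply: (@le_trans _ _ (\sum_o' (cl o' == cl o)%:R)); last first.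
    by rewrite -natr_sum ler_nat /cl sum_cell.
  apply: ler_sum => o' _; rewrite /B (sum_delta (cl o) (fun e => (cl o' == e)%:R)) //.
  by rewrite normr_nat.
move=> /(_ bs) h.
have E o : \sum_f (M o f)%:C%C *: \sum_e (B f e)%:C%C *: phi e = \sum_e (M o e)%:C%C *: phi (cl e).
  apply: eq_bigr => f _; congr (_ *: _); rewrite (bigD1 (cl f)) //= /B eqxx scale1r.
  by rewrite big1 ?addr0 // => e fe; rewrite eq_sym (negbTE fe) scale0r.
under eq_bigr do rewrite -E.
apply: le_trans h _.
rewrite !card_prod !card_ord.
have -> : (n * n)%:R = n%:R ^+ 2 :> R by rewrite natrM expr2.
have -> : (n * K * (2 * n * K))%:R = 2 * n%:R ^+ 2 * K%:R ^+ 2 :> R by rewrite !natrM; ring.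
rewrite !mulrA ler_wpM2r ?powR_ge0 // ler_wpM2r ?powR_ge0 //.
(* As H = n K a, the factorially large a cancels between the two norms. *)
have -> : Num.sqrt g2 * Num.sqrt (a * (n * a))%:R = Num.sqrt 8 * (Num.sqrt ((2 + ln n%:R) / n%:R ^+ 5) / K%:R).
  have K1 : K%:R^-1 = Num.sqrt (K%:R^-1 ^+ 2) :> R by rewrite sqrtr_sqr gtr0_norm ?invr_gt0.
  rewrite K1 -!sqrtrM ?(ltW g20) ?divr_ge0 ?exprn_ge0 ?(ltW nr) ?addr_ge0 //; congr Num.sqrt.
  by rewrite /g2 /H !natrM; field; rewrite !gt_eqF.
by rewrite le_eqVlt; apply/orP; left; apply/eqP; ring.
Qed.

Section Exponents.
Context {R : realType}.
Implicit Types (X : banachType R).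

Lemma ln_le_exp (eta x : R) : 0 < eta -> 0 < x -> ln x <= eta^-1 * expR (eta * ln x).
Proof.
move=> e0 x0; rewrite -(ler_pM2l e0) mulrA divff ?gt_eqF // mul1r.
by apply: le_trans (expR_ge1Dx _); rewrite lerDr.
Qed.

(** Powers of n, with K about n^eta: the norms give -5/2, the outputs 2 (1 - 1/q), the inputs 2/p,
    in total 2 (1/p - 1/q) - 1/2, which is negative by hypothesis. The logarithm and the remaining
    K^(2/p - 1) cost at most n^eta each up to constants, and the rounding error 16 / K is about
    n^(-eta). *)
Lemma type_cotype_line_decay X (p : R) (q : \bar R) :
  has_type p X -> has_cotype q X -> ((p^-1)%:E - q^-1 < (4^-1)%:E)%E -> line_decay X.
Proof.
move=> tX cX hpq; have [C C0 hC] := type_cotype_line_cells tX cX.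
have p1 := tX.1; have q1 := cX.1.
have p0 : 0 < p by exact: lt_le_trans p1.
have qE : p^-1 - inv_exponent q < 4^-1.
  case: q q1 hpq {cX hC} => [q q1|_|].
  - rewrite lee_fin in q1; have q0 : 0 < q by exact: lt_le_trans q1.
    by rewrite inver gt_eqF // -EFinN -EFinD lte_fin.
  - by rewrite invey oppe0 adde0 lte_fin subr0.
  - by rewrite leeNy_eq.
set s := inv_exponent q in hC qE.
have s1 : 0 <= s <= 1.
  rewrite /s; case: q q1 {cX hC s hpq qE} => [q q1|_|_]; rewrite ?lexx ?ler01 //.
  rewrite lee_fin in q1; have q0 : 0 < q by exact: lt_le_trans q1.
  by rewrite invr_ge0 (ltW q0) invf_le1.
have t1 : 0 <= p^-1 <= 1 by rewrite invr_ge0 (ltW p0) invf_le1.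
set t := p^-1 in hC qE t1.
(* The main exponent 2 (t - s) - 1/2 equals -8 eta, which leaves room for the two losses. *)
pose eta : R := (4^-1 - (t - s)) / 4.
have [e0 e1] : 0 < eta /\ eta <= 1 by rewrite /eta; move: qE t1 s1; lra.
exists (32 + C * (2 * (2 + eta^-1))), eta; split => //.
  have : 0 < eta^-1 by rewrite invr_gt0.
  by have := C0; nra.
move=> n n0.
have nr : 0 < n%:R :> R by rewrite ltr0n.
have n1 : 1 <= n%:R :> R by rewrite ler1n.
pose L : R := ln n%:R.
have L0 : 0 <= L by exact: ln_ge0.
have nL : n%:R = expR L :> R by rewrite lnK // posrE.
pose y := expR (eta * L).
have y1 : 1 <= y by rewrite -expR0 ler_expR mulr_ge0 // ltW.
have yn : y <= n%:R by rewrite nL ler_expR ler_piMl.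
(* K is about n^eta, at least 1 and at most n, so that n K divides (n^2)!. *)
pose K := Num.trunc y.
have /andP[Ky yK] : K%:R <= y < K.+1%:R by apply: truncn_itv; lra.
have K0 : (0 < K)%N.
  by rewrite -ltnS -(ltr_nat R); apply: le_lt_trans yK.
have Kr : 0 < K%:R :> R by rewrite ltr0n.
have Kn : (K <= n)%N by rewrite -(ler_nat R); lra.
pose Lk : R := ln K%:R.
have Lk0 : 0 <= Lk by rewrite ln_ge0 // ler1n.
have LkL : Lk <= eta * L by rewrite -ler_expR lnK ?posrE.
have KL : K%:R = expR Lk :> R by rewrite lnK // posrE.
have dv : (n * K %| line_height n)%N.
  by apply: dvdn_line_height; rewrite muln_gt0 n0 K0 /= expnS expn1 leq_mul2l Kn orbT.
pose a := (line_height n %/ (n * K))%N.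
have aE : (n * K * a = line_height n)%N by rewrite mulnC divnK.
have a0 : (0 < a)%N by have := line_height_gt0 n; rewrite -aE muln_gt0 => /andP[].
have := hC n K a n0 K0 a0; rewrite aE => /(_ _)/mat_bound_le; apply; last first.
  move=> d /andP[d0 dn]; apply: dvdn_line_height; rewrite d0 (leq_trans (ltnW dn)) //.
  by rewrite expnS expn1 leq_pmulr.
rewrite [leRHS]mulrDl; apply: lerD.
  rewrite expRN ler_pdivrMr // -mulrA mulrCA -[leLHS]mulr1 -[16]/(16%:R) .
  have : y < 2 * K%:R by move: yK; rewrite -natr1; have := K0; rewrite -(ler_nat R); lra.
  rewrite -/L -/y => yK2; have y0 : 0 < y by lra.
  have : 1 <= 2 * (y^-1 * K%:R) by rewrite mulrCA ler_pdivlMl // mulr1 ltW.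
  by lra.
rewrite -[leRHS]mulrA ler_wpM2l //.
have S1 : Num.sqrt ((2 + L) / n%:R ^+ 5) <= (2 + L) * expR (- (5 / 2 * L)).
  have w0 : 0 <= (2 + L) * expR (- (5 / 2 * L)) by rewrite mulr_ge0 ?expR_ge0 // addr_ge0.
  rewrite -(ger0_norm w0) -sqrtr_sqr ler_wsqrtr // exprMn -expRM_natl.
  have -> : n%:R ^+ 5 = expR (5 * L) :> R by rewrite nL -expRM_natl.
  rewrite -expRN; have -> : 2 * - (5 / 2 * L) = - (5 * L) by field.
  rewrite ler_wpM2r ?expR_ge0 // expr2; nra.
have S2 : 2 + L <= (2 + eta^-1) * expR (eta * L).
  have h1 := ln_le_exp e0 nr; rewrite -/L in h1.
  have h2 : 1 <= expR (eta * L) := y1.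
  by lra.
have lX (x : R) : 0 < x -> ln (x ^+ 2) = 2 * ln x by move=> x0; rewrite lnXn // mulr_natl.
have S3 : (n%:R ^+ 2) `^ (1 - s) = expR ((1 - s) * (2 * L)) :> R.
  by rewrite /powR gt_eqF ?exprn_gt0 // lX.
have S4 : (2 * n%:R ^+ 2 * K%:R ^+ 2) `^ t <= 2 * expR (t * (2 * L) + t * (2 * Lk)) :> R.
  rewrite /powR gt_eqF ?mulr_gt0 ?exprn_gt0 // !lnM ?posrE ?mulr_gt0 ?exprn_gt0 //.
  have -> : t * (ln 2 + (ln n%:R + ln n%:R) + (ln K%:R + ln K%:R)) =
      t * ln 2 + (t * (2 * L) + t * (2 * Lk)) by rewrite -/L -/Lk; ring.
  rewrite expRD.
  rewrite ler_wpM2r ?expR_ge0 // -[leRHS](@lnK R 2) ?posrE // ler_expR.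
  by rewrite ler_piMl ?ln_ge0 ?ler1n //; case/andP: t1.
rewrite S3 KL -expRN.
apply: (@le_trans _ _ (((2 + eta^-1) * expR (eta * L) * expR (- (5 / 2 * L))) * expR (- Lk) *
  (expR ((1 - s) * (2 * L)) * (2 * expR (t * (2 * L) + t * (2 * Lk)))))).
  rewrite -/L; apply: ler_pM; rewrite ?mulr_ge0 ?expR_ge0 ?sqrtr_ge0 ?powR_ge0 //.
    rewrite ler_wpM2r ?expR_ge0 //; apply: le_trans S1 _.
    by rewrite ler_wpM2r ?expR_ge0.
  by rewrite ler_wpM2l ?expR_ge0 // -KL.
set c := 2 + eta^-1.
have -> : c * expR (eta * L) * expR (- (5 / 2 * L)) * expR (- Lk) *
    (expR ((1 - s) * (2 * L)) * (2 * expR (t * (2 * L) + t * (2 * Lk)))) =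
    2 * c * expR (eta * L + - (5 / 2 * L) + - Lk + (1 - s) * (2 * L) + (t * (2 * L) + t * (2 * Lk))).
  by rewrite !expRD; ring.
have c0 : 0 <= 2 * c by rewrite mulr_ge0 // addr_ge0 // invr_ge0 ltW.
rewrite ler_wpM2l // ler_expR -/L.
have E : t - s = 4^-1 - 4 * eta by rewrite /eta; field.
have -> : eta * L + - (5 / 2 * L) + - Lk + (1 - s) * (2 * L) + (t * (2 * L) + t * (2 * Lk)) =
    eta * L - L / 2 + 2 * (t - s) * L + (2 * t - 1) * Lk by field.
rewrite E; have : (1 - t) * Lk >= 0 by rewrite mulr_ge0 // subr_ge0; case/andP: t1.
have : 0 <= eta * L by rewrite mulr_ge0 // ltW.
by move: LkL; lra.
Qed.

Lemma E4_line_decay X : E4 X -> line_decay X.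
Proof.
elim => {X} [X p q tX cX pq|X Y _ IH sXY|X Y _ IH sXY|X Y _ IH sXY|X X0 X1 Y V i0 i1 theta _ IH iso cc th iY].
- exact: type_cotype_line_decay tX cX pq.
- exact: line_decay_subspace sXY IH.
- exact: line_decay_quotient sXY IH.
- exact: line_decay_ultrapower sXY IH.
- exact: line_decay_interpolation iso th iY IH.
Qed.

End Exponents.

(** * Averages over one-parameter groups *)

Section Average.
Context {R : realType} {X : banachType R}.
Implicit Types (f g : R -> X).

(* [rsum f 0 = 0] and [i / 0 = 0]: only [N > 0] is meaningful. *)
Definition rsum f N : X := (N%:R^-1 : R)%:C%C *: \sum_(i < N) f (i%:R / N%:R).

Definition ravg f : X := limn (rsum f).

Lemma sum_ord_mul (V : nmodType) N M (g : nat -> V) :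
  \sum_(k < N * M) g k = \sum_(i < N) \sum_(j < M) g (i * M + j)%N.
Proof.
elim: N => [|N IH]; first by rewrite mul0n !big_ord0.
by rewrite mulSnr big_split_ord big_ord_recr /= IH.
Qed.

Lemma rsum_refine f N M : (0 < N)%N -> (0 < M)%N -> rsum f (N * M) =
  (N%:R^-1 : R)%:C%C *: \sum_(i < N) rsum (fun s => f ((i%:R + s) / N%:R)) M.
Proof.
move=> N0 M0; have Nr : N%:R != 0 :> R by rewrite pnatr_eq0 -lt0n.
have Mr : M%:R != 0 :> R by rewrite pnatr_eq0 -lt0n.
rewrite /rsum (sum_ord_mul N M (fun k => f (k%:R / (N * M)%:R))) natrM invfM rmorphM -scalerA.
congr (_ *: _); rewrite scaler_sumr; apply: eq_bigr => i _; congr (_ *: _).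
apply: eq_bigr => j _; congr (f _); rewrite natrD natrM; field.
by rewrite Nr Mr.
Qed.

Lemma rsum_le f W N : (forall s, 0 <= s <= 1 -> rnorm (f s) <= W) -> 0 <= W -> rnorm (rsum f N) <= W.
Proof.
move=> fW W0; case: N => [|N]; first by rewrite /rsum big_ord0 scaler0 rnorm0.
have N0 : 0 < N.+1%:R :> R by rewrite ltr0n.
rewrite /rsum rnormZr gtr0_norm ?invr_gt0 // ler_pdivrMl //.
apply: le_trans (ler_rnorm_sum _ _ _) _.
apply: le_trans (_ : \sum_(i < N.+1) W <= _).
  by apply: ler_sum => i _; apply: fW; rewrite divr_ge0 //= ler_pdivrMr // mul1r ler_nat ltnW.
by rewrite sumr_const card_ord -[leLHS]mulr_natl.
Qed.

Lemma rsumB f g N : rsum f N - rsum g N = rsum (fun s => f s - g s) N.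
Proof. by rewrite /rsum sumrB scalerBr. Qed.

Lemma rsum_cst v N : (0 < N)%N -> rsum (fun=> v) N = v.
Proof.
move=> N0; have Nr : N%:R != 0 :> R by rewrite pnatr_eq0 -lt0n.
rewrite /rsum sumr_const card_ord -[v *+ N]scaler_nat scalerA.
have -> : (N%:R : R[i]) = (N%:R : R)%:C%C by rewrite rmorph_nat.
by rewrite -rmorphM mulVf // scale1r.
Qed.

(** Refining a subdivision moves the nodes by less than 1 / N, so uniform continuity applies. Two
    arbitrary numbers of nodes are then compared through their product. *)
Lemma rsum_cauchy f : continuous f -> forall e : R, 0 < e ->
  exists N0, forall N M, (N0 <= N)%N -> (0 < N)%N -> (0 < M)%N ->
    rnorm (rsum f (N * M) - rsum f N) <= e.
Proof.
move=> cf e e0.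
have [d d0 hd] := compact_uniform (@segment_compact R 0 1) cf e0.
exists (Num.trunc d^-1).+1 => N M N0 N1 M1.
have Nr : 0 < N%:R :> R by rewrite ltr0n.
rewrite rsum_refine // /rsum -/(rsum f N) -scalerBr -sumrB rnormZr gtr0_norm ?invr_gt0 //.
rewrite ler_pdivrMl //; apply: le_trans (ler_rnorm_sum _ _ _) _.
apply: le_trans (_ : \sum_(i < N) e <= _); last by rewrite sumr_const card_ord -[leLHS]mulr_natl.
apply: ler_sum => i _; rewrite -[X in _ - X](rsum_cst _ M1).
have -> : (M%:R^-1 : R)%:C%C *: \sum_(j < M) f ((i%:R + j%:R / M%:R) / N%:R) =
  rsum (fun s => f ((i%:R + s) / N%:R)) M by [].
rewrite rsumB.
apply: rsum_le (ltW e0) => s /andP[s0 s1]; apply/ltW/hd.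
  by rewrite /= in_itv /= divr_ge0 //= ler_pdivrMr // mul1r ler_nat ltnW.
rewrite /ball /= distrC mulrDl addrAC subrr add0r ger0_norm ?divr_ge0 // ltr_pdivrMr //.
apply: le_lt_trans s1 _; rewrite -ltr_pdivrMl // mulr1.
have : d^-1 < (Num.trunc d^-1).+1%:R by apply: truncnS_gt; exact: num_real.
by move=> /lt_le_trans; apply; rewrite ler_nat.
Qed.

Lemma cvg_ravg f : continuous f -> rsum f N @[N --> \oo] --> ravg f.
Proof.
move=> cf; apply: cvg_cauchy_rnorm => e e0.
have e20 : 0 < e / 2 by rewrite divr_gt0.
have [N0 hN] := rsum_cauchy cf e20.
exists N0.+1 => m n m0 n0.
have m1 : (0 < m)%N by apply: leq_trans m0.
have n1 : (0 < n)%N by apply: leq_trans n0.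
apply: le_trans (ler_rnorm_trans (rsum f (m * n)) _ _) _.
rewrite [X in X + _]rnormBC (splitr e); apply: lerD; first by apply: hN => //; exact: ltnW.
by rewrite mulnC; apply: hN => //; exact: ltnW.
Qed.

Lemma ravg_le f W : continuous f -> (forall s, 0 <= s <= 1 -> rnorm (f s) <= W) -> rnorm (ravg f) <= W.
Proof.
move=> cf fW; have W0 : 0 <= W by apply: le_trans (fW 0 _); rewrite ?rnorm_ge0 // lexx ler01.
by apply: cvg_rnorm_le (cvg_ravg cf) _; apply: nearW => N; exact: rsum_le.
Qed.

Lemma ravg_unique f l : continuous f -> rsum f N @[N --> \oo] --> l -> ravg f = l.
Proof. by move=> cf fl; apply: cvg_unique (cvg_ravg cf) fl. Qed.

Lemma ravg_cst v : ravg (fun=> v) = v.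
Proof.
apply: ravg_unique; first exact: cst_continuous.
by apply: cvg_near_cst; near=> N; apply: rsum_cst; near: N; exists 1%N.
Unshelve. all: by end_near. Qed.

Lemma ravg_linear (Y : banachType R) (T : {linear X -> Y}) f : continuous T -> continuous f ->
  T (ravg f) = limn (fun N => (N%:R^-1 : R)%:C%C *: \sum_(i < N) T (f (i%:R / N%:R))).
Proof.
move=> cT cf; apply/esym/cvg_lim => //.
have -> : (fun N => (N%:R^-1 : R)%:C%C *: \sum_(i < N) T (f (i%:R / N%:R))) = T \o rsum f.
  apply/funext => N /=; rewrite /rsum (linearZZ T); congr (_ *: _).
  by rewrite linear_sum.
by apply: continuous_cvg; [exact: cT|exact: cvg_ravg].
Qed.

Lemma ravgD f g : continuous f -> continuous g -> ravg (fun s => f s + g s) = ravg f + ravg g.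
Proof.
move=> cf cg; apply: ravg_unique; first by move=> s; apply: cvgD; [exact: cf|exact: cg].
have -> : rsum (fun s => f s + g s) = fun N => rsum f N + rsum g N.
  by apply/funext => N; rewrite /rsum big_split scalerDr.
by apply: cvgD; exact: cvg_ravg.
Qed.

Lemma ravgB f g : continuous f -> continuous g -> ravg (fun s => f s - g s) = ravg f - ravg g.
Proof.
move=> cf cg; apply: ravg_unique; first by move=> s; apply: cvgB; [exact: cf|exact: cg].
have -> : rsum (fun s => f s - g s) = fun N => rsum f N - rsum g N.
  by apply/funext => N; rewrite rsumB.
by apply: cvgB; exact: cvg_ravg.
Qed.

Lemma ravg_lattice f H : (0 < H)%N -> continuous f ->
  ravg f = (H%:R^-1 : R)%:C%C *: \sum_(r < H) ravg (fun s => f ((r%:R + s) / H%:R)).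
Proof.
move=> H0 cf; have ci r : continuous (fun s : R => f ((r%:R + s) / H%:R)).
  move=> s; apply: (@continuous_comp _ _ _ (fun s : R => (r%:R + s) / H%:R) f); last exact: cf.
  by apply: cvgM; [apply: cvgD; [exact: cvg_cst|exact: cvg_id]|exact: cvg_cst].
have h1 : rsum f (H * N.+1) @[N --> \oo] --> ravg f.
  apply/cvg_rnorm_seqP => e e0; have [N0 hN] := (cvg_rnorm_seqP _ _).1 (cvg_ravg cf) e e0.
  exists N0 => N NN; apply: hN; apply: leq_trans NN _; apply: leq_trans (leqnSn N) _.
  exact: leq_pmull.
transitivity (limn (fun N => rsum f (H * N.+1))); first by apply/esym/cvg_lim.
apply: cvg_lim => //.
have -> : (fun N => rsum f (H * N.+1)) = (fun N => (H%:R^-1 : R)%:C%C *: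
    \sum_(r < H) rsum (fun s => f ((r%:R + s) / H%:R)) N.+1).
  by apply/funext => N; rewrite rsum_refine.
have cs (s : seq 'I_H) : (fun N => \sum_(r <- s) rsum (fun s => f ((r%:R + s) / H%:R)) N.+1) @ \oo -->
    \sum_(r <- s) ravg (fun s => f ((r%:R + s) / H%:R)).
  elim: s => [|r s IH].
    by under eq_fun do rewrite big_nil; rewrite big_nil; exact: cvg_cst.
  rewrite big_cons; under eq_fun do rewrite big_cons.
  apply: cvgD IH.
  apply/cvg_rnorm_seqP => e e0; have [N0 hN] := (cvg_rnorm_seqP _ _).1 (cvg_ravg (ci r)) e e0.
  by exists N0 => N NN; apply: hN; exact: leq_trans NN _.
by apply: cvgZr; exact: cs.
Qed.

End Average.

Section OneParameter.
Context {R : realType} {X : banachType R}.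

Definition one_param (x : R -> {linear X -> X}) : Prop :=
  [/\ forall v, x 0 v = v, forall a b v, x (a + b) v = x a (x b v),
      forall a, continuous (x a) & forall v, continuous (fun a => x a v)].

Definition avg (x : R -> {linear X -> X}) (A : R) (v : X) : X := ravg (fun s => x (A * s) v).

Implicit Types (x : R -> {linear X -> X}) (A W : R) (v : X).

Lemma one_param_scale x (c A : R) v : one_param x -> continuous (fun s => x (c + A * s) v).
Proof.
move=> [_ _ _ cx] s; apply: (@continuous_comp _ _ _ (fun s : R => c + A * s) (fun a => x a v)).
  by apply: cvgD; [exact: cvg_cst|apply: cvgM; [exact: cvg_cst|exact: cvg_id]].
exact: cx.
Qed.

Lemma one_param_scale0 x A v : one_param x -> continuous (fun s => x (A * s) v).
Proof.
move=> ox; have := @one_param_scale x 0 A v ox.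
by under eq_fun do rewrite add0r.
Qed.

Lemma one_paramC x a b v : one_param x -> x a (x b v) = x b (x a v).
Proof. by move=> [_ xD _ _]; rewrite -!xD addrC. Qed.

Lemma one_paramK x a v : one_param x -> x a (x (- a) v) = v.
Proof. by move=> [x0 xD _ _]; rewrite -xD subrr x0. Qed.

Lemma one_param_opp x : one_param x -> one_param (fun a => x (- a)).
Proof.
move=> [x0 xD xc cx]; split=> [v|a b v|a|v]; rewrite ?oppr0 ?opprD //.
move=> a; apply: (@continuous_comp _ _ _ (fun a : R => - a) (fun a => x a v)); last exact: cx.
by apply: cvgN; exact: cvg_id.
Qed.

Lemma avg_le x A W v : one_param x -> 0 <= A ->
  (forall a, `|a| <= A -> rnorm (x a v) <= W) -> rnorm (avg x A v) <= W.
Proof.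
move=> ox A0 xW; apply: ravg_le; first exact: one_param_scale0.
by move=> s /andP[s0 s1]; apply: xW; rewrite ger0_norm ?mulr_ge0 // ler_piMr.
Qed.

Lemma avg_comm x (T : {linear X -> X}) A v : one_param x -> continuous T ->
  (forall a w, T (x a w) = x a (T w)) -> T (avg x A v) = avg x A (T v).
Proof.
move=> ox cT Tx; rewrite ravg_linear //; last exact: one_param_scale0.
by rewrite /avg /ravg; congr (limn _); apply/funext => N; rewrite /rsum; congr (_ *: _); apply: eq_bigr => i _.
Qed.

Lemma avg_is_linear x A : one_param x -> linear (avg x A).
Proof.
move=> ox a u v; have cs w := @one_param_scale0 x A w ox; rewrite /avg.
have -> : (fun s => x (A * s) (a *: u + v)) = fun s => a *: x (A * s) u + x (A * s) v.
  by apply/funext => s; rewrite linearP.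
rewrite ravgD //; last by move=> s; apply: cvgZr; exact: cs.
congr (_ + _); apply: ravg_unique; first by move=> s; apply: cvgZr; exact: cs.
have -> : rsum (fun s => a *: x (A * s) u) = fun N => a *: rsum (fun s => x (A * s) u) N.
  by apply/funext => N; rewrite /rsum -scaler_sumr !scalerA mulrC.
by apply: cvgZr; apply: cvg_ravg; exact: cs.
Qed.

Lemma avgB x A u v : one_param x -> avg x A (u - v) = avg x A u - avg x A v.
Proof.
move=> ox; have := avg_is_linear A ox (-1) v u.
by rewrite !scaleN1r (addrC (- v)) => ->; rewrite addrC.
Qed.

Lemma avg_sum x A (I : Type) (s : seq I) (F : I -> X) : one_param x ->
  avg x A (\sum_(i <- s) F i) = \sum_(i <- s) avg x A (F i).
Proof.
move=> ox; pose L : {linear X -> X} :=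
  HB.pack (avg x A) (GRing.isLinear.Build _ _ _ _ _ (avg_is_linear A ox)).
exact: (linear_sum L).
Qed.

Lemma avgZ x A a v : one_param x -> avg x A (a *: v) = a *: avg x A v.
Proof.
move=> ox; pose L : {linear X -> X} :=
  HB.pack (avg x A) (GRing.isLinear.Build _ _ _ _ _ (avg_is_linear A ox)).
exact: (linearZZ L).
Qed.

Lemma avg_fixed x A v : (forall a, x a v = v) -> avg x A v = v.
Proof.
move=> xv; rewrite /avg (_ : (fun s => _) = fun=> v); first exact: ravg_cst.
by apply/funext => s.
Qed.

Lemma avg_lattice x A H v : (0 < H)%N -> one_param x ->
  avg x A v = (H%:R^-1 : R)%:C%C *: \sum_(r < H) x (A * (r%:R / H%:R)) (avg x (A / H%:R) v).
Proof.
move=> H0 ox; have [_ xD xc _] := ox; rewrite /avg (ravg_lattice H0) //; last exact: one_param_scale0.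
congr (_ *: _); apply: eq_bigr => r _.
rewrite -/(avg x (A / H%:R) v) (avg_comm _ _ ox) //; last by move=> a w; exact: one_paramC.
rewrite /avg; congr ravg; apply/funext => s; rewrite -xD; congr (x _ v).
by field; rewrite pnatr_eq0 -lt0n.
Qed.

(** Consecutive dyadic averages differ by half the difference of the means over the adjacent
    intervals [0, A] and [A, 2 A], the continuous form of the two boxes in [line_mat]. *)
Lemma avg_double x A v : one_param x ->
  avg x A v - avg x (2 * A) v = (2^-1 : R)%:C%C *: (avg x A v - x A (avg x A v)).
Proof.
move=> ox; have [x0 _ _ _] := ox; rewrite (@avg_lattice x (2 * A) 2) // 2!big_ord_recl big_ord0 addr0 /=.
rewrite mul0r mulr0 x0 (_ : 2 * A * (1%:R / 2%:R) = A); last by field.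
rewrite (_ : 2 * A / 2%:R = A); last by field.
set u := avg x A v; rewrite -{1}[u]scale1r (_ : (1 : R[i]) = (2^-1 + 2^-1 : R)%:C%C).
  by rewrite rmorphD scalerDl scalerBr scalerDr opprD addrA addrK.
by congr (_%:C%C); field.
Qed.

(** A translation by the fraction [tau] of the interval changes only two end pieces of that relative
    length. For tau = k / N this is a telescoping sum over N pieces; the general case is a limit of
    rational ones. *)
Lemma avg_shift x A W v (tau : R) : one_param x -> 0 <= A -> 0 <= tau <= 1 ->
  (forall a, `|a| <= 2 * A -> rnorm (x a v) <= W) ->
  rnorm (avg x A (x (A * tau) v) - avg x A v) <= 2 * W * tau.
Proof.
move=> ox A0 /andP[t0 t1] xW; have [x0 xD xc cx] := ox.
have W0 : 0 <= W by apply: le_trans (xW 0 _); rewrite ?rnorm_ge0 // normr0 mulr_ge0.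
have rat (N k : nat) : (0 < N)%N -> (k <= N)%N ->
    rnorm (avg x A (x (A * (k%:R / N%:R)) v) - avg x A v) <= 2 * W * (k%:R / N%:R).
  move=> N0 kN; have Nr : 0 < N%:R :> R by rewrite ltr0n.
  pose g (r : nat) := avg x (A / N%:R) (x (A * (r%:R / N%:R)) v).
  have gW r : (r < N + k)%N -> rnorm (g r) <= W.
    move=> rN; apply: avg_le => //; first by rewrite divr_ge0 ?(ltW Nr).
    move=> a aN; rewrite -xD; apply: xW; apply: le_trans (ler_normD _ _) _.
    rewrite [X in _ + X]ger0_norm ?mulr_ge0 ?divr_ge0 ?(ltW Nr) //.
    apply: le_trans (lerD aN (lexx _)) _.
    have -> : A / N%:R + A * (r%:R / N%:R) = A * (r.+1%:R / N%:R).
      by rewrite -natr1; field; rewrite gt_eqF.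
    rewrite mulrC ler_wpM2r // ler_pdivrMr // -natrM ler_nat; lia.
  have xg (r k' : nat) : x (A * (r%:R / N%:R)) (avg x (A / N%:R) (x (A * (k'%:R / N%:R)) v)) = g (r + k')%N.
    rewrite (avg_comm _ _ ox) //; last by move=> a w; exact: one_paramC.
    by rewrite -xD /g natrD; congr (avg _ _ (x _ _)); ring.
  have E : avg x A (x (A * (k%:R / N%:R)) v) - avg x A v =
      (N%:R^-1 : R)%:C%C *: (\sum_(r < N) g (r + k)%N - \sum_(r < N) g r).
    rewrite (@avg_lattice x A N (x _ v)) // (@avg_lattice x A N v) // -scalerBr.
    congr (_ *: (_ - _)); apply: eq_bigr => r _; first exact: xg.
    by have := xg r 0%N; rewrite mul0r mulr0 x0 addn0.
  rewrite E rnormZr gtr0_norm ?invr_gt0 // ler_pdivrMl //.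
  have -> : N%:R * (2 * W * (k%:R / N%:R)) = 2 * W * k%:R by field; rewrite gt_eqF.
  have tel M : \sum_(r < M) g (r + k)%N - \sum_(r < M) g r = \sum_(r < k) (g (M + r)%N - g r).
    elim: M => [|M IH].
      by rewrite !big_ord0 subrr; apply/esym/big1 => r _; rewrite add0n subrr.
    have hl : \sum_(r < k.+1) g (M + r)%N = \sum_(r < k) g (M + r)%N + g (M + k)%N.
      by rewrite big_ord_recr.
    have hr : \sum_(r < k.+1) g (M + r)%N = g M + \sum_(r < k) g (M.+1 + r)%N.
      by rewrite big_ord_recl addn0; congr (_ + _); apply: eq_bigr => r _; rewrite lift0 addSnnS.
    rewrite !big_ord_recr /= opprD addrACA IH !sumrB.
    have <- : g M + \sum_(r < k) g (M.+1 + r)%N - g M = \sum_(r < k) g (M.+1 + r)%N.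
      by rewrite addrAC subrr add0r.
    by rewrite -hr hl addrAC !addrA [X in X - _]addrAC.
  rewrite tel; apply: le_trans (ler_rnorm_sum _ _ _) _.
  apply: le_trans (_ : \sum_(r < k) (2 * W) <= _); last by rewrite sumr_const card_ord -[leLHS]mulr_natr.
  apply: ler_sum => r _; apply: le_trans (ler_rnormB _ _) _.
  have g1 := gW (N + r)%N; have g2 := gW r; have rk := ltn_ord r.
  rewrite ltn_add2l rk in g1; rewrite (leq_trans rk (leq_addl _ _)) in g2.
  by have := g1 isT; have := g2 isT; lra.
have cF : continuous (fun t : R => avg x A (x (A * t) v)).
  have -> : (fun t : R => avg x A (x (A * t) v)) = (fun t : R => x (A * t) (avg x A v)).
    by apply/funext => t; rewrite (avg_comm _ _ ox) //; move=> a w; exact: one_paramC.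
  exact: one_param_scale0.
have h : rnorm (avg x A (x (A * ((Num.floor (tau * m.+1%:R))%:~R / m.+1%:R)) v) - avg x A v) @[m --> \oo]
    --> rnorm (avg x A (x (A * tau) v) - avg x A v).
  apply: cvg_rnorm; apply: cvgB; last exact: cvg_cst.
  by apply: (@continuous_cvg _ _ _ _ _ _ (fun t : R => avg x A (x (A * t) v))); [exact: cF|exact: floor_grid_cvg].
have h' : 2 * W * ((Num.floor (tau * m.+1%:R))%:~R / m.+1%:R) @[m --> \oo] --> 2 * W * tau.
  by apply: cvgM; [exact: cvg_cst|exact: floor_grid_cvg].
apply: ler_cvg_to h h' _; apply: nearW => m.
have m0 : 0 < m.+1%:R :> R by rewrite ltr0n.
have f0 : (0 <= Num.floor (tau * m.+1%:R))%R by rewrite floor_ge0 mulr_ge0.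
have Ek : (Num.floor (tau * m.+1%:R))%:~R = (absz (Num.floor (tau * m.+1%:R)))%:R :> R.
  by rewrite -[in LHS](gez0_abs f0).
rewrite Ek; apply: rat => //; rewrite -(ler_nat R) -Ek.
by apply: le_trans (ge_floor _) _; rewrite ?num_real // ler_piMl.
Qed.

Lemma avg_cvg0 x v (c : nat -> R) : one_param x -> c m @[m --> \oo] --> (0 : R) ->
  avg x (c m) v @[m --> \oo] --> v.
Proof.
move=> ox c0; have [x0 _ _ cx] := ox; apply/cvg_rnorm_seqP => e e0.
have e20 : 0 < e / 2 by rewrite divr_gt0.
have [d d0 hd] := (continuous_rnorm_realP _ _).1 (cx v 0) _ e20.
have /cvgrPdist_lt/(_ d d0)[N _ hN] := c0.
exists N => n Nn; have := hN n Nn; rewrite /= sub0r normrN => cd.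
apply: (@le_lt_trans _ _ (e / 2)); last by lra.
have cs := @one_param_scale0 x (c n) v ox.
rewrite -[X in _ - X](ravg_cst v) /avg -ravgB //; last exact: cst_continuous.
apply: ravg_le => [s|s /andP[s0 s1]].
  by apply: cvgB; [exact: cs|exact: cvg_cst].
have := hd (c n * s); rewrite x0 subr0 => h; apply/ltW/h.
rewrite normrM (ger0_norm s0); apply: le_lt_trans cd.
by rewrite ler_piMr.
Qed.

End OneParameter.

(** * Heisenberg groups *)

Section Reversal.
Context {R : realType} {X : banachType R}.

(** The substitution s -> 1 - s. It exchanges a group with its inverse, hence the two signs in
    [heisenberg]. *)
Lemma avg_rev (x : R -> {linear X -> X}) A v : one_param x ->
  avg x A v = x A (avg (fun a => x (- a)) A v).
Proof.
move=> ox; have [x0 xD xc cx] := ox; have ox' := one_param_opp ox.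
rewrite (avg_comm _ _ ox') //; last by move=> a w; exact: one_paramC.
pose f s := x (A * s) v.
have cf : continuous f by exact: one_param_scale0.
have E : (fun s => x (- (A * s)) (x A v)) = fun s => f (1 - s).
  by apply/funext => s; rewrite -xD /f; congr (x _ v); ring.
rewrite {2}/avg E; apply/esym.
have cf1 : continuous (fun s : R => f (1 - s)).
  move=> s; apply: (@continuous_comp _ _ _ (fun s : R => 1 - s) f); last exact: cf.
  by apply: cvgB; [exact: cvg_cst|exact: cvg_id].
apply: ravg_unique => //.
(* Reversal turns left endpoints into right endpoints, an error of order 1 / N; the case N = 0
   follows the convention of [rsum]. *)
have -> : rsum (fun s => f (1 - s)) = fun N => rsum f N + (N%:R^-1 : R)%:C%C *: (if N is 0%N then 0 else f 1 - f 0).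
  apply/funext => -[|N]; first by rewrite /rsum !big_ord0 !scaler0 addr0.
  have N0 : N.+1%:R != 0 :> R by rewrite pnatr_eq0.
  rewrite /rsum -scalerDr; congr (_ *: _).
  rewrite (reindex_inj rev_ord_inj) /= big_ord_recr [in RHS]big_ord_recl /= mul0r.
  have -> : 1 - (N.+1 - N.+1)%:R / N.+1%:R = 1 :> R by rewrite subnn mul0r subr0.
  rewrite [RHS]addrAC [f 0 + _]addrC subrK [RHS]addrC; congr (_ + _).
  apply: eq_bigr => i _; congr f.
  have -> : (N.+1 - i.+1)%:R = N.+1%:R - i.+1%:R :> R by rewrite natrB // ltnS ltnW.
  by rewrite mulrBl divff // opprB addrC subrK.
rewrite -[X in _ --> X]addr0; apply: cvgD; first exact: cvg_ravg.
apply/cvg_rnorm_seqP => e e0.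
exists (Num.trunc (rnorm (f 1 - f 0) / e)).+1 => -[|N] // hN.
have N0 : 0 < N.+1%:R :> R by rewrite ltr0n.
rewrite subr0 rnormZr gtr0_norm ?invr_gt0 // ltr_pdivrMl // -ltr_pdivrMr //.
apply: lt_le_trans (_ : (Num.trunc (rnorm (f 1 - f 0) / e)).+1%:R <= _); last by rewrite ler_nat.
by apply: truncnS_gt; exact: num_real.
Qed.

End Reversal.

Section AverageLinear.
Context {R : realType} {X : banachType R} (x : R -> {linear X -> X}) (A : R).
Hypothesis ox : one_param x.

Lemma avg0 : avg x A 0 = 0.
Proof. by rewrite -[X in avg _ _ X](subrr 0) avgB // subrr. Qed.

Lemma avgD u v : avg x A (u + v) = avg x A u + avg x A v.
Proof. by rewrite -{1}(opprK v) avgB // -[- v]sub0r avgB // avg0 sub0r opprK. Qed.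

End AverageLinear.

Section Heisenberg.
Context {R : realType} {X : banachType R}.
Variables (C eps : R).
Hypotheses (C0 : 0 <= C) (eps0 : 0 < eps) (eps1 : eps <= 2^-1)
  (decay : forall n, (0 < n)%N ->
     mat_bound X (@line_mat R n (line_height n) (2 * n * line_height n))
       (C * expR (- (eps * ln n%:R)))).

Definition bounded_on (x : R -> {linear X -> X}) (A W : R) :=
  forall a v, `|a| <= A -> rnorm (x a v) <= W * rnorm v.

(** [sg] is the sign of the commutator; exchanging x and y, or inverting all three groups, changes
    it. *)
Definition heisenberg (x y z : R -> {linear X -> X}) (sg : R) :=
  [/\ one_param x, one_param y, one_param z,
      forall a b v, x a (y b v) = y b (x a (z (sg * (a * b)) v)) &
      forall a b v, x a (z b v) = z b (x a v) /\ y a (z b v) = z b (y a v)].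

Lemma sum_box_shift (V : lmodType R[i]) (f : nat -> V) U s H : (s + H <= U)%N ->
  \sum_(u < U) ((box s H u)%:R : R)%:C%C *: f u = \sum_(r < H) f (s + r)%N.
Proof.
move=> sU; have -> : U = (s + (H + (U - s - H)))%N by lia.
rewrite big_split_ord big_split_ord /= big1 ?add0r.
  rewrite [X in _ + X]big1 ?addr0.
    apply: eq_bigr => r _; rewrite /box /= leq_addr /= ltn_add2l ltn_ord.
    by rewrite scale1r.
  move=> k _; rewrite /box /= addnA (ltnNge _ (s + H)) leq_addr andbF.
  by rewrite scale0r.
by move=> k _; rewrite /box leqNgt ltn_ord /= scale0r.
Qed.

(** Cutting the averages into H pieces exhibits the numerators of [line_mat] at a fixed r as the
    coefficients, with vectors that do not depend on s. *)
Lemma shifted_half_difference (z : R -> {linear X -> X}) (c : R) H U s v : one_param z -> (0 < H)%N -> (s + 2 * H <= U)%N ->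
  z (c * (s%:R / H%:R)) (avg z c v - avg z (2 * c) v) =
  ((2 * H%:R)^-1 : R)%:C%C *: \sum_(u < U)
     ((box s H u)%:R - (box (s + H) H u)%:R : R)%:C%C *:
       z (c * (u%:R / H%:R)) (avg z (c / H%:R) v).
Proof.
move=> oz H0 sU; have [z0 zD zc cz] := oz.
have Hr : H%:R != 0 :> R by rewrite pnatr_eq0 -lt0n.
pose f (u : nat) := z (c * (u%:R / H%:R)) (avg z (c / H%:R) v).
have E : z (c * (s%:R / H%:R)) (avg z c v) = (H%:R^-1 : R)%:C%C *: \sum_(r < H) f (s + r)%N.
  rewrite (avg_lattice c v H0 oz) (linearZZ (z _)) linear_sum; congr (_ *: _).
  by apply: eq_bigr => r _; rewrite -zD /f natrD mulrDl mulrDr.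
have E2 : z (c * (s%:R / H%:R)) (z c (avg z c v)) = (H%:R^-1 : R)%:C%C *: \sum_(r < H) f (s + H + r)%N.
  rewrite -zD (avg_lattice c v H0 oz) (linearZZ (z _)) linear_sum; congr (_ *: _).
  apply: eq_bigr => r _; rewrite -zD /f !natrD; congr (z _ _); by field.
rewrite avg_double // (linearZZ (z _)) linearB /= E E2 -scalerBr scalerA -rmorphM -invfM.
congr (_ *: _); rewrite -(sum_box_shift f (U := U)); last by lia.
rewrite -(sum_box_shift f (U := U)); last by lia.
by rewrite -sumrB; apply: eq_bigr => u _; rewrite -scalerBl -rmorphB.
Qed.

Lemma line_point_le n H (j l : 'I_n) (r : 'I_H) : (l * H + r * j + 2 * H <= 2 * n * H)%N.
Proof.
have h1 : (l.+1 * H <= n * H)%N by rewrite leq_mul2r ltn_ord orbT.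
have h2 : (r * j <= H * j)%N by rewrite leq_mul2r (ltnW (ltn_ord r)) orbT.
have h3 : (j.+1 * H <= n * H)%N by rewrite leq_mul2r ltn_ord orbT.
by rewrite !mulSn in h1 h3; lia.
Qed.

Section Positive.
Variables (x y z : R -> {linear X -> X}).
Hypothesis hxyz : heisenberg x y z 1.

(** Shifting y by B tau2 and x by A tau1 under their averages costs only O(rho). Commuting the two
    shifts produces z at A B rho^2 (r / H) (j / n), which is c r j / H by the choice of [rho]; so,
    averaged over r, the difference of z-averages is spread along a line of slope j. A translation
    by c l along z brings it to the line (j, l). The same vector is thus estimated through each of
    the n^2 lines, and [decay] bounds the sum of these estimates. *)
Lemma heisenberg_lines (A B c W : R) n (rho : R) v : 0 < A -> 0 < B -> 0 < c -> (0 < n)%N -> 1 <= W ->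
  0 <= rho <= 1 -> rho ^+ 2 * (A * B) = n%:R * c -> n%:R * c <= A * B ->
  bounded_on x (2 * A) W -> bounded_on y (2 * B) W -> bounded_on z (2 * (A * B)) W ->
  rnorm (avg x A (avg y B (avg z c v - avg z (2 * c) v))) <=
    W ^+ 7 * (8 * rho + C * expR (- (eps * ln n%:R))) * rnorm v.
Proof.
move=> A0 B0 c0 n0 W1 /andP[rho0 rho1] rhoE ncAB bx yb zb.
have [ox oy oz xy xz] := hxyz.
have [x0 xD xc cx] := ox; have [y0 yD yc cy] := oy; have [z0 zD zc cz] := oz.
have W0 : 0 <= W by exact: le_trans W1.
set H := line_height n; have H0 : (0 < H)%N := line_height_gt0 n.
have Hr : 0 < H%:R :> R by rewrite ltr0n.
have nr : 0 < n%:R :> R by rewrite ltr0n.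
have n1 : 1 <= n%:R :> R by rewrite ler1n.
have AB0 : 0 < A * B by rewrite mulr_gt0.
have cAB : c <= A * B by apply: le_trans ncAB; rewrite ler_peMl // ltW.
have nv := rnorm_ge0 v.
have avgx w : rnorm (avg x A w) <= W * rnorm w.
  by apply: avg_le => //; [exact: ltW|move=> a aA; apply: bx; lra].
have avgy w : rnorm (avg y B w) <= W * rnorm w.
  by apply: avg_le => //; [exact: ltW|move=> a aA; apply: yb; lra].
have avgz t w : 0 <= t <= 2 * (A * B) -> rnorm (avg z t w) <= W * rnorm w.
  by move=> /andP[t0 t1]; apply: avg_le => // a aA; apply: zb; apply: le_trans t1.
set w := avg z c v - avg z (2 * c) v.
have nw : rnorm w <= 2 * (W * rnorm v).
  apply: le_trans (ler_rnormB _ _) _.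
  have := avgz c v; have := avgz (2 * c) v.
  rewrite mulr_ge0 ?(ltW c0) //= ler_pM2l // cAB => /(_ isT) h1.
  have c2 : c <= 2 * (A * B) by lra.
  by rewrite c2 => /(_ isT) h2; lra.
have nw0 := rnorm_ge0 w.
pose tau1 (r : nat) : R := rho * (r%:R / H%:R).
pose tau2 (j : nat) : R := rho * (j%:R / n%:R).
have t1 (r : 'I_H) : 0 <= tau1 r <= rho.
  have h : 0 <= ((r : nat)%:R / H%:R : R) <= 1.
    by rewrite divr_ge0 ?(ltW Hr) //= ler_pdivrMr // mul1r ler_nat ltnW.
  by rewrite /tau1; nra.
have t2 (j : 'I_n) : 0 <= tau2 j <= rho.
  have h : 0 <= ((j : nat)%:R / n%:R : R) <= 1.
    by rewrite divr_ge0 ?(ltW nr) //= ler_pdivrMr // mul1r ler_nat ltnW.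
  by rewrite /tau2; nra.
(* One family of vectors serves all lines; the line enters only through the scalars of
   [line_mat]. *)
pose F (e : 'I_H * 'I_(2 * n * H)) : X :=
  x (A * tau1 e.1) (avg y B (z (c * (e.2%:R / H%:R)) (avg z (c / H%:R) v))).
have FW e : rnorm (F e) <= W ^+ 4 * rnorm v.
  have h1 := t1 e.1; have [h2 h3] := andP h1.
  apply: le_trans (bx _ _ _) _.
    by rewrite ger0_norm ?mulr_ge0 ?(ltW A0) //; nra.
  rewrite (_ : W ^+ 4 * rnorm v = W * (W ^+ 3 * rnorm v)); last by ring.
  rewrite ler_wpM2l //; apply: le_trans (avgy _) _.
  rewrite (_ : W ^+ 3 * rnorm v = W * (W ^+ 2 * rnorm v)); last by ring.
  rewrite ler_wpM2l //; apply: le_trans (zb _ _ _) _.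
    rewrite ger0_norm ?mulr_ge0 ?divr_ge0 ?(ltW c0) ?(ltW Hr) //.
    apply: (@le_trans _ _ (c * (2 * n%:R))); last by lra.
    by rewrite ler_pM2l // ler_pdivrMr // -!natrM ler_nat ltnW.
  rewrite expr2 -mulrA ler_wpM2l //; apply: avgz.
  rewrite divr_ge0 ?(ltW c0) ?(ltW Hr) //= ler_pdivrMr //.
  apply: (@le_trans _ _ (2 * (A * B) * 1)); first by lra.
  by rewrite ler_wpM2l ?ler1n // mulr_ge0 // (ltW AB0).
have main (o : 'I_n * 'I_n) : rnorm (avg x A (avg y B w)) <=
    4 * W ^+ 3 * rho * rnorm w +
    W ^+ 3 / 2 * (n%:R ^+ 2 * rnorm (\sum_e (@line_mat R n H (2 * n * H) o e)%:C%C *: F e)).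
  case: o => j l; set Xw := avg x A (avg y B w).
  pose yw := y (B * tau2 j) (avg y B w).
  have [j0 j1] := andP (t2 j).
  have byj u : rnorm (y (B * tau2 j) u) <= W * rnorm u.
    by apply: yb; rewrite ger0_norm ?mulr_ge0 ?(ltW B0) //; nra.
  have e1 : rnorm (Xw - avg x A yw) <= 2 * W ^+ 2 * rho * rnorm w.
    rewrite -avgB //; apply: le_trans (avgx _) _.
    rewrite (_ : 2 * W ^+ 2 * rho * rnorm w = W * (2 * (W * rnorm w) * rho)); last by ring.
    rewrite ler_wpM2l // rnormBC /yw (avg_comm _ _ oy) //; last by move=> a u; exact: one_paramC.
    apply: le_trans (avg_shift oy (ltW B0) _ _) _; first by rewrite j0 (le_trans j1).
      by move=> a aB; apply: yb.
    by rewrite ler_wpM2l // !mulr_ge0.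
  have nyw : rnorm yw <= W ^+ 2 * rnorm w.
    by apply: le_trans (byj _) _; rewrite expr2 -mulrA ler_wpM2l.
  have e2 (r : 'I_H) : rnorm (avg x A yw - avg x A (x (A * tau1 r) yw)) <= 2 * W ^+ 3 * rho * rnorm w.
    have [r0 r1] := andP (t1 r).
    rewrite rnormBC; apply: le_trans (avg_shift ox (ltW A0) _ _) _; first by rewrite r0 (le_trans r1).
      by move=> a aA; apply: bx.
    apply: (@le_trans _ _ (2 * (W * (W ^+ 2 * rnorm w)) * rho)); last by rewrite le_eqVlt; apply/orP; left; apply/eqP; ring.
    apply: ler_pM => //; first by rewrite !mulr_ge0 ?rnorm_ge0.
    by rewrite ler_pM2l // ler_wpM2l.
  (* The translates are averaged over r before any norm is taken, since the cancellation is in this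
     sum. *)
  pose S := (H%:R^-1 : R)%:C%C *: \sum_(r < H) x (A * tau1 r) (z (c * ((r * j)%:R / H%:R)) (avg y B w)).
  have e3 : rnorm (Xw - avg x A (y (B * tau2 j) S)) <= 4 * W ^+ 3 * rho * rnorm w.
    have -> : Xw - avg x A (y (B * tau2 j) S) =
        (H%:R^-1 : R)%:C%C *: \sum_(r < H) (Xw - avg x A (x (A * tau1 r) yw)).
      rewrite sumrB scalerBr; congr (_ - _).
        rewrite sumr_const card_ord -[Xw *+ H]scaler_nat scalerA.
        have -> : (H%:R : R[i]) = (H%:R : R)%:C%C by rewrite rmorph_nat.
        by rewrite -rmorphM mulVf ?gt_eqF // scale1r.
      rewrite /S (linearZZ (y _)) avgZ // linear_sum avg_sum //; congr (_ *: _).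
      apply: eq_bigr => r _; rewrite /yw xy; congr (avg x A (y _ (x _ (z _ _)))).
      rewrite mul1r /tau1 /tau2 natrM.
      have -> : c * (r%:R * j%:R / H%:R) = (n%:R * c) * (r%:R / H%:R) * (j%:R / n%:R).
        by field; rewrite !gt_eqF.
      by rewrite -rhoE; ring.
    rewrite rnormZr gtr0_norm ?invr_gt0 // ler_pdivrMl //.
    apply: le_trans (ler_rnorm_sum _ _ _) _.
    apply: le_trans (_ : \sum_(r < H) (4 * W ^+ 3 * rho * rnorm w) <= _); last by rewrite sumr_const card_ord -[leLHS]mulr_natl.
    apply: ler_sum => r _; apply: le_trans (ler_rnorm_trans (avg x A yw) _ _) _.
    have h1 := e1; have h2 := e2 r; apply: le_trans (lerD h1 h2) _.
    have h3 : W ^+ 2 * (rho * rnorm w) <= W ^+ 3 * (rho * rnorm w).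
      by rewrite ler_wpM2r ?mulr_ge0 // [leRHS]exprS ler_peMl // exprn_ge0.
    by lra.
  have nS : rnorm S <= W / 2 * (n%:R ^+ 2 * rnorm (\sum_e (@line_mat R n H (2 * n * H) (j, l) e)%:C%C *: F e)).
    have E : z (c * l%:R) S = (2^-1 * n%:R ^+ 2 : R)%:C%C *:
        \sum_e (@line_mat R n H (2 * n * H) (j, l) e)%:C%C *: F e.
      rewrite /S (linearZZ (z _)) linear_sum.
      have e4 (r : 'I_H) : z (c * l%:R) (x (A * tau1 r) (z (c * ((r * j)%:R / H%:R)) (avg y B w))) =
          ((2 * H%:R)^-1 : R)%:C%C *: \sum_(u < 2 * n * H)
            ((box (l * H + r * j) H u)%:R - (box (l * H + r * j + H) H u)%:R : R)%:C%C *: F (r, u).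
        rewrite -(xz _ _ _).1 -zD.
        have -> : c * l%:R + c * ((r * j)%:R / H%:R) = c * ((l * H + r * j)%:R / H%:R).
          by rewrite natrD natrM; field; rewrite gt_eqF.
        rewrite (avg_comm _ _ oy) //; last by move=> a u; rewrite (xz _ _ _).2.
        rewrite (@shifted_half_difference z c H (2 * n * H)) //; last first.
          exact: line_point_le.
        rewrite avgZ // (linearZZ (x _)) avg_sum // linear_sum; congr (_ *: _).
        by apply: eq_bigr => u _; rewrite avgZ // (linearZZ (x _)).
      under eq_bigr do rewrite e4.
      rewrite -scaler_sumr scalerA -(pair_bigA _ (fun r u => (@line_mat R n H (2 * n * H) (j, l) (r, u))%:C%C *: F (r, u))) /=.
      rewrite !scaler_sumr; apply: eq_bigr => r _; rewrite !scaler_sumr; apply: eq_bigr => u _.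
      rewrite !scalerA -!rmorphM; congr (_%:C%C *: _); rewrite /line_mat /=.
      by field; rewrite !gt_eqF.
    have -> : S = z (- (c * l%:R)) (z (c * l%:R) S) by rewrite -zD addNr z0.
    apply: le_trans (zb _ _ _) _.
      rewrite normrN ger0_norm ?mulr_ge0 ?(ltW c0) //.
      apply: (@le_trans _ _ (n%:R * c)); last by lra.
      by rewrite mulrC ler_pM2r // ler_nat ltnW.
    rewrite E rnormZr ger0_norm ?mulr_ge0 ?exprn_ge0 ?(ltW nr) //.
    by rewrite le_eqVlt; apply/orP; left; apply/eqP; ring.
  have -> : Xw = (Xw - avg x A (y (B * tau2 j) S)) + avg x A (y (B * tau2 j) S) by rewrite subrK.
  apply: le_trans (ler_rnormD _ _) _; apply: lerD => //.
  apply: le_trans (avgx _) _.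
  set T := n%:R ^+ 2 * _ in nS *.
  rewrite (_ : W ^+ 3 / 2 * T = W * (W * (W / 2 * T))); last by field.
  by rewrite ler_wpM2l //; apply: le_trans (byj _) _; rewrite ler_wpM2l.
have D := mat_bound_scale (decay n0) (r := W ^+ 4 * rnorm v) (x := F) _ FW.
have {D} := D _; rewrite mulr_ge0 ?exprn_ge0 // => /(_ isT) D.
set N := rnorm (avg x A (avg y B w)).
have : \sum_(o : 'I_n * 'I_n) N <= \sum_(o : 'I_n * 'I_n) (4 * W ^+ 3 * rho * rnorm w +
    W ^+ 3 / 2 * (n%:R ^+ 2 * rnorm (\sum_e (@line_mat R n H (2 * n * H) o e)%:C%C *: F e))).
  by apply: ler_sum => o _; exact: main.
have cst (c' : R) : \sum_(o : 'I_n * 'I_n) c' = c' * n%:R ^+ 2.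
  by rewrite sumr_const card_prod card_ord -(mulr_natr c') natrM expr2.
rewrite big_split /= !cst -!mulr_sumr.
set T := \sum_o _ in D * => h.
have n2 : 0 < n%:R ^+ 2 :> R by rewrite exprn_gt0.
have {h} : N <= 4 * W ^+ 3 * rho * rnorm w + W ^+ 3 / 2 * T.
  by rewrite -(ler_pM2r n2); apply: le_trans h _; rewrite [leRHS]mulrDl lerD2l le_eqVlt; apply/orP; left; apply/eqP; ring.
move=> /le_trans; apply.
have W3 : 0 <= W ^+ 3 by rewrite exprn_ge0.
apply: (@le_trans _ _ (4 * W ^+ 3 * rho * (2 * (W * rnorm v)) + W ^+ 3 / 2 *
   (W ^+ 4 * rnorm v * (C * expR (- (eps * ln n%:R)))))).
  by apply: lerD; apply: ler_wpM2l => //; rewrite ?divr_ge0 // !mulr_ge0.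
have e0 := expR_ge0 (- (eps * ln n%:R)); set E := expR _ in e0 *.
have W47 : W ^+ 4 <= W ^+ 7 by rewrite ler_weXn2l.
have h1 : 8 * rho * rnorm v * W ^+ 4 <= 8 * rho * rnorm v * W ^+ 7.
  by rewrite ler_wpM2l // !mulr_ge0.
have h2 : 0 <= W ^+ 7 * (C * E * rnorm v) by rewrite !mulr_ge0 ?exprn_ge0.
have -> : 4 * W ^+ 3 * rho * (2 * (W * rnorm v)) + W ^+ 3 / 2 * (W ^+ 4 * rnorm v * (C * E)) =
  8 * rho * rnorm v * W ^+ 4 + W ^+ 7 * (C * E * rnorm v) / 2 by field.
have -> : W ^+ 7 * (8 * rho + C * E) * rnorm v = 8 * rho * rnorm v * W ^+ 7 + W ^+ 7 * (C * E * rnorm v) by ring.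
by apply: lerD => //; lra.
Qed.

Lemma heisenberg_dyadic_pos (A B c W : R) v : 0 < A -> 0 < B -> 0 < c -> c <= A * B -> 1 <= W ->
  bounded_on x (2 * A) W -> bounded_on y (2 * B) W -> bounded_on z (2 * (A * B)) W ->
  rnorm (avg x A (avg y B (avg z c v - avg z (2 * c) v))) <=
    (8 + 2 * C) * W ^+ 7 * expR (- (eps / 2 * ln (A * B / c))) * rnorm v.
Proof.
move=> A0 B0 c0 cAB W1 bx yb zb.
have AB0 : 0 < A * B by rewrite mulr_gt0.
pose K : R := ln (A * B / c).
have KE : A * B / c = expR K by rewrite lnK // posrE divr_gt0.
have K0 : 0 <= K by rewrite ln_ge0 // ler_pdivlMr // mul1r.
(* With n about sqrt (A B / c), [rho] is about (A B / c)^(-1/4) and n^(-eps) about (A B /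
   c)^(-eps/2); the latter dominates because eps <= 1/2. *)
pose q := expR (K / 2); pose n := Num.trunc q.
have q1 : 1 <= q by rewrite -expR0 ler_expR divr_ge0.
have /andP[nq qn] : n%:R <= q < n.+1%:R by apply: truncn_itv; rewrite (le_trans _ q1).
have n0 : (0 < n)%N by rewrite -ltnS -(ltr_nat R); apply: le_lt_trans qn.
have nr : 0 < n%:R :> R by rewrite ltr0n.
have n1 : 1 <= n%:R :> R by rewrite ler1n.
have cE : c = A * B * expR (- K).
  by rewrite expRN -KE; field; rewrite !gt_eqF.
pose rho : R := Num.sqrt (n%:R * expR (- K)).
have rhoE : rho ^+ 2 * (A * B) = n%:R * c.
  by rewrite sqr_sqrtr ?mulr_ge0 ?expR_ge0 // cE; ring.
have nK : n%:R * expR (- K) <= expR (- (K / 2)).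
  rewrite (_ : - (K / 2) = K / 2 + - K); last by field.
  by rewrite expRD ler_pM2r ?expR_gt0.
have rho1 : rho <= expR (- (K / 4)).
  rewrite -[leRHS]ger0_norm ?expR_ge0 // -sqrtr_sqr ler_wsqrtr // -expRM_natl.
  by rewrite (_ : 2 * - (K / 4) = - (K / 2)) //; field.
have ncAB : n%:R * c <= A * B.
  rewrite cE mulrCA ler_piMr ?(ltW AB0) //; apply: le_trans nK _.
  by rewrite -expR0 ler_expR oppr_le0 divr_ge0.
have h : 0 <= rho <= 1.
  rewrite sqrtr_ge0 (le_trans rho1) // -[leRHS]expR0 ler_expR oppr_le0.
  by rewrite divr_ge0.
apply: le_trans (heisenberg_lines v A0 B0 c0 n0 W1 h rhoE ncAB bx yb zb) _.
rewrite ler_wpM2r ?rnorm_ge0 // -mulrA [leRHS]mulrCA ler_wpM2l ?exprn_ge0 ?(le_trans _ W1) //.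
rewrite [leRHS]mulrDl; apply: lerD.
  rewrite ler_pM2l //; apply: le_trans rho1 _; rewrite ler_expR lerN2 -/K.
  by move: eps1 K0; nra.
rewrite -/K (_ : 2 * C * expR (- (eps / 2 * K)) = C * (2 * expR (- (eps / 2 * K)))); last by ring.
rewrite ler_wpM2l //.
have q2 : q <= 2 * n%:R by move: qn; rewrite -natr1; lra.
have l2 : K / 2 <= ln 2 + ln n%:R by rewrite -lnM ?posrE // -ler_expR lnK // posrE mulr_gt0.
have -> : 2 * expR (- (eps / 2 * K)) = expR (ln 2 - eps / 2 * K) :> R.
  by rewrite expRD lnK // posrE.
rewrite ler_expR; have L2 : 0 <= ln 2 :> R by rewrite ln_ge0 // ler1n.
have h1 : eps * (K / 2) <= eps * (ln 2 + ln n%:R) by rewrite ler_pM2l.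
have h2 : eps * ln 2 <= ln 2 by rewrite ler_piMl // (le_trans eps1) // invf_le1 // ler1n.
by lra.
Qed.

End Positive.

(** For [sg = -1] the group x is replaced by its inverse; [avg_rev] then costs one more factor W. *)
Lemma heisenberg_dyadic x y z sg (A B c W : R) v : heisenberg x y z sg -> sg = 1 \/ sg = -1 ->
  0 < A -> 0 < B -> 0 < c -> c <= A * B -> 1 <= W ->
  bounded_on x (2 * A) W -> bounded_on y (2 * B) W -> bounded_on z (2 * (A * B)) W ->
  rnorm (avg x A (avg y B (avg z c v - avg z (2 * c) v))) <=
    (8 + 2 * C) * W ^+ 8 * expR (- (eps / 2 * ln (A * B / c))) * rnorm v.
Proof.
move=> h sg1 A0 B0 c0 cAB W1 bx yb zb.
have W0 : 0 <= W by exact: le_trans W1.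
have [ox oy oz xy xz] := h.
case: sg1 => sgE.
  rewrite sgE in h; apply: le_trans (heisenberg_dyadic_pos h v A0 B0 c0 cAB W1 bx yb zb) _.
  rewrite ler_wpM2r ?rnorm_ge0 // ler_wpM2r ?expR_ge0 // ler_wpM2l ?addr_ge0 ?mulr_ge0 //.
  by rewrite ler_weXn2l.
have ox' := one_param_opp ox.
have h' : heisenberg (fun a => x (- a)) y z 1.
  split=> // [a b w|a b w]; last by split; [exact: (xz (- a) b w).1|exact: (xz a b w).2].
  by rewrite xy sgE; congr (y _ (x _ (z _ _))); ring.
rewrite avg_rev //; apply: le_trans (bx _ _ _) _; first by rewrite ger0_norm ?(ltW A0) //; lra.
have bx' : bounded_on (fun a => x (- a)) (2 * A) W by move=> a w aA; apply: bx; rewrite normrN.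
rewrite exprS -[X in _ <= X * _ * _](mulrCA W) -!(mulrA W) ler_wpM2l //.
exact: (heisenberg_dyadic_pos h' v A0 B0 c0 cAB W1 bx' yb zb).
Qed.

(** Sum of the dyadic estimates at the scales c / 2^k: a geometric series, as each halving gains the
    factor q = 2^(-eps/2), while the averages over [0, c / 2^k] tend to v. *)
Lemma heisenberg_absorb : exists2 D : R, 0 <= D &
  forall x y z sg (A B c W : R) v, heisenberg x y z sg -> sg = 1 \/ sg = -1 ->
  0 < A -> 0 < B -> 0 < c -> c <= A * B -> 1 <= W ->
  bounded_on x (2 * A) W -> bounded_on y (2 * B) W -> bounded_on z (2 * (A * B)) W ->
  rnorm (avg x A (avg y B (v - avg z c v))) <=
    D * W ^+ 8 * expR (- (eps / 2 * ln (A * B / c))) * rnorm v.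
Proof.
pose q : R := expR (- (eps / 2 * ln 2)).
have q0 : 0 < q by exact: expR_gt0.
have q1 : q < 1.
  by rewrite -expR0 ltr_expR oppr_lt0 mulr_gt0 ?divr_gt0 // ln_gt0 // ltr1n.
exists ((8 + 2 * C) * (1 - q)^-1).
  by rewrite mulr_ge0 ?addr_ge0 ?mulr_ge0 // invr_ge0 subr_ge0 ltW.
move=> x y z sg A B c W v h sg1 A0 B0 c0 cAB W1 bx yb zb.
have [ox oy oz xy xz] := h; have [z0 zD zc cz] := oz.
have W0 : 0 <= W by exact: le_trans W1.
pose ck (k : nat) : R := c / 2 ^+ k.
have ck0 k : 0 < ck k by rewrite divr_gt0 ?exprn_gt0.
have ckS k : 2 * ck k.+1 = ck k.
  by rewrite /ck exprS; field; rewrite expf_neq0.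
have ckAB k : ck k <= A * B.
  by apply: le_trans cAB; rewrite ler_pdivrMr ?exprn_gt0 // ler_peMr ?(ltW c0) // exprn_ege1 // ler1n.
set K : R := ln (A * B / c); set M := (8 + 2 * C) * W ^+ 8 * expR (- (eps / 2 * K)) * rnorm v.
have M0 : 0 <= M.
  by rewrite !mulr_ge0 ?rnorm_ge0 ?expR_ge0 ?exprn_ge0 // addr_ge0 // mulr_ge0.
have XYD u w : avg x A (avg y B (u + w)) = avg x A (avg y B u) + avg x A (avg y B w).
  by rewrite !avgD.
have step k : rnorm (avg x A (avg y B (avg z (ck k.+1) v - avg z (ck k) v))) <= M * q ^+ k.+1.
  have hd := heisenberg_dyadic v h sg1 A0 B0 (ck0 k.+1) (ckAB k.+1) W1 bx yb zb.
  rewrite ckS in hd; apply: le_trans hd _.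
  have -> : ln (A * B / ck k.+1) = K + k.+1%:R * ln 2.
    rewrite /ck invf_div mulrA [A * B * _ / _]mulrAC lnM ?posrE ?divr_gt0 ?exprn_gt0 ?mulr_gt0 //.
    by rewrite lnXn // mulr_natl.
  rewrite mulrDr opprD expRD.
  have -> : expR (- (eps / 2 * (k.+1%:R * ln 2))) = q ^+ k.+1.
    by rewrite /q -expRM_natl; congr expR; ring.
  by rewrite le_eqVlt; apply/orP; left; apply/eqP; rewrite /M; ring.
have tele m : rnorm (avg x A (avg y B (avg z (ck m) v - avg z c v))) <= M * (1 - q)^-1.
  apply: (@le_trans _ _ (M * \sum_(k < m) q ^+ k)); last first.
    rewrite ler_wpM2l // -(ler_pM2l (_ : 0 < 1 - q)) ?subr_gt0 // divff ?gt_eqF ?subr_gt0 //.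
    have -> : (1 - q) * (\sum_(k < m) q ^+ k) = 1 - q ^+ m by rewrite -(opprB q 1) mulNr -subrX1 opprB.
    by rewrite gerBl exprn_ge0 // ltW.
  elim: m => [|m IH].
    have -> : ck 0%N = c by rewrite /ck expr0 divr1.
    by rewrite subrr !avg0 // rnorm0 big_ord0 mulr0.
  have -> : avg z (ck m.+1) v - avg z c v =
      (avg z (ck m.+1) v - avg z (ck m) v) + (avg z (ck m) v - avg z c v) by rewrite subrKA.
  rewrite XYD big_ord_recr /= mulrDr addrC; apply: le_trans (ler_rnormD _ _) _.
  apply: (lerD IH); have hs := step m; apply: (le_trans hs).
  by rewrite ler_wpM2l // exprS ler_piMl ?exprn_ge0 // ltW.
have W2 u : rnorm (avg x A (avg y B u)) <= W ^+ 2 * rnorm u.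
  have h1 w : rnorm (avg x A w) <= W * rnorm w.
    by apply: avg_le => //; [exact: ltW|move=> a aA; apply: bx; lra].
  have h2 w : rnorm (avg y B w) <= W * rnorm w.
    by apply: avg_le => //; [exact: ltW|move=> a aA; apply: yb; lra].
  by apply: le_trans (h1 _) _; rewrite expr2 -mulrA ler_wpM2l.
have -> : (8 + 2 * C) * (1 - q)^-1 * W ^+ 8 * expR (- (eps / 2 * K)) * rnorm v = M * (1 - q)^-1.
  by rewrite /M; ring.
apply/ler_addgt0Pr => e e0.
have cv : ck m @[m --> \oo] --> (0 : R).
  have -> : ck = fun m => c * (2^-1) ^+ m by apply/funext => m; rewrite /ck exprVn.
  rewrite -[X in _ --> X](mulr0 c); apply: cvgM; first exact: cvg_cst.
  by apply: cvg_expr; rewrite ger0_norm ?invr_ge0 // invf_lt1 // ltr1n.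
have e1 : 0 < e / W ^+ 2 by rewrite divr_gt0 ?exprn_gt0 // (lt_le_trans _ W1).
have [N hN] := (cvg_rnorm_seqP _ _).1 (@avg_cvg0 _ _ z v _ oz cv) _ e1.
have -> : v - avg z c v = (avg z (ck N) v - avg z c v) + (v - avg z (ck N) v) by rewrite [RHS]addrC subrKA.
rewrite XYD; apply: le_trans (ler_rnormD _ _) _; apply: (lerD (tele N)).
have h2 := W2 (v - avg z (ck N) v); apply: (le_trans h2); rewrite rnormBC.
rewrite -ler_pdivlMl ?exprn_gt0 ?(lt_le_trans _ W1) // mulrC.
by apply/ltW/hN.
Qed.

End Heisenberg.

Section Limits.
Context {R : realType}.

Lemma expR_geometric_cvg0 (K a : R) : 0 < a -> K * expR (- (a * m%:R)) @[m --> \oo] --> (0 : R).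
Proof.
move=> a0; rewrite -[X in _ --> X](mulr0 K); apply: cvgM; first exact: cvg_cst.
have -> : (fun m => expR (- (a * m%:R)) : R) = fun m => expR (- a) ^+ m.
  by apply/funext => m; rewrite -expRM_natl; congr expR; ring.
by apply: cvg_expr; rewrite ger0_norm ?expR_ge0 // -expR0 ltr_expR oppr_lt0.
Qed.

Lemma rnorm_eq0_cvg (X : normedModType R[i]) (v : X) (u : nat -> R) n0 :
  u n @[n --> \oo] --> (0 : R) -> (forall n, (n0 <= n)%N -> rnorm v <= u n) -> v = 0.
Proof.
move=> u0 vu; apply: rnorm0_eq0; apply/eqP; rewrite eq_le rnorm_ge0 andbT.
apply: ler_cvg_to (cvg_cst (rnorm v)) u0 _.
by exists n0 => // n /= /vu.
Qed.

Lemma geometric_cauchy (X : banachType R) (u : nat -> X) (K g : R) n0 : 0 <= K -> 0 <= g -> g < 1 ->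
  (forall n, (n0 <= n)%N -> rnorm (u n - u n.+1) <= K * g ^+ n) ->
  u n @[n --> \oo] --> limn u /\
  forall n, (n0 <= n)%N -> rnorm (u n - limn u) <= K / (1 - g) * g ^+ n.
Proof.
move=> K0 g0 g1 h.
have g1' : 0 < 1 - g by rewrite subr_gt0.
have tel n m : (n0 <= n)%N -> rnorm (u n - u (n + m)%N) <= K / (1 - g) * g ^+ n.
  move=> n0n; apply: (@le_trans _ _ (K / (1 - g) * g ^+ n * (1 - g ^+ m))); last first.
    apply: ler_piMr; last by rewrite gerBl exprn_ge0.
    by apply: mulr_ge0; [apply: divr_ge0 => //; exact: ltW|exact: exprn_ge0].
  elim: m => [|m IH]; first by rewrite addn0 subrr rnorm0 expr0 subrr mulr0.
  apply: le_trans (ler_rnorm_trans (u (n + m)%N) _ _) _.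
  rewrite addnS; apply: le_trans (lerD IH (h (n + m)%N (leq_trans n0n (leq_addr _ _)))) _.
  rewrite le_eqVlt; apply/orP; left; apply/eqP; rewrite exprD exprS; field.
  by rewrite gt_eqF.
have cv0 : K / (1 - g) * g ^+ n @[n --> \oo] --> (0 : R).
  rewrite -[X in _ --> X](mulr0 (K / (1 - g))); apply: cvgM; first exact: cvg_cst.
  by apply: cvg_expr; rewrite ger0_norm.
have cu : u n @[n --> \oo] --> limn u.
  apply: cvg_cauchy_rnorm => e e0; have e20 : 0 < e / 2 by rewrite divr_gt0.
  have /cvgrPdist_lt/(_ (e / 2) e20)[N _ hN] := cv0.
  exists (n0 + N)%N => m n mm nn.
  have bd k : (n0 + N <= k)%N -> rnorm (u (n0 + N)%N - u k) <= e / 2.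
    move=> kk; rewrite -(subnKC kk); apply: le_trans (tel _ _ (leq_addr _ _)) _.
    have := hN (n0 + N)%N (leq_addl _ _); rewrite /= sub0r normrN ger0_norm; first exact: ltW.
    by rewrite mulr_ge0 ?divr_ge0 ?exprn_ge0 // ltW.
  apply: le_trans (ler_rnorm_trans (u (n0 + N)%N) _ _) _; rewrite [X in X + _]rnormBC.
  by have := bd m mm; have := bd n nn; lra.
split=> // n nn; apply: (cvg_rnorm_le (F := \oo) (f := fun k => u n - u k)).
  by apply: cvgB => //; exact: cvg_cst.
by exists n => // k /= nk; rewrite -(subnKC nk); exact: tel.
Qed.

End Limits.

(** * Chains of absorptions *)

Section Chain.
Context {R : realType} {X : banachType R}.
Variables (D kappa delta M : R).
Hypotheses (D0 : 0 <= D) (kappa0 : 0 < kappa) (kappa1 : kappa <= 1).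
Hypotheses (delta0 : 0 <= delta) (deltak : 200 * delta <= kappa) (M1 : 1 <= M).
Hypothesis absorb : forall x y z sg (A B c W : R) (v : X), heisenberg x y z sg -> sg = 1 \/ sg = -1 ->
  0 < A -> 0 < B -> 0 < c -> c <= A * B -> 1 <= W ->
  bounded_on x (2 * A) W -> bounded_on y (2 * B) W -> bounded_on z (2 * (A * B)) W ->
  rnorm (avg x A (avg y B (v - avg z c v))) <=
    D * W ^+ 8 * expR (- (kappa * ln (A * B / c))) * rnorm v.

(** Growth of order (1 + |a|)^delta, which is what a length logarithmic in |a| leaves of the factor
    e^(t l). *)
Definition slow_growth (x : R -> {linear X -> X}) :=
  forall a v, rnorm (x a v) <= M * expR (delta * ln (1 + `|a|)) * rnorm v.

(* The bound of the one-parameter groups on [-8 exp (2 L), 8 exp (2 L)]. *)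
Definition range_bound (L : R) : R := M * expR (delta * (ln 9 + 2 * L)).

Let M0 : 0 <= M. Proof. exact: le_trans M1. Qed.
Let ln90 : 0 <= ln 9 :> R. Proof. by rewrite ln_ge0 // ler1n. Qed.

Lemma range_bound_ge1 (L : R) : 0 <= L -> 1 <= range_bound L.
Proof.
move=> L0; rewrite /range_bound -[X in X <= _]mulr1; apply: ler_pM => //.
rewrite -[X in X <= _]expR0 ler_expR; apply: mulr_ge0 => //.
by apply: addr_ge0; [exact: ln90|exact: mulr_ge0].
Qed.

Lemma slow_growth_bounded_on x (L A : R) : slow_growth x -> 0 <= L -> A <= 8 * expR (2 * L) ->
  bounded_on x A (range_bound L).
Proof.
move=> gx L0 AL a v aA; apply: le_trans (gx a v) _.
rewrite ler_wpM2r ?rnorm_ge0 // ler_wpM2l // ler_expR ler_wpM2l //.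
have e1 : 1 <= expR (2 * L) by rewrite -expR0 ler_expR mulr_ge0.
have a1 : 0 < 1 + `|a| by rewrite ltr_wpDr.
have -> : ln 9 + 2 * L = ln (9 * expR (2 * L)) by rewrite lnM ?posrE ?expR_gt0 // expRK.
by rewrite ler_ln ?posrE ?mulr_gt0 ?expR_gt0 //; lra.
Qed.

(** As y fixes v and commutes with z, its averages act trivially on [v - avg z c v] for every B.
    Letting B tend to infinity kills the x-average of this vector, letting A tend to 0 removes x,
    and [avg_double] passes from the averages of z to z itself. *)
Lemma fixed_transfer x y z sg v : heisenberg x y z sg -> sg = 1 \/ sg = -1 ->
  slow_growth x -> slow_growth y -> slow_growth z ->
  (forall b, y b v = v) -> forall c, z c v = v.
Proof.
move=> h sg1 gx gy gz yv; have [ox oy oz _ xz] := h; have [z0 zD zc cz] := oz.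
have Xfix (A c : R) : 0 < A -> A <= 1 -> 0 < c -> avg x A (v - avg z c v) = 0.
  move=> A0 A1 c0.
  have l2 B : avg y B (v - avg z c v) = v - avg z c v.
    apply: avg_fixed => a; rewrite linearB /= yv; congr (_ - _).
    have cy : continuous (y a) by case: oy.
    rewrite (avg_comm _ _ oz) //; last by move=> b w; exact: (xz b b w).2 || exact: (xz a b w).2.
    by rewrite yv.
  pose K := D * M ^+ 8 * expR (8 * delta * ln 9) * expR (- (kappa * ln (A / c))) * rnorm v.
  have u0 := @expR_geometric_cvg0 R K (kappa - 16 * delta).
  have {}u0 := u0 _; have kd : 0 < kappa - 16 * delta by move: kappa0 delta0 deltak; lra.
  apply: (rnorm_eq0_cvg (n0 := (Num.trunc (ln (c / A))).+1) (u0 kd)) => n nn.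
  (* Along B = e^n the absorption gains e^(-kappa n), while the factor W^8 loses e^(16 delta n). *)
  pose B : R := expR n%:R; have B0 : 0 < B by exact: expR_gt0.
  have cAB : c <= A * B.
    rewrite mulrC -ler_pdivrMr // -[leLHS]lnK ?posrE ?divr_gt0 // ler_expR.
    apply/ltW; apply: lt_le_trans (_ : (Num.trunc (ln (c / A))).+1%:R <= _); last by rewrite ler_nat.
    by apply: truncnS_gt; exact: num_real.
  have n0 : 0 <= n%:R :> R by [].
  have BL : B <= expR (2 * n%:R) by rewrite ler_expR; lra.
  have e1 : 1 <= expR (2 * n%:R) :> R by rewrite -expR0 ler_expR mulr_ge0.
  have AB : A * B <= expR (2 * n%:R) by apply: le_trans BL; rewrite ler_piMl // ltW.
  have := absorb v h sg1 A0 B0 c0 cAB (range_bound_ge1 n0).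
  rewrite l2 => hb; have {}hb := hb _ _ _; apply: le_trans (hb _ _ _) _.
  - by apply: slow_growth_bounded_on => //; lra.
  - by apply: slow_growth_bounded_on => //; lra.
  - by apply: slow_growth_bounded_on => //; lra.
  rewrite /range_bound exprMn -expRM_natl.
  have -> : ln (A * B / c) = ln (A / c) + n%:R.
    by rewrite mulrAC (lnM (x := A / c)) ?posrE ?divr_gt0 // expRK.
  have -> : 8%:R * (delta * (ln 9 + 2 * n%:R)) = 8 * delta * ln 9 + 16 * delta * n%:R :> R by ring.
  have -> : - (kappa * (ln (A / c) + n%:R)) = - (kappa * ln (A / c)) + - (kappa * n%:R) by ring.
  have -> : - ((kappa - 16 * delta) * n%:R) = 16 * delta * n%:R + - (kappa * n%:R) by ring.
  by rewrite !expRD /K le_eqVlt; apply/orP; left; apply/eqP; ring.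
have Zfix c : 0 < c -> avg z c v = v.
  move=> c0; apply/esym/eqP; rewrite -subr_eq0; apply/eqP.
  have cv : (2^-1 : R) ^+ m @[m --> \oo] --> (0 : R).
    by apply: cvg_expr; rewrite ger0_norm ?invr_ge0 // invf_lt1 // ltr1n.
  have lim1 := @avg_cvg0 R X x (v - avg z c v) _ ox cv.
  apply: cvg_unique lim1 _ => //.
  have -> : (fun m => avg x (2^-1 ^+ m) (v - avg z c v)) = fun=> 0.
    apply/funext => m; apply: Xfix => //; rewrite ?exprn_gt0 ?invr_gt0 //.
    by rewrite exprn_ile1 // ?invr_ge0 // invf_le1 // ler1n.
  exact: cvg_cst.
have pos c : 0 < c -> z c v = v.
  move=> c0; have := avg_double c v oz.
  rewrite !Zfix ?mulr_gt0 // subrr => /esym/eqP; rewrite scaler_eq0 => /orP[|].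
    by rewrite fmorph_eq0 invr_eq0 pnatr_eq0.
  by rewrite subr_eq0 => /eqP.
move=> c; have [c0|c0|<-] := ltgtP (0 : R) c; last exact: z0.
  exact: pos.
by rewrite -{1}(pos (- c)) ?oppr_gt0 // one_paramK.
Qed.

Variables (p q r z1 z2 : R -> {linear X -> X}).
Hypotheses (hpq : heisenberg p q z1 1) (hqr : heisenberg q r z2 1)
  (hzz : heisenberg z1 z2 q (-1))
  (gp : slow_growth p) (gq : slow_growth q) (gr : slow_growth r)
  (g1 : slow_growth z1) (g2 : slow_growth z2).

Definition triple_avg (b : R) (v : X) : X := avg p 1 (avg q b (avg r 1 v)).

Let op : one_param p. Proof. by case: hpq. Qed.
Let oq : one_param q. Proof. by case: hpq. Qed.
Let or : one_param r. Proof. by case: hqr. Qed.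
Let o1 : one_param z1. Proof. by case: hpq. Qed.
Let o2 : one_param z2. Proof. by case: hqr. Qed.

(** The average of q traded for averages of z1 and z2. It does not involve b, so it can stand
    between b and 2 b. *)
Let middle (s : R) (v : X) : X := avg p 1 (avg z1 s (avg z2 s (avg r 1 v))).

Lemma avg_avgC (x y : R -> {linear X -> X}) A B W v : one_param x -> one_param y -> 0 <= B ->
  bounded_on y B W -> (forall a b w, x a (y b w) = y b (x a w)) ->
  avg x A (avg y B v) = avg y B (avg x A v).
Proof.
move=> ox oy B0 yW xy; have [_ _ xc _] := ox.
pose L : {linear X -> X} :=
  HB.pack (avg y B) (GRing.isLinear.Build _ _ _ _ _ (avg_is_linear B oy)).
apply/esym; apply: (avg_comm (T := L)) => // [|a w].
  apply: (@rnorm_bound_continuous _ _ _ L W) => w.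
  by apply: avg_le => // a aB; exact: yW.
by apply/esym; apply: (avg_comm _ _ oy).
Qed.

(** Three absorptions: of z1 by p and q, and of z2 by q and r, each at the cost of a power of s / b;
    then of q by z1 and z2, whose commutators lie in q, at the cost of a power of b / s^2. So s has
    to be well between sqrt b and b. *)
Lemma triple_avg_middle (L b s : R) v : 0 <= L -> 1 <= s -> s <= b -> b <= s ^+ 2 ->
  2 * b ^+ 2 <= 8 * expR (2 * L) ->
  rnorm (triple_avg b v - middle s v) <= D * range_bound L ^+ 11 *
    (2 * expR (- (kappa * ln (b / s))) + expR (- (kappa * ln (s ^+ 2 / b)))) * rnorm v.
Proof.
move=> L0 s1 sb bs bL; set W := range_bound L.
have W1 : 1 <= W by exact: range_bound_ge1.
have W0 : 0 <= W by exact: le_trans W1.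
have s0 : 0 < s by exact: lt_le_trans s1.
have b1 : 1 <= b by exact: le_trans sb.
have b0 : 0 < b by exact: lt_le_trans b1.
have sb2 : s * s <= b ^+ 2 by rewrite expr2; apply: ler_pM => //; exact: ltW.
have bb2 : b <= b ^+ 2 by rewrite expr2 ler_peMl // ltW.
have bd x A : slow_growth x -> A <= 2 * b ^+ 2 -> bounded_on x A W.
  by move=> gx AB; apply: slow_growth_bounded_on => //; exact: le_trans bL.
have av x A w : slow_growth x -> one_param x -> 0 <= A -> A <= 2 * b ^+ 2 ->
    rnorm (avg x A w) <= W * rnorm w.
  by move=> gx ox A0 AB; apply: avg_le => // a aA; exact: (bd x A).
have P w : rnorm (avg p 1 w) <= W * rnorm w by apply: av => //; lra.
have Z w : rnorm (avg z1 s w) <= W * rnorm w by apply: av => //; lra.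
have Rv : rnorm (avg r 1 v) <= W * rnorm v by apply: av => //; lra.
have [_ _ _ _ c1] := hpq; have [_ _ _ _ c2] := hqr; have [_ _ _ _ c3] := hzz.
set w := avg r 1 v.
set E1 := expR (- (kappa * ln (b / s))); set E2 := expR (- (kappa * ln (s ^+ 2 / b))).
have s2b : s <= 2 * b ^+ 2 by lra.
have s3 : 2 * s <= 2 * b ^+ 2 by rewrite ler_pM2l // (le_trans sb).
have s4 : 2 * (s * s) <= 2 * b ^+ 2 by rewrite ler_pM2l.
have b1s : bounded_on z1 s W := bd _ _ g1 s2b.
have b2s : bounded_on z2 s W := bd _ _ g2 s2b.
have step1 : rnorm (triple_avg b v - avg p 1 (avg q b (avg z1 s w))) <=
    D * W ^+ 8 * E1 * (W * rnorm v).
  rewrite /triple_avg -/w -!avgB //.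
  have h := absorb w hpq (or_introl erefl) ltr01 b0 s0; rewrite !mul1r in h.
  apply: le_trans (h W sb W1 _ _ _) _; [by apply: bd => //; lra|by apply: bd => //; lra|by apply: bd => //; lra|].
  by rewrite ler_wpM2l // !mulr_ge0 ?exprn_ge0 ?expR_ge0.
have sw1 u : avg q b (avg z1 s u) = avg z1 s (avg q b u).
  exact: (@avg_avgC _ _ _ _ W u oq o1 (ltW s0) b1s (fun a a' u' => (c1 a a' u').2)).
have step2 : rnorm (avg p 1 (avg z1 s (avg q b w)) -
    avg p 1 (avg z1 s (avg q b (avg r 1 (avg z2 s v))))) <= W * (W * (D * W ^+ 8 * E1 * rnorm v)).
  rewrite -!avgB //; apply: le_trans (P _) _; rewrite ler_wpM2l //.
  apply: le_trans (Z _) _; rewrite ler_wpM2l //.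
  have h := absorb v hqr (or_introl erefl) b0 ltr01 s0; rewrite !mulr1 in h.
  by apply: h => //; apply: bd => //; lra.
have sw2 : avg r 1 (avg z2 s v) = avg z2 s w.
  exact: (@avg_avgC _ _ _ _ W v or o2 (ltW s0) b2s (fun a a' u' => (c2 a a' u').2)).
have sw3 : avg q b (avg z2 s w) = avg z2 s (avg q b w).
  exact: (@avg_avgC _ _ _ _ W w oq o2 (ltW s0) b2s (fun a a' u' => esym (c3 a' a u').2)).
have step3 : rnorm (avg p 1 (avg z1 s (avg z2 s (avg q b w))) - middle s v) <=
    W * (D * W ^+ 8 * E2 * (W * rnorm v)).
  rewrite rnormBC /middle -/w -!avgB //; apply: le_trans (P _) _; rewrite ler_wpM2l //.
  have h := absorb w hzz (or_intror erefl) s0 s0 b0.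
  have bss : b <= s * s by rewrite -expr2.
  have {}h := h W bss W1 (bd _ _ g1 s3) (bd _ _ g2 s3) (bd _ _ gq s4).
  apply: le_trans h _; rewrite -expr2 -/E2.
  by rewrite ler_wpM2l // !mulr_ge0 ?exprn_ge0 ?expR_ge0.
apply: le_trans (ler_rnorm_trans (avg p 1 (avg q b (avg z1 s w))) _ _) _.
rewrite sw1; apply: le_trans (lerD _ (ler_rnorm_trans (avg p 1 (avg z1 s (avg q b (avg r 1 (avg z2 s v))))) _ _)) _.
  by rewrite -sw1; exact: step1.
rewrite sw2 sw3; rewrite sw2 sw3 in step2.
apply: le_trans (lerD (lexx _) (lerD step2 step3)) _.
have e1 : 0 <= E1 by exact: expR_ge0.
have e2 : 0 <= E2 by exact: expR_ge0.
have nv := rnorm_ge0 v.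
have W9 : W ^+ 9 <= W ^+ 11 by rewrite ler_weXn2l.
have W10 : W ^+ 10 <= W ^+ 11 by rewrite ler_weXn2l.
have t1 : D * E1 * rnorm v * W ^+ 9 <= D * E1 * rnorm v * W ^+ 11 by rewrite ler_wpM2l // !mulr_ge0.
have t2 : D * E1 * rnorm v * W ^+ 10 <= D * E1 * rnorm v * W ^+ 11 by rewrite ler_wpM2l // !mulr_ge0.
have t3 : D * E2 * rnorm v * W ^+ 10 <= D * E2 * rnorm v * W ^+ 11 by rewrite ler_wpM2l // !mulr_ge0.
have -> : D * W ^+ 8 * E1 * (W * rnorm v) + (W * (W * (D * W ^+ 8 * E1 * rnorm v)) +
    W * (D * W ^+ 8 * E2 * (W * rnorm v))) =
    D * E1 * rnorm v * W ^+ 9 + (D * E1 * rnorm v * W ^+ 10 + D * E2 * rnorm v * W ^+ 10) by ring.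
have -> : D * W ^+ 11 * (2 * E1 + E2) * rnorm v =
    D * E1 * rnorm v * W ^+ 11 + (D * E1 * rnorm v * W ^+ 11 + D * E2 * rnorm v * W ^+ 11) by ring.
by apply: lerD => //; apply: lerD.
Qed.

Let l2 : R := ln 2.
Let l20 : 0 < l2. Proof. by rewrite ln_gt0 // ltr1n. Qed.

Let pow2 (n : nat) : 2 ^+ n = expR (n%:R * l2) :> R.
Proof. by rewrite expRM_natl lnK // posrE. Qed.

Let rate : R := kappa / 8 * l2.

Let rate0 : 0 < rate. Proof. by rewrite mulr_gt0 ?divr_gt0. Qed.

Let C1 : R := 3 * D * M ^+ 11 * expR (11 * delta * ln 9).

Let C10 : 0 <= C1. Proof. by rewrite !mulr_ge0 ?exprn_ge0 ?expR_ge0. Qed.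

(** The same s = 2^(3 n / 4) suits b = 2^n and b = 2^(n + 1); n >= 4 keeps s^2 / b above 2^(n / 4).
    The factor W^11 loses e^(22 delta L), and [200 * delta <= kappa] leaves half of the exponent
    kappa / 4. *)
Lemma triple_avg_middle_pow2 (n k : nat) v : (4 <= n)%N -> (n <= k <= n.+1)%N ->
  rnorm (triple_avg (2 ^+ k) v - middle (expR (3 / 4 * (n%:R * l2))) v) <=
    C1 * expR (- (rate * n%:R)) * rnorm v.
Proof.
move=> n4 /andP[nk kn].
have n4r : 4 <= n%:R :> R by rewrite ler_nat.
have nkr : n%:R <= k%:R :> R by rewrite ler_nat.
have knr : k%:R <= n%:R + 1 :> R by rewrite natr1 ler_nat.
pose L : R := n%:R * l2; have L0 : 0 <= L by rewrite mulr_ge0 // ltW.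
have l2n := l20.
have h1 : n%:R * l2 <= k%:R * l2 by rewrite ler_pM2r.
have h2 : k%:R * l2 <= n%:R * l2 + l2 by rewrite -{3}[l2]mul1r -mulrDl ler_pM2r.
have h4 : 4 * l2 <= n%:R * l2 by rewrite ler_pM2r.
rewrite -/L in h1 h2 h4 *.
set s := expR _.
have s1 : 1 <= s by rewrite -expR0 ler_expR mulr_ge0.
have sb : s <= 2 ^+ k by rewrite pow2 ler_expR; lra.
have bs : 2 ^+ k <= s ^+ 2 by rewrite pow2 -expRM_natl ler_expR; lra.
have bL : 2 * (2 ^+ k) ^+ 2 <= 8 * expR (2 * L).
  rewrite pow2 -expRM_natl.
  have -> : 8 * expR (2 * L) = 2 * expR (2 * (l2 + L)).
    have -> : 2 * (l2 + L) = l2 + l2 + 2 * L by ring.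
    by rewrite !expRD /l2 lnK ?posrE //; ring.
  by rewrite ler_pM2l // ler_expR; lra.
apply: le_trans (triple_avg_middle v L0 s1 sb bs bL) _.
rewrite ler_wpM2r ?rnorm_ge0 //.
have E1 : expR (- (kappa * ln (2 ^+ k / s))) <= expR (- (kappa * (L / 4))).
  rewrite ler_expR lerN2 ler_pM2l // pow2 -expRN -expRD expRK; lra.
have E2 : expR (- (kappa * ln (s ^+ 2 / 2 ^+ k))) <= expR (- (kappa * (L / 4))).
  rewrite ler_expR lerN2 ler_pM2l // pow2 -expRM_natl -expRN -expRD expRK; lra.
have W0 : 0 <= range_bound L by apply: le_trans (range_bound_ge1 L0).
apply: (@le_trans _ _ (D * range_bound L ^+ 11 * (3 * expR (- (kappa * (L / 4)))))).
  by rewrite ler_wpM2l ?mulr_ge0 ?exprn_ge0 //; lra.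
rewrite /range_bound exprMn -expRM_natl.
have -> : 11%:R * (delta * (ln 9 + 2 * L)) = 11 * delta * ln 9 + 22 * delta * L :> R by ring.
have -> : D * (M ^+ 11 * expR (11 * delta * ln 9 + 22 * delta * L)) * (3 * expR (- (kappa * (L / 4)))) =
    C1 * expR (22 * delta * L + - (kappa * (L / 4))) by rewrite /C1 !expRD; ring.
rewrite ler_wpM2l // ler_expR /rate.
have -> : kappa / 8 * l2 * n%:R = kappa / 8 * L by rewrite /L; ring.
have dk : 200 * delta * L <= kappa * L by rewrite ler_wpM2r.
by have := mulr_ge0 delta0 L0; lra.
Qed.

Lemma triple_avg_step n v : (4 <= n)%N ->
  rnorm (triple_avg (2 ^+ n) v - triple_avg (2 ^+ n.+1) v) <=
    2 * C1 * rnorm v * expR (- rate) ^+ n.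
Proof.
move=> n4; apply: le_trans (ler_rnorm_trans (middle (expR (3 / 4 * (n%:R * l2))) v) _ _) _.
rewrite [X in _ + X]rnormBC.
have h1 := @triple_avg_middle_pow2 n n v n4; rewrite leqnn leqnSn in h1.
have h2 := @triple_avg_middle_pow2 n n.+1 v n4; rewrite leqnn leqnSn in h2.
apply: le_trans (lerD (h1 isT) (h2 isT)) _.
have -> : expR (- (rate * n%:R)) = expR (- rate) ^+ n by rewrite -expRM_natl; congr expR; ring.
by rewrite le_eqVlt; apply/orP; left; apply/eqP; ring.
Qed.

Definition triple_limit (v : X) : X := limn (fun n => triple_avg (2 ^+ n) v).

Lemma triple_limitP : exists2 K : R, 0 <= K & forall n v, (4 <= n)%N ->
  rnorm (triple_avg (2 ^+ n) v - triple_limit v) <= K * expR (- (rate * n%:R)) * rnorm v.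
Proof.
exists (2 * C1 / (1 - expR (- rate))).
  by rewrite divr_ge0 ?mulr_ge0 // subr_ge0 -[leRHS]expR0 ler_expR oppr_le0 ltW.
move=> n v n4.
have g0 := expR_ge0 (- rate).
have g1' : expR (- rate) < 1 by rewrite -[ltRHS]expR0 ltr_expR oppr_lt0.
have K0 : 0 <= 2 * C1 * rnorm v by rewrite !mulr_ge0 ?rnorm_ge0.
have [_ h] := geometric_cauchy K0 g0 g1' (fun m m4 => @triple_avg_step m v m4).
apply: le_trans (h n n4) _.
have -> : expR (- (rate * n%:R)) = expR (- rate) ^+ n by rewrite -expRM_natl; congr expR; ring.
by rewrite le_eqVlt; apply/orP; left; apply/eqP; field; rewrite gt_eqF // subr_gt0.
Qed.

Lemma triple_limit_cvg v : triple_avg (2 ^+ n) v @[n --> \oo] --> triple_limit v.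
Proof.
have g0 := expR_ge0 (- rate).
have g1' : expR (- rate) < 1 by rewrite -[ltRHS]expR0 ltr_expR oppr_lt0.
have K0 : 0 <= 2 * C1 * rnorm v by rewrite !mulr_ge0 ?rnorm_ge0.
by have [] := geometric_cauchy K0 g0 g1' (fun m m4 => @triple_avg_step m v m4).
Qed.

Lemma triple_limit_linear : linear triple_limit.
Proof.
move=> a u v; apply: cvg_lim => //.
have -> : (fun n => triple_avg (2 ^+ n) (a *: u + v)) =
    (fun n => a *: triple_avg (2 ^+ n) u + triple_avg (2 ^+ n) v).
  by apply/funext => n; rewrite /triple_avg !avg_is_linear.
by apply: cvgD; [apply: cvgZr|]; exact: triple_limit_cvg.
Qed.

Lemma triple_limit_fixed v : (forall a, p a v = v) -> (forall a, q a v = v) -> (forall a, r a v = v) ->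
  triple_limit v = v.
Proof.
move=> pv qv rv; apply: cvg_lim => //.
have -> : (fun n => triple_avg (2 ^+ n) v) = fun=> v.
  by apply/funext => n; rewrite /triple_avg !avg_fixed.
exact: cvg_cst.
Qed.

(** The middle vector contains an average of z1 over a length s that outgrows c, and p commutes with
    z1; so [z1 c] moves it only by O(c / s), up to the bounds of the groups. The middle vectors
    converge to the limit. *)
Lemma triple_limit_z1 v c : 0 <= c -> z1 c (triple_limit v) = triple_limit v.
Proof.
move=> c0; apply/eqP; rewrite -subr_eq0; apply/eqP.
have [K K0 hK] := triple_limitP.
have [_ _ zc _] := o1; have [_ _ _ _ c1] := hpq.
have l2n := l20; have ln9 := ln90.
pose a : R := l2 / 4; have a0 : 0 < a by rewrite divr_gt0.
have [B B0 zB] := linear_rnorm_bound (zc c).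
pose K1 : R := (B + 1) * (K + C1) + 2 * M ^+ 4 * expR (4 * delta * ln 9) * c.
pose r' := Num.min rate a; have r'0 : 0 < r' by rewrite lt_min rate0.
(* This start of the range ensures c <= s, through s >= 1 + 3 L / 4 and L / 4 > c + 1. *)
apply: (rnorm_eq0_cvg (n0 := (4 + (Num.trunc ((c + 1) / a)).+1)%N) (expR_geometric_cvg0 (K1 * rnorm v) r'0)) => n nn.
have n4 : (4 <= n)%N by apply: leq_trans nn; rewrite leq_addr.
have n4r : 4 <= n%:R :> R by rewrite ler_nat.
pose L : R := n%:R * l2; have L0 : 0 <= L by rewrite mulr_ge0 // ltW.
pose s := expR (3 / 4 * L).
have cs : c <= s.
  have h1 : (c + 1) / a < n%:R.
    apply: (@lt_le_trans _ _ (Num.trunc ((c + 1) / a)).+1%:R).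
      by apply: truncnS_gt; exact: num_real.
    rewrite ler_nat.
    by apply: leq_trans nn; rewrite leq_addl.
  rewrite ltr_pdivrMr // in h1; apply: le_trans (expR_ge1Dx _).
  by rewrite /L /a in h1 *; lra.
have s0 : 0 < s by exact: expR_gt0.
set W := range_bound L; have W1 : 1 <= W by exact: range_bound_ge1.
have W0 : 0 <= W by exact: le_trans W1.
have sL : 2 * s <= 8 * expR (2 * L).
  have : s <= expR (2 * L) by rewrite ler_expR; lra.
  by have := expR_gt0 (2 * L); lra.
have eL : 1 <= expR (2 * L) by rewrite -[leLHS]expR0 ler_expR mulr_ge0.
have P u : rnorm (avg p 1 u) <= W * rnorm u.
  by apply: avg_le => // a' aa; apply: (slow_growth_bounded_on (A := 1) gp L0) => //; lra.
have Z2 u : rnorm (avg z2 s u) <= W * rnorm u.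
  apply: avg_le => //; first exact: ltW.
  by move=> a' aa; apply: (slow_growth_bounded_on (A := s) g2 L0) => //; lra.
have Rr u : rnorm (avg r 1 u) <= W * rnorm u.
  by apply: avg_le => // a' aa; apply: (slow_growth_bounded_on (A := 1) gr L0) => //; lra.
set T := triple_avg (2 ^+ n) v; set S := middle s v.
have TP := hK n v n4; rewrite -/T in TP.
have TS : rnorm (T - S) <= C1 * expR (- (rate * n%:R)) * rnorm v.
  by apply: triple_avg_middle_pow2 => //; rewrite leqnn leqnSn.
have SS : rnorm (z1 c S - S) <= 2 * W ^+ 4 * (c / s) * rnorm v.
  rewrite /S /middle (avg_comm _ _ op) //; last by move=> a' u; rewrite (c1 a' c u).1.
  rewrite (avg_comm _ _ o1) //; last by move=> a' u; exact: one_paramC.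
  set u := avg z2 s (avg r 1 v); rewrite -avgB //; apply: le_trans (P _) _.
  have nu : rnorm u <= W ^+ 2 * rnorm v.
    by apply: le_trans (Z2 _) _; rewrite expr2 -mulrA ler_wpM2l.
  have cE : c = s * (c / s) by field; rewrite gt_eqF.
  rewrite [in X in avg _ _ (z1 X _)]cE.
  have csb : 0 <= c / s <= 1 by rewrite divr_ge0 ?(ltW s0) //= ler_pdivrMr // mul1r.
  have h := avg_shift (W := W * rnorm u) o1 (ltW s0) csb.
  apply: le_trans (ler_wpM2l W0 (h _ _)) _.
    by move=> a' aa; apply: (slow_growth_bounded_on g1 L0 sL).
  have h2 : W ^+ 2 * (c / s) * rnorm u <= W ^+ 2 * (c / s) * (W ^+ 2 * rnorm v).
    by case/andP: csb => cs0 _; rewrite ler_wpM2l // mulr_ge0 ?exprn_ge0.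
  by move: h2; lra.
have cs4 : W ^+ 4 * (c / s) <= M ^+ 4 * expR (4 * delta * ln 9) * c * expR (- (a * n%:R)).
  rewrite /W /range_bound exprMn -expRM_natl /s -expRN.
  have -> : 4%:R * (delta * (ln 9 + 2 * L)) = 4 * delta * ln 9 + 8 * delta * L :> R by ring.
  have -> : M ^+ 4 * expR (4 * delta * ln 9 + 8 * delta * L) * (c * expR (- (3 / 4 * L))) =
      M ^+ 4 * expR (4 * delta * ln 9) * c * expR (8 * delta * L + - (3 / 4 * L)) by rewrite !expRD; ring.
  apply: ler_wpM2l; first by rewrite !mulr_ge0 ?exprn_ge0 ?expR_ge0.
  rewrite ler_expR.
  have -> : a * n%:R = L / 4 by rewrite /a /L; ring.
  have dk : 200 * delta * L <= kappa * L by rewrite ler_wpM2r.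
  have k1 : kappa * L <= 1 * L by rewrite ler_wpM2r.
  by have := mulr_ge0 delta0 L0; lra.
have -> : z1 c (triple_limit v) - triple_limit v =
    (z1 c S - S) + (z1 c (triple_limit v - S) - (triple_limit v - S)).
  by rewrite linearB /= opprB addrACA (addrC (z1 c S)) subrK addKr.
have PS : rnorm (triple_limit v - S) <= (K + C1) * expR (- (rate * n%:R)) * rnorm v.
  apply: le_trans (ler_rnorm_trans T _ _) _; rewrite [X in X + _]rnormBC.
  by move: TP TS; lra.
apply: le_trans (ler_rnormD _ _) _.
have h3 : rnorm (z1 c (triple_limit v - S) - (triple_limit v - S)) <=
    (B + 1) * ((K + C1) * expR (- (rate * n%:R)) * rnorm v).
  apply: le_trans (ler_rnormB _ _) _; rewrite mulrDl mul1r; apply: lerD => //.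
  by apply: le_trans (zB _) _; rewrite ler_wpM2l.
have nv := rnorm_ge0 v.
have er : expR (- (rate * n%:R)) <= expR (- (r' * n%:R)).
  by rewrite ler_expR lerN2 ler_wpM2r // ge_min lexx.
have ea : expR (- (a * n%:R)) <= expR (- (r' * n%:R)).
  by rewrite ler_expR lerN2 ler_wpM2r // ge_min lexx orbT.
set e := expR (- (r' * n%:R)) in er ea *.
have h4 : (B + 1) * ((K + C1) * expR (- (rate * n%:R)) * rnorm v) <= (B + 1) * (K + C1) * e * rnorm v.
  have -> : (B + 1) * ((K + C1) * expR (- (rate * n%:R)) * rnorm v) =
      (B + 1) * (K + C1) * rnorm v * expR (- (rate * n%:R)) by ring.
  have -> : (B + 1) * (K + C1) * e * rnorm v = (B + 1) * (K + C1) * rnorm v * e by ring.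
  by apply: ler_wpM2l => //; rewrite !mulr_ge0 ?addr_ge0.
have h5 : 2 * W ^+ 4 * (c / s) * rnorm v <= 2 * M ^+ 4 * expR (4 * delta * ln 9) * c * e * rnorm v.
  have -> : 2 * W ^+ 4 * (c / s) * rnorm v = 2 * rnorm v * (W ^+ 4 * (c / s)) by ring.
  have -> : 2 * M ^+ 4 * expR (4 * delta * ln 9) * c * e * rnorm v =
      2 * rnorm v * (M ^+ 4 * expR (4 * delta * ln 9) * c * e) by ring.
  apply: ler_wpM2l; first by rewrite mulr_ge0.
  apply: le_trans cs4 _; apply: ler_wpM2l => //.
  by rewrite !mulr_ge0 ?exprn_ge0 ?expR_ge0.
apply: le_trans (lerD SS h3) _; apply: le_trans (lerD h5 h4) _.
by rewrite /K1 le_eqVlt; apply/orP; left; apply/eqP; ring.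
Qed.

End Chain.

(** * Root subgroups of SL(3) *)

Section ElementaryMatrices.
Context {n : nat} {R : realType}.
Implicit Types (i j k : 'I_n) (r : R).

(** The factor [*+ (i != j)] makes the determinant 1 for all indices: for i = j the matrix is the
    identity. *)
Definition elem_mx i j r : 'M[R]_n := 1%:M + (r *+ (i != j)) *: delta_mx i j.

Lemma elem_mxE i j r (a b : 'I_n) : elem_mx i j r a b = (a == b)%:R + r *+ (i != j) * ((a == i) && (b == j))%:R.
Proof. by rewrite !mxE. Qed.

Lemma det_elem_mx i j r : \det (elem_mx i j r) == 1.
Proof.
have tr (a b : 'I_n) : (a < b)%N -> \det (elem_mx b a r) = 1.
  move=> ab; rewrite det_trig.
    rewrite big1 // => k _; rewrite elem_mxE eqxx.
    suff -> : (k == b) && (k == a) = false by rewrite mulr0 addr0.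
    by apply/negP => /andP[/eqP kb /eqP ka]; move: ab; rewrite -kb -ka ltnn.
  apply/is_trig_mxP => c e ce; rewrite elem_mxE (_ : c == e = false); last by apply/eqP => h; move: ce; rewrite h ltnn.
  suff -> : (c == b) && (e == a) = false by rewrite mulr0 addr0.
  by apply/negP => /andP[/eqP cb /eqP ea]; move: ce; rewrite cb ea ltnNge (ltnW ab).
apply/eqP; have [ij|ij|/val_inj ij] := ltngtP i j.
- rewrite -det_tr (_ : (elem_mx i j r)^T = elem_mx j i r); first exact: tr.
  by rewrite /elem_mx linearD /= linearZ /= trmx1 trmx_delta eq_sym.
- exact: tr.
- by rewrite /elem_mx ij eqxx scale0r addr0 det1.
Qed.

Definition elem i j r : SL n R := MkSL (det_elem_mx i j r).

Lemma elem0 i j : elem i j 0 = 1%g.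
Proof. by apply: val_inj; rewrite /= /elem_mx mul0rn scale0r addr0. Qed.

Lemma elemD i j (a b : R) : i != j -> elem i j (a + b) = (elem i j a * elem i j b)%g.
Proof.
move=> ij; apply: val_inj => /=; rewrite /elem_mx ij !mulr1n.
rewrite mulmxDl mul1mx mulmxDr mulmx1 -scalemxAl -scalemxAr mul_delta_mx_cond.
by rewrite (eq_sym j) (negbTE ij) mulr0n !scaler0 addr0 scalerDl addrA addrAC.
Qed.

Lemma elem_commutator i j k (a b : R) : i != j -> j != k -> i != k ->
  (elem i j a * elem j k b = elem j k b * (elem i j a * elem i k (a * b)))%g.
Proof.
move=> ij jk ik; apply: val_inj => /=; rewrite /elem_mx ij jk ik !mulr1n.
rewrite !(mulmxDl, mulmxDr) !(mul1mx, mulmx1) -?scalemxAl -?scalemxAr !mul_delta_mx_cond.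
have ji : j == i = false by rewrite eq_sym (negbTE ij).
have ki : k == i = false by rewrite eq_sym (negbTE ik).
rewrite ji ki eqxx mulr1n !mulr0n !mulmx0 !scaler0 !addr0 scalerA.
by rewrite addrAC (addrC (a *: _)) addrA.
Qed.

Lemma elem_comm i j k l (a b : R) : i != j -> k != l -> j != k -> i != l ->
  (elem i j a * elem k l b = elem k l b * elem i j a)%g.
Proof.
move=> ij kl jk il; apply: val_inj => /=; rewrite /elem_mx ij kl !mulr1n.
rewrite !(mulmxDl, mulmxDr) !(mul1mx, mulmx1) -?scalemxAl -?scalemxAr !mul_delta_mx_cond.
have li : l == i = false by rewrite eq_sym (negbTE il).
by rewrite (negbTE jk) li !mulr0n !scaler0 !addr0 addrAC.
Qed.

Lemma elem_continuous i j : continuous (fun r => elem i j r : SL n R).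
Proof.
apply: continuous_to_SL => a b; rewrite /=.
have -> : (fun t => elem_mx i j t a b) =
    (fun t : R => (a == b)%:R + t *+ (i != j) * ((a == i) && (b == j))%:R).
  by apply/funext => t; rewrite elem_mxE.
move=> t; apply: cvgD; first exact: cvg_cst.
apply: cvgM; last exact: cvg_cst.
by case: (i != j) => /=; [exact: cvg_id|rewrite mulr0n; under eq_fun do rewrite mulr0n; exact: cvg_cst].
Qed.

Lemma elem_mulE i j r (g : SL n R) (a b : 'I_n) : i != j ->
  SLval (elem i j r * g)%g a b = g a b + (a == i)%:R * (r * g j b).
Proof.
move=> ij; rewrite /= /elem_mx ij mulr1n mulmxDl mul1mx mxE; congr (_ + _).
rewrite -scalemxAl mxE mxE (bigD1 j) //= big1 ?addr0; last first.
  by move=> k kj; rewrite mxE (negbTE kj) andbF mul0r.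
by rewrite mxE eqxx andbT; case: eqP => _; rewrite ?mul1r // !mul0r mulr0.
Qed.

Lemma mul_elemE i j r (g : SL n R) (a b : 'I_n) : i != j ->
  SLval (g * elem i j r)%g a b = g a b + (b == j)%:R * (r * g a i).
Proof.
move=> ij; rewrite /= /elem_mx ij mulr1n mulmxDr mulmx1 mxE; congr (_ + _).
rewrite -scalemxAr mxE mxE (bigD1 i) //= big1 ?addr0; last first.
  by move=> k ki; rewrite mxE (negbTE ki) /= mulr0.
by rewrite mxE eqxx /=; case: eqP => _; rewrite ?mul1r ?mulr1 // mulr0 mul0r mulr0.
Qed.

Lemma SL_col_neq0 (g : SL n R) (b : 'I_n) : exists a, g a b != 0.
Proof.
apply/existsP; rewrite -[[exists a, _]]negbK negb_exists; apply/negP => /forallP h.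
have : ((g^-1 * g)%g : SL n R) = 1%g by rewrite mulVg.
move=> /(congr1 (fun A : SL n R => SLval A b b)) /=; rewrite mxE big1.
  by rewrite mxE eqxx => /eqP; rewrite eq_sym oner_eq0.
by move=> k _; have := h k; rewrite negbK => /eqP ->; rewrite mulr0.
Qed.

(** The determinant settles the last diagonal entry, so row reduction can stop one entry early. *)
Lemma SL_diag1 (g : SL n R) (k : 'I_n) :
  (forall a b, a != b -> g a b = 0) -> (forall a, a != k -> g a a = 1) -> g = 1%g.
Proof.
move=> off diag; have : \det g = g k k.
  rewrite det_trig; last by apply/is_trig_mxP => a b ab; apply: off; apply/eqP => h; rewrite h ltnn in ab.
  by rewrite (bigD1 k) //= big1 ?mulr1 // => a; exact: diag.
rewrite SL_det => gk; apply: val_inj; apply/matrixP => a b /=; rewrite mxE.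
have [<-|ab] := eqVneq a b; last by rewrite off.
by have [->|ak] := eqVneq a k; [rewrite -gk|rewrite diag].
Qed.

End ElementaryMatrices.

(** * Generation of SL(3) by elementary matrices *)

Section Generation.
Context {R : realType} (S : SL 3 R -> Prop).
Hypotheses (S1 : S 1%g) (SM : forall g h, S g -> S h -> S (g * h)%g)
  (Se : forall i j r, i != j -> S (elem i j r)).

Let Sl i j r g : i != j -> S (elem i j r * g)%g -> S g.
Proof.
move=> ij h; have -> : g = (elem i j (- r) * (elem i j r * g))%g.
  by rewrite mulgA -elemD // addNr elem0 mul1g.
by apply: SM => //; exact: Se.
Qed.

Let Sr i j r g : i != j -> S (g * elem i j r)%g -> S g.
Proof.
move=> ij h; have -> : g = (g * elem i j r * elem i j (- r))%g.
  by rewrite -mulgA -elemD // subrr elem0 mulg1.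
by apply: SM => //; exact: Se.
Qed.

Let i0 : 'I_3 := ord0.
Let i1 : 'I_3 := lift ord0 ord0.
Let i2 : 'I_3 := ord_max.

Let I3P (P : 'I_3 -> Prop) : P i0 -> P i1 -> P i2 -> forall i, P i.
Proof.
move=> h0 h1 h2 [[|[|[|m]]] hm] //.
- by have -> : Ordinal hm = i0 by exact: val_inj.
- by have -> : Ordinal hm = i1 by exact: val_inj.
- by have -> : Ordinal hm = i2 by exact: val_inj.
Qed.

Let S_first_clean (g : SL 3 R) : (forall b, g i0 b = (i0 == b)%:R) -> (forall a, g a i0 = (a == i0)%:R) ->
  g i1 i1 = 1 -> S g.
Proof.
move=> row col g11.
apply: (@Sl i2 i1 (- g i2 i1)) => //; set h := (elem _ _ _ * g)%g.
have hE a b : h a b = g a b + (a == i2)%:R * (- g i2 i1 * g i1 b) by exact: elem_mulE.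
apply: (@Sr i1 i2 (- h i1 i2)) => //; set k := (h * _)%g.
have kE a b : k a b = h a b + (b == i2)%:R * (- h i1 i2 * h a i1) by exact: mul_elemE.
suff -> : k = 1%g by [].
have g01 := row i1; have g02 := row i2; have g10 := col i1; have g20 := col i2; have g00 := row i0.
apply: (@SL_diag1 _ _ k i2).
  by apply: I3P; apply: I3P => // _; rewrite !kE !hE /= ?g01 ?g02 ?g10 ?g20 ?g00 ?g11 /=; ring.
by apply: I3P => // _; rewrite !kE !hE /= ?g01 ?g02 ?g10 ?g20 ?g00 ?g11 /=; ring.
Qed.

Let S_row_col (g : SL 3 R) : (forall b, g i0 b = (i0 == b)%:R) -> (forall a, g a i0 = (a == i0)%:R) -> S g.
Proof.
move=> row col; have g01 := row i1; have g02 := row i2; have g10 := col i1; have g20 := col i2; have g00 := row i0.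
have key (h : SL 3 R) : (forall b, h i0 b = (i0 == b)%:R) -> (forall a, h a i0 = (a == i0)%:R) -> h i2 i1 != 0 -> S h.
  move=> hr hc h21; apply: (@Sl i1 i2 ((1 - h i1 i1) / h i2 i1)) => //.
  apply: S_first_clean => [b|a|]; rewrite elem_mulE //=.
  - by rewrite mul0r addr0 hr.
  - by rewrite !hc /= !mulr0 addr0.
  - by rewrite mul1r divfK // addrC subrK.
have [h21|] := eqVneq (g i2 i1) 0; last exact: key.
apply: (@Sl i2 i1 1) => //; apply: key => [b|a|]; rewrite elem_mulE //=.
- by rewrite mul0r addr0 row.
- by rewrite !col /= !mulr0 addr0.
- rewrite h21 add0r !mul1r; apply/eqP => g11.
  have [a] := SL_col_neq0 g i1; move: a; apply: I3P; rewrite ?g01 ?g11 ?h21 ?eqxx //.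
Qed.

Let S_pivot (g : SL 3 R) : g i0 i0 = 1 -> S g.
Proof.
move=> g00.
apply: (@Sl i1 i0 (- g i1 i0)) => //; set h := (elem _ _ _ * g)%g.
have hE a b : h a b = g a b + (a == i1)%:R * (- g i1 i0 * g i0 b) by exact: elem_mulE.
apply: (@Sl i2 i0 (- h i2 i0)) => //; set k := (elem _ _ _ * h)%g.
have kE a b : k a b = h a b + (a == i2)%:R * (- h i2 i0 * h i0 b) by exact: elem_mulE.
apply: (@Sr i0 i1 (- k i0 i1)) => //; set u := (k * _)%g.
have uE a b : u a b = k a b + (b == i1)%:R * (- k i0 i1 * k a i0) by exact: mul_elemE.
apply: (@Sr i0 i2 (- u i0 i2)) => //; set w := (u * _)%g.
have wE a b : w a b = u a b + (b == i2)%:R * (- u i0 i2 * u a i0) by exact: mul_elemE.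
by apply: S_row_col; apply: I3P; rewrite !wE !uE !kE !hE /= ?g00; ring.
Qed.

(** Row reduction: a nonzero entry below the corner brings the corner to 1, the corner clears its
    row and column, and the remaining 2 by 2 block is treated alike. If only the corner of the first
    column is nonzero, a row operation first fills an entry below it. *)
Lemma SL3_generated g : S g.
Proof.
have key (h : SL 3 R) (a : 'I_3) : a != i0 -> h a i0 != 0 -> S h.
  move=> a0 ha; apply: (@Sl i0 a ((1 - h i0 i0) / h a i0)); first by rewrite eq_sym.
  by apply: S_pivot; rewrite elem_mulE 1?eq_sym //= mul1r divfK // addrC subrK.
have [g10|] := eqVneq (g i1 i0) 0; last exact: key.
have [g20|] := eqVneq (g i2 i0) 0; last exact: key.
apply: (@Sl i1 i0 1) => //; apply: (@key _ i1) => //; rewrite elem_mulE //= g10 add0r !mul1r.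
apply/eqP => g00.
by have [a] := SL_col_neq0 g i0; move: a; apply: I3P; rewrite ?g10 ?g20 ?g00 ?eqxx.
Qed.

End Generation.

(** * Length of elementary matrices *)

Section LengthGrowth.
Context {n : nat} {R : realType} (l : SL n R -> R).
Hypothesis hl : length_function l.

Let diag_entry (i j a : 'I_n) : R := if a == i then expR 1 else if a == j then expR (- 1) else 1.

Let det_diag_entry i j : i != j -> \det (diag_mx (\row_a diag_entry i j a)) == 1.
Proof.
move=> ij; rewrite det_diag (bigD1 i) //= (bigD1 j) 1?eq_sym //= big1.
  by rewrite !mxE /diag_entry !eqxx (eq_sym j) (negbTE ij) mulr1 -expRD subrr expR0.
by move=> a /andP[ai aj]; rewrite mxE /diag_entry (negbTE ai) (negbTE aj).
Qed.

(** Conjugation by the diagonal matrix d with entries e and 1 / e at i and j multiplies the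
    parameter by e^2 and adds at most 2 l(d) to the length; so O(1 + ln (1 + |r|)) conjugations
    reach r from [-1, 1], where the length is bounded by compactness. *)
Lemma length_elem_growth (i j : 'I_n) : i != j ->
  exists2 C : R, 0 <= C & forall r : R, l (elem i j r) <= C * (1 + ln (1 + `|r|)).
Proof.
move=> ij; have [l0 lK lV lM] := hl.
pose d : SL n R := MkSL (det_diag_entry ij).
have conj r : (d * elem i j r = elem i j (r * expR 2) * d)%g.
  apply: val_inj; apply/matrixP => a b; rewrite /= mul_diag_mx mul_mx_diag !mxE ij !mulr1n.
  rewrite /diag_entry; have [<-|ab] := eqVneq a b.
    have -> : (a == i) && (a == j) = false.
      by apply/negP => /andP[/eqP ai /eqP aj]; have : i != j := ij; rewrite -ai -aj eqxx.
    by rewrite !mulr0 !addr0 mul1r mulr1.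
  rewrite !add0r; case: (boolP ((a == i) && (b == j))) => [/andP[/eqP -> /eqP ->]|_]; last by rewrite !mulr0 mul0r.
  rewrite !eqxx (eq_sym j) (negbTE ij) !mulr1 -mulrA -expRD mulrC; congr (_ * expR _); ring.
have [M hM] : exists M, forall r, `|r| <= 1 -> l (elem i j r) <= M.
  have cK : compact (elem i j @` `[(-1 : R), 1]).
    apply: continuous_compact; last exact: segment_compact.
    by apply: continuous_subspaceT; exact: elem_continuous.
  have [M hM] := lK _ cK; exists M => r r1; apply: hM; exists r => //.
  by rewrite /= in_itv /= -ler_norml.
have step k r : `|r| <= 1 -> l (elem i j (r * expR (2 * k%:R))) <= M + 2 * k%:R * l d.
  move=> r1; elim: k => [|k IH]; first by rewrite !mulr0 mul0r addr0 expR0 mulr1; exact: hM.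
  have -> : elem i j (r * expR (2 * k.+1%:R)) = (d * elem i j (r * expR (2 * k%:R)) * d^-1)%g.
    rewrite conj mulgK -mulrA -expRD; congr (elem i j (r * expR _)).
    by rewrite -natr1; ring.
  apply: le_trans (lM _ _) _; rewrite lV; apply: le_trans (lerD (lM _ _) (lexx _)) _.
  by rewrite -natr1; have := IH; lra.
have M0 : 0 <= M by apply: le_trans (l0 _) (hM 0 _); rewrite normr0.
exists (M + 4 * l d); first by rewrite addr_ge0 // mulr_ge0.
move=> r; set L := ln (1 + `|r|).
have r1 : 1 <= 1 + `|r| by rewrite lerDl.
have L0 : 0 <= L by exact: ln_ge0.
pose k := (Num.trunc L).+1.
have kL : L < k%:R by apply: truncnS_gt; exact: num_real.
have kL1 : k%:R <= L + 1.
  by have /andP[h _] := truncn_itv L0; rewrite -natr1; lra.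
have -> : r = r * expR (- (2 * k%:R)) * expR (2 * k%:R) by rewrite -mulrA -expRD addNr expR0 mulr1.
apply: le_trans (step k _ _) _.
  rewrite normrM (ger0_norm (expR_ge0 _)) expRN ler_pdivrMr ?expR_gt0 // mul1r.
  apply: (@le_trans _ _ (1 + `|r|)); first by lra.
  by rewrite -[leLHS]lnK ?posrE ?ler_expR; [rewrite -/L; lra|lra].
have := mulr_ge0 M0 L0; have := l0 d; have h := ler_wpM2r (l0 d) kL1; have := mulr_ge0 (l0 d) L0.
by lra.
Qed.

End LengthGrowth.

Section OperatorNorm.
Context {R : realType} {X Y : normedModType R[i]}.

Lemma opnorm_leP (T : {linear X -> Y}) (M : R) : 0 <= M -> (opnorm T <= M%:E)%E ->
  forall v, rnorm (T v) <= M * rnorm v.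
Proof.
move=> M0 TM v; have [v0|v0] := eqVneq (rnorm v) 0.
  by rewrite (rnorm0_eq0 v0) linear0 !rnorm0 mulr0.
have vp : 0 < rnorm v by rewrite lt_def v0 rnorm_ge0.
have h : ((rnorm (T ((rnorm v)^-1%:C%C *: v)))%:E <= M%:E)%E.
  apply: le_trans TM; apply: ereal_sup_ubound; exists ((rnorm v)^-1%:C%C *: v) => //=.
  by rewrite rnormZr gtr0_norm ?invr_gt0 // mulVf.
by move: h; rewrite lee_fin (linearZZ T) rnormZr gtr0_norm ?invr_gt0 // mulrC ler_pdivrMr.
Qed.

Lemma opnorm_le (T : X -> Y) (M : R) : 0 <= M -> (forall v, rnorm (T v) <= M * rnorm v) ->
  (opnorm T <= M%:E)%E.
Proof.
move=> M0 TM; apply: ge_ereal_sup => _ [v v1 <-]; rewrite lee_fin.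
by apply: le_trans (TM v) _; rewrite ler_piMr.
Qed.

End OperatorNorm.

Lemma heisenberg_opp (R : realType) (X : banachType R) (x y z : R -> {linear X -> X}) sg :
  heisenberg x y z sg ->
  heisenberg (fun a => x (- a)) (fun a => y (- a)) (fun a => z (- a)) (- sg).
Proof.
move=> [ox oy oz xy xz]; split; try exact: one_param_opp.
  by move=> a b v; rewrite xy mulrNN mulNr opprK.
by move=> a b v; split; [exact: (xz _ _ _).1|exact: (xz _ _ _).2].
Qed.

(** For the symmetrized measures: P1 and P2 are the limits for a product and for its inverse. Their
    mean takes values in F and is the identity on F. It is continuous by comparison with the index
    4, the first at which the estimates hold. *)
Lemma half_sum_projection (R : realType) (X : banachType R) (F : set X) (T1 T2 : nat -> X -> X)
    (P1 P2 : X -> X) (K1 K2 rate W : R) :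
  linear P1 -> linear P2 -> (forall v, F (P1 v)) -> (forall v, F (P2 v)) ->
  (forall a u v, F u -> F v -> F (a *: (u + v))) ->
  (forall v, F v -> P1 v = v) -> (forall v, F v -> P2 v = v) ->
  0 <= K1 -> 0 <= K2 -> 0 < rate ->
  (forall n v, (4 <= n)%N -> rnorm (T1 n v - P1 v) <= K1 * expR (- (rate * n%:R)) * rnorm v) ->
  (forall n v, (4 <= n)%N -> rnorm (T2 n v - P2 v) <= K2 * expR (- (rate * n%:R)) * rnorm v) ->
  (forall v, rnorm (T1 4%N v) <= W * rnorm v) -> (forall v, rnorm (T2 4%N v) <= W * rnorm v) ->
  exists2 P : {linear X -> X}, projection_onto F P &
    forall n v, (4 <= n)%N ->
      rnorm ((2^-1 : R)%:C%C *: (T1 n v + T2 n v) - P v) <=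
        (K1 + K2) * expR (- (rate * n%:R)) * rnorm v.
Proof.
move=> l1 l2 F1 F2 FZ f1 f2 K10 K20 rate0 hK1 hK2 t1 t2.
pose P0 v := (2^-1 : R)%:C%C *: (P1 v + P2 v).
have l0 : linear P0.
  by move=> a u v; rewrite /P0 l1 l2 addrACA -scalerDr [LHS]scalerDr !scalerA mulrC.
have [P PE] : exists P : {linear X -> X}, forall v, P v = P0 v.
  by exists (HB.pack P0 (GRing.isLinear.Build _ _ _ _ _ l0) : {linear X -> X}).
have FP v : F (P v) by rewrite PE; apply: FZ.
have Pf v : F v -> P v = v.
  move=> vf; rewrite PE /P0 f1 // f2 //.
  rewrite -{1 2}[v]scale1r -scalerDl scalerA (_ : _ * _ = 1) ?scale1r //.
  by rewrite -(rmorphD (real_complex R) 1 1) -rmorphM mulVf // pnatr_eq0.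
have lim n v : (4 <= n)%N -> rnorm ((2^-1 : R)%:C%C *: (T1 n v + T2 n v) - P v) <=
    (K1 + K2) * expR (- (rate * n%:R)) * rnorm v.
  move=> n4; rewrite PE /P0 -scalerBr opprD addrACA rnormZr ger0_norm ?invr_ge0 //.
  apply: (@le_trans _ _ (rnorm (T1 n v - P1 v + (T2 n v - P2 v)))).
    by rewrite ler_piMl ?rnorm_ge0 // invf_le1 // ler1n.
  apply: le_trans (ler_rnormD _ _) _; rewrite !mulrDl.
  by apply: lerD; [exact: hK1|exact: hK2].
exists P => //; split=> [|v|].
- apply: (@rnorm_bound_continuous _ _ _ P ((K1 + K2) + W)) => v.
  have -> : P v = (2^-1 : R)%:C%C *: (T1 4%N v + T2 4%N v) -
      ((2^-1 : R)%:C%C *: (T1 4%N v + T2 4%N v) - P v) by rewrite subKr.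
  apply: le_trans (ler_rnormB _ _) _; rewrite addrC mulrDl; apply: lerD.
    apply: le_trans (lim 4%N v (leqnn _)) _; rewrite ler_wpM2r ?rnorm_ge0 // ler_piMr ?addr_ge0 //.
    by rewrite -[leRHS]expR0 ler_expR oppr_le0 mulr_ge0 // ltW.
  rewrite rnormZr ger0_norm ?invr_ge0 //.
  by have := ler_rnormD (T1 4%N v) (T2 4%N v); have := t1 v; have := t2 v; lra.
- exact: Pf.
- apply/seteqP; split=> [_ [v _ <-]|v vf]; first exact: FP.
  by exists v => //; exact: Pf.
Qed.

Section Representation.
Context {R : realType} {X : banachType R} (pi : SL 3 R -> {linear X -> X}).
Hypothesis hpi : strongly_continuous_rep pi.

Definition root (i j : 'I_3) (r : R) : {linear X -> X} := pi (elem i j r).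

Lemma root_one_param i j : i != j -> one_param (root i j).
Proof.
move=> ij; have [pi1 piM pic cpi] := hpi; split=> [v|a b v|a|v]; rewrite /root.
- by rewrite elem0.
- by rewrite elemD // piM.
- exact: pic.
- move=> a; apply: (@continuous_comp _ _ _ (fun a => elem i j a : SL 3 R) (fun g => pi g v)).
    exact: elem_continuous.
  exact: cpi.
Qed.

Lemma root_comm i j k l (a b : R) v : i != j -> k != l -> j != k -> i != l ->
  root i j a (root k l b v) = root k l b (root i j a v).
Proof. by move=> ij kl jk il; have [_ piM _ _] := hpi; rewrite /root -!piM elem_comm. Qed.

Lemma heisenberg_root i j k : i != j -> j != k -> i != k ->
  heisenberg (root i j) (root j k) (root i k) 1.
Proof.
move=> ij jk ik; have [_ piM _ _] := hpi; split; try exact: root_one_param.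
  by move=> a b v; rewrite mul1r /root -!piM elem_commutator // !mulgA.
by move=> a b v; split; apply: root_comm => //; rewrite eq_sym.
Qed.

Lemma heisenberg_root_swap i j k : i != j -> j != k -> i != k ->
  heisenberg (root j k) (root i j) (root i k) (-1).
Proof.
move=> ij jk ik; have [oij ojk oik xy xz] := heisenberg_root ij jk ik; split=> //; last first.
  by move=> a b v; have [h1 h2] := xz a b v; split.
move=> a b v; have h := xy b a (root i k (- (a * b)) v).
rewrite mul1r mulrC one_paramK // in h; rewrite mulN1r -h.
by rewrite (mulrC a b).
Qed.

Lemma root_generate v : (forall i j r, i != j -> root i j r v = v) -> forall g, pi g v = v.
Proof.
have [pi1 piM _ _] := hpi => h; apply: (@SL3_generated _ (fun g => pi g v = v)) => //.
by move=> g k gv kv; rewrite piM kv.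
Qed.

Variables (D kappa delta M : R).
Hypotheses (D0 : 0 <= D) (kappa0 : 0 < kappa) (kappa1 : kappa <= 1).
Hypotheses (delta0 : 0 <= delta) (deltak : 200 * delta <= kappa) (M1 : 1 <= M).
Hypothesis absorb : forall x y z sg (A B c W : R) (v : X), heisenberg x y z sg -> sg = 1 \/ sg = -1 ->
  0 < A -> 0 < B -> 0 < c -> c <= A * B -> 1 <= W ->
  bounded_on x (2 * A) W -> bounded_on y (2 * B) W -> bounded_on z (2 * (A * B)) W ->
  rnorm (avg x A (avg y B (v - avg z c v))) <=
    D * W ^+ 8 * expR (- (kappa * ln (A * B / c))) * rnorm v.
Hypothesis growth : forall i j, i != j -> slow_growth delta M (root i j).

(** By [fixed_transfer], invariance under x_ij passes to the other root subgroup in row i and to the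
    other one in column j; repeated, this reaches all six. *)
Lemma root_fixed i j k v : i != j -> j != k -> i != k -> (forall r, root i j r v = v) ->
  forall g, pi g v = v.
Proof.
move=> ij jk ik fij.
have row a b c : a != b -> b != c -> a != c -> (forall r, root b c r v = v) -> forall r, root a c r v = v.
  move=> ab bc ac; apply: (fixed_transfer kappa0 delta0 deltak M1 absorb (heisenberg_root ab bc ac) (or_introl erefl)); exact: growth.
have col a b c : a != b -> b != c -> a != c -> (forall r, root a b r v = v) -> forall r, root a c r v = v.
  move=> ab bc ac; apply: (fixed_transfer kappa0 delta0 deltak M1 absorb (heisenberg_root_swap ab bc ac) (or_intror erefl)); exact: growth.
have ji : j != i by rewrite eq_sym.
have kj : k != j by rewrite eq_sym.
have ki : k != i by rewrite eq_sym.
have fik : forall r, root i k r v = v by apply: (@col i j k).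
have fkj : forall r, root k j r v = v by apply: (@row k i j).
have fjk : forall r, root j k r v = v by apply: (@row j i k).
have fki : forall r, root k i r v = v by apply: (@col k j i).
have fji : forall r, root j i r v = v by apply: (@col j k i).
have I3 (a : 'I_3) : [\/ a = i, a = j | a = k].
  case: i j k a ij jk ik {fij ji kj ki fik fkj fjk fki fji} => [[|[|[|i']]] hi] [[|[|[|j']]] hj] [[|[|[|k']]] hk] [[|[|[|a']]] ha] //= _ _ _;
   first [by apply: Or31; apply: val_inj|by apply: Or32; apply: val_inj|by apply: Or33; apply: val_inj].
apply: root_generate => a b r.
by case: (I3 a) => ->; case: (I3 b) => ->; rewrite ?eqxx // => _.
Qed.

Lemma slow_growth_opp (x : R -> {linear X -> X}) : slow_growth delta M x -> slow_growth delta M (fun a => x (- a)).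
Proof. by move=> gx a v; have := gx (- a) v; rewrite normrN. Qed.

Let i0 : 'I_3 := ord0.
Let i1 : 'I_3 := lift ord0 ord0.
Let i2 : 'I_3 := ord_max.

Let neg (x : R -> {linear X -> X}) := fun a => x (- a).

(** The second term averages over the inverses: the factors in reversed order, with opposite
    parameters. *)
Definition mean_op (b : R) (v : X) : X := (2^-1 : R)%:C%C *:
  (triple_avg (root i0 i1) (root i1 i2) (root i2 i0) b v +
   triple_avg (neg (root i2 i0)) (neg (root i1 i2)) (neg (root i0 i1)) b v).

Lemma mean_op_limit : exists2 P : {linear X -> X},
  projection_onto [set v | forall g, pi g v = v] P &
  exists K rate : R, [/\ 0 <= K, 0 < rate & forall n v, (4 <= n)%N ->
    rnorm (mean_op (2 ^+ n) v - P v) <= K * expR (- (rate * n%:R)) * rnorm v].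
Proof.
have [pi1 piM pic cpi] := hpi.
have h01 : i0 != i1 by []. have h12 : i1 != i2 by []. have h20 : i2 != i0 by [].
have h02 : i0 != i2 by []. have h10 : i1 != i0 by []. have h21 : i2 != i1 by [].
pose P1 := triple_limit (root i0 i1) (root i1 i2) (root i2 i0).
pose P2 := triple_limit (neg (root i2 i0)) (neg (root i1 i2)) (neg (root i0 i1)).
have gn i j : i != j -> slow_growth delta M (neg (root i j)) by move=> ij; apply: slow_growth_opp; exact: growth.
have on i j : i != j -> one_param (neg (root i j)) by move=> ij; apply: one_param_opp; exact: root_one_param.
(* The cycle behind [middle]: x_12 and x_23 give x_13, x_23 and x_31 give x_21, and x_13 and x_21
   give x_23 again, with sign -1. *)
have a1 := heisenberg_root h01 h12 h02.
have a2 := heisenberg_root h12 h20 h10.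
have a3 : heisenberg (root i0 i2) (root i1 i0) (root i1 i2) (-1) := heisenberg_root_swap h10 h02 h12.
(* For the inverses, the reversed order changes the sign of the commutator and the opposite
   parameters change it back. *)
have b1 : heisenberg (neg (root i2 i0)) (neg (root i1 i2)) (neg (root i1 i0)) 1.
  by rewrite -[1]opprK; exact: heisenberg_opp (heisenberg_root_swap h12 h20 h10).
have b2 : heisenberg (neg (root i1 i2)) (neg (root i0 i1)) (neg (root i0 i2)) 1.
  by rewrite -[1]opprK; exact: heisenberg_opp (heisenberg_root_swap h01 h12 h02).
have b3 : heisenberg (neg (root i1 i0)) (neg (root i0 i2)) (neg (root i1 i2)) (-1).
  exact: heisenberg_opp (heisenberg_root h10 h02 h12).
have g01 := growth h01. have g12 := growth h12. have g20 := growth h20.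
have g02 := growth h02. have g10 := growth h10.
have f1 v g : pi g (P1 v) = P1 v.
  apply: (@root_fixed i0 i2 i1) => // r.
  have pos c : 0 <= c -> root i0 i2 c (P1 v) = P1 v.
    exact: (triple_limit_z1 D0 kappa0 kappa1 delta0 deltak M1 absorb a1 a2 a3 g01 g12 g20 g02 g10).
  have [r0|r0] := leP 0 r; first exact: pos.
  by rewrite -{1}(pos (- r)) ?oppr_ge0 ?(ltW r0) // one_paramK //; exact: root_one_param.
have f2 v g : pi g (P2 v) = P2 v.
  apply: (@root_fixed i1 i0 i2) => // r.
  have pos c : 0 <= c -> neg (root i1 i0) c (P2 v) = P2 v.
    exact: (triple_limit_z1 D0 kappa0 kappa1 delta0 deltak M1 absorb b1 b2 b3 (gn _ _ h20) (gn _ _ h12) (gn _ _ h01) (gn _ _ h10) (gn _ _ h02)).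
  have [r0|r0] := leP r 0.
    by have := pos (- r); rewrite /neg opprK; apply; rewrite oppr_ge0.
  have h := pos r (ltW r0).
  by rewrite -{1}h /neg one_paramK //; exact: root_one_param.
have l1 : linear P1 := triple_limit_linear D0 kappa0 delta0 deltak M1 absorb a1 a2 a3 g01 g12 g20 g02 g10.
have l2 : linear P2 := triple_limit_linear D0 kappa0 delta0 deltak M1 absorb b1 b2 b3 (gn _ _ h20) (gn _ _ h12) (gn _ _ h01) (gn _ _ h10) (gn _ _ h02).
have [K1 K10 hK1] := triple_limitP D0 kappa0 delta0 deltak M1 absorb a1 a2 a3 g01 g12 g20 g02 g10.
have [K2 K20 hK2] := triple_limitP D0 kappa0 delta0 deltak M1 absorb b1 b2 b3 (gn _ _ h20) (gn _ _ h12) (gn _ _ h01) (gn _ _ h10) (gn _ _ h02).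
have rate0 : 0 < kappa / 8 * ln 2 by rewrite mulr_gt0 ?divr_gt0 // ln_gt0 // ltr1n.
have W1 : 1 <= range_bound delta M 1 := range_bound_ge1 delta0 M1 ler01.
have W0 : 0 <= range_bound delta M 1 by exact: le_trans W1.
have e8 : 16 <= 8 * expR (2 * 1) :> R by have := expR_ge1Dx (2 * 1 : R); lra.
have av (x : R -> {linear X -> X}) (A : R) v : slow_growth delta M x -> one_param x -> 0 <= A -> A <= 16 ->
    rnorm (avg x A v) <= range_bound delta M 1 * rnorm v.
  move=> gx ox A0 A16; apply: avg_le => // a aA.
  apply: (slow_growth_bounded_on delta0 M1 gx ler01 e8); exact: le_trans A16.
have tr (x y z : R -> {linear X -> X}) v : slow_growth delta M x -> one_param x -> slow_growth delta M y -> one_param y ->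
    slow_growth delta M z -> one_param z ->
    rnorm (triple_avg x y z (2 ^+ 4) v) <= range_bound delta M 1 ^+ 3 * rnorm v.
  move=> gx ox gy oy gz oz; rewrite /triple_avg; set rb := range_bound _ _ _.
  have -> : rb ^+ 3 * rnorm v = rb * (rb * (rb * rnorm v)) by ring.
  have l16 : 2 ^+ 4 <= 16 :> R by rewrite -natrX ler_nat.
  have l1' : (1 : R) <= 16 by rewrite ler1n.
  apply: le_trans (av _ _ _ gx ox ler01 l1') _; rewrite ler_wpM2l //.
  apply: le_trans (av _ _ _ gy oy (exprn_ge0 _ (ler0n _ 2)) l16) _; rewrite ler_wpM2l //.
  exact: av.
have [P PF hP] := half_sum_projection (F := [set v | forall g, pi g v = v]) l1 l2
  (fun v => f1 v) (fun v => f2 v)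
  (fun a u v fu fv g => etrans (linearZZ (pi g) a (u + v)) (congr1 (fun w => a *: w)
     (etrans (linearD (pi g) u v) (f_equal2 +%R (fu g) (fv g)))))
  (fun v vf => triple_limit_fixed
     (fun a => vf _) (fun a => vf _) (fun a => vf _))
  (fun v vf => triple_limit_fixed
     (fun a => vf _) (fun a => vf _) (fun a => vf _))
  K10 K20 rate0 hK1 hK2
  (fun v => tr _ _ _ v g01 (root_one_param h01) g12 (root_one_param h12) g20 (root_one_param h20))
  (fun v => tr _ _ _ v (gn _ _ h20) (on _ _ h20) (gn _ _ h12) (on _ _ h12) (gn _ _ h01) (on _ _ h01)).
exists P => //; exists (K1 + K2), (kappa / 8 * ln 2); split => //; exact: addr_ge0.
Qed.

End Representation.

(** * Bochner integrals *)

Section SimpleIntegral.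
Context {R : realType} d (T : measurableType d) (mu : probability T R).
Context {X : normedModType R[i]}.
Implicit Types (s : seq (set T * X)) (A B D : set T) (x y : X) (F : T -> X).

Definition measurable_sets s := forall Ax, Ax \in s -> measurable Ax.1.

Lemma measurable_sets_cons A x s : measurable_sets ((A, x) :: s) <-> measurable A /\ measurable_sets s.
Proof.
split=> [h|[mA ms] Ax]; last by rewrite inE => /orP[/eqP -> //|]; exact: ms.
by split; [apply: (h (A, x)); rewrite inE eqxx|move=> Ax Axs; apply: h; rewrite inE Axs orbT].
Qed.

Lemma simple_fun_cons A x s t : simple_fun ((A, x) :: s) t = (\1_A t : R)%:C%C *: x + simple_fun s t.
Proof. by rewrite /simple_fun big_cons. Qed.

Lemma measurable_rnorm_simple F s y : (forall y, measurable_fun setT (fun t => rnorm (F t - y))) ->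
  measurable_sets s -> measurable_fun setT (fun t => rnorm (F t - (simple_fun s t + y))).
Proof.
move=> mF; elim: s y => [|[A x] s IH] y.
  by move=> _; under eq_fun do rewrite /simple_fun big_nil add0r; exact: mF.
move=> /measurable_sets_cons[mA ms].
have -> : (fun t => rnorm (F t - (simple_fun ((A, x) :: s) t + y))) =
    (fun t => \1_A t * rnorm (F t - (simple_fun s t + (x + y))) +
              (1 - \1_A t) * rnorm (F t - (simple_fun s t + y))).
  apply/funext => t; rewrite simple_fun_cons indicE; case: (t \in A) => /=.
    by rewrite scale1r mul1r subrr mul0r addr0 (addrC x) addrA.
  by rewrite scale0r add0r mul0r add0r subr0 mul1r.
apply: measurable_funD; apply: measurable_funM; rewrite ?IH //.
- exact: IH.
- by apply: measurable_funB => //; exact: measurable_indic.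
- exact: IH.
Qed.

Lemma measurable_rnorm_simple0 F s : (forall y, measurable_fun setT (fun t => rnorm (F t - y))) ->
  measurable_sets s -> measurable_fun setT (fun t => rnorm (F t - simple_fun s t)).
Proof.
by move=> mF ms; have := measurable_rnorm_simple 0 mF ms; under eq_fun do rewrite addr0.
Qed.

Lemma fine_split A B : measurable A -> measurable B ->
  fine (mu B) = fine (mu (B `&` A)) + fine (mu (B `\` A)).
Proof.
move=> mA mB; rewrite (measureDI mu mB mA) addeC fineD //; apply: fin_num_measure.
  exact: measurableI.
exact: measurableD.
Qed.

(** The sets of a simple function may overlap, so B is split along each of them in turn; [y]
    collects the value already reached on the current piece. *)
Lemma simple_integral_le s B y : measurable_sets s -> measurable B ->
  ((rnorm (\sum_(Ax <- s) (fine (mu (Ax.1 `&` B)))%:C%C *: Ax.2 + (fine (mu B))%:C%C *: y))%:E <=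
   \int[mu]_(t in B) (rnorm (simple_fun s t + y))%:E)%E.
Proof.
elim: s B y => [|[A x] s IH] B y.
  move=> _ mB; rewrite big_nil add0r rnormZr ger0_norm ?fine_ge0 //.
  under eq_integral do rewrite /simple_fun big_nil add0r.
  by rewrite integral_cst // EFinM fineK ?fin_num_measure // muleC.
move=> /measurable_sets_cons[mA ms] mB.
have mBA : measurable (B `&` A) by exact: measurableI.
have mBD : measurable (B `\` A) by exact: measurableD.
have mf y' : measurable_fun setT (fun t => (rnorm (simple_fun s t + y'))%:E).
  apply/measurable_EFinP.
  have -> : (fun t => rnorm (simple_fun s t + y')) = fun t => rnorm (0 - (simple_fun s t + y')).
    by apply/funext => t; rewrite sub0r rnormN.
  apply: (@measurable_rnorm_simple (fun=> 0)) => // z; exact: measurable_cst.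
have mf' : measurable_fun setT (fun t => (rnorm (simple_fun ((A, x) :: s) t + y))%:E).
  apply/measurable_EFinP.
  have -> : (fun t => rnorm (simple_fun ((A, x) :: s) t + y)) =
      fun t => rnorm (0 - (simple_fun ((A, x) :: s) t + y)).
    by apply/funext => t; rewrite sub0r rnormN.
  apply: (@measurable_rnorm_simple (fun=> 0)) => //.
  by apply/measurable_sets_cons.
have BE : B = (B `&` A) `|` (B `\` A) by rewrite setDE -setIUr setUv setIT.
have -> : (\int[mu]_(t in B) (rnorm (simple_fun ((A, x) :: s) t + y))%:E =
    \int[mu]_(t in B `&` A) (rnorm (simple_fun s t + (x + y)))%:E +
    \int[mu]_(t in B `\` A) (rnorm (simple_fun s t + y))%:E)%E.
  rewrite {1}BE ge0_integral_setU //=.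
  - congr (_ + _)%E; apply: eq_integral => t; rewrite inE => -[_ At].
      by rewrite simple_fun_cons indicE mem_set //= scale1r (addrC x) addrA.
    by rewrite simple_fun_cons indicE memNset //= scale0r add0r.
  - exact: measurable_funTS.
  - by move=> t _; rewrite lee_fin rnorm_ge0.
  - by apply/disj_setPS => t [[_ At] [_ nAt]].
apply: le_trans (leeD (IH _ _ ms mBA) (IH _ _ ms mBD)).
rewrite -EFinD lee_fin; apply: le_trans (ler_rnormD _ _).
rewrite le_eqVlt; apply/orP; left; apply/eqP; congr rnorm.
rewrite big_cons /= addrACA -big_split /=.
have -> : \sum_(Ax <- s) ((fine (mu (Ax.1 `&` (B `&` A))))%:C%C *: Ax.2 +
    (fine (mu (Ax.1 `&` (B `\` A))))%:C%C *: Ax.2) =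
    \sum_(Ax <- s) (fine (mu (Ax.1 `&` B)))%:C%C *: Ax.2.
  apply: eq_big_seq => Ax Axs; rewrite -scalerDl -rmorphD.
  rewrite (@fine_split A (Ax.1 `&` B)) //; last by apply: measurableI => //; exact: ms.
  by rewrite setIA setIDA.
rewrite (fine_split mA mB) rmorphD !scalerDl scalerDr (setIC A B) -!addrA addrCA.
by [].
Qed.

Variable D : set T.
Hypotheses (mD : measurable D) (D1 : mu (~` D) = 0%E).

Definition weighted_sum s : X := \sum_(Ax <- s) (fine (mu Ax.1))%:C%C *: Ax.2.

Lemma fine_setI_full A : measurable A -> fine (mu (A `&` D)) = fine (mu A).
Proof.
move=> mA; rewrite (@fine_split D A) //.
suff -> : mu (A `\` D) = 0%E by rewrite addr0.
apply/eqP; rewrite eq_le measure_ge0 andbT -D1 le_measure ?inE //.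
- exact: measurableD.
- exact: measurableC.
Qed.

Lemma weighted_sum_le s : measurable_sets s ->
  ((rnorm (weighted_sum s))%:E <= \int[mu]_(t in D) (rnorm (simple_fun s t))%:E)%E.
Proof.
move=> ms; have := @simple_integral_le s D 0 ms mD.
rewrite scaler0 addr0; under eq_integral do rewrite addr0.
suff -> : weighted_sum s = \sum_(Ax <- s) (fine (mu (Ax.1 `&` D)))%:C%C *: Ax.2 by [].
by apply: eq_big_seq => Ax Axs; rewrite fine_setI_full //; exact: ms.
Qed.

Definition neg_seq s : seq (set T * X) := [seq (Ax.1, - Ax.2) | Ax <- s].

Lemma weighted_sum_dist s s' : measurable_sets s -> measurable_sets s' ->
  ((rnorm (weighted_sum s - weighted_sum s'))%:E <=
    \int[mu]_(t in D) (rnorm (simple_fun s t - simple_fun s' t))%:E)%E.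
Proof.
move=> ms ms'.
have E t : simple_fun (s ++ neg_seq s') t = simple_fun s t - simple_fun s' t.
  rewrite /simple_fun big_cat /= big_map /= -sumrN; congr (_ + _).
  by apply: eq_bigr => Ax _; rewrite scalerN.
have -> : weighted_sum s - weighted_sum s' = weighted_sum (s ++ neg_seq s').
  rewrite /weighted_sum big_cat /= big_map /= -sumrN; congr (_ + _).
  by apply: eq_bigr => Ax _; rewrite scalerN.
under eq_integral do rewrite -E.
apply: weighted_sum_le => Ax; rewrite mem_cat => /orP[/ms //|/mapP[Ax' /ms' mAx ->]].
exact: mAx.
Qed.

(** The last hypothesis makes [v] the integral of F over D: simple functions converge to F uniformly
    on D and their sums converge to [v]. *)
Lemma weighted_sum_approx F v s : (forall y, measurable_fun setT (fun t => rnorm (F t - y))) ->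
  measurable_sets s ->
  (forall e : R, 0 < e -> exists r, [/\ measurable_sets r,
     forall t, D t -> rnorm (F t - simple_fun r t) <= e & rnorm (weighted_sum r - v) <= e]) ->
  ((rnorm (weighted_sum s - v))%:E <= \int[mu]_(t in D) (rnorm (F t - simple_fun s t))%:E)%E.
Proof.
move=> mF ms h.
have rnorm_ge0E t : (0 <= (rnorm (F t - simple_fun s t))%:E)%E by rewrite lee_fin rnorm_ge0.
 apply/lee_addgt0Pr => e e0.
have [r [mr hr vr]] := h _ (divr_gt0 e0 (ltr0n R 2)).
apply: (@le_trans _ _ ((rnorm (weighted_sum s - weighted_sum r))%:E + (e / 2)%:E)%E).
  by rewrite -EFinD lee_fin; apply: le_trans (ler_rnorm_trans (weighted_sum r) _ _) _; rewrite lerD2l.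
rewrite [in X in (_ <= X)%E](splitr e) EFinD addeA; apply: leeD => //.
apply: le_trans (weighted_sum_dist ms mr) _.
have mFs := measurable_rnorm_simple0 mF ms.
apply: (@le_trans _ _ (\int[mu]_(t in D) ((rnorm (F t - simple_fun s t))%:E + (cst (e / 2)%:E) t))%E).
  apply: ge0_le_integral => //.
  - by move=> t _; rewrite lee_fin rnorm_ge0.
  - apply/measurable_EFinP/measurable_funTS.
    have -> : (fun t => rnorm (simple_fun s t - simple_fun r t)) =
        fun t => rnorm (0 - simple_fun (r ++ neg_seq s) t).
      apply/funext => t; rewrite sub0r rnormN rnormBC /simple_fun big_cat /= big_map /= -sumrN.
      by congr (rnorm (_ + _)); apply: eq_bigr => Ax _; rewrite scalerN.
    apply: (@measurable_rnorm_simple0 (fun=> 0)) => [y|Ax]; first exact: measurable_cst.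
    by rewrite mem_cat => /orP[/mr //|/mapP[Ax' /ms mAx ->]]; exact: mAx.
  - apply: emeasurable_funD; first exact/measurable_EFinP/measurable_funTS.
    exact: measurable_cst.
  - move=> t Dt; rewrite -EFinD lee_fin; apply: le_trans (ler_rnorm_trans (F t) _ _) _.
    by rewrite (rnormBC _ (F t)) lerD2l; exact: hr.
have mFD : measurable_fun D (fun t => (rnorm (F t - simple_fun s t))%:E).
  exact/measurable_EFinP/measurable_funTS.
have e2 : (0 <= (e / 2)%:E)%E by rewrite lee_fin divr_ge0 // ltW.
rewrite (ge0_integralD mu mD (fun t _ => rnorm_ge0E t) mFD (fun _ _ => e2) (measurable_cst _)).
rewrite leeD2l // integral_cst // -[leRHS]mule1; apply: lee_wpmul2l; last exact: probability_le1.
by rewrite lee_fin divr_ge0 // ltW.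
Qed.

End SimpleIntegral.

Section MeasurableContinuous.
Context {R : realType}.
Notation I := (measurableTypeR R).

Lemma measurable_fun_gt d (T : measurableType d) (f : T -> R) :
  (forall a, measurable [set t | a < f t]) -> measurable_fun setT f.
Proof.
move=> mf mD; apply: (measurability _ (RGenOInfty.measurableE R)) => //.
move=> /= _ [_ [x ->] <-]; apply: measurableI => //.
suff -> : f @^-1` `]x, +oo[%classic = [set t | x < f t] by exact: mf.
by apply/funext => t /=; rewrite in_itv /= andbT.
Qed.

(* An open set is the union of the boxes of rational centre and radius [1 / (n + 1)]
   that it contains. *)
Lemma open_measurable3 (A : set (R * R * R)) : open A -> measurable (A : set (I * I * I)).
Proof.
move=> oA.
pose seg (q : rat) n : set I := [set t : R | ratr q - n.+1%:R^-1 < t < ratr q + n.+1%:R^-1].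
have mseg q n : measurable (seg q n).
  suff -> : seg q n = [set` `](ratr q - n.+1%:R^-1 : R), ratr q + n.+1%:R^-1[] by exact: measurable_itv.
  by apply/funext => t /=; rewrite in_itv.
pose box (c : rat * rat * rat * nat) : set (I * I * I) :=
  ((seg c.1.1.1 c.2 `*` seg c.1.1.2 c.2) `*` seg c.1.2 c.2).
have mbox c : measurable (box c) by apply: measurableX; [apply: measurableX|]; exact: mseg.
have -> : A = \bigcup_c (if `[< box c `<=` (A : set (I * I * I)) >] then box c else set0).
  apply/seteqP; split=> [[[a b] c] At|t [k _]]; last by case: (asboolP (box k `<=` _)) => [|//]; exact.
  have /nbhs_ballP[e /= e0 he] : nbhs (a, b, c) A by exact: open_nbhs_nbhs.
  have e2 : 0 < e / 2 by rewrite divr_gt0.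
  have [n ne] : exists n, n.+1%:R^-1 < e / 2.
    exists (Num.truncn (e / 2)^-1).
    by rewrite -[ltRHS]invrK ltf_pV2 ?posrE ?invr_gt0 // truncnS_gt.
  have n0 : 0 < n.+1%:R^-1 :> R by rewrite invr_gt0 ltr0n.
  have near (x : R) : exists q : rat, seg q n x.
    have lt : x - n.+1%:R^-1 < x + n.+1%:R^-1 by rewrite ltrD2l (lt_trans _ n0) // oppr_lt0.
    have [q] := rat_in_itvoo lt; rewrite in_itv /= => qx; exists q; rewrite /seg /=.
    by move: n.+1%:R^-1 qx => rho /andP[q1 q2]; apply/andP; split; lra.
  have close q (x y : R) : seg q n x -> seg q n y -> ball x e y.
    rewrite /seg -ball_normE /=; move: n.+1%:R^-1 ne => rho rhoe /andP[x1 x2] /andP[y1 y2].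
    by rewrite ltr_norml; apply/andP; split; lra.
  have [qa ha] := near a; have [qb hb] := near b; have [qc hc] := near c.
  exists (qa, qb, qc, n) => //; case: asboolP => [_|]; first by split; [split|].
  case=> -[[x y] z] [[/= xa yb] zc]; apply: he.
  by split; [split|]; [exact: close ha xa|exact: close hb yb|exact: close hc zc].
apply: countable_bigcupT_measurable => // c.
by case: asboolP.
Qed.

End MeasurableContinuous.

(** * Riemann sums on the unit cube *)

Section CubeMeasure.
Context {R : realType}.
Notation I := (measurableTypeR R).

Definition unit_prob : probability I R := uniform_prob (@ltr01 R).
Definition cube_prob : probability (I * I * I)%type R := ((unit_prob \x unit_prob) \x unit_prob)%E.

(** Half-open, so that the grid cells partition it. *)
Definition cube : set (I * I * I) := ([set` `[(0 : R), 1[] `*` [set` `[(0 : R), 1[]) `*` [set` `[(0 : R), 1[].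

Lemma unit_prob_ico (s t : R) : 0 <= s -> s <= t -> t <= 1 -> unit_prob [set` `[s, t[] = (t - s)%:E.
Proof.
move=> s0 st t1; rewrite /unit_prob /= /uniform_prob.
transitivity (\int[lebesgue_measure]_(x in [set` `[s, t[]) (cst 1%:E x) : \bar R)%E.
  apply: eq_integral => x; rewrite inE /= in_itv /= => /andP[sx xt].
  by rewrite /uniform_pdf subr0 invr1 (le_trans s0 sx) (le_trans (ltW xt) t1).
have mI : measurable ([set` `[s, t[] : set I) by exact: measurable_itv.
rewrite (integral_cst lebesgue_measure mI) mul1e.
have := @lebesgue_measure_itv R `[s, t[ => /= ->; rewrite lte_fin; case: ltP => // ts.
by rewrite (@le_anti _ _ s t) ?st // subrr.
Qed.

Lemma cube_probX (A B C : set I) : measurable A -> measurable B -> measurable C ->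
  cube_prob ((A `*` B) `*` C) = (unit_prob A * unit_prob B * unit_prob C)%E.
Proof.
move=> mA mB mC; 
have mAB : measurable (A `*` B) by exact: measurableX.
rewrite /cube_prob /= (product_measure1E _ _ mAB mC); congr (_ * _)%E.
exact: (product_measure1E _ _ mA mB).
Qed.

Lemma measurable_cube : measurable cube.
Proof. by apply: measurableX; [apply: measurableX|]; exact: measurable_itv. Qed.

Lemma cube_prob_full : cube_prob (~` cube) = 0%E.
Proof.
rewrite probability_setC; last exact: measurable_cube.
rewrite cube_probX; try exact: measurable_itv.
by rewrite unit_prob_ico // subr0 !mule1 subee.
Qed.

Definition corner N (c : 'I_N * 'I_N * 'I_N) : R * R * R :=
  (c.1.1%:R / N%:R, c.1.2%:R / N%:R, c.2%:R / N%:R).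

Definition grid_ico N (i : 'I_N) : set I := [set` `[(i%:R / N%:R : R), i.+1%:R / N%:R[].

Definition grid_cell N (c : 'I_N * 'I_N * 'I_N) : set (I * I * I) :=
  (grid_ico c.1.1 `*` grid_ico c.1.2) `*` grid_ico c.2.

Lemma measurable_grid_cell N (c : 'I_N * 'I_N * 'I_N) : measurable (grid_cell c).
Proof. by apply: measurableX; [apply: measurableX|]; exact: measurable_itv. Qed.

Lemma unit_prob_grid_ico N (i : 'I_N) : (0 < N)%N -> unit_prob (grid_ico i) = (N%:R^-1)%:E.
Proof.
move=> N0; have Nr : 0 < N%:R :> R by rewrite ltr0n.
rewrite unit_prob_ico.
- by rewrite -mulrBl -natrB ?leqnSn // subSnn mul1r.
- by rewrite divr_ge0.
- by rewrite ler_pM2r ?invr_gt0 // ler_nat.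
- by rewrite ler_pdivrMr // mul1r ler_nat.
Qed.

Lemma cube_prob_grid_cell N (c : 'I_N * 'I_N * 'I_N) : (0 < N)%N ->
  cube_prob (grid_cell c) = (N%:R^-1 * N%:R^-1 * N%:R^-1)%:E.
Proof.
move=> N0; rewrite cube_probX; try exact: measurable_itv.
by rewrite !unit_prob_grid_ico.
Qed.

Lemma grid_ico_exists N (t : R) : (0 < N)%N -> 0 <= t < 1 -> exists i : 'I_N, grid_ico i t.
Proof.
move=> N0 /andP[t0 t1]; have Nr : 0 < N%:R :> R by rewrite ltr0n.
have /andP[h1 h2] := truncn_itv (mulr_ge0 t0 (ltW Nr)).
have iN : (Num.truncn (t * N%:R) < N)%N.
  by rewrite -(ltr_nat R); apply: le_lt_trans h1 _; rewrite gtr_pMl.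
by exists (Ordinal iN); rewrite /grid_ico /= in_itv /= ler_pdivrMr // ltr_pdivlMr // h1.
Qed.

Lemma grid_ico_inj N (i j : 'I_N) (t : R) : (0 < N)%N -> grid_ico i t -> grid_ico j t -> i = j.
Proof.
move=> N0; have Nr : 0 < N%:R :> R by rewrite ltr0n.
rewrite /grid_ico /= !in_itv /= !ler_pdivrMr // !ltr_pdivlMr // => /andP[i1 i2] /andP[j1 j2].
apply/val_inj/eqP; rewrite eqn_leq; apply/andP; split; rewrite -ltnS -(ltr_nat R).
  exact: le_lt_trans i1 j2.
exact: le_lt_trans j1 i2.
Qed.

Lemma grid_cell_inj N (c c' : 'I_N * 'I_N * 'I_N) (t : I * I * I) : (0 < N)%N ->
  grid_cell c t -> grid_cell c' t -> c = c'.
Proof.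
case: c c' => [[i j] k] [[i' j'] k'] N0 [[/= h1 h2] h3] [[/= h1' h2'] h3'].
by rewrite (grid_ico_inj N0 h1 h1') (grid_ico_inj N0 h2 h2') (grid_ico_inj N0 h3 h3').
Qed.

Context {X : banachType R}.
Implicit Types F : R * R * R -> X.

Definition riemann F N : seq (set (I * I * I) * X) :=
  [seq (grid_cell c, F (corner c)) | c <- enum {: 'I_N * 'I_N * 'I_N}].

Lemma measurable_riemann F N : measurable_sets (riemann F N).
Proof. by move=> Ax /mapP[c _ ->]; exact: measurable_grid_cell. Qed.

Lemma simple_fun_riemann F N (c : 'I_N * 'I_N * 'I_N) t : (0 < N)%N -> grid_cell c t ->
  simple_fun (riemann F N) t = F (corner c).
Proof.
move=> N0 ct; rewrite /simple_fun big_map big_enum /= (bigD1 c) //= big1 => [|c' c'c].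
  by rewrite addr0 indicE mem_set // scale1r.
rewrite indicE memNset ?scale0r // => c't.
by move/eqP: c'c; apply; exact: grid_cell_inj c't ct.
Qed.

Lemma corner_close F (e : R) : continuous F -> 0 < e -> exists N0, forall N, (N0 < N)%N ->
  forall t, cube t -> exists2 c : 'I_N * 'I_N * 'I_N, grid_cell c t & rnorm (F t - F (corner c)) < e.
Proof.
move=> cF e0.
pose K : set (R * R * R) := (`[0, 1]%classic `*` `[0, 1]%classic) `*` `[0, 1]%classic.
have cK : compact K by apply: compact_setX; [apply: compact_setX|]; exact: segment_compact.
have [d d0 hd] := compact_uniform cK cF e0.
exists (Num.truncn d^-1) => N dN [[a b] c] [[/= a01 b01] c01].
have N0 : (0 < N)%N by apply: leq_ltn_trans dN.
have Nr : 0 < N%:R :> R by rewrite ltr0n.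
have Nd : N%:R^-1 < d.
  rewrite -[d]invrK ltf_pV2 ?posrE ?invr_gt0 //.
  by apply: lt_le_trans (truncnS_gt _) _; rewrite ler_nat.
move: a01 b01 c01; rewrite !in_itv /= => a01 b01 c01.
have [i ia] := grid_ico_exists N0 a01; have [j jb] := grid_ico_exists N0 b01.
have [k kc] := grid_ico_exists N0 c01.
exists (i, j, k) => //; apply: hd.
  have h (l : 'I_N) : (0 : R) <= l%:R / N%:R <= (1 : R).
    by rewrite divr_ge0 //= (ler_pdivrMr _ _ Nr) mul1r ler_nat ltnW.
  by split; [split|]; rewrite /= in_itv; exact: h.
have h (l : 'I_N) (x : R) : grid_ico l x -> `|l%:R / N%:R - x| < d.
  rewrite /grid_ico /= in_itv /= -natr1 mulrDl mul1r => /andP[l1 l2].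
  by rewrite ltr_norml; apply/andP; split; lra.
by split; [split|]; rewrite /= -ball_normE /=; exact: h.
Qed.

(** Total boundedness of the image; the finite nets serve to build simple functions on the group. *)
Lemma cube_net F (e : R) : continuous F -> 0 < e -> exists ys : seq X, forall t, cube t ->
  exists2 y, y \in ys & rnorm (F t - y) < e.
Proof.
move=> cF e0; have [N0 hN0] := corner_close cF e0.
exists [seq F (corner c) | c <- enum {: 'I_N0.+1 * 'I_N0.+1 * 'I_N0.+1}] => t ct.
have [c _ h] := hN0 _ (ltnSn N0) t ct.
by exists (F (corner c)) => //; apply: map_f; rewrite mem_enum.
Qed.

Lemma riemann_approx F L : continuous F -> weighted_sum cube_prob (riemann F N) @[N --> \oo] --> L ->
  forall e : R, 0 < e -> exists s, [/\ measurable_sets s,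
    forall t, cube t -> rnorm (F t - simple_fun s t) <= e & rnorm (weighted_sum cube_prob s - L) <= e].
Proof.
move=> cF FL e e0; have [N0 hN0] := corner_close cF e0.
have [N1 hN1] := (cvg_rnorm_seqP _ _).1 FL e e0.
exists (riemann F (N0 + N1).+1); split; first exact: measurable_riemann.
- move=> t ct; have N0N : (N0 < (N0 + N1).+1)%N by rewrite ltnS leq_addr.
  have [c tc h] := hN0 _ N0N t ct.
  by rewrite (simple_fun_riemann F _ tc) // ltW.
- by apply/ltW/hN1; rewrite leqW // leq_addl.
Qed.

Lemma weighted_sum_riemann F N : (0 < N)%N -> weighted_sum cube_prob (riemann F N) =
  rsum (fun a => rsum (fun b => rsum (fun c => F (a, b, c)) N) N) N.
Proof.
move=> N0; rewrite /weighted_sum big_map big_enum /=.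
under eq_bigr do rewrite cube_prob_grid_cell //= !rmorphM -!scalerA.
rewrite /rsum -scaler_sumr; congr (_ *: _).
under [RHS]eq_bigr do rewrite -scaler_sumr.
rewrite -!scaler_sumr; congr (_ *: _); congr (_ *: _).
rewrite pair_bigA /= pair_bigA /=.
by apply: eq_bigr => -[[i j] k].
Qed.

(** An exchange of finite sums, for the inverses, whose factors come in reversed order. *)
Lemma weighted_sum_riemann_rev F N : (0 < N)%N ->
  weighted_sum cube_prob (riemann F N) =
  weighted_sum cube_prob (riemann (fun w => F (w.2, w.1.2, w.1.1)) N).
Proof.
move=> N0; rewrite !weighted_sum_riemann //=.
have exch (h : R -> R -> X) :
    rsum (fun a => rsum (fun b => h a b) N) N = rsum (fun b => rsum (fun a => h a b) N) N.
  by rewrite /rsum -!scaler_sumr exchange_big.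
have cong (h h' : R -> X) : h =1 h' -> rsum h N = rsum h' N by move=> /funext ->.
rewrite (cong _ _ (fun a => exch (fun b c => F (a, b, c)))) exch.
exact: (cong _ _ (fun c => exch (fun a b => F (a, b, c)))).
Qed.

Lemma rsum_linear (T : {linear X -> X}) f N : T (rsum f N) = rsum (fun s => T (f s)) N.
Proof. by rewrite /rsum linearZ linear_sum. Qed.

(** The inner vector varies with N as well; the uniform bound W carries its error through, so that
    iterated Riemann sums converge along the diagonal. *)
Lemma rsum_avg_cvg (x : R -> {linear X -> X}) (A W : R) (u : nat -> X) (w : X) : one_param x -> 0 <= W ->
  (forall s v, 0 <= s <= 1 -> rnorm (x (A * s) v) <= W * rnorm v) ->
  u N @[N --> \oo] --> w -> rsum (fun s => x (A * s) (u N)) N @[N --> \oo] --> avg x A w.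
Proof.
move=> ox W0 xW uw.
have -> : (fun N => rsum (fun s => x (A * s) (u N)) N) =
    (fun N => rsum (fun s => x (A * s) w) N + rsum (fun s => x (A * s) (u N - w)) N).
  apply/funext => N; 
  rewrite (_ : (fun s => x (A * s) (u N - w)) = fun s => x (A * s) (u N) - x (A * s) w);
    last by apply/funext => s; rewrite linearB.
  by rewrite -rsumB addrC subrK.
rewrite -[avg x A w]addr0; apply: cvgD; first exact/cvg_ravg/one_param_scale0.
apply/cvg_rnorm_seqP => e e0; have W1 : 0 < W + 1 by lra.
have [N hN] := (cvg_rnorm_seqP _ _).1 uw _ (divr_gt0 e0 W1).
exists N => n /hN; rewrite subr0 ltr_pdivlMr // => h.
apply: (@le_lt_trans _ _ (W * rnorm (u n - w))).
  by apply: rsum_le => [s s01|]; [exact: xW|rewrite mulr_ge0 // rnorm_ge0].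
by apply: le_lt_trans h; rewrite mulrC ler_wpM2l ?rnorm_ge0 // lerDl.
Qed.

Variables (p q r : R -> {linear X -> X}) (b W : R).
Hypotheses (op : one_param p) (oq : one_param q) (or : one_param r) (W0 : 0 <= W).
Hypotheses (pW : forall s v, 0 <= s <= 1 -> rnorm (p (1 * s) v) <= W * rnorm v)
  (qW : forall s v, 0 <= s <= 1 -> rnorm (q (b * s) v) <= W * rnorm v).

Lemma riemann_triple_avg F v : (forall a b' c, F (a, b', c) = p a (q (b * b') (r c v))) ->
  weighted_sum cube_prob (riemann F N) @[N --> \oo] --> triple_avg p q r b v.
Proof.
move=> FE.
have : rsum (fun a => p (1 * a) (rsum (fun b' => q (b * b') (rsum (fun c => r (1 * c) v) N)) N)) N
    @[N --> \oo] --> triple_avg p q r b v.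
  apply: rsum_avg_cvg op W0 pW _; apply: rsum_avg_cvg oq W0 qW _.
  exact/cvg_ravg/one_param_scale0.
apply: cvg_trans; apply: near_eq_cvg; exists 1%N => // N /= N0.
rewrite weighted_sum_riemann //.
congr (rsum _ _); apply/funext => a; rewrite rsum_linear; congr (rsum _ _); apply/funext => b'.
rewrite !rsum_linear; congr (rsum _ _); apply/funext => c.
by rewrite FE !mul1r.
Qed.

Lemma riemann_triple_avg_rev F v : (forall a b' c, F (c, b', a) = p a (q (b * b') (r c v))) ->
  weighted_sum cube_prob (riemann F N) @[N --> \oo] --> triple_avg p q r b v.
Proof.
move=> FE; have := @riemann_triple_avg (fun w => F (w.2, w.1.2, w.1.1)) v FE.
apply: cvg_trans; apply: near_eq_cvg; exists 1%N => // N /= N0.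
by rewrite -weighted_sum_riemann_rev.
Qed.

End CubeMeasure.

(** * Integration against the mean of two image measures *)

Section AverageOfLaws.
Context {R : realType} d d' (T : measurableType d) (T' : measurableType d').
Variables (P : probability T R) (f g : {mfun T >-> T'}).

Definition law_average_measure : {measure set T' -> \bar R} :=
  mscale ((2^-1 : R)%:nng) (measure_add (distribution P f) (distribution P g)).

Definition law_average : set T' -> \bar R := law_average_measure.

Lemma law_averageE A : law_average A = ((2^-1)%:E * (P (f @^-1` A) + P (g @^-1` A)))%E.
Proof. by rewrite -(measure_addE (distribution P f) (distribution P g) A). Qed.

Lemma law_average_swap A B : f @^-1` A = g @^-1` B -> g @^-1` A = f @^-1` B -> law_average A = law_average B.
Proof. by rewrite !law_averageE => -> ->; rewrite addeC. Qed.

Let law_average0 : law_average set0 = 0%E.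
Proof. exact: measure0. Qed.

Let law_average_fin A : measurable A -> law_average A \is a fin_num.
Proof.
move=> mA; rewrite law_averageE fin_numM // fin_numD.
by rewrite !fin_num_measure //; exact: measurable_funPTI.
Qed.

Let law_average_sigma : semi_sigma_additive law_average.
Proof. exact: measure_semi_sigma_additive. Qed.

HB.instance Definition _ := isCharge.Build _ T' R law_average
  law_average0 law_average_fin law_average_sigma.

Definition law_average_charge : {charge set T' -> \bar R} := law_average.

(** The charge is positive, so the negative part vanishes for every Hahn decomposition. *)
Lemma charge_variation_law_average S N (mSN : hahn_decomposition law_average_charge S N) A :
  measurable A -> charge_variation mSN A = law_average_measure A.
Proof.
move=> mA; have [[mS _] [mN negN] _ _] := mSN.
have jn0 : jordan_neg mSN A = 0%E.
  rewrite jordan_negE cjordan_negE /crestr0 mem_set // /crestr.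
  suff -> : law_average_charge (A `&` N) = 0%E by rewrite oppe0.
  apply/eqP; rewrite eq_le negN /=; last exact: subIsetr.
    exact: measure_ge0 law_average_measure _.
  exact: measurableI.
have jdec : law_average A = (jordan_pos mSN A - jordan_neg mSN A)%E.
  by have := jordan_decomp mSN mA; rewrite /cadd /= cscaleN1.
have vE : charge_variation mSN A = (jordan_pos mSN A + jordan_neg mSN A)%E by [].
by rewrite vE jn0 adde0; rewrite jn0 oppe0 adde0 in jdec; rewrite -jdec.
Qed.

Variable D : set T.
Hypotheses (mD : measurable D) (D1 : P (~` D) = 0%E).

Lemma integral_charge_variation_law_average S N (mSN : hahn_decomposition law_average_charge S N)
    (h : T' -> R) : measurable_fun setT h -> (forall t, 0 <= h t) ->
  (\int[charge_variation mSN]_t (h t)%:E =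
   (2^-1)%:E * (\int[P]_(w in D) (h (f w))%:E + \int[P]_(w in D) (h (g w))%:E))%E.
Proof.
move=> mh h0; have h0E t : (0 <= (h t)%:E)%E by rewrite lee_fin.
have mhE : measurable_fun setT (fun t => (h t)%:E) by exact/measurable_EFinP.
have restr (u : {mfun T >-> T'}) : (\int[distribution P u]_t (h t)%:E = \int[P]_(w in D) (h (u w))%:E)%E.
  rewrite (ge0_integral_distribution _ mhE h0E) /=.
  have mu : measurable_fun setT (fun w => (h (u w))%:E).
    by apply/measurable_EFinP; exact: measurableT_comp.
  rewrite (ge0_negligible_integral (measurableC mD) measurableT mu) //.
  by rewrite setTD setCK.
rewrite -!restr (@eq_measure_integral _ _ _ _ law_average_measure); last first.
  by move=> A mA _; exact: charge_variation_law_average.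
rewrite /law_average_measure ge0_integral_mscale //.
by rewrite ge0_integral_measure_add.
Qed.

Context {X : normedModType R[i]}.
Implicit Types (s : seq (set T' * X)) (F : T' -> X) (ys : seq X).

Definition pull (u : T -> T') s : seq (set T * X) := [seq (u @^-1` Ax.1, Ax.2) | Ax <- s].

Lemma simple_fun_pull u s w : simple_fun (pull u s) w = simple_fun s (u w).
Proof. by rewrite /simple_fun big_map /=. Qed.

Lemma measurable_pull (u : {mfun T >-> T'}) s : measurable_sets s -> measurable_sets (pull u s).
Proof. by move=> ms Ax /mapP[Bx /ms mB ->]; exact: measurable_funPTI. Qed.

Lemma simple_integral_law_average s : measurable_sets s -> simple_integral law_average_charge s =
  (2^-1 : R)%:C%C *: (weighted_sum P (pull f s) + weighted_sum P (pull g s)).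
Proof.
move=> ms; rewrite /simple_integral /weighted_sum !big_map -big_split /= scaler_sumr.
apply: eq_big_seq => Ax /ms mA.
rewrite [law_average _]law_averageE -scalerDl scalerA -rmorphD -rmorphM; congr (_%:C%C *: _).
by rewrite fineM ?fineD ?fin_numD ?fin_num_measure //; exact: measurable_funPTI.
Qed.

Variables (F : T' -> X) (vf vg : X).
Hypothesis mF : forall y, measurable_fun setT (fun t => rnorm (F t - y)).
Hypothesis approx_f : forall e : R, 0 < e -> exists r, [/\ measurable_sets r,
  forall w, D w -> rnorm (F (f w) - simple_fun r w) <= e & rnorm (weighted_sum P r - vf) <= e].
Hypothesis approx_g : forall e : R, 0 < e -> exists r, [/\ measurable_sets r,
  forall w, D w -> rnorm (F (g w) - simple_fun r w) <= e & rnorm (weighted_sum P r - vg) <= e].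

(** Being valid for all simple functions and all Hahn decompositions, this yields both the
    uniqueness of the Bochner integral and the convergence of the approximations built below. *)
Lemma simple_integral_dist S N (mSN : hahn_decomposition law_average_charge S N) s : measurable_sets s ->
  ((rnorm (simple_integral law_average_charge s - (2^-1 : R)%:C%C *: (vf + vg)))%:E <=
   \int[charge_variation mSN]_t (rnorm (F t - simple_fun s t))%:E)%E.
Proof.
move=> ms; have mFs := measurable_rnorm_simple0 mF ms.
rewrite (integral_charge_variation_law_average mSN mFs); last by move=> t; exact: rnorm_ge0.
rewrite simple_integral_law_average // -scalerBr rnormZr ger0_norm // opprD addrACA EFinM.
apply: lee_wpmul2l => //; apply: (@le_trans _ _ ((rnorm (weighted_sum P (pull f s) - vf))%:E +
    (rnorm (weighted_sum P (pull g s) - vg))%:E)%E).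
  by rewrite -EFinD lee_fin ler_rnormD.
apply: leeD.
  under eq_integral do rewrite -simple_fun_pull.
  apply: (@weighted_sum_approx _ _ _ _ _ _ mD D1 (F \o f)) approx_f => [y|]; last exact: measurable_pull.
  exact: measurableT_comp (mF y) _.
under eq_integral do rewrite -simple_fun_pull.
apply: (@weighted_sum_approx _ _ _ _ _ _ mD D1 (F \o g)) approx_g => [y|]; last exact: measurable_pull.
exact: measurableT_comp (mF y) _.
Qed.

(** Its value at t is the first point of the net within [e] of [F t]: removing each set from the
    later ones makes them disjoint. *)
Fixpoint net_fun (e : R) ys : seq (set T' * X) :=
  if ys is y :: ys' then
    ([set t | rnorm (F t - y) < e], y) ::
    [seq (Ax.1 `\` [set t | rnorm (F t - y) < e], Ax.2) | Ax <- net_fun e ys']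
  else [::].

Lemma measurable_net_fun e ys : measurable_sets (net_fun e ys).
Proof.
have mB y : measurable [set t | rnorm (F t - y) < e].
  rewrite -[X in measurable X]setTI.
  exact: (measurable_fun_ltr (mF y) (measurable_cst e)).
elim: ys => //= y ys IH; apply/measurable_sets_cons; split=> // Ax /mapP[Bx /IH mBx ->].
exact: measurableD.
Qed.

Lemma net_fun_dist e ys t : (exists2 y, y \in ys & rnorm (F t - y) < e) ->
  rnorm (F t - simple_fun (net_fun e ys) t) < e.
Proof.
elim: ys => [[y]//|y ys IH] [y' y'ys ty'] /=; rewrite simple_fun_cons indicE.
have [ty|ty] := boolP (t \in _).
  rewrite /simple_fun big_map big1 => [|Ax _]; last first.
    rewrite indicE memNset ?scale0r // => -[_]; apply.
    by move: ty; rewrite inE.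
  by rewrite scale1r addr0; move: ty; rewrite inE.
rewrite scale0r add0r.
have -> : simple_fun [seq (Ax.1 `\` [set t | rnorm (F t - y) < e], Ax.2) | Ax <- net_fun e ys] t =
    simple_fun (net_fun e ys) t.
  rewrite /simple_fun big_map; apply: eq_bigr => Ax _ /=; rewrite !indicE.
  suff -> : (t \in Ax.1 `\` [set t | rnorm (F t - y) < e]) = (t \in Ax.1) by [].
  apply/idP/idP; rewrite !inE; first by case.
  by move=> At; split=> // h; move/negP: ty; apply; rewrite inE.
apply: IH; move: y'ys ty'; rewrite inE => /orP[/eqP -> h|]; last by exists y'.
by move/negP: ty; case; rewrite inE.
Qed.

Hypothesis net : forall e : R, 0 < e -> exists ys, forall w, D w ->
  (exists2 y, y \in ys & rnorm (F (f w) - y) < e) /\ (exists2 y, y \in ys & rnorm (F (g w) - y) < e).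

(** [bochner_integral] is a choice among all integrals, so both existence and uniqueness are shown.
    The nets have to be fine only on the images of D, which carry the measure. *)
Lemma law_average_bochner : bochner_integral law_average_charge F = (2^-1 : R)%:C%C *: (vf + vg).
Proof.
set v := _ *: _.
have uniq w : is_bochner_integral law_average_charge F w -> w = v.
  move=> [S [N [mSN [s [/= ms merr err0 sw]]]]].
  apply/eqP; rewrite -subr_eq0; apply/eqP/rnorm0_eq0/EFin_inj.
  have h1 : (rnorm (simple_integral law_average_charge (s n) - v))%:E @[n --> \oo] --> (rnorm (w - v))%:E.
    by apply: cvg_EFin; [exact: nearW|apply: cvg_rnorm; apply: cvgB => //; exact: cvg_cst].
  have h2 : (rnorm (simple_integral law_average_charge (s n) - v))%:E @[n --> \oo] --> 0%E.
    apply: (@squeeze_cvge _ _ _ _ (fun=> 0%E) _ _ _ _ (cvg_cst _) err0); apply: nearW => n.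
    by rewrite lee_fin rnorm_ge0 /= (simple_integral_dist mSN (ms n)).
  by rewrite -(cvg_lim (@ereal_hausdorff R) h1) (cvg_lim (@ereal_hausdorff R) h2).
suff h : is_bochner_integral law_average_charge F v.
  by apply: uniq; apply: (xgetPex 0 (P := [set v | is_bochner_integral law_average_charge F v])); exists v.
have [S [N mSN]] := Hahn_decomposition law_average_charge.
have /choice[ys hys] n : exists ys, forall w, D w ->
    (exists2 y, y \in ys & rnorm (F (f w) - y) < n.+1%:R^-1) /\
    (exists2 y, y \in ys & rnorm (F (g w) - y) < n.+1%:R^-1) by apply: net; rewrite invr_gt0.
pose s n := net_fun n.+1%:R^-1 (ys n).
have ms n : measurable_sets (s n) by exact: measurable_net_fun.
have merr n : measurable_fun setT (fun t => rnorm (F t - simple_fun (s n) t)).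
  exact: measurable_rnorm_simple0.
have err n : (\int[charge_variation mSN]_t (rnorm (F t - simple_fun (s n) t))%:E <= (n.+1%:R^-1)%:E)%E.
  rewrite integral_charge_variation_law_average //; last by move=> t; exact: rnorm_ge0.
  have le1 (u : {mfun T >-> T'}) : (forall w, D w -> rnorm (F (u w) - simple_fun (s n) (u w)) <= n.+1%:R^-1) ->
      (\int[P]_(w in D) (rnorm (F (u w) - simple_fun (s n) (u w)))%:E <= (n.+1%:R^-1)%:E)%E.
    move=> hu; apply: (@le_trans _ _ (\int[P]_(w in D) (cst (n.+1%:R^-1)%:E w))%E).
      apply: ge0_le_integral => //.
      - by move=> w _; rewrite lee_fin rnorm_ge0.
      - by apply/measurable_EFinP/measurable_funTS; exact: measurableT_comp (merr n) _.
    rewrite integral_cst // -[leRHS]mule1; apply: lee_wpmul2l; last exact: probability_le1.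
    by rewrite lee_fin invr_ge0.
  have -> : (n.+1%:R^-1)%:E = ((2^-1)%:E * ((n.+1%:R^-1)%:E + (n.+1%:R^-1)%:E))%E :> \bar R.
    by rewrite -EFinD -EFinM; congr EFin; rewrite -mulr2n -[X in _ * X]mulr_natl mulKf.
  apply: lee_wpmul2l => //; apply: leeD; apply: le1 => w Dw; apply/ltW/net_fun_dist.
    by have [] := hys n w Dw.
  by have [] := hys n w Dw.
exists S, N, mSN, s; split=> //.
  apply: (@squeeze_cvge _ _ _ _ (fun=> 0%E) _ (fun n => (n.+1%:R^-1 : R)%:E)).
  - apply: nearW => n; rewrite err andbT; apply: integral_ge0 => t _.
    by rewrite lee_fin rnorm_ge0.
  - exact: cvg_cst.
  - by apply: cvg_EFin; [exact: nearW|exact: cvg_harmonic].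
apply: cvg_rnormP_le => e e0; near=> n.
rewrite -lee_fin; apply: le_trans (simple_integral_dist mSN (ms n)) _; apply: le_trans (err n) _.
rewrite lee_fin; near: n; apply: (cvgr_le _ (@cvg_harmonic R)).
exact: e0.
Unshelve. all: by end_near. Qed.

End AverageOfLaws.

Section TopologicalGroupLaws.
Context {R : realType} (G : topGroupType).
Notation I := (measurableTypeR R).
Notation borel G := (g_sigma_algebraType (@open G)).

Lemma continuous_measurable_borel3 (phi : R * R * R -> G) : continuous phi ->
  measurable_fun setT (phi : I * I * I -> borel G).
Proof.
move=> cphi; have sub : preimage_set_system setT (phi : I * I * I -> borel G) (@open G) `<=` measurable.
  move=> _ [A oA <-]; rewrite setTI; apply: open_measurable3.
  by apply: open_comp => // w _; exact: cphi.
exact: (@measurability _ _ (I * I * I)%type (borel G) setT phi (@open G) erefl sub).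
Qed.

Lemma borel_continuous_measurable (h : G -> R) : continuous h ->
  measurable_fun setT (h : borel G -> R).
Proof.
move=> ch; apply: measurable_fun_gt => a; apply: sub_sigma_algebra.
apply: (@open_comp _ _ h [set x | a < x]) => [x _|]; first exact: ch.
exact: open_gt.
Qed.

Variable phi : R * R * R -> G.
Hypothesis cphi : continuous phi.
Let psi w := (phi w)^-1%g.

Lemma continuous_law_inv : continuous psi.
Proof. by move=> w; apply: (@continuous_comp _ _ _ phi (fun g => g^-1%g)); [exact: cphi|exact: invg_continuous]. Qed.

Variables f g : {mfun (I * I * I)%type >-> borel G}.
Hypotheses (fE : f = phi :> (_ -> _)) (gE : g = psi :> (_ -> _)).

(** Inversion in the group exchanges the two laws. *)
Lemma law_average_symmetric : symmetric_charge (law_average_charge cube_prob f g).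
Proof.
move=> A mA; apply: law_average_swap; rewrite fE gE //.
by apply/funext => w; rewrite /preimage /= /psi invgK.
Qed.

Lemma law_average_compactly_supported : compactly_supported (law_average_charge cube_prob f g).
Proof.
pose K : set (R * R * R) := (`[0, 1]%classic `*` `[0, 1]%classic) `*` `[0, 1]%classic.
have cK : compact K by apply: compact_setX; [apply: compact_setX|]; exact: segment_compact.
have cubeK (w : R * R * R) : cube w -> K w.
  case: w => [[a b] c] [[]]; rewrite /= !in_itv /= => /andP[a0 a1] /andP[b0 b1] /andP[c0 c1].
  by split; [split|]; rewrite /= in_itv /=; apply/andP; split=> //; apply: ltW.
exists (phi @` K `|` psi @` K).
  by apply: compactU; apply: continuous_compact cK; apply: continuous_subspaceT => //; exact: continuous_law_inv.
move=> A mA AK; have null (u : {mfun (I * I * I)%type >-> borel G}) : (forall w, K w -> ~ A (u w)) ->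
    cube_prob (u @^-1` A) = 0%E.
  move=> uA; apply/eqP; rewrite eq_le measure_ge0 andbT -cube_prob_full le_measure ?inE //.
  - exact: measurable_funPTI.
  - by apply: measurableC; exact: measurable_cube.
  - by move=> w Aw /cubeK/uA.
have AK0 x : A x -> (phi @` K `|` psi @` K) x -> False.
  by move=> Ax Kx; have : (A `&` (phi @` K `|` psi @` K)) x by []; rewrite AK.
rewrite [LHS]law_averageE !null ?adde0 ?mule0 // => w Kw Aw.
  by apply: (AK0 _ Aw); right; exists w => //; rewrite gE.
by apply: (AK0 _ Aw); left; exists w => //; rewrite fE.
Qed.

Context {X : banachType R} (F : G -> X) (vf vg : X).
Hypotheses (cF : continuous F)
  (vfP : weighted_sum cube_prob (riemann (F \o phi) N) @[N --> \oo] --> vf)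
  (vgP : weighted_sum cube_prob (riemann (F \o psi) N) @[N --> \oo] --> vg).

Lemma law_average_bochner_continuous :
  bochner_integral (law_average_charge cube_prob f g) (F : borel G -> X) = (2^-1 : R)%:C%C *: (vf + vg).
Proof.
have cf : continuous (F \o phi) by move=> w; apply: continuous_comp; [exact: cphi|exact: cF].
have cg : continuous (F \o psi).
  by move=> w; apply: continuous_comp; [exact: continuous_law_inv|exact: cF].
apply: (law_average_bochner measurable_cube cube_prob_full).
- move=> y; apply: (@borel_continuous_measurable (fun t => rnorm (F t - y))) => t.
  by apply: cvg_rnorm; apply: cvgB; [exact: cF|exact: cvg_cst].
- by rewrite fE; exact: riemann_approx cf vfP.
- by rewrite gE; exact: riemann_approx cg vgP.
- move=> e e0; have [ys hys] := cube_net cf e0; have [zs hzs] := cube_net cg e0.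
  exists (ys ++ zs) => w cw; rewrite fE gE; split.
    by have [y yys h] := hys w cw; exists y => //; rewrite mem_cat yys.
  by have [y yzs h] := hzs w cw; exists y => //; rewrite mem_cat yzs orbT.
Qed.

End TopologicalGroupLaws.

Section SL3Measures.
Context {R : realType}.
Notation I := (measurableTypeR R).
Notation borel G := (g_sigma_algebraType (@open G)).

Let i0 : 'I_3 := ord0.
Let i1 : 'I_3 := lift ord0 ord0.
Let i2 : 'I_3 := ord_max.

Definition root_product n (w : R * R * R) : SL 3 R :=
  (elem i0 i1 w.1.1 * (elem i1 i2 (2 ^+ n * w.1.2)%R * elem i2 i0 w.2))%g.

Lemma root_product_continuous n : continuous (root_product n).
Proof.
have mulc (T : topologicalType) (u v : T -> SL 3 R) : continuous u -> continuous v ->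
    continuous (fun w => u w * v w)%g.
  move=> cu cv w; apply: (@continuous_comp _ _ _ (fun w => (u w, v w)) (fun gh => gh.1 * gh.2)%g).
    exact: cvg_pair (cu w) (cv w).
  exact: mulg_continuous.
have elemc (T : topologicalType) i j (u : T -> R) : continuous u -> continuous (fun w => elem i j (u w) : SL 3 R).
  by move=> cu w; apply: (@continuous_comp _ _ _ u (elem i j)); [exact: cu|exact: elem_continuous].
have c1 : continuous (fun w : R * R * R => w.1.1).
  by move=> w; apply: (@continuous_comp _ _ _ fst fst); exact: cvg_fst.
have c2 : continuous (fun w : R * R * R => w.1.2).
  by move=> w; apply: (@continuous_comp _ _ _ fst snd); [exact: cvg_fst|exact: cvg_snd].
have c3 : continuous (fun w : R * R * R => w.2) by move=> w; exact: cvg_snd.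
have c2n : continuous (fun w : R * R * R => 2 ^+ n * w.1.2).
  by move=> w; apply: cvgM; [exact: cvg_cst|exact: c2].
exact: mulc (elemc _ i0 i1 _ c1) (mulc _ _ _ (elemc _ i1 i2 _ c2n) (elemc _ i2 i0 _ c3)).
Qed.

Definition root_product_rv n (w : I * I * I) : borel (SL 3 R) := root_product n w.
Definition root_product_inv_rv n (w : I * I * I) : borel (SL 3 R) := (root_product n w)^-1%g.

HB.instance Definition _ n := isMeasurableFun.Build _ _ _ _ (root_product_rv n)
  (continuous_measurable_borel3 (@root_product_continuous n)).
HB.instance Definition _ n := isMeasurableFun.Build _ _ _ _ (root_product_inv_rv n)
  (continuous_measurable_borel3 (continuous_law_inv (@root_product_continuous n))).

Definition root_measure n : {charge set (borel (SL 3 R)) -> \bar R} :=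
  law_average_charge cube_prob (root_product_rv n) (root_product_inv_rv n).

Context {X : banachType R} (pi : SL 3 R -> {linear X -> X}).
Hypothesis hpi : strongly_continuous_rep pi.
Variables delta M : R.
Hypotheses (delta0 : 0 <= delta) (M1 : 1 <= M)
  (growth : forall i j, i != j -> slow_growth delta M (root pi i j)).

Lemma rep_root_measure n v : rep_measure pi (root_measure n) v = mean_op pi (2 ^+ n) v.
Proof.
have [pi1 piM pic cpi] := hpi; have M0 : 0 <= M := le_trans ler01 M1.
have h01 : i0 != i1 by []. have h12 : i1 != i2 by []. have h20 : i2 != i0 by [].
have b0 : 0 <= 2 ^+ n :> R by rewrite exprn_ge0.
pose W := M * expR (delta * ln (1 + 2 ^+ n)).
have W0 : 0 <= W by rewrite mulr_ge0 // expR_ge0.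
have bnd (x : R -> {linear X -> X}) (B : R) : slow_growth delta M x -> `|B| <= 2 ^+ n -> 
    forall s w, 0 <= s <= 1 -> rnorm (x (B * s) w) <= W * rnorm w.
  move=> gx B2 s w /andP[s0 s1]; apply: le_trans (gx _ _) _.
  apply: ler_wpM2r; first exact: rnorm_ge0.
  apply: ler_wpM2l => //; rewrite ler_expR ler_wpM2l // ler_ln ?posrE ?ltr_pwDl //.
  rewrite lerD2l normrM (ger0_norm s0) (le_trans _ B2) // ler_piMr //.
have one2 : `|1 : R| <= 2 ^+ n by rewrite normr1 exprn_ege1 // ler1n.
have two2 : `|2 ^+ n : R| <= 2 ^+ n by rewrite ger0_norm.
have gn i j : i != j -> slow_growth delta M (fun a => root pi i j (- a)).
  by move=> ij; apply: slow_growth_opp; exact: growth.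
have on i j : i != j -> one_param (fun a => root pi i j (- a)).
  by move=> ij; apply: one_param_opp; exact: root_one_param.
have elemV i j (a : R) : i != j -> (elem i j a)^-1%g = elem i j (- a) :> SL 3 R.
  by move=> ij; apply: (mulgI (elem i j a)); rewrite mulgV -elemD // subrr elem0.
rewrite /rep_measure /root_measure.
rewrite /mean_op; apply: (@law_average_bochner_continuous _ _ (root_product n) (@root_product_continuous n)
  (root_product_rv n) (root_product_inv_rv n) erefl erefl X (fun g => pi g v) _ _ (cpi v)).
  apply: (riemann_triple_avg (root_one_param hpi h01) (root_one_param hpi h12) (root_one_param hpi h20) W0).
  - exact: bnd (growth h01) one2.
  - exact: bnd (growth h12) two2.
  - by move=> a b c; rewrite /= /root_product !piM.
(* Inversion reverses the order of the three factors, hence the reversed Riemann sums. *)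
apply: (riemann_triple_avg_rev (on _ _ h20) (on _ _ h12) (on _ _ h01) W0).
- exact: bnd (gn _ _ h20) one2.
- exact: bnd (gn _ _ h12) two2.
- move=> a b c; rewrite /= /root_product !invgM !elemV // !piM.
  by [].
Qed.

End SL3Measures.

(** * Strong property (T) *)

(** Lowering the exponent weakens the bound; [eps <= 2^-1] is what the choice of n in the Heisenberg
    estimate relies on. *)
Lemma line_decay_small (R : realType) (X : banachType R) : line_decay X ->
  exists C eps : R, [/\ 0 <= C, 0 < eps, eps <= 2^-1 & forall n, (0 < n)%N ->
    mat_bound X (@line_mat R n (line_height n) (2 * n * line_height n)) (C * expR (- (eps * ln n%:R)))].
Proof.
move=> [C [eps [C0 eps0 decay]]]; exists C, (Num.min eps 2^-1); split=> //.
- by rewrite lt_min eps0 invr_gt0 ltr0n.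
- by rewrite ge_min lexx orbT.
- move=> n n0; apply: mat_bound_le (decay n n0); apply: ler_wpM2l => //.
  rewrite ler_expR lerN2; apply: ler_wpM2r; last by rewrite ge_min lexx.
  by rewrite ln_ge0 // ler1n.
Qed.

Theorem theorem1p2 (R : realType) : strong_banach_T (SL 3 R) (@E4 R).
Proof.
move=> l hl; exists (@root_measure R); split=> [n|X EX].
  split; first exact: (@law_average_compactly_supported R _ (root_product n) (@root_product_continuous R n)
    (root_product_rv n) (root_product_inv_rv n) erefl erefl).
  exact: (@law_average_symmetric R _ (root_product n) (root_product_rv n) (root_product_inv_rv n) erefl erefl).
have [C [eps [C0 eps0 eps1 decay]]] := line_decay_small (E4_line_decay EX).
have [D D0 absorb] := heisenberg_absorb C0 eps0 eps1 decay.
(* One constant for all root subgroups; the summand 1 makes it positive, so that t can be divided by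
   it. *)
have [Cl Cl0 lC] : exists2 Cl : R, 0 < Cl & forall (i j : 'I_3) a, i != j ->
    l (elem i j a) <= Cl * (1 + ln (1 + `|a|)).
  have /choice[c hc] (ij : 'I_3 * 'I_3) : exists c : R, ij.1 != ij.2 ->
      0 <= c /\ forall a, l (elem ij.1 ij.2 a) <= c * (1 + ln (1 + `|a|)).
    have [ij12|] := boolP (ij.1 != ij.2); last by exists 0.
    by have [c c0 h] := length_elem_growth hl ij12; exists c.
  exists (\sum_ij `|c ij| + 1); first by rewrite ltr_wpDl // sumr_ge0.
  move=> i j a ij; have [c0 h] := hc (i, j) ij; apply: le_trans (h a) _.
  apply: ler_wpM2r; first by rewrite addr_ge0 // ln_ge0 // lerDl.
  rewrite (bigD1 (i, j)) //= (ger0_norm c0) -addrA lerDl addr_ge0 //.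
  by apply: sumr_ge0.
(* With this t, [t * Cl] is the exponent delta = kappa / 200 of [slow_growth], where kappa = eps / 2
   is the exponent of absorption. *)
exists (eps / 2 / 200 / Cl); first by rewrite !divr_gt0.
set t := _ / Cl => pi L hpi L0 piL.
have tCl : t * Cl = eps / 2 / 200 by rewrite /t divfK // gt_eqF.
have kappa0 : 0 < eps / 2 by rewrite divr_gt0.
have kappa1 : eps / 2 <= 1 by lra.
set delta := eps / 2 / 200 in tCl; have delta0 : 0 <= delta by rewrite divr_ge0 // ltW.
have deltak : 200 * delta <= eps / 2 by rewrite /delta mulrC divfK // pnatr_eq0.
(* M takes up L and the constant term in the bound on [l (elem i j a)]. *)
set M := Num.max 1 (L * expR delta); have M1 : 1 <= M by rewrite le_max lexx.
have growth (i j : 'I_3) : i != j -> slow_growth delta M (root pi i j).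
  move=> ij a v; apply: le_trans (opnorm_leP _ (piL _) v) _; first by rewrite mulr_ge0 // expR_ge0.
  apply: ler_wpM2r; first exact: rnorm_ge0.
  have t0 : 0 <= t by rewrite /t !divr_ge0 // ltW.
  apply: (@le_trans _ _ (L * (expR delta * expR (delta * ln (1 + `|a|))))).
    apply: ler_wpM2l => //; rewrite -expRD ler_expR.
    apply: le_trans (ler_wpM2l t0 (lC i j a ij)) _.
    by rewrite mulrA tCl mulrDr mulr1.
  rewrite mulrA; apply: ler_wpM2r; first exact: expR_ge0.
  by rewrite /M le_max lexx orbT.
have [P Pproj [K [rate [K0 rate0 hK]]]] := mean_op_limit hpi D0 kappa0 kappa1 delta0 deltak M1 absorb growth.
exists P => //.
apply: (@squeeze_cvge _ _ _ _ (fun=> 0%E) _ (fun n => (K * expR (- (rate * n%:R)))%:E)).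
- exists 4%N => // n /= n4; apply/andP; split.
    apply: (@le_trans _ _ (rnorm (rep_measure pi (root_measure n) 0 - P 0))%:E).
      by rewrite lee_fin rnorm_ge0.
    by apply: ereal_sup_ubound; exists 0 => //=; rewrite rnorm0.
  apply: opnorm_le => [|v]; first by rewrite mulr_ge0 // expR_ge0.
  by rewrite (rep_root_measure hpi delta0 M1 growth); exact: hK.
- exact: cvg_cst.
- by apply: cvg_EFin; [exact: nearW|exact: expR_geometric_cvg0].
Qed.
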